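(* Let $\psi\in\mathcal{SR}(\mathbb H)$ and $0<p\le q<\infty$. For $I\in\mathbb S$ and $w\in\mathbb C_I$ put $$\mathcal B_{\psi,I}(w):=\int_{\mathbb C_I}\left|(k_w\bullet\psi)_I(z)\right|^q e^{-\frac{\alpha q}{2}|z|^2}\,dm_{2,I}(z).$$ Then the following assertions hold. (i) The operator $C_\psi^\bullet:F_\alpha^p(\mathbb H)\to F_\alpha^q(\mathbb H)$, $C_\psi^\bullet f=f\bullet\psi$, is bounded if and only if, for some, equivalently for every, $I\in\mathbb S$, $$\sup_{w\in\mathbb C_I}\mathcal B_{\psi,I}(w)<\infty.$$ Moreover, $\|C_\psi^\bullet\|\approx\sup_{w\in\mathbb C_I}\mathcal B_{\psi,I}(w)^{1/q}$. (ii) The operator $C_\psi^\bullet:F_\alpha^p(\mathbb H)\to F_\alpha^q(\mathbb H)$ is compact if and only if, for some, equivalently for every, $I\in\mathbb S$, $$\mathcal B_{\psi,I}(w)\longrightarrow0\qquad\text{as }|w|\to\infty,\ w\in\mathbb C_I.$$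
   Context: $\mathbb H$ denotes the quaternions, $\mathbb S=\{I\in\mathbb H: I^2=-1\}$, and for $I\in\mathbb S$, $\mathbb C_I=\{x+yI: x,y\in\mathbb R\}$. A real differentiable $f:\mathbb H\to\mathbb H$ is slice regular if for every $I\in\mathbb S$ the restriction $f_I:=f|_{\mathbb C_I}$ satisfies $\frac12(\partial_x+I\partial_y)f_I(x+yI)=0$; $\mathcal{SR}(\mathbb H)$ is the class of such functions. Every $f\in\mathcal{SR}(\mathbb H)$ has a power series $f(\xi)=\sum_{n\ge0}\xi^na_n$, $a_n\in\mathbb H$, converging on $\mathbb H$. For $f=\sum\xi^na_n$, $g=\sum\xi^nb_n$ the $\star$-product is $(f\star g)(\xi)=\sum_n\xi^n\sum_{k=0}^na_kb_{n-k}$. The slice regular composition of $f=\sum\xi^na_n$ with $\psi\in\mathcal{SR}(\mathbb H)$ is $(f\bullet\psi)(\xi)=\sum_{n\ge0}\psi^{\star n}(\xi)a_n$, where $\psi^{\star n}$ is the $n$-th $\star$-power and $\psi^{\star0}\equiv1$. Fix $\alpha>0$; $dm_{2,I}$ is planar Lebesgue measure on $\mathbb C_I$. For $0<p<\infty$, the quaternionic Fock space $F_\alpha^p(\mathbb H)$ consists of $f\in\mathcal{SR}(\mathbb H)$ with $\|f\|_{F_\alpha^p(\mathbb H)}^p:=\frac{\alpha p}{2\pi}\int_{\mathbb C_I}|f_I(z)|^pe^{-\frac{\alpha p}{2}|z|^2}dm_{2,I}(z)<\infty$ for a fixed $I$; different choices of $I$ give the same space with equivalent quasi-norms (constants independent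 of $f$). For $w\in\mathbb C_I$ the normalized reproducing kernel is $k_w(z)=e^{-\frac\alpha2|w|^2}\sum_{n\ge0}\frac{\alpha^nz^n\overline w^{\,n}}{n!}$. Conventions: $A\lesssim B$ means $A\le CB$ for a positive constant $C$ independent of the test function and of the free variables under consideration; implicit constants may depend on $\alpha,p,q$ and the fixed slice. $A\approx B$ means $A\lesssim B$ and $B\lesssim A$. $\|T\|$ is the operator bound between the corresponding (quasi-)Banach spaces. *)

(* Defs.v *)
From HB Require Import structures.
From mathcomp Require Import all_boot all_order all_algebra.
From mathcomp Require Import all_classical all_reals all_analysis.
From mathcomp Require Import ring lra.

Set Implicit Arguments.
Unset Strict Implicit.
Unset Printing Implicit Defensive.

Import Order.TTheory GRing.Theory Num.Theory.
Import numFieldNormedType.Exports.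

Local Open Scope classical_set_scope.
Local Open Scope ring_scope.

(* [Quat a b c d] is a + b i + c j + d k. *)
Record quat (R : Type) := Quat { qre : R; qi : R; qj : R; qk : R }.

Section Quaternions.
Variable R : realType.
Implicit Types x y z : quat R.

Definition quat_tuple x := (qre x, qi x, qj x, qk x).
Definition tuple_quat (t : R * R * R * R) :=
  let: (a, b, c, d) := t in Quat a b c d.
Lemma quat_tupleK : cancel quat_tuple tuple_quat. Proof. by case. Qed.

HB.instance Definition _ := Choice.copy (quat R) (can_type quat_tupleK).

Definition qadd x y :=
  Quat (qre x + qre y) (qi x + qi y) (qj x + qj y) (qk x + qk y).
Definition qopp x := Quat (- qre x) (- qi x) (- qj x) (- qk x).
Definition qzero : quat R := Quat 0 0 0 0.
Definition qscale (a : R) x := Quat (a * qre x) (a * qi x) (a * qj x) (a * qk x).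
Definition qone : quat R := Quat 1 0 0 0.
Definition qmul x y := Quat
  (qre x * qre y - qi x * qi y - qj x * qj y - qk x * qk y)
  (qre x * qi y + qi x * qre y + qj x * qk y - qk x * qj y)
  (qre x * qj y - qi x * qk y + qj x * qre y + qk x * qi y)
  (qre x * qk y + qi x * qj y - qj x * qi y + qk x * qre y).
Definition qnorm x : R :=
  Num.sqrt (qre x ^+ 2 + qi x ^+ 2 + qj x ^+ 2 + qk x ^+ 2).

Lemma qaddA : associative qadd.
Proof. by move=> [? ? ? ?] [? ? ? ?] [? ? ? ?]; congr Quat; rewrite /= addrA. Qed.
Lemma qaddC : commutative qadd.
Proof. by move=> [? ? ? ?] [? ? ? ?]; congr Quat; rewrite /= addrC. Qed.
Lemma qadd0 : left_id qzero qadd.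
Proof. by move=> [? ? ? ?]; congr Quat; rewrite /= add0r. Qed.
Lemma qaddN : left_inverse qzero qopp qadd.
Proof. by move=> [? ? ? ?]; congr Quat; rewrite /= addNr. Qed.

HB.instance Definition _ := GRing.isZmodule.Build (quat R) qaddA qaddC qadd0 qaddN.

Lemma qmulA : associative qmul.
Proof. by move=> [? ? ? ?] [? ? ? ?] [? ? ? ?]; congr Quat => /=; ring. Qed.
Lemma qmul1l : left_id qone qmul.
Proof. by move=> [? ? ? ?]; congr Quat => /=; ring. Qed.
Lemma qmul1r : right_id qone qmul.
Proof. by move=> [? ? ? ?]; congr Quat => /=; ring. Qed.
Lemma qmulDl : left_distributive qmul (fun x y => x + y).
Proof. by move=> [? ? ? ?] [? ? ? ?] [? ? ? ?]; congr Quat => /=; ring. Qed.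
Lemma qmulDr : right_distributive qmul (fun x y => x + y).
Proof. by move=> [? ? ? ?] [? ? ? ?] [? ? ? ?]; congr Quat => /=; ring. Qed.
Lemma qone_neq0 : qone != 0.
Proof. by apply/eqP => -[] /eqP; rewrite oner_eq0. Qed.

HB.instance Definition _ := GRing.Zmodule_isNzRing.Build (quat R)
  qmulA qmul1l qmul1r qmulDl qmulDr qone_neq0.

Lemma qscaleA a b x : qscale a (qscale b x) = qscale (a * b) x.
Proof. by congr Quat; rewrite /= mulrA. Qed.
Lemma qscale1 : left_id 1 qscale.
Proof. by move=> [? ? ? ?]; congr Quat; rewrite /= mul1r. Qed.
Lemma qscaleDr : right_distributive qscale +%R.
Proof. by move=> ? [? ? ? ?] [? ? ? ?]; congr Quat; rewrite /= mulrDr. Qed.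
Lemma qscaleDl x : {morph qscale^~ x : a b / a + b}.
Proof. by move=> ? ?; congr Quat; rewrite /= mulrDl. Qed.

HB.instance Definition _ := GRing.Zmodule_isLmodule.Build R (quat R)
  qscaleA qscale1 qscaleDr qscaleDl.

Lemma qscaleAl (a : R) x y : a *: (x * y) = (a *: x) * y.
Proof. by congr Quat => /=; ring. Qed.
Lemma qscaleAr (a : R) x y : a *: (x * y) = x * (a *: y).
Proof. by congr Quat => /=; ring. Qed.

HB.instance Definition _ := GRing.Lmodule_isLalgebra.Build R (quat R) qscaleAl.
HB.instance Definition _ := GRing.Lalgebra_isAlgebra.Build R (quat R) qscaleAr.

Lemma qnormD x y : qnorm (x + y) <= qnorm x + qnorm y.
Proof.
case: x y => [a b c d] [a' b' c' d']; rewrite /qnorm /=.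
set X := a ^+ 2 + _ + _ + _; set Y := a' ^+ 2 + _ + _ + _; set Z := (X in Num.sqrt X <= _).
have X0 : 0 <= X by rewrite !addr_ge0 ?sqr_ge0.
have Y0 : 0 <= Y by rewrite !addr_ge0 ?sqr_ge0.
have S0 : 0 <= Num.sqrt X + Num.sqrt Y by rewrite addr_ge0 ?sqrtr_ge0.
rewrite -[leRHS](ger0_norm S0) -sqrtr_sqr ler_wsqrtr//.
rewrite sqrrD !sqr_sqrtr// -sqrtrM//.
pose p := a * a' + b * b' + c * c' + d * d'.
have -> : Z = X + p *+ 2 + Y by rewrite /Z /X /Y /p; ring.
rewrite lerD2r lerD2l ler_pMn2r//.
apply: (le_trans (ler_norm p)); rewrite -sqrtr_sqr ler_wsqrtr// -subr_ge0.
have -> : X * Y - p ^+ 2 = (a * b' - b * a') ^+ 2 + (a * c' - c * a') ^+ 2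
  + (a * d' - d * a') ^+ 2 + (b * c' - c * b') ^+ 2
  + (b * d' - d * b') ^+ 2 + (c * d' - d * c') ^+ 2.
  by rewrite /X /Y /p; ring.
by rewrite !addr_ge0 ?sqr_ge0.
Qed.

Lemma qnormZ (a : R) x : qnorm (a *: x) = `|a| * qnorm x.
Proof.
rewrite /qnorm /= !exprMn -!mulrDr sqrtrM ?sqr_ge0//; by rewrite sqrtr_sqr.
Qed.

Lemma qnorm0_eq0 x : qnorm x = 0 -> x = 0.
Proof.
case: x => a b c d; rewrite /qnorm /= => /eqP; rewrite sqrtr_eq0 => h.
have ha := sqr_ge0 a; have hb := sqr_ge0 b; have hc := sqr_ge0 c; have hd := sqr_ge0 d.
by congr Quat; apply/eqP; rewrite -sqrf_eq0 eq_le sqr_ge0 andbT; lra.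
Qed.

HB.instance Definition _ :=
  Lmodule_isNormed.Build R (quat R) qnormD qnormZ qnorm0_eq0.

Definition qconj x : quat R := Quat (qre x) (- qi x) (- qj x) (- qk x).

Definition imag_unit (I : quat R) : Prop := I ^+ 2 = -1.

(* The coordinate map (x, y) |-> x + y I, used to carry planar Lebesgue measure
   and the partial derivatives to the slice C_I. *)
Definition slice_pt (I : quat R) (z : R * R) : quat R := z.1%:A + z.2 *: I.

Definition slice (I : quat R) : set (quat R) := range (slice_pt I).

Definition slice_regular (f : quat R -> quat R) : Prop :=
  (forall x, differentiable f x) /\
  forall I, imag_unit I -> forall z : R * R,
    2^-1 *: ('D_((1, 0) : R * R) (f \o slice_pt I) z
             + I * 'D_((0, 1) : R * R) (f \o slice_pt I) z) = 0.

Definition power_series (a : nat -> quat R) (x : quat R) : quat R :=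
  limn (fun N => \sum_(n < N) x ^+ n * a n).

Definition has_power_series (f : quat R -> quat R) (a : nat -> quat R) : Prop :=
  forall x, (fun N => \sum_(n < N) x ^+ n * a n) @ \oo --> f x.

(* The power series coefficients of a function; meaningful for functions that
   have an everywhere convergent expansion, in particular slice regular ones. *)
Definition ps_coef (f : quat R -> quat R) : nat -> quat R :=
  xget (fun=> 0) [set a | has_power_series f a].

Definition star (f g : quat R -> quat R) : quat R -> quat R :=
  power_series (fun n => \sum_(k < n.+1) ps_coef f k * ps_coef g (n - k)%N).

Definition star_exp (f : quat R -> quat R) (n : nat) : quat R -> quat R :=
  iter n (star f) (fun=> 1).

Definition slice_comp (f psi : quat R -> quat R) : quat R -> quat R :=
  fun x => limn (fun N => \sum_(n < N) star_exp psi n x * ps_coef f n).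

Definition comp_op (psi f : quat R -> quat R) : quat R -> quat R :=
  slice_comp f psi.

Definition slice_integral (I : quat R) (h : quat R -> R) : \bar R :=
  (\int[(lebesgue_measure \x lebesgue_measure)%E]_(z in [set: R * R])
     (h (slice_pt I z))%:E)%E.

Definition fock_normp (alpha p : R) (I : quat R) (f : quat R -> quat R) : \bar R :=
  ((alpha * p / (2 * pi))%:E *
   slice_integral I
     (fun z => `|f z| `^ p * expR (- (alpha * p / 2) * `|z| ^+ 2))%R)%E.

Definition fock_norm (alpha p : R) (I : quat R) (f : quat R -> quat R) : \bar R :=
  (fock_normp alpha p I f `^ p^-1)%E.

Definition fock (alpha p : R) (I : quat R) : set (quat R -> quat R) :=
  [set f | slice_regular f /\ (fock_normp alpha p I f < +oo)%E].

Definition fock_kernel (alpha : R) (w z : quat R) : quat R :=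
  expR (- (alpha / 2) * `|w| ^+ 2) *:
  limn (fun N => \sum_(n < N) (alpha ^+ n / n`!%:R) *: (z ^+ n * qconj w ^+ n)).

Definition berezin (alpha q : R) (psi : quat R -> quat R) (I w : quat R) : \bar R :=
  slice_integral I
    (fun z => `|slice_comp (fock_kernel alpha w) psi z| `^ q
              * expR (- (alpha * q / 2) * `|z| ^+ 2)).

Section Operators.
Variables (alpha p q : R) (I : quat R).
Variable T : (quat R -> quat R) -> (quat R -> quat R).

Definition maps_fock : Prop :=
  forall f, fock alpha p I f -> fock alpha q I (T f).

Definition op_bound (C : R) : Prop :=
  [/\ 0 <= C, maps_fock & forall f, fock alpha p I f ->
    (fock_norm alpha q I (T f) <= C%:E * fock_norm alpha p I f)%E].

Definition bounded_op : Prop := exists C, op_bound C.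

Definition op_norm : \bar R := ereal_inf [set C%:E | C in op_bound].

(* Sequential form of relative compactness of images of bounded sets, for the
   quasi-metric topology given by the quasi-norm of the target space. *)
Definition compact_op : Prop :=
  maps_fock /\
  forall (f : nat -> quat R -> quat R) (M : R),
    (forall n, fock alpha p I (f n) /\ (fock_norm alpha p I (f n) <= M%:E)%E) ->
    exists phi : nat -> nat, {homo phi : m n / (m < n)%N} /\
    exists2 g, fock alpha q I g &
      fock_norm alpha q I (T (f (phi n)) \- g) @[n --> \oo] --> 0%E.

End Operators.

End Quaternions.

(* Main.v *)
(* On a slice C_I the values of the star powers of psi at z obey a two-term recursion whose
   characteristic roots l, m lie in C_I.  Hence (f • psi)(z) is a combination, with coefficients
   independent of f, of f(l), of the divided difference of f at l, m, and of the divided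
   difference at the conjugate points.  Two normalized kernels centred at lattice points near l and
   m interpolate any data at l and m, with a control that stays uniform when l and m merge, so
   |(f • psi)(z)| is at most C S_w |(k_w • psi)(z)| for some lattice point w, where S_w is a
   Gaussian-weighted supremum of f around w.  A sub-mean-value estimate turns S_w^p into a
   Gaussian-weighted integral G_w of |f|^p, and sum_w G_w is bounded by the p-norm, whence
   ||f • psi||_q^q <= C ||f||_p^(q-p) sum_w G_w B(w).  This gives sufficiency for boundedness; for
   compactness one combines it with a Montel argument, since the terms with |w| large are small
   by hypothesis and the others tend to 0 by dominated convergence.  Necessity follows by
   testing on the kernels, which tend to 0 pointwise after composition with psi.  The
   representation formula compares the norms on different slices. *)

(* The obstacle is that [psi] need not map $C_I$ into itself, so a composed value is in general not
   a value of f. What survives is a functional whose part in $C_I$ and part anticommuting with [I]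
   can be separated: for a kernel centred in $C_I$ each part is dominated by the modulus of the
   whole composition, and this lets kernels control every other f. Since p and q may be below 1,
   duality and convexity are avoided: the pointwise estimate keeps a single lattice point, the one
   with the largest term. The weight in $S_w$ is $e^{-\alpha|u-w|^2/4}$, with half the exponent of
   the Gaussian of a kernel; this slack absorbs nodes that are far apart. The assumption p <= q
   enters through $G_w^{q/p}\le G_w N^{(q-p)/p}$, N being the total integral. The lattice keeps a
   distance [rho] from 0, so that in the compactness part a large [rho] places all its points where
   B is already below 1; no separate bound on bounded sets of w is required. Slice regularity
   provides differentiability only, hence Cauchy's theory starts from Goursat's bisection. *)
Require Import Defs.
From HB Require Import structures.
From mathcomp Require Import all_boot all_order all_algebra.
From mathcomp Require Import all_classical all_reals all_analysis.
From mathcomp Require Import measurable_realfun.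
From mathcomp Require Import zify ring lra.
Set Implicit Arguments.
Unset Strict Implicit.
Unset Printing Implicit Defensive.
Import Order.TTheory GRing.Theory Num.Theory.
Import numFieldNormedType.Exports.
Local Open Scope classical_set_scope.
Local Open Scope ring_scope.

(** * Quaternions and slices *)

Section QuaternionAlgebra.
Variable R : realType.
Implicit Types (x y z : quat R) (a : R).

Lemma quat_eq x y : qre x = qre y -> qi x = qi y -> qj x = qj y -> qk x = qk y ->
  x = y.
Proof. by case: x y => ? ? ? ? [? ? ? ?] /= -> -> -> ->. Qed.

Lemma qreD x y : qre (x + y) = qre x + qre y. Proof. by []. Qed.
Lemma qiD x y : qi (x + y) = qi x + qi y. Proof. by []. Qed.
Lemma qjD x y : qj (x + y) = qj x + qj y. Proof. by []. Qed.
Lemma qkD x y : qk (x + y) = qk x + qk y. Proof. by []. Qed.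
Lemma qreN x : qre (- x) = - qre x. Proof. by []. Qed.
Lemma qiN x : qi (- x) = - qi x. Proof. by []. Qed.
Lemma qjN x : qj (- x) = - qj x. Proof. by []. Qed.
Lemma qkN x : qk (- x) = - qk x. Proof. by []. Qed.
Lemma qreZ a x : qre (a *: x) = a * qre x. Proof. by []. Qed.
Lemma qiZ a x : qi (a *: x) = a * qi x. Proof. by []. Qed.
Lemma qjZ a x : qj (a *: x) = a * qj x. Proof. by []. Qed.
Lemma qkZ a x : qk (a *: x) = a * qk x. Proof. by []. Qed.
Lemma qreM x y : qre (x * y) =
  qre x * qre y - qi x * qi y - qj x * qj y - qk x * qk y.
Proof. by []. Qed.
Lemma qiM x y : qi (x * y) =
  qre x * qi y + qi x * qre y + qj x * qk y - qk x * qj y.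
Proof. by []. Qed.
Lemma qjM x y : qj (x * y) =
  qre x * qj y - qi x * qk y + qj x * qre y + qk x * qi y.
Proof. by []. Qed.
Lemma qkM x y : qk (x * y) =
  qre x * qk y + qi x * qj y - qj x * qi y + qk x * qre y.
Proof. by []. Qed.
Lemma qre1 : qre (1 : quat R) = 1. Proof. by []. Qed.
Lemma qi1 : qi (1 : quat R) = 0. Proof. by []. Qed.
Lemma qj1 : qj (1 : quat R) = 0. Proof. by []. Qed.
Lemma qk1 : qk (1 : quat R) = 0. Proof. by []. Qed.
Lemma qre0 : qre (0 : quat R) = 0. Proof. by []. Qed.
Lemma qi0 : qi (0 : quat R) = 0. Proof. by []. Qed.
Lemma qj0 : qj (0 : quat R) = 0. Proof. by []. Qed.
Lemma qk0 : qk (0 : quat R) = 0. Proof. by []. Qed.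
Lemma qreC x : qre (qconj x) = qre x. Proof. by []. Qed.
Lemma qiC x : qi (qconj x) = - qi x. Proof. by []. Qed.
Lemma qjC x : qj (qconj x) = - qj x. Proof. by []. Qed.
Lemma qkC x : qk (qconj x) = - qk x. Proof. by []. Qed.

Definition qE := (qreD, qiD, qjD, qkD, qreN, qiN, qjN, qkN, qreZ, qiZ, qjZ, qkZ,
  qreM, qiM, qjM, qkM, (qre1, qi1, qj1, qk1, qre0, qi0, qj0, qk0),
  (qreC, qiC, qjC, qkC)).

Lemma qnormE x : `|x| = Num.sqrt (qre x ^+ 2 + qi x ^+ 2 + qj x ^+ 2 + qk x ^+ 2).
Proof. by []. Qed.

Lemma sqr_qnorm x : `|x| ^+ 2 = qre x ^+ 2 + qi x ^+ 2 + qj x ^+ 2 + qk x ^+ 2.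
Proof. by rewrite qnormE sqr_sqrtr// !addr_ge0 ?sqr_ge0. Qed.

(** Euler's four-square identity. *)
Lemma qnormM x y : `|x * y| = `|x| * `|y|.
Proof.
apply/eqP; rewrite -(@eqrXn2 _ 2)// ?mulr_ge0// exprMn !sqr_qnorm !qE.
by apply/eqP; ring.
Qed.

Lemma qnorm1 : `|1 : quat R| = 1.
Proof. by rewrite qnormE !qE !expr0n/= !addr0 expr1n sqrtr1. Qed.

Lemma qnormX x n : `|x ^+ n| = `|x| ^+ n.
Proof. by elim: n => [|n IH]; rewrite ?expr0 ?qnorm1// !exprS qnormM IH. Qed.

Lemma qconjM x y : qconj (x * y) = qconj y * qconj x.
Proof. by apply: quat_eq; rewrite !qE; ring. Qed.

Lemma qconjD x y : qconj (x + y) = qconj x + qconj y.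
Proof. by apply: quat_eq; rewrite !qE; ring. Qed.

Lemma qconjZ a x : qconj (a *: x) = a *: qconj x.
Proof. by apply: quat_eq; rewrite !qE; ring. Qed.

Lemma qconjN x : qconj (- x) = - qconj x.
Proof. by apply: quat_eq; rewrite !qE. Qed.

Lemma qconjK x : qconj (qconj x) = x.
Proof. by apply: quat_eq; rewrite !qE ?opprK. Qed.

Lemma qconj1 : qconj 1 = 1 :> quat R.
Proof. by apply: quat_eq; rewrite !qE ?oppr0. Qed.

Lemma qconj0 : qconj 0 = 0 :> quat R.
Proof. by apply: quat_eq; rewrite !qE ?oppr0. Qed.

Lemma qconjX x n : qconj (x ^+ n) = qconj x ^+ n.
Proof.
by elim: n => [|n IH]; rewrite ?expr0 ?qconj1// exprS qconjM IH exprSr.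
Qed.

Lemma qnormC x : `|qconj x| = `|x|.
Proof. by rewrite !qnormE !qE !sqrrN. Qed.

Lemma mulq_conj x : x * qconj x = (`|x| ^+ 2)%:A.
Proof. by apply: quat_eq; rewrite sqr_qnorm !qE; ring. Qed.

Lemma mulqC_conj x : qconj x * x = (`|x| ^+ 2)%:A.
Proof. by apply: quat_eq; rewrite sqr_qnorm !qE; ring. Qed.

Definition qinv x := `|x| ^- 2 *: qconj x.

Lemma mulVq x : x != 0 -> qinv x * x = 1.
Proof.
move=> x0; rewrite /qinv -scalerAl mulqC_conj scalerA mulVf ?scale1r//.
by rewrite sqrf_eq0 normr_eq0.
Qed.

Lemma qnormV x : `|qinv x| = `|x|^-1.
Proof.
rewrite /qinv normrZ qnormC normfV normrX normr_id.
have [->|x0] := eqVneq x 0; first by rewrite normr0 invr0 mulr0.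
by rewrite expr2 invfM -mulrA mulVf ?mulr1// normr_eq0.
Qed.

Lemma ler_qre x : `|qre x| <= `|x|.
Proof.
rewrite -(@ler_pXn2r _ 2)// ?nnegrE// sqr_qnorm real_normK ?num_real//.
by rewrite -!addrA lerDl !addr_ge0 ?sqr_ge0.
Qed.
Lemma ler_qi x : `|qi x| <= `|x|.
Proof.
rewrite -(@ler_pXn2r _ 2)// ?nnegrE// sqr_qnorm real_normK ?num_real//.
by rewrite -!addrA [leRHS]addrCA lerDl !addr_ge0 ?sqr_ge0.
Qed.
Lemma ler_qj x : `|qj x| <= `|x|.
Proof.
rewrite -(@ler_pXn2r _ 2)// ?nnegrE// sqr_qnorm real_normK ?num_real//.
by rewrite [leRHS]addrAC lerDr !addr_ge0 ?sqr_ge0.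
Qed.
Lemma ler_qk x : `|qk x| <= `|x|.
Proof.
rewrite -(@ler_pXn2r _ 2)// ?nnegrE// sqr_qnorm real_normK ?num_real//.
by rewrite lerDr !addr_ge0 ?sqr_ge0.
Qed.

Lemma ler_qnorm_comp x (M : R) : `|qre x| <= M -> `|qi x| <= M -> `|qj x| <= M ->
  `|qk x| <= M -> `|x| <= 2 * M.
Proof.
move=> h1 h2 h3 h4; have M0 : 0 <= M := le_trans (normr_ge0 _) h1.
rewrite -(@ler_pXn2r _ 2)// ?nnegrE ?mulr_ge0// sqr_qnorm.
have sq (t : R) : `|t| <= M -> t ^+ 2 <= M ^+ 2.
  by move=> h; rewrite -real_normK ?num_real// ler_pXn2r// ?nnegrE.
rewrite exprMn; move: (sq _ h1) (sq _ h2) (sq _ h3) (sq _ h4).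
by move: (M ^+ 2) => ? ? ? ? ?; lra.
Qed.

(** The imaginary components of $I^2$ are $2\,\mathrm{Re}(I)$ times those of [I]. A nonzero real
    part would thus make [I] real, with a nonnegative square. *)
Lemma imag_unitE (I : quat R) : imag_unit I ->
  qre I = 0 /\ qi I ^+ 2 + qj I ^+ 2 + qk I ^+ 2 = 1.
Proof.
rewrite /imag_unit expr2 => h.
have := congr1 (@qre R) h; have := congr1 (@qi R) h; have := congr1 (@qj R) h.
have := congr1 (@qk R) h; rewrite !qE => hk hj hi hr.
have re0 : qre I = 0.
  apply/eqP/negPn/negP => r0.
  have z t : qre I * t + t * qre I = 0 -> t = 0.
    by rewrite [t * _]mulrC -mulr2n => /eqP; rewrite mulrn_eq0/= mulf_eq0 (negPf r0) => /eqP.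
  have i0 : qi I = 0 by apply: z; lra.
  have j0 : qj I = 0 by apply: z; lra.
  have k0 : qk I = 0 by apply: z; lra.
  rewrite i0 j0 k0 !mulr0 !subr0 in hr; have := sqr_ge0 (qre I).
  by rewrite expr2 hr; lra.
by split => //; rewrite re0 in hr; rewrite !expr2; lra.
Qed.

Lemma imag_unit_norm (I : quat R) : imag_unit I -> `|I| = 1.
Proof.
by move=> /imag_unitE[r0 s]; rewrite qnormE r0 expr0n/= add0r s sqrtr1.
Qed.

Lemma imag_unit_conj (I : quat R) : imag_unit I -> qconj I = - I.
Proof. by move=> /imag_unitE[r0 _]; apply: quat_eq; rewrite !qE// r0 oppr0. Qed.

Lemma imag_unitM (I : quat R) : imag_unit I -> I * I = -1.
Proof. by rewrite -expr2. Qed.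

Section Slice.
Variable I : quat R.
Local Notation S := (slice_pt I).

Lemma slice_ptD (u v : R * R) : S (u + v) = S u + S v.
Proof. by rewrite /slice_pt /= !scalerDl addrACA. Qed.

Lemma slice_ptZ a (u : R * R) : S (a *: u) = a *: S u.
Proof. by rewrite /slice_pt /= -!scalerA -scalerDr. Qed.

Lemma slice_ptN (u : R * R) : S (- u) = - S u.
Proof. by rewrite -scaleN1r slice_ptZ scaleN1r. Qed.

Lemma slice_ptB (u v : R * R) : S (u - v) = S u - S v.
Proof. by rewrite slice_ptD slice_ptN. Qed.

Lemma slice_pt0 : S 0 = 0.
Proof. by rewrite /slice_pt /= !scale0r addr0. Qed.

Lemma slice_pt_re a : S (a, 0) = a%:A.
Proof. by rewrite /slice_pt /= scale0r addr0. Qed.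

Hypothesis unitI : imag_unit I.

Lemma slice_ptM (u v : R * R) :
  S u * S v = S (u.1 * v.1 - u.2 * v.2, u.1 * v.2 + u.2 * v.1).
Proof.
have [r0 s1] := imag_unitE unitI.
apply: quat_eq; rewrite /slice_pt !qE /= r0; try by ring.
transitivity (u.1 * v.1 - u.2 * v.2 * (qi I ^+ 2 + qj I ^+ 2 + qk I ^+ 2)).
  by ring.
by rewrite s1; ring.
Qed.

Lemma slice_ptC (u v : R * R) : S u * S v = S v * S u.
Proof. by rewrite !slice_ptM; congr S; congr pair; ring. Qed.

Lemma sqr_norm_slice_pt (u : R * R) : `|S u| ^+ 2 = u.1 ^+ 2 + u.2 ^+ 2.
Proof.
have [r0 s] := imag_unitE unitI.
rewrite sqr_qnorm /slice_pt !qE r0 !mulr0 !mulr1 !add0r addr0 !exprMn.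
by rewrite -!addrA -!mulrDr addrA s mulr1.
Qed.

Lemma slice_pt_conj (u : R * R) : qconj (S u) = S (u.1, - u.2).
Proof.
by rewrite /slice_pt qconjD !qconjZ qconj1 imag_unit_conj// scalerN scaleNr.
Qed.

Lemma slice1 : slice I 1. Proof. by exists (1, 0) => //; rewrite slice_pt_re scale1r. Qed.
Lemma slice0 : slice I 0. Proof. by exists 0 => //; rewrite slice_pt0. Qed.
Lemma slice_self : slice I I.
Proof. by exists (0, 1) => //; rewrite /slice_pt/= scale0r add0r scale1r. Qed.
Lemma slice_real a : slice I a%:A. Proof. by exists (a, 0) => //; rewrite slice_pt_re. Qed.
Lemma sliceD x y : slice I x -> slice I y -> slice I (x + y).
Proof. by move=> [u _ <-] [v _ <-]; exists (u + v) => //; rewrite slice_ptD. Qed.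
Lemma sliceN x : slice I x -> slice I (- x).
Proof. by move=> [u _ <-]; exists (- u) => //; rewrite slice_ptN. Qed.
Lemma sliceB x y : slice I x -> slice I y -> slice I (x - y).
Proof. by move=> hx hy; apply: sliceD => //; exact: sliceN. Qed.
Lemma sliceZ a x : slice I x -> slice I (a *: x).
Proof. by move=> [u _ <-]; exists (a *: u) => //; rewrite slice_ptZ. Qed.
Lemma sliceM x y : slice I x -> slice I y -> slice I (x * y).
Proof. by move=> [u _ <-] [v _ <-]; rewrite slice_ptM; eexists. Qed.
Lemma sliceX x n : slice I x -> slice I (x ^+ n).
Proof.
move=> hx; elim: n => [|n IH]; first by rewrite expr0; exact: slice1.
by rewrite exprS; exact: sliceM.
Qed.
Lemma slice_conj x : slice I x -> slice I (qconj x).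
Proof. by move=> [u _ <-]; rewrite slice_pt_conj; eexists. Qed.
Lemma slice_inv x : slice I x -> slice I (qinv x).
Proof. by move=> hx; apply: sliceZ; exact: slice_conj. Qed.
Lemma sliceC x y : slice I x -> slice I y -> x * y = y * x.
Proof. by move=> [u _ <-] [v _ <-]; exact: slice_ptC. Qed.
(** Half-angle formulas: with r the modulus of x + yI, the root is
    $\sqrt{(r+x)/2}\pm\sqrt{(r-x)/2}\,I$, the sign being that of y. It yields the roots of the
    characteristic polynomial of the star powers. *)
Lemma slice_sqrt x : slice I x -> exists2 s, slice I s & s * s = x.
Proof.
move=> [u _ <-]; set r := `|S u|.
have r2 : r ^+ 2 = u.1 ^+ 2 + u.2 ^+ 2 by rewrite sqr_norm_slice_pt.
have r0 : 0 <= r := normr_ge0 _.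
have rge : `|u.1| <= r.
  rewrite -(@ler_pXn2r _ 2)// ?nnegrE// r2 real_normK ?num_real//.
  by rewrite lerDl sqr_ge0.
move: rge; rewrite ler_norml => /andP[rl rh].
pose a := Num.sqrt ((r + u.1) / 2); pose b := Num.sqrt ((r - u.1) / 2).
have a2 : a * a = (r + u.1) / 2 by rewrite -expr2 sqr_sqrtr//; lra.
have b2 : b * b = (r - u.1) / 2 by rewrite -expr2 sqr_sqrtr//; lra.
have ab : a * b = `|u.2| / 2.
  rewrite -sqrtrM; last by lra.
  have -> : (r + u.1) / 2 * ((r - u.1) / 2) = (u.2 / 2) ^+ 2.
    have -> : (r + u.1) / 2 * ((r - u.1) / 2) = (r ^+ 2 - u.1 ^+ 2) / 4 by field.
    by rewrite r2; field.
  by rewrite sqrtr_sqr normrM normfV [`|2|]ger0_norm.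
have [s0|s0] := leP 0 u.2.
  exists (S (a, b)); first by eexists.
  rewrite slice_ptM /=; congr S; rewrite a2 b2 [b * a]mulrC ab ger0_norm//.
  by case: (u) => ? ? /=; congr pair; field.
exists (S (a, - b)); first by eexists.
rewrite slice_ptM /=; congr S; rewrite mulrNN a2 b2 mulrN mulNr [b * a]mulrC ab ltr0_norm//.
by case: (u) => ? ? /=; congr pair; field.
Qed.

End Slice.

(** The imaginary part of [x], normalized, is the required unit. For real [x] there is no such
    direction, and [J] serves. *)
Lemma quat_in_slice (J x : quat R) : imag_unit J -> exists2 I, imag_unit I & slice I x.
Proof.
move=> unitJ.
pose m := Num.sqrt (qi x ^+ 2 + qj x ^+ 2 + qk x ^+ 2).
have m2 : m ^+ 2 = qi x ^+ 2 + qj x ^+ 2 + qk x ^+ 2.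
  by rewrite sqr_sqrtr// !addr_ge0 ?sqr_ge0.
have [m0|m0] := eqVneq m 0.
  exists J => //; exists (qre x, 0) => //; rewrite slice_pt_re.
  have /eqP := m2; rewrite m0 expr0n/= eq_sym !paddr_eq0 ?addr_ge0 ?sqr_ge0// !sqrf_eq0.
  move=> /andP[/andP[/eqP i0 /eqP j0] /eqP k0].
  by apply: quat_eq; rewrite !qE ?mulr1 ?mulr0.
exists (Quat 0 (qi x / m) (qj x / m) (qk x / m)).
  rewrite /imag_unit expr2; apply: quat_eq; rewrite !qE /=; try by ring.
  have : (qi x ^+ 2 + qj x ^+ 2 + qk x ^+ 2) / m ^+ 2 = 1.
    by rewrite -m2 divff// sqrf_eq0.
  by move=> h; rewrite -[in RHS]h; field.
exists (qre x, m) => //; rewrite /slice_pt /=.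
by apply: quat_eq; rewrite !qE /= ?(mulrCA m) ?mulr0 ?mulr1 ?add0r ?addr0// divff// mulr1.
Qed.

End QuaternionAlgebra.

(** * Absolutely convergent sums of quaternions *)

Section QuaternionLimits.
Variable R : realType.
Implicit Types (x y z : quat R).

Section Filters.
Variables (T : Type) (F : set_system T).
Context {FF : Filter F}.
Implicit Types f g : T -> quat R.

Lemma cvg_lip1 (phi : quat R -> R) f x :
  (forall x y, phi (x - y) = phi x - phi y) -> (forall x, `|phi x| <= `|x|) ->
  f @ F --> x -> phi \o f @ F --> phi x.
Proof.
move=> phiB le /cvgrPdist_lt fx; apply/cvgrPdist_lt => e e0.
near=> t; rewrite /= -phiB (le_lt_trans (le _))//; near: t; exact: fx.
Unshelve. all: end_near. Qed.

Lemma cvg_qre f x : f @ F --> x -> (fun t => qre (f t)) @ F --> qre x.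
Proof. by apply: (@cvg_lip1 (@qre R)) => // ?; exact: ler_qre. Qed.
Lemma cvg_qi f x : f @ F --> x -> (fun t => qi (f t)) @ F --> qi x.
Proof. by apply: (@cvg_lip1 (@qi R)) => // ?; exact: ler_qi. Qed.
Lemma cvg_qj f x : f @ F --> x -> (fun t => qj (f t)) @ F --> qj x.
Proof. by apply: (@cvg_lip1 (@qj R)) => // ?; exact: ler_qj. Qed.
Lemma cvg_qk f x : f @ F --> x -> (fun t => qk (f t)) @ F --> qk x.
Proof. by apply: (@cvg_lip1 (@qk R)) => // ?; exact: ler_qk. Qed.

Lemma cvg_quat f x : (fun t => qre (f t)) @ F --> qre x ->
  (fun t => qi (f t)) @ F --> qi x -> (fun t => qj (f t)) @ F --> qj x ->
  (fun t => qk (f t)) @ F --> qk x -> f @ F --> x.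
Proof.
move=> /cvgrPdist_le h1 /cvgrPdist_le h2 /cvgrPdist_le h3 /cvgrPdist_le h4.
apply/cvgrPdist_le => e e0; have e20 : 0 < e / 2 by rewrite divr_gt0.
near=> t; have -> : e = 2 * (e / 2) by field.
by apply: ler_qnorm_comp; rewrite ?qreD ?qiD ?qjD ?qkD ?qreN ?qiN ?qjN ?qkN; near: t;
  [exact: h1|exact: h2|exact: h3|exact: h4].
Unshelve. all: end_near. Qed.

Lemma cvg_quatM f g x y : f @ F --> x -> g @ F --> y ->
  (fun t => f t * g t) @ F --> x * y.
Proof.
move=> fx gy.
have [f1 f2 f3 f4] := And4 (cvg_qre fx) (cvg_qi fx) (cvg_qj fx) (cvg_qk fx).
have [g1 g2 g3 g4] := And4 (cvg_qre gy) (cvg_qi gy) (cvg_qj gy) (cvg_qk gy).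
apply: cvg_quat.
- exact: (cvgB (cvgB (cvgB (cvgM f1 g1) (cvgM f2 g2)) (cvgM f3 g3)) (cvgM f4 g4)).
- exact: (cvgB (cvgD (cvgD (cvgM f1 g2) (cvgM f2 g1)) (cvgM f3 g4)) (cvgM f4 g3)).
- exact: (cvgD (cvgD (cvgB (cvgM f1 g3) (cvgM f2 g4)) (cvgM f3 g1)) (cvgM f4 g2)).
- exact: (cvgD (cvgB (cvgD (cvgM f1 g4) (cvgM f2 g3)) (cvgM f3 g2)) (cvgM f4 g1)).
Qed.

Lemma cvg_qconj f x : f @ F --> x -> (fun t => qconj (f t)) @ F --> qconj x.
Proof.
move=> fx.
have [f1 f2 f3 f4] := And4 (cvg_qre fx) (cvg_qi fx) (cvg_qj fx) (cvg_qk fx).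
by apply: cvg_quat => //; [exact: (cvgN f2)|exact: (cvgN f3)|exact: (cvgN f4)].
Qed.

End Filters.

Lemma cvg_quat_unique (u : nat -> quat R) x y :
  u @ \oo --> x -> u @ \oo --> y -> x = y.
Proof. by move=> ux uy; apply: (cvg_unique (@norm_hausdorff _ _) ux uy). Qed.

Lemma cvg_quat_limn (u : nat -> quat R) x : u @ \oo --> x -> limn u = x.
Proof. by move=> ux; apply/cvg_lim => //; exact: norm_hausdorff. Qed.

Lemma cvg_quat_le (u : nat -> quat R) x (M : R) :
  (\forall n \near \oo, `|u n| <= M) -> u @ \oo --> x -> `|x| <= M.
Proof.
move=> uM /cvg_norm ux; rewrite -(cvg_lim (@Rhausdorff R) ux).
by apply: limr_le => //; apply/cvg_ex; eexists; exact: ux.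
Qed.

End QuaternionLimits.

Section AbsoluteSums.
Variable R : realType.
Implicit Types (u v : nat -> quat R) (a b : nat -> R) (M : R).

Definition psum u N := \sum_(n < N) u n.

(** Summability of nonnegative terms is encoded as a uniform bound on the partial sums, so that
    majorants are compared term by term and no limit has to be handled. *)
Definition sum_le a M := forall N, \sum_(n < N) a n <= M.

Definition asum u := exists M, sum_le (fun n => `|u n|) M.

Definition qsum u := limn (psum u).

Lemma sum_le_ge0 a M : sum_le a M -> 0 <= M.
Proof. by move=> /(_ 0%N); rewrite big_ord0. Qed.

Lemma cvg_sum_le a M : (forall n, 0 <= a n) -> sum_le a M ->
  exists2 l, 0 <= l <= M & (fun N => \sum_(n < N) a n) @ \oo --> l.
Proof.
move=> a0 aM; have nd : nondecreasing_seq (fun N => \sum_(n < N) a n).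
  apply/nondecreasing_seqP => N.
  by rewrite big_ord_recr /= lerDl.
have cv : cvgn (fun N => \sum_(n < N) a n).
  by apply: nondecreasing_is_cvgn => //; exists M => _ [N _ <-]; exact: aM.
exists (limn (fun N => \sum_(n < N) a n)) => //; apply/andP; split.
  by apply: limr_ge => //; apply: nearW => N; rewrite sumr_ge0.
by apply: limr_le => //; apply: nearW => N; exact: aM.
Qed.

Lemma sum_le_trans a b M : (forall n, a n <= b n) -> sum_le b M -> sum_le a M.
Proof. by move=> ab bM N; apply: le_trans (bM N); apply: ler_sum. Qed.

Lemma asum_comp u b M : (forall n, `|u n| <= b n) -> sum_le b M -> asum u.
Proof. by move=> ub bM; exists M; exact: sum_le_trans bM. Qed.

Lemma real_cvg_asum a M : sum_le (fun n => `|a n|) M ->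
  cvgn (fun N => \sum_(n < N) a n).
Proof.
move=> aM.
have E (c : nat -> R) : (fun N => \sum_(n < N) c n) = series c.
  by apply/funext => N; rewrite /series /= big_mkord.
rewrite E; apply: normed_cvg.
have [l _ cl] := cvg_sum_le (fun n => normr_ge0 (a n)) aM.
apply/cvg_ex; exists l; move: cl; rewrite (E (fun n => `|a n|)).
exact.
Qed.

Lemma cvg_qsum u : asum u -> psum u @ \oo --> qsum u.
Proof.
move=> [M uM].
have cv (phi : quat R -> R) : (forall x, `|phi x| <= `|x|) ->
    cvgn (fun N => \sum_(n < N) phi (u n)).
  by move=> le; exact: (@real_cvg_asum (phi \o u) _ (sum_le_trans (fun n => le (u n)) uM)).
pose L (phi : quat R -> R) := limn (fun N => \sum_(n < N) phi (u n)).
suff : psum u @ \oo --> Quat (L (@qre R)) (L (@qi R)) (L (@qj R)) (L (@qk R)).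
  by move=> h; rewrite /qsum (cvg_quat_limn h).
have sumE (phi : quat R -> R) : (forall x y, phi (x + y) = phi x + phi y) ->
    phi 0 = 0 -> (fun N => phi (psum u N)) = (fun N => \sum_(n < N) phi (u n)).
  by move=> pD p0; apply/funext => N; rewrite /psum (big_morph phi pD p0).
apply: cvg_quat => /=.
- by rewrite (sumE (@qre R))//; apply: cv => x; exact: ler_qre.
- by rewrite (sumE (@qi R))//; apply: cv => x; exact: ler_qi.
- by rewrite (sumE (@qj R))//; apply: cv => x; exact: ler_qj.
- by rewrite (sumE (@qk R))//; apply: cv => x; exact: ler_qk.
Qed.

Lemma norm_psum_le u b M N : (forall n, `|u n| <= b n) -> sum_le b M -> `|psum u N| <= M.
Proof.
move=> ub bM; apply: le_trans (ler_norm_sum _ _ _) _.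
by apply: le_trans (bM N); apply: ler_sum.
Qed.

Lemma norm_qsum_le u b M : (forall n, `|u n| <= b n) -> sum_le b M -> `|qsum u| <= M.
Proof.
move=> ub bM; apply: cvg_quat_le (cvg_qsum (asum_comp ub bM)).
by apply: nearW => N; exact: norm_psum_le ub bM.
Qed.

Lemma qsum_eq u x : psum u @ \oo --> x -> qsum u = x.
Proof. exact: cvg_quat_limn. Qed.

Lemma asumD u v : asum u -> asum v -> asum (fun n => u n + v n).
Proof.
move=> [M uM] [M' vM]; exists (M + M') => N.
apply: le_trans (lerD (uM N) (vM N)); rewrite -big_split /=.
by apply: ler_sum => n _; exact: ler_normD.
Qed.

Lemma asumMl (x : quat R) u : asum u -> asum (fun n => x * u n).
Proof.
move=> [M uM]; exists (`|x| * M) => N; under eq_bigr do rewrite qnormM.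
by rewrite -mulr_sumr ler_wpM2l.
Qed.

Lemma asumN u : asum u -> asum (fun n => - u n).
Proof. by move=> [M uM]; exists M => N; under eq_bigr do rewrite normrN. Qed.

Lemma asumZ (c : R) u : asum u -> asum (fun n => c *: u n).
Proof.
move=> [M uM]; exists (`|c| * M) => N; under eq_bigr do rewrite normrZ.
by rewrite -mulr_sumr ler_wpM2l.
Qed.

Lemma qsumD u v : asum u -> asum v ->
  qsum (fun n => u n + v n) = qsum u + qsum v.
Proof.
move=> au av; apply: qsum_eq.
have -> : psum (fun n => u n + v n) = psum u + psum v.
  by apply/funext => N; rewrite /psum big_split.
exact: (cvgD (cvg_qsum au) (cvg_qsum av)).
Qed.

Lemma qsumMl (x : quat R) u : asum u -> qsum (fun n => x * u n) = x * qsum u.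
Proof.
move=> au; apply: qsum_eq.
have -> : psum (fun n => x * u n) = (fun N => x * psum u N).
  by apply/funext => N; rewrite /psum mulr_sumr.
exact: (cvg_quatM (cvg_cst x) (cvg_qsum au)).
Qed.

Lemma qsumMr (x : quat R) u : asum u -> qsum (fun n => u n * x) = qsum u * x.
Proof.
move=> au; apply: qsum_eq.
have -> : psum (fun n => u n * x) = (fun N => psum u N * x).
  by apply/funext => N; rewrite /psum mulr_suml.
exact: (cvg_quatM (cvg_qsum au) (cvg_cst x)).
Qed.

Lemma qsumN u : asum u -> qsum (fun n => - u n) = - qsum u.
Proof.
move=> au; rewrite -mulN1r -qsumMl//; congr qsum; apply/funext => n.
by rewrite mulN1r.
Qed.

Lemma qsumB u v : asum u -> asum v ->
  qsum (fun n => u n - v n) = qsum u - qsum v.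
Proof. by move=> au av; rewrite -qsumN// -qsumD//; exact: asumN. Qed.

Lemma qsumZ (c : R) u : asum u -> qsum (fun n => c *: u n) = c *: qsum u.
Proof.
move=> au; rewrite -[c *: _]mulr_algl -qsumMl//; congr qsum; apply/funext => n.
by rewrite mulr_algl.
Qed.

Lemma qsum_conj u : asum u -> qsum (fun n => qconj (u n)) = qconj (qsum u).
Proof.
move=> au; apply: qsum_eq.
have -> : psum (fun n => qconj (u n)) = (fun N => qconj (psum u N)).
  apply/funext => N; rewrite /psum; apply: esym.
  by apply: (big_morph (@qconj R)); [exact: qconjD|exact: qconj0].
exact: (cvg_qconj (cvg_qsum au)).
Qed.

Lemma asum_shift u N : asum u -> asum (fun n => u (n + N)%N).
Proof.
move=> [M uM]; exists M => K; apply: le_trans (uM (N + K)%N).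
rewrite [leRHS]big_split_ord /=; under eq_bigr do rewrite addnC.
by rewrite lerDr sumr_ge0.
Qed.

Lemma qsum_split u N : asum u -> qsum u = psum u N + qsum (fun n => u (n + N)%N).
Proof.
move=> au; apply: qsum_eq.
rewrite -(cvg_shiftn N).
have -> : [sequence psum u (n + N)%N]_n =
    cst (psum u N) + psum (fun n => u (n + N)%N).
  apply/funext => K; rewrite /psum /= addnC big_split_ord /=; congr (_ + _).
  by apply: eq_bigr => i _; rewrite addnC.
exact: (cvgD (cvg_cst (psum u N)) (cvg_qsum (asum_shift N au))).
Qed.

Lemma geometric_sum_le (q : R) : 0 <= q < 1 -> sum_le (fun n => q ^+ n) (1 - q)^-1.
Proof.
move=> /andP[q0 q1] N; have d0 : 0 < 1 - q by rewrite subr_gt0.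
rewrite -(ler_pM2l d0) divff ?gt_eqF//.
have -> : (1 - q) * \sum_(n < N) q ^+ n = 1 - q ^+ N.
  by rewrite -[1 - q ^+ N]opprB subrX1 -mulNr opprB.
by rewrite gerBl exprn_ge0.
Qed.

Section Mertens.
Variables (V : nmodType).

Lemma triangle_sum (f : nat -> nat -> V) N :
  \sum_(n < N) \sum_(k < n.+1) f k (n - k)%N =
  \sum_(i < N) \sum_(j < N - i) f i j.
Proof.
elim: N => [|N IH]; first by rewrite !big_ord0.
rewrite big_ord_recr /= IH [RHS]big_ord_recr /= subSnn.
rewrite [X in _ + X]big_ord_recr /= subnn addrA big_ord1; congr (_ + _).
rewrite -big_split /=; apply: eq_bigr => i _.
by rewrite subSn ?big_ord_recr//= ltnW.
Qed.

End Mertens.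

Definition cprod (V : pzSemiRingType) (a b : nat -> V) n := \sum_(k < n.+1) a k * b (n - k)%N.

Lemma sum_conv_le a b A B : (forall n, 0 <= a n) -> (forall n, 0 <= b n) ->
  sum_le a A -> sum_le b B -> sum_le (cprod a b) (A * B).
Proof.
move=> a0 b0 aA bB N; rewrite (triangle_sum (fun i j => a i * b j)).
apply: (@le_trans _ _ (\sum_(i < N) a i * B)).
  by apply: ler_sum => i _; rewrite -mulr_sumr ler_wpM2l.
by rewrite -mulr_suml ler_wpM2r// (sum_le_ge0 bB).
Qed.

Lemma norm_conv_le u v n :
  `|cprod u v n| <= cprod (fun n => `|u n|) (fun n => `|v n|) n.
Proof.
apply: le_trans (ler_norm_sum _ _ _) _; apply: ler_sum => i _.
by rewrite qnormM.
Qed.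

(** The product of two partial sums differs from the partial sum of the Cauchy product by the terms
    with i + j >= N of the square of side N. These are dominated by the same terms for the norms,
    which vanish in the limit by the sandwich [CP], [PC] of nonnegative double sums. *)
Lemma qsum_conv u v : asum u -> asum v -> qsum (cprod u v) = qsum u * qsum v.
Proof.
move=> au av; have [[A uA] [B vB]] := (au, av).
pose a n := `|u n|; pose b n := `|v n|.
have a0 n : 0 <= a n := normr_ge0 _.
have b0 n : 0 <= b n := normr_ge0 _.
have [la _ ca] := cvg_sum_le a0 uA.
have [lb _ cb] := cvg_sum_le b0 vB.
have conv0 n : 0 <= cprod a b n by apply: sumr_ge0 => i _; rewrite mulr_ge0.
have [l _ cl] := cvg_sum_le conv0 (sum_conv_le a0 b0 uA vB).
pose Pn N := (\sum_(n < N) a n) * (\sum_(n < N) b n).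
pose Cn N := \sum_(n < N) cprod a b n.
have cP : Pn @ \oo --> la * lb by apply: cvgM.
have CE N : Cn N = \sum_(i < N) \sum_(j < N - i) a i * b j.
  by rewrite /Cn /cprod (triangle_sum (fun i j => a i * b j)).
have PE N : Pn N = \sum_(i < N) \sum_(j < N) a i * b j.
  by rewrite /Pn mulr_suml; apply: eq_bigr => i _; rewrite mulr_sumr.
have split_tri (V : nmodType) (f : nat -> nat -> V) N : \sum_(i < N) \sum_(j < N) f i j =
    \sum_(i < N) \sum_(j < N - i) f i j +
    \sum_(i < N) \sum_(N - i <= j < N) f i j.
  rewrite -big_split; apply: eq_bigr => i _ /=.
  by rewrite -!(big_mkord predT (f i)) -big_cat_nat// leq_subr.
have CP N : Cn N <= Pn N.
  by rewrite PE (split_tri _ (fun i j => a i * b j)) -CE lerDl sumr_ge0// => i _; rewrite sumr_ge0// => j _; rewrite mulr_ge0.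
(* The square of side N lies in the triangle of side 2N. *)
have PC N : Pn N <= Cn (N + N)%N.
  rewrite PE CE big_split_ord /= -[leLHS]addr0; apply: lerD; last first.
    by apply: sumr_ge0 => i _; apply: sumr_ge0 => j _; rewrite mulr_ge0.
  apply: ler_sum => i _.
  have -> : (N + N - i = N + (N - i))%N by rewrite addnBA// ltnW.
  by rewrite big_split_ord /= lerDl sumr_ge0// => j _; rewrite mulr_ge0.
have lP : l = la * lb.
  apply/eqP; rewrite eq_le; apply/andP; split.
    by apply: (ler_cvg_to cl cP); apply: nearW.
  have cl2 : (fun N => Cn (N + N)%N) @ \oo --> l.
    apply: (cvg_comp _ _ _ cl).
    move=> A0 [K _ KA]; exists K => // n /= Kn; apply: KA => /=.
    exact: leq_trans (leq_addr _ _).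
  by apply: (ler_cvg_to cP cl2); apply: nearW.
have c0 : (fun N => Pn N - Cn N) @ \oo --> 0.
  by rewrite -(subrr l) {1}lP; apply: cvgB.
apply: qsum_eq.
rewrite -[qsum u * qsum v]subr0.
have -> : psum (cprod u v) = (fun N => psum u N * psum v N -
    (psum u N * psum v N - psum (cprod u v) N)).
  by apply/funext => N; rewrite subKr.
apply: cvgB; first exact: (cvg_quatM (cvg_qsum au) (cvg_qsum av)).
apply/cvgrPdist_le => e e0.
move/cvgrPdist_le : c0 => /(_ e e0); apply: filterS => N.
rewrite !sub0r !normrN => hN; apply: le_trans hN; apply: le_trans (ler_norm _).
rewrite PE (split_tri _ (fun i j => a i * b j)) -CE [leRHS]addrC addKr.
have -> : psum u N * psum v N - psum (cprod u v) N =
    \sum_(i < N) \sum_(N - i <= j < N) u i * v j.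
  rewrite /psum mulr_suml.
  under eq_bigr do rewrite mulr_sumr.
  by rewrite /cprod (triangle_sum (fun i j => u i * v j))
    (split_tri _ (fun i j => u i * v j)) addrC addKr.
apply: le_trans (ler_norm_sum _ _ _) _; apply: ler_sum => i _.
apply: le_trans (ler_norm_sum _ _ _) _; apply: ler_sum => j _.
by rewrite qnormM.
Qed.

End AbsoluteSums.

(** * Cauchy's formula on a slice *)

Section SegmentIntegral.
Variable R : realType.
Implicit Types (f g : R -> R) (a b c M : R).

(** An unoriented integral: for [b < a] the segment is empty and the value is 0, so orientation is
    always tracked by hand through [a <= b]. *)
Definition rint a b f : R := \int[@lebesgue_measure R]_(x in `[a, b]) f x.

Lemma integrable_segment a b f : continuous f ->
  (@lebesgue_measure R).-integrable `[a, b] (EFin \o f).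
Proof.
move=> cf; apply: continuous_compact_integrable; first exact: segment_compact.
exact: continuous_subspaceT.
Qed.

Lemma rintD a b f g : continuous f -> continuous g ->
  rint a b (fun x => f x + g x) = rint a b f + rint a b g.
Proof. by move=> cf cg; rewrite /rint RintegralD//; exact: integrable_segment. Qed.

Lemma rintZ a b k f : continuous f -> rint a b (fun x => k * f x) = k * rint a b f.
Proof. by move=> cf; rewrite /rint RintegralZl//; exact: integrable_segment. Qed.

Lemma rintN a b f : continuous f -> rint a b (fun x => - f x) = - rint a b f.
Proof.
move=> cf; rewrite -mulN1r -rintZ//; congr rint.
by apply/funext => x; rewrite mulN1r.
Qed.

Lemma rintB a b f g : continuous f -> continuous g ->
  rint a b (fun x => f x - g x) = rint a b f - rint a b g.
Proof.
move=> cf cg; rewrite -rintN// -rintD// => x.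
by apply: cvgN; exact: cg.
Qed.

Lemma rint_cst a b k : a <= b -> rint a b (fun=> k) = k * (b - a).
Proof.
move=> ab; rewrite /rint Rintegral_cst//= lebesgue_measure_itv /= lte_fin.
by have [//|ba] := ltP a b; rewrite (@le_anti _ _ a b) ?ab// subrr.
Qed.

Lemma rint_le a b f g : continuous f -> continuous g ->
  (forall x, a <= x <= b -> f x <= g x) -> rint a b f <= rint a b g.
Proof.
move=> cf cg h.
apply: (le_Rintegral _ (integrable_segment a b cf) (integrable_segment a b cg)) => //.
Qed.

Lemma rint_bound a b f M : a <= b -> continuous f ->
  (forall x, a <= x <= b -> `|f x| <= M) -> `|rint a b f| <= M * (b - a).
Proof.
move=> ab cf h; rewrite -rint_cst// ler_norml.
have cc : continuous (fun _ : R => M) by move=> x; exact: cst_continuous.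
have cc' : continuous (fun x : R => - M : R) by move=> x; exact: cst_continuous.
rewrite -rintN//; apply/andP; split; apply: rint_le => // x xab;
  by have := h x xab; rewrite ler_norml => /andP[].
Qed.

Lemma rint_split a b c f : a <= c -> c <= b -> continuous f ->
  rint a b f = rint a c f + rint c b f.
Proof.
move=> ac cb cf; have i1 := integrable_segment a b cf.
have := @Rintegral_itvB R f (BLeft a) (BRight b) c i1.
rewrite !bnd_simp Rintegral_itv_obnd_cbnd; last first.
  by apply: integrableS (integrable_segment c b cf) => //; apply: subset_itvr; rewrite bnd_simp.
by move=> /(_ ac cb) /eqP; rewrite subr_eq addrC => /eqP.
Qed.

End SegmentIntegral.

Section Sections.
Variable R : realType.

Lemma continuous_section2 (F : R * R -> R) t : continuous F -> continuous (fun s => F (s, t)).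
Proof.
move=> cF s; apply: (@continuous_comp _ _ _ (fun s : R => (s, t)) F); last exact: cF.
exact: (cvg_pair cvg_id (cvg_cst _)).
Qed.

Lemma continuous_section1 (F : R * R -> R) s : continuous F -> continuous (fun t => F (s, t)).
Proof.
move=> cF t; apply: (@continuous_comp _ _ _ (fun t : R => (s, t)) F); last exact: cF.
exact: (cvg_pair (cvg_cst _) cvg_id).
Qed.

(** The counterclockwise circulation of the 1-form A ds + B dt around the rectangle [a, b] x
    [c, d]. *)
Definition boundary (A B : R * R -> R) (a b c d : R) :=
  (rint c d (fun t => B (b, t)) - rint c d (fun t => B (a, t))) -
  (rint a b (fun s => A (s, d)) - rint a b (fun s => A (s, c))).

Lemma boundary_split1 A B a m b c d : continuous A -> a <= m -> m <= b ->
  boundary A B a b c d = boundary A B a m c d + boundary A B m b c d.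
Proof.
move=> cA am mb; rewrite /boundary !(rint_split am mb); try exact: continuous_section2.
by ring.
Qed.

Lemma boundary_split2 A B a b c m d : continuous B -> c <= m -> m <= d ->
  boundary A B a b c d = boundary A B a b c m + boundary A B a b m d.
Proof.
move=> cB cm md; rewrite /boundary !(rint_split cm md); try exact: continuous_section1.
by ring.
Qed.

End Sections.

(** * Goursat's theorem for closed forms on rectangles *)

Section Goursat.
Variable R : realType.
Variables (A B : R * R -> R).
(** The shared coefficient [a2] says that A ds + B dt is closed at each point. Only pointwise
    differentiability is available, hence bisection instead of Green's formula. *)
Hypothesis dAB : forall v, exists a1 a2 b2, is_diff v A (fun h => a1 * h.1 + a2 * h.2) /\
  is_diff v B (fun h => a2 * h.1 + b2 * h.2).

Let contA : continuous A.
Proof.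
by move=> v; have [a1 [a2 [b2 [hA _]]]] := dAB v; apply: differentiable_continuous.
Qed.
Let contB : continuous B.
Proof.
by move=> v; have [a1 [a2 [b2 [_ hB]]]] := dAB v; apply: differentiable_continuous.
Qed.

Local Notation Phi := (boundary A B).

(** The affine parts of [A] and [B] at [v] form a closed form: its increments [a2 * w] and [a2 * h]
    between opposite sides contribute equal integrals, which cancel. Only the differentiability
    error remains, of order the perimeter times the diameter. *)
Let small_square (v : R * R) (e : R) : 0 < e -> exists2 dl, 0 < dl & forall s t w h,
  0 <= w -> 0 <= h -> w + h < dl -> s <= v.1 <= s + w -> t <= v.2 <= t + h ->
  `|Phi s (s + w) t (t + h)| <= e * (w + h) ^+ 2.
Proof.
move=> e0; have [a1 [a2 [b2 [hA hB]]]] := dAB v.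
have expand (F : R * R -> R) df1 df2 : is_diff v F (fun h => df1 * h.1 + df2 * h.2) ->
    exists2 dl, 0 < dl & forall x, `|v - x| < dl ->
      `|F x - (F v + (df1 * (x - v).1 + df2 * (x - v).2))| <= e / 2 * `|x - v|.
  move=> hF; have dF : differentiable F v by exact: ex_diff.
  have /diff_locallyP [_ hd] := dF.
  move/eqaddoP : hd => /(_ (e / 2)) /=; rewrite (@diff_val _ _ _ _ _ _ _ hF).
  move=> /(_ ltac:(by rewrite divr_gt0)) /nbhs_ballP [dl /= dl0 hdl].
  exists dl => // x vx; have := hdl (x - v); rewrite -ball_normE /= sub0r normrN distrC.
  move=> /(_ vx); rewrite !fctE /= subrK; exact.
have [dA dA0 eA] := expand A _ _ hA; have [dB dB0 eB] := expand B _ _ hB.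
exists (Num.min dA dB); first by rewrite lt_min dA0.
move=> s t w h w0 h0 wh /andP[s1 s2] /andP[t1 t2].
have near x : s <= x.1 <= s + w -> t <= x.2 <= t + h -> `|x - v| <= w + h.
  move=> /andP[x1 x2] /andP[y1 y2]; rewrite prod_normE /= ge_max.
  by rewrite !ler_norml; apply/andP; split; apply/andP; split; lra.
have ll (F : R * R -> R) df1 df2 dl x y : (forall x, `|v - x| < dl ->
      `|F x - (F v + (df1 * (x - v).1 + df2 * (x - v).2))| <= e / 2 * `|x - v|) ->
    Num.min dA dB <= dl ->
    s <= x.1 <= s + w -> t <= x.2 <= t + h -> s <= y.1 <= s + w -> t <= y.2 <= t + h ->
    `|F x - F y - (df1 * (x.1 - y.1) + df2 * (x.2 - y.2))| <= e * (w + h).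
  move=> hF ldl x1 x2 y1 y2.
  have hx := near x x1 x2; have hy := near y y1 y2.
  have /hF ex : `|v - x| < dl by rewrite distrC; apply: (le_lt_trans hx); exact: lt_le_trans ldl.
  have /hF ey : `|v - y| < dl by rewrite distrC; apply: (le_lt_trans hy); exact: lt_le_trans ldl.
  have -> : F x - F y - (df1 * (x.1 - y.1) + df2 * (x.2 - y.2)) =
     (F x - (F v + (df1 * (x - v).1 + df2 * (x - v).2))) -
     (F y - (F v + (df1 * (y - v).1 + df2 * (y - v).2))) by rewrite /=; ring.
  apply: le_trans (ler_normB _ _) _; apply: le_trans (lerD ex ey) _.
  have -> : e * (w + h) = e / 2 * (w + h) + e / 2 * (w + h) by field.
  by apply: lerD; rewrite ler_wpM2l// ltW// divr_gt0.
have lA : Num.min dA dB <= dA by rewrite ge_min lexx.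
have lB : Num.min dA dB <= dB by rewrite ge_min lexx orbT.
have cst_cont k : continuous (fun _ : R => k : R) by move=> ?; exact: cst_continuous.
have cB2 x := continuous_section1 (s := x) contB.
have cA2 x := continuous_section2 (t := x) contA.
have iB : `|rint t (t + h) (fun y => B (s + w, y) - B (s, y) - a2 * w)| <= e * (w + h) * h.
  have eh : t + h - t = h by ring.
  rewrite -[X in _ <= _ * X]eh.
  apply: rint_bound; first by rewrite lerDl.
    move=> y; apply: cvgB; last exact: cst_cont.
    by apply: cvgB; [exact: cB2|exact: cB2].
  move=> y yt; have := ll B _ _ _ (s + w, y) (s, y) eB lB.
  have -> : a2 * ((s + w, y).1 - (s, y).1) + b2 * ((s + w, y).2 - (s, y).2) = a2 * w.
    by move=> /=; ring.
  by apply => //=; rewrite ?lexx ?lerDl ?w0.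
have iA : `|rint s (s + w) (fun x => A (x, t + h) - A (x, t) - a2 * h)| <= e * (w + h) * w.
  have ew : s + w - s = w by ring.
  rewrite -[X in _ <= _ * X]ew.
  apply: rint_bound; first by rewrite lerDl.
    move=> y; apply: cvgB; last exact: cst_cont.
    by apply: cvgB; [exact: cA2|exact: cA2].
  move=> x xs; have := ll A _ _ _ (x, t + h) (x, t) eA lA.
  have -> : a1 * ((x, t + h).1 - (x, t).1) + a2 * ((x, t + h).2 - (x, t).2) = a2 * h.
    by move=> /=; ring.
  by apply => //=; rewrite ?lexx ?lerDl ?h0.
rewrite rintB ?rint_cst ?rintB ?lerDl// in iB; last first.
  by move=> y; apply: cvgB; [exact: cB2|exact: cB2].
rewrite rintB ?rint_cst ?rintB ?lerDl// in iA; last first.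
  by move=> y; apply: cvgB; [exact: cA2|exact: cA2].
have -> : Phi s (s + w) t (t + h) =
   (rint t (t + h) (fun y => B (s + w, y)) - rint t (t + h) (fun y => B (s, y)) -
       a2 * w * (t + h - t)) -
   (rint s (s + w) (fun x => A (x, t + h)) - rint s (s + w) (fun x => A (x, t)) -
       a2 * h * (s + w - s)) by rewrite /boundary; ring.
apply: le_trans (ler_normB _ _) _; apply: le_trans (lerD iB iA) _.
by rewrite -mulrDr [h + w]addrC -mulrA -expr2.
Qed.

(** Repeated bisection keeps a quarter carrying at least a fourth of the circulation. At the common
    point of the nested rectangles the circulation at stage n is at least $K/4^n$, whereas
    [small_square] bounds it by $e(w+h)^2/4^n$. *)
Theorem goursat a b c d : a <= b -> c <= d ->
  rint c d (fun t => B (b, t)) - rint c d (fun t => B (a, t)) =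
  rint a b (fun s => A (s, d)) - rint a b (fun s => A (s, c)).
Proof.
move=> ab cd; apply/eqP; rewrite -subr_eq0 -/(Phi a b c d); apply/negPn/negP => P0.
pose w := b - a; pose h := d - c.
have w0 : 0 <= w by rewrite subr_ge0.
have h0 : 0 <= h by rewrite subr_ge0.
pose w_ (n : nat) := w / 2 ^+ n; pose h_ (n : nat) := h / 2 ^+ n.
pose K := `|Phi a b c d|.
have K0 : 0 < K by rewrite normr_gt0.
have two_gt0 n : 0 < 2 ^+ n :> R by rewrite exprn_gt0.
have w_0 n : 0 <= w_ n by rewrite divr_ge0// ltW.
have h_0 n : 0 <= h_ n by rewrite divr_ge0// ltW.
have w_S n : w_ n = w_ n.+1 + w_ n.+1 by rewrite /w_ exprS; field; rewrite gt_eqF.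
have h_S n : h_ n = h_ n.+1 + h_ n.+1 by rewrite /h_ exprS; field; rewrite gt_eqF.
have stepP n (x : R * R) : exists y : R * R, [/\ x.1 <= y.1 <= x.1 + w_ n.+1,
    x.2 <= y.2 <= x.2 + h_ n.+1 &
    `|Phi x.1 (x.1 + w_ n) x.2 (x.2 + h_ n)| <=
      4 * `|Phi y.1 (y.1 + w_ n.+1) y.2 (y.2 + h_ n.+1)|].
  set s := x.1; set t := x.2; set w1 := w_ n.+1; set h1 := h_ n.+1.
  have w10 : 0 <= w1 by exact: w_0.
  have h10 : 0 <= h1 by exact: h_0.
  have E : Phi s (s + w_ n) t (t + h_ n) =
    Phi s (s + w1) t (t + h1) + Phi s (s + w1) (t + h1) (t + h1 + h1) +
    (Phi (s + w1) (s + w1 + w1) t (t + h1) +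
     Phi (s + w1) (s + w1 + w1) (t + h1) (t + h1 + h1)).
    have e1 : s + w_ n = s + w1 + w1 by rewrite w_S addrA.
    have e2 : t + h_ n = t + h1 + h1 by rewrite h_S addrA.
    have sw : s <= s + w1 by rewrite lerDl.
    have sw' : s + w1 <= s + w1 + w1 by rewrite lerDl.
    have th : t <= t + h1 by rewrite lerDl.
    have th' : t + h1 <= t + h1 + h1 by rewrite lerDl.
    rewrite e1 e2 (boundary_split1 _ t (t + h1 + h1) contA sw sw').
    rewrite (boundary_split2 _ s (s + w1) contB th th').
    by rewrite (boundary_split2 _ (s + w1) (s + w1 + w1) contB th th').
  set X := `|Phi s (s + w_ n) t (t + h_ n)|.
  have tri : X <= `|Phi s (s + w1) t (t + h1)| + `|Phi s (s + w1) (t + h1) (t + h1 + h1)| +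
    (`|Phi (s + w1) (s + w1 + w1) t (t + h1)| +
     `|Phi (s + w1) (s + w1 + w1) (t + h1) (t + h1 + h1)|).
    rewrite /X E; apply: le_trans (ler_normD _ _) _.
    by apply: lerD; exact: ler_normD.
  have [l1|l1] := leP X (4 * `|Phi s (s + w1) t (t + h1)|).
    by exists (s, t); rewrite /= !lexx !lerDl w10 h10.
  have [l2|l2] := leP X (4 * `|Phi s (s + w1) (t + h1) (t + h1 + h1)|).
    by exists (s, t + h1); rewrite /= !lexx !lerDl w10 h10.
  have [l3|l3] := leP X (4 * `|Phi (s + w1) (s + w1 + w1) t (t + h1)|).
    by exists (s + w1, t); rewrite /= !lexx !lerDl w10 h10.
  have [l4|l4] := leP X (4 * `|Phi (s + w1) (s + w1 + w1) (t + h1) (t + h1 + h1)|).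
    by exists (s + w1, t + h1); rewrite /= !lexx !lerDl w10 h10.
  by exfalso; lra.
pose nxt n x := projT1 (cid (stepP n x)).
pose P_ := fix P_ n := if n is m.+1 then nxt m (P_ m) else (a, c).
have P_S n : [/\ (P_ n).1 <= (P_ n.+1).1 <= (P_ n).1 + w_ n.+1,
    (P_ n).2 <= (P_ n.+1).2 <= (P_ n).2 + h_ n.+1 &
    `|Phi (P_ n).1 ((P_ n).1 + w_ n) (P_ n).2 ((P_ n).2 + h_ n)| <=
      4 * `|Phi (P_ n.+1).1 ((P_ n.+1).1 + w_ n.+1) (P_ n.+1).2 ((P_ n.+1).2 + h_ n.+1)|].
  by rewrite /= /nxt; case: cid.
have big n : K <= 4 ^+ n * `|Phi (P_ n).1 ((P_ n).1 + w_ n) (P_ n).2 ((P_ n).2 + h_ n)|.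
  elim: n => [|n IH].
    by rewrite expr0 mul1r /= /w_ /h_ expr0 !divr1 /w /h ![_ + (_ - _)]addrC !subrK.
  apply: (le_trans IH); rewrite exprSr -mulrA ler_wpM2l ?exprn_ge0//.
  by have [] := P_S n.
have lim (x_ : nat -> R) (v_ : nat -> R) : (forall n, 0 <= v_ n) ->
    (forall n, v_ n = v_ n.+1 + v_ n.+1) ->
    (forall n, x_ n <= x_ n.+1 <= x_ n + v_ n.+1) ->
    exists x, forall n, x_ n <= x <= x_ n + v_ n.
  move=> v0 vS hx.
  have nd : nondecreasing_seq x_ by apply/nondecreasing_seqP => n; case/andP: (hx n).
  have ub m n : x_ m <= x_ n + v_ n.
    have ni : nonincreasing_seq (fun n => x_ n + v_ n).
      apply/nonincreasing_seqP => k; case/andP: (hx k) => _ hk.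
      by have := vS k; lra.
    have [mn|nm] := leqP m n.
      by apply: (le_trans (nd _ _ mn)); rewrite lerDl.
    apply: le_trans (ni _ _ (ltnW nm)); by rewrite lerDl.
  have cx : cvgn x_.
    by apply: nondecreasing_is_cvgn => //; exists (x_ 0%N + v_ 0%N) => _ [m _ <-].
  exists (limn x_) => n; apply/andP; split; first exact: nondecreasing_cvgn_le.
  by apply: limr_le => //; apply: nearW => m; exact: ub.
have [xs hxs] := lim (fun n => (P_ n).1) w_ w_0 w_S (fun n => let: And3 x _ _ := P_S n in x).
have [ys hys] := lim (fun n => (P_ n).2) h_ h_0 h_S (fun n => let: And3 _ x _ := P_S n in x).
have wh0 : 0 <= w + h by rewrite addr_ge0.
(* Chosen so that $e(w+h)^2<K$; the summand 1 keeps the denominator positive for a rectangle reduced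
   to a point. *)
pose e := K / (2 * ((w + h) ^+ 2 + 1)).
have D0 : 0 < 2 * ((w + h) ^+ 2 + 1) by rewrite mulr_gt0// ltr_wpDl// sqr_ge0.
have e0 : 0 < e by rewrite divr_gt0.
have [dl dl0 hdl] := small_square (xs, ys) e0.
have [n hn] : exists n, (w + h) / 2 ^+ n < dl.
  have : geometric (w + h) (2^-1 : R) @ \oo --> 0.
    by apply: cvg_geometric; rewrite ger0_norm ?invf_lt1 ?ltr1n// invr_ge0.
  move=> /cvgrPdist_lt /(_ dl dl0) [n _ /(_ n (leqnn n))] /=.
  rewrite sub0r normrN ger0_norm; last by rewrite mulr_ge0// exprn_ge0// invr_ge0.
  by rewrite exprVn; exists n.
have := hdl (P_ n).1 (P_ n).2 (w_ n) (h_ n) (w_0 n) (h_0 n).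
rewrite /w_ /h_ -mulrDl => /(_ hn (hxs n) (hys n)) => hP.
have := big n; apply/negP; rewrite -ltNge.
apply: (@le_lt_trans _ _ (4 ^+ n * (e * ((w + h) / 2 ^+ n) ^+ 2))).
  by rewrite ler_pM2l ?exprn_gt0.
have -> : 4 ^+ n * (e * ((w + h) / 2 ^+ n) ^+ 2) = e * (w + h) ^+ 2.
  rewrite exprMn exprVn -exprM mulnC exprM [2 ^+ 2](_ : _ = 4); last by ring.
  by field; rewrite expf_neq0.
rewrite /e -mulrA -[ltRHS]mulr1 ltr_pM2l// mulrC ltr_pdivrMr// mul1r.
by have := sqr_ge0 (w + h); lra.
Qed.

End Goursat.

Lemma is_diff_ext (R : realType) (V W : normedModType R) (x : V) (f g df dg : V -> W) :
  is_diff x f df -> f =1 g -> df =1 dg -> is_diff x g dg.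
Proof. by move=> h /funext <- /funext <-. Qed.

Section RealDifferentials.
Variable R : realType.

Lemma is_diff_fst (v : R * R) : is_diff v (fst : R * R -> R) fst.
Proof.
have cf : continuous (fst : R * R -> R) by move=> x; exact: cvg_fst.
by apply: DiffDef; [exact: linear_differentiable|exact: diff_lin].
Qed.

Lemma is_diff_snd (v : R * R) : is_diff v (snd : R * R -> R) snd.
Proof.
have cf : continuous (snd : R * R -> R) by move=> x; exact: cvg_snd.
by apply: DiffDef; [exact: linear_differentiable|exact: diff_lin].
Qed.

Lemma is_derive_is_diff (f : R -> R) (x df : R) : is_derive x 1 f df ->
  is_diff x f (fun h => h * df).
Proof.
move=> hf; have dfx : derivable f x 1 by exact: ex_derive.
apply: DiffDef; first exact/derivable1_diffP.
by rewrite deriv1E//; apply/funext => h; rewrite derive1E derive_val.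
Qed.

Lemma is_diff_comp_fst (f : R -> R) (v : R * R) (df : R) : is_derive v.1 1 f df ->
  is_diff v (fun x => f x.1) (fun h => h.1 * df).
Proof.
by move=> hf; have := is_diff_comp (is_diff_fst v) (is_derive_is_diff hf).
Qed.

Lemma is_diff_comp_snd (f : R -> R) (v : R * R) (df : R) : is_derive v.2 1 f df ->
  is_diff v (fun x => f x.2) (fun h => h.2 * df).
Proof.
by move=> hf; have := is_diff_comp (is_diff_snd v) (is_derive_is_diff hf).
Qed.

Lemma derive_continuous (f df : R -> R) : (forall t : R, is_derive t 1 f (df t)) -> continuous f.
Proof.
move=> hf t; apply: differentiable_continuous; apply/derivable1_diffP.
exact: (@ex_derive _ _ _ _ _ _ _ (hf t)).
Qed.

End RealDifferentials.

(** * Contraction of a closed curve onto its centre *)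

Section Homotopy.
Variable R : realType.
Variables (u v : R * R -> R) (c1 c2 dc1 dc2 b1 b2 db1 db2 : R -> R) (x0 y0 K T : R).
Hypothesis huv : forall p, exists u1 u2, is_diff p u (fun h => u1 * h.1 + u2 * h.2) /\
  is_diff p v (fun h => u2 * h.1 - u1 * h.2).
Hypothesis hc1 : forall t : R, is_derive t 1 c1 (dc1 t).
Hypothesis hc2 : forall t : R, is_derive t 1 c2 (dc2 t).
Hypothesis hb1 : forall t : R, is_derive t 1 b1 (db1 t).
Hypothesis hb2 : forall t : R, is_derive t 1 b2 (db2 t).
Hypothesis eq1 : forall t, b1 t * c1 t - b2 t * c2 t = dc1 t.
Hypothesis eq2 : forall t, b1 t * c2 t + b2 t * c1 t = dc2 t.
Hypotheses (T0 : 0 <= T) (c1T : c1 T = c1 0) (c2T : c2 T = c2 0).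
Hypothesis c1K : forall t, `|c1 t| <= K.
Hypothesis c2K : forall t, `|c2 t| <= K.
Hypothesis b1K : forall t, `|b1 t| <= K.
Hypothesis b2K : forall t, `|b2 t| <= K.

Let P (x : R * R) := (x0 + expR x.1 * c1 x.2, y0 + expR x.1 * c2 x.2).
Let A x := u (P x).
Let B x := b1 x.2 * u (P x) + b2 x.2 * v (P x).

Let dP x : is_diff x P (fun h =>
  (expR x.1 * c1 x.2 * h.1 + expR x.1 * dc1 x.2 * h.2,
   expR x.1 * c2 x.2 * h.1 + expR x.1 * dc2 x.2 * h.2)).
Proof.
have hc z (c dc : R -> R) : (forall t : R, is_derive t 1 c (dc t)) ->
  is_diff x (fun x => z + expR x.1 * c x.2)
    (fun h => expR x.1 * c x.2 * h.1 + expR x.1 * dc x.2 * h.2).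
  move=> hc; have h1 := is_diff_comp_fst (is_derive_expR x.1).
  have h2 := is_diff_comp_snd (hc x.2).
  have := is_diffD (is_diff_cst z x) (is_diffM h1 h2).
  by rewrite add0r; move/is_diff_ext; apply => // h; rewrite !fctE /= /GRing.scale /=; ring.
exact: (is_diff_pair (hc x0 _ _ hc1) (hc y0 _ _ hc2)).
Qed.

Let dAB x : exists a1 a2 b2', is_diff x A (fun h => a1 * h.1 + a2 * h.2) /\
  is_diff x B (fun h => a2 * h.1 + b2' * h.2).
Proof.
have [u1 [u2 [hu hv]]] := huv (P x).
pose e := expR x.1; pose s := x.2.
exists (u1 * (e * c1 s) + u2 * (e * c2 s)).
exists (u1 * (e * dc1 s) + u2 * (e * dc2 s)).
exists (b1 s * (u1 * (e * dc1 s) + u2 * (e * dc2 s)) + u (P x) * db1 s +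
        (b2 s * (u2 * (e * dc1 s) - u1 * (e * dc2 s)) + v (P x) * db2 s)).
have hA := is_diff_comp (dP x) hu; have hV := is_diff_comp (dP x) hv.
split.
  by apply: (is_diff_ext hA) => // h; rewrite !fctE /= -/e -/s; ring.
have h1 := is_diff_comp_snd (hb1 s); have h2 := is_diff_comp_snd (hb2 s).
have := is_diffD (is_diffM h1 hA) (is_diffM h2 hV).
move/is_diff_ext; apply => // h; rewrite !fctE /= /GRing.scale /= -/e -/s.
by rewrite -(eq1 s) -(eq2 s); ring.
Qed.

(** F = u - iv is holomorphic and b = c'/c in complex notation, so that [A] ds + [B] dt is the real
    part of the pullback of $F(\zeta)\,d\zeta/(\zeta-z_0)$ by $\zeta=z_0+e^s c(t)$. The exponential
    keeps the scaling away from the singularity while s runs to minus infinity. On the rectangle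
    [s, 0] x [0, T] the sides t = 0 and t = T agree because the curve is closed, so the integral
    over t does not depend on s; as the curve shrinks, F tends to $F(z_0)$. *)
Lemma homotopy_integral :
  rint 0 T (fun t => b1 t * u (x0 + c1 t, y0 + c2 t) + b2 t * v (x0 + c1 t, y0 + c2 t)) =
  u (x0, y0) * rint 0 T b1 + v (x0, y0) * rint 0 T b2.
Proof.
have cb1 : continuous b1 := derive_continuous hb1.
have cb2 : continuous b2 := derive_continuous hb2.
have K0 : 0 <= K := le_trans (normr_ge0 _) (c1K 0).
have cB : continuous B.
  by move=> x; have [a1 [a2 [b3 [_ hB]]]] := dAB x; apply: differentiable_continuous.
have E s : s <= 0 -> rint 0 T (fun t => B (0, t)) = rint 0 T (fun t => B (s, t)).
  move=> s0; have := goursat dAB s0 T0.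
  by move/eqP; rewrite /A /P /= c1T c2T subrr subr_eq0 => /eqP.
have -> : (fun t => b1 t * u (x0 + c1 t, y0 + c2 t) + b2 t * v (x0 + c1 t, y0 + c2 t)) =
    (fun t => B (0, t)).
  by apply/funext => t; rewrite /B /P /= expR0 !mul1r.
rewrite -[_ * rint _ _ _]rintZ// -[v _ * rint _ _ _]rintZ// -rintD; last 2 first.
  by move=> t; apply: cvgM; [exact: cst_continuous|exact: cb1].
  by move=> t; apply: cvgM; [exact: cst_continuous|exact: cb2].
apply/eqP; rewrite -subr_eq0 -normr_le0; apply/ler_addgt0Pl => e e0.
rewrite addr0.
have cu : {for (x0, y0), continuous u}.
  by have [u1 [u2 [hu _]]] := huv (x0, y0); apply: differentiable_continuous.
have cv : {for (x0, y0), continuous v}.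
  by have [u1 [u2 [_ hv]]] := huv (x0, y0); apply: differentiable_continuous.
pose D := 2 * K * T + 1.
have D0 : 0 < D by rewrite ltr_wpDl// mulr_ge0// mulr_ge0.
pose e' := e / D.
have e'0 : 0 < e' by rewrite divr_gt0.
move/cvgrPdist_le : cu => /(_ e' e'0) /nbhs_ballP [d1 /= d10 hd1].
move/cvgrPdist_le : cv => /(_ e' e'0) /nbhs_ballP [d2 /= d20 hd2].
pose d := Num.min d1 d2.
have d0 : 0 < d by rewrite lt_min d10.
(* The scale $e^s=q$ brings the whole curve, of size at most [K] in each coordinate, within [d] of
   the centre; the minimum with 1 gives s <= 0. *)
pose q := Num.min 1 (d / 2 / (K + 1)).
have K10 : 0 < K + 1 by rewrite ltr_wpDl.
have q0 : 0 < q by rewrite lt_min ltr01 !divr_gt0.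
pose s := ln q.
have es : expR s = q by rewrite lnK.
have s0 : s <= 0 by rewrite -(@ln1 R) ler_ln ?posrE// ge_min lexx.
rewrite (E s s0) -rintB; last 2 first.
  exact: continuous_section1.
  move=> t; apply: cvgD.
    by apply: cvgM; [exact: cst_continuous|exact: cb1].
  by apply: cvgM; [exact: cst_continuous|exact: cb2].
apply: (@le_trans _ _ (2 * K * e' * (T - 0))); last first.
  have -> : 2 * K * e' * (T - 0) = 2 * K * T / D * e by rewrite /e'; ring.
  rewrite -[leRHS]mul1r ler_pM2r// ler_pdivrMr// mul1r /D lerDl//.
have qc c : (forall t, `|c t| <= K) -> forall t, `|expR s * c t| < d.
  move=> cK t; rewrite es normrM (ger0_norm (ltW q0)).
  apply: (@le_lt_trans _ _ (d / 2 / (K + 1) * (K + 1))).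
    apply: ler_pM => //; first exact: ltW.
      by rewrite ge_min lexx orbT.
    by apply: le_trans (cK t) _; rewrite lerDl.
  by rewrite divfK ?gt_eqF// ltr_pdivrMr// ltr_pMr// ltr1n.
have Pd t : `|(x0, y0) - P (s, t)| < d.
  rewrite prod_normE /P /= gt_max !opprD !addrA !subrr !add0r !normrN.
  by rewrite !qc.
apply: rint_bound => // [|t _].
  move=> t; apply: cvgB; first exact: continuous_section1.
  apply: cvgD.
    by apply: cvgM; [exact: cst_continuous|exact: cb1].
  by apply: cvgM; [exact: cst_continuous|exact: cb2].
have hu' : `|u (x0, y0) - u (P (s, t))| <= e'.
  by apply: hd1; rewrite -ball_normE /=; apply: lt_le_trans (Pd t) _; rewrite ge_min lexx.
have hv' : `|v (x0, y0) - v (P (s, t))| <= e'.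
  by apply: hd2; rewrite -ball_normE /=; apply: lt_le_trans (Pd t) _; rewrite ge_min lexx orbT.
have -> : B (s, t) - (u (x0, y0) * b1 t + v (x0, y0) * b2 t) =
   - (b1 t * (u (x0, y0) - u (P (s, t))) + b2 t * (v (x0, y0) - v (P (s, t)))).
  by rewrite /B /=; ring.
rewrite normrN; apply: le_trans (ler_normD _ _) _; rewrite !normrM.
have -> : 2 * K * e' = K * e' + K * e' by ring.
by apply: lerD; apply: ler_pM.
Qed.

End Homotopy.

Section LinearComponents.
Variable R : realType.

Definition lmulq (x y : quat R) : quat R := x * y.
HB.instance Definition _ (x : quat R) := GRing.isLinear.Build R (quat R) (quat R) *:%R
  (lmulq x) (fun a y z => etrans (mulrDr x (a *: y) z) (congr1 (fun t => t + x * z) (esym (scalerAr a x y)))).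
HB.instance Definition _ := GRing.isLinear.Build R (quat R) R *:%R
  (@qre R) (fun a x y => erefl).
HB.instance Definition _ := GRing.isLinear.Build R (quat R) R *:%R
  (@qi R) (fun a x y => erefl).
HB.instance Definition _ := GRing.isLinear.Build R (quat R) R *:%R
  (@qj R) (fun a x y => erefl).
HB.instance Definition _ := GRing.isLinear.Build R (quat R) R *:%R
  (@qk R) (fun a x y => erefl).

Lemma continuous_lmulq (x : quat R) : continuous (lmulq x).
Proof.
move=> y; apply: (@cvg_quatM R _ (nbhs y) _ (cst x) id); [exact: cvg_cst|exact: cvg_id].
Qed.
Lemma continuous_qre : continuous (@qre R).
Proof. by move=> y; apply: (@cvg_qre R _ (nbhs y) _ id); exact: cvg_id. Qed.
Lemma continuous_qi : continuous (@qi R).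
Proof. by move=> y; apply: (@cvg_qi R _ (nbhs y) _ id); exact: cvg_id. Qed.
Lemma continuous_qj : continuous (@qj R).
Proof. by move=> y; apply: (@cvg_qj R _ (nbhs y) _ id); exact: cvg_id. Qed.
Lemma continuous_qk : continuous (@qk R).
Proof. by move=> y; apply: (@cvg_qk R _ (nbhs y) _ id); exact: cvg_id. Qed.

Lemma is_diff_linear (V W : normedModType R) (L : {linear V -> W}) x :
  continuous L -> is_diff x L L.
Proof. by move=> cL; apply: DiffDef; [exact: linear_differentiable|exact: diff_lin]. Qed.

End LinearComponents.

(** * Integration of quaternion-valued functions over a period *)

Section CircleIntegral.
Variable R : realType.
Local Notation quat := (quat R).
Implicit Types f g : R -> quat.

Let T : R := 2 * pi.
Let T0 : 0 < T. Proof. by rewrite mulr_gt0// pi_gt0. Qed.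

Definition qint f : quat := Quat (rint 0 T (fun t => qre (f t))) (rint 0 T (fun t => qi (f t)))
  (rint 0 T (fun t => qj (f t))) (rint 0 T (fun t => qk (f t))).

Lemma continuous_comp_linear f (phi : quat -> R) : continuous phi -> continuous f ->
  continuous (fun t => phi (f t)).
Proof. by move=> cphi cf t; apply: (@continuous_comp _ _ _ f phi); [exact: cf|exact: cphi]. Qed.

Let comps f : continuous f -> [/\ continuous (fun t => qre (f t)), continuous (fun t => qi (f t)),
  continuous (fun t => qj (f t)) & continuous (fun t => qk (f t))].
Proof.
move=> cf; split; apply: continuous_comp_linear => //.
- exact: continuous_qre.
- exact: continuous_qi.
- exact: continuous_qj.
- exact: continuous_qk.
Qed.

Lemma qintD f g : continuous f -> continuous g -> qint (fun t => f t + g t) = qint f + qint g.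
Proof.
move=> /comps[f1 f2 f3 f4] /comps[g1 g2 g3 g4].
by apply: quat_eq; rewrite !qE /=; exact: rintD.
Qed.

Lemma rint_lin4 (a b c d : R) (f1 f2 f3 f4 : R -> R) : continuous f1 -> continuous f2 ->
  continuous f3 -> continuous f4 ->
  rint 0 T (fun t => a * f1 t + b * f2 t + c * f3 t + d * f4 t) =
  a * rint 0 T f1 + b * rint 0 T f2 + c * rint 0 T f3 + d * rint 0 T f4.
Proof.
move=> c1 c2 c3 c4.
have cZ k (h : R -> R) : continuous h -> continuous (fun t => k * h t).
  by move=> ch t; apply: cvgM; [exact: cst_continuous|exact: ch].
have cD (h k : R -> R) : continuous h -> continuous k -> continuous (fun t => h t + k t).
  by move=> ch ck t; apply: cvgD; [exact: ch|exact: ck].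
have z1 := cZ a _ c1; have z2 := cZ b _ c2; have z3 := cZ c _ c3; have z4 := cZ d _ c4.
rewrite (rintD _ _ (cD _ _ (cD _ _ z1 z2) z3) z4) (rintD _ _ (cD _ _ z1 z2) z3).
by rewrite (rintD _ _ z1 z2) !rintZ.
Qed.

Lemma qintMl x f : continuous f -> qint (fun t => x * f t) = x * qint f.
Proof.
move=> /comps[f1 f2 f3 f4]; apply: quat_eq; rewrite qE /=.
- have := rint_lin4 (qre x) (- qi x) (- qj x) (- qk x) f1 f2 f3 f4.
  by rewrite !mulNr => <-; congr rint; apply/funext => t; rewrite ?qE; ring.
- have := rint_lin4 (qi x) (qre x) (- qk x) (qj x) f1 f2 f3 f4 => h.
  transitivity (qi x * rint 0 T (fun t => qre (f t)) + qre x * rint 0 T (fun t => qi (f t)) +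
    - qk x * rint 0 T (fun t => qj (f t)) + qj x * rint 0 T (fun t => qk (f t))); last by ring.
  by rewrite -h; congr rint; apply/funext => t; rewrite ?qE; ring.
- have := rint_lin4 (qj x) (qk x) (qre x) (- qi x) f1 f2 f3 f4 => h.
  transitivity (qj x * rint 0 T (fun t => qre (f t)) + qk x * rint 0 T (fun t => qi (f t)) +
    qre x * rint 0 T (fun t => qj (f t)) + - qi x * rint 0 T (fun t => qk (f t))); last by ring.
  by rewrite -h; congr rint; apply/funext => t; rewrite ?qE; ring.
- have := rint_lin4 (qk x) (- qj x) (qi x) (qre x) f1 f2 f3 f4 => h.
  transitivity (qk x * rint 0 T (fun t => qre (f t)) + - qj x * rint 0 T (fun t => qi (f t)) +
    qi x * rint 0 T (fun t => qj (f t)) + qre x * rint 0 T (fun t => qk (f t))); last by ring.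
  by rewrite -h; congr rint; apply/funext => t; rewrite ?qE; ring.
Qed.

(** The four components are estimated separately, which costs the factor 2. It reappears as the
    factor in [2 * M] of all the Cauchy estimates, where it is harmless. *)
Lemma norm_qint f M : continuous f -> (forall t, `|f t| <= M) -> `|qint f| <= 2 * (M * T).
Proof.
move=> /comps[f1 f2 f3 f4] fM.
have b (phi : quat -> R) : (forall x, `|phi x| <= `|x|) -> continuous (fun t => phi (f t)) ->
    `|rint 0 T (fun t => phi (f t))| <= M * T.
  move=> le cphi; rewrite -[X in _ <= _ * X]subr0; apply: rint_bound => //; first exact: ltW.
  by move=> t _; apply: le_trans (le _) (fM t).
by apply: ler_qnorm_comp; apply: b => //; [exact: ler_qre|exact: ler_qi|exact: ler_qj|exact: ler_qk].
Qed.

Lemma qint_slice I (f1 f2 : R -> R) : continuous f1 -> continuous f2 ->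
  qint (fun t => slice_pt I (f1 t, f2 t)) = slice_pt I (rint 0 T f1, rint 0 T f2).
Proof.
move=> c1 c2; rewrite /slice_pt /=.
have cc : continuous (fun _ : R => 0 : R) by move=> ?; exact: cst_continuous.
have E (a b : R) : rint 0 T (fun t => f1 t * a + f2 t * b) = rint 0 T f1 * a + rint 0 T f2 * b.
  have h := rint_lin4 a b 0 0 c1 c2 cc cc.
  transitivity (a * rint 0 T f1 + b * rint 0 T f2 + 0 * rint 0 T (fun=> 0) +
    0 * rint 0 T (fun=> 0)); last by ring.
  by rewrite -h; congr rint; apply/funext => t; ring.
by apply: quat_eq => /=; rewrite ?qE -E.
Qed.

(** The fundamental theorem of calculus is read off from [goursat], applied to the exact form F(t)
    ds + s F'(t) dt, the differential of sF(t), on [0, 1] x [a, b]. *)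
Lemma rint_derive (F dF ddF : R -> R) a b : a <= b ->
  (forall t : R, is_derive t 1 F (dF t)) -> (forall t : R, is_derive t 1 dF (ddF t)) ->
  rint a b dF = F b - F a.
Proof.
move=> ab hF hdF.
have h : forall v : R * R, exists a1 a2 b2,
    is_diff v (fun x => F x.2) (fun h => a1 * h.1 + a2 * h.2) /\
    is_diff v (fun x => x.1 * dF x.2) (fun h => a2 * h.1 + b2 * h.2).
  move=> v; exists 0, (dF v.2), (v.1 * ddF v.2); split.
    by apply: (is_diff_ext (is_diff_comp_snd (hF v.2))) => // h; ring.
  apply: (is_diff_ext (is_diffM (is_diff_fst v) (is_diff_comp_snd (hdF v.2)))) => // h.
  by rewrite !fctE /= /GRing.scale /=; ring.
have := goursat h ler01 ab => /=.
have cdF : continuous dF := derive_continuous hdF.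
under [X in rint a b X - _]eq_fun do rewrite mul1r.
under [X in _ - rint a b X]eq_fun do rewrite mul0r.
by rewrite !rint_cst// mul0r !subr0 !mulr1 => ->.
Qed.

End CircleIntegral.

Lemma is_derive_ext (R : realType) (V W : normedModType R) (x v : V) (f g : V -> W) (df dg : W) :
  is_derive x v f df -> f =1 g -> df = dg -> is_derive x v g dg.
Proof. by move=> h /funext <- <-. Qed.

Section Trig.
Variable R : realType.
Implicit Types k a b t : R.

Definition trig k a b t := k + (a * cos t + b * sin t).

Lemma is_derive_trig k a b t : is_derive t 1 (trig k a b) (trig 0 b (- a) t).
Proof.
have hc := is_deriveZ a (is_derive_cos t); have hs := is_deriveZ b (is_derive_sin t).
have h := is_deriveD (is_derive_cst k t 1) (is_deriveD hc hs).
by apply: (is_derive_ext h) => //; rewrite /trig /GRing.scale /=; ring.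
Qed.

Lemma trig_2pi k a b : trig k a b (2 * pi) = trig k a b 0.
Proof. by rewrite /trig mulr_natl cos2pi sin2pi cos0 sin0. Qed.

Lemma derivable_trig_quot k a b k' a' b' t : trig k' a' b' t != 0 ->
  derivable (fun t => trig k a b t / trig k' a' b' t) t 1.
Proof.
move=> d0; apply: (@derivableM _ _ (trig k a b) (fun t => (trig k' a' b' t)^-1)).
  exact: (@ex_derive _ _ _ _ _ _ _ (is_derive_trig k a b t)).
exact: derivableV.
Qed.

Lemma rint_cos n : (0 < n)%N -> rint 0 (2 * pi) (fun t => cos (n%:R * t)) = 0 :> R.
Proof.
move=> n0; have n1 : n%:R != 0 :> R by rewrite pnatr_eq0 -lt0n.
have hl t : is_derive t 1 (fun t => n%:R * t) n%:R.
  have := is_deriveZ n%:R (is_derive_id t (1 : R)).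
  by move=> h; apply: (is_derive_ext h) => //; rewrite /GRing.scale /= mulr1.
have := @rint_derive R (fun t => n%:R^-1 * sin (n%:R * t)) (fun t => cos (n%:R * t))
  (fun t => n%:R * (- sin (n%:R * t))) 0 (2 * pi).
have -> : sin (n%:R * (2 * pi)) = 0 :> R.
  have -> : n%:R * (2 * pi) = 0 + pi *+ 2 *+ n :> R by rewrite add0r !mulr_natl.
  by rewrite (periodicn (@sinD2pi R)) sin0.
rewrite !mulr0 sin0 mulr0 subr0; apply; first by rewrite mulr_ge0// pi_ge0.
  move=> t; have h := is_deriveZ n%:R^-1 (is_derive1_comp (is_derive_sin (n%:R * t)) (hl t)).
  by apply: (is_derive_ext h) => //; rewrite /GRing.scale /=; field.
move=> t; have h := is_derive1_comp (is_derive_cos (n%:R * t)) (hl t).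
by apply: (is_derive_ext h) => //; rewrite mulrC.
Qed.

Lemma rint_sin n : rint 0 (2 * pi) (fun t => sin (n%:R * t)) = 0 :> R.
Proof.
have [->|n0] := posnP n.
  under eq_fun do rewrite mul0r sin0.
  by rewrite rint_cst ?mul0r// mulr_ge0// pi_ge0.
have n1 : n%:R != 0 :> R by rewrite pnatr_eq0 -lt0n.
have hl t : is_derive t 1 (fun t => n%:R * t) n%:R.
  have := is_deriveZ n%:R (is_derive_id t (1 : R)).
  by move=> h; apply: (is_derive_ext h) => //; rewrite /GRing.scale /= mulr1.
have := @rint_derive R (fun t => - n%:R^-1 * cos (n%:R * t)) (fun t => sin (n%:R * t))
  (fun t => n%:R * cos (n%:R * t)) 0 (2 * pi).
have -> : cos (n%:R * (2 * pi)) = 1 :> R.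
  have -> : n%:R * (2 * pi) = 0 + pi *+ 2 *+ n :> R by rewrite add0r !mulr_natl.
  by rewrite (periodicn (@cosD2pi R)) cos0.
rewrite mulr0 cos0 subrr; apply; first by rewrite mulr_ge0// pi_ge0.
  move=> t; have h := is_deriveZ (- n%:R^-1) (is_derive1_comp (is_derive_cos (n%:R * t)) (hl t)).
  by apply: (is_derive_ext h) => //; rewrite /GRing.scale /=; field.
move=> t; have h := is_derive1_comp (is_derive_sin (n%:R * t)) (hl t).
by apply: (is_derive_ext h) => //; rewrite mulrC.
Qed.

End Trig.

(** * Taylor expansion with remainder on a circle *)

Section Holomorphic.
Variable R : realType.
Local Notation quat := (quat R).
Variable I : quat.
Hypothesis unitI : imag_unit I.
Local Notation S := (slice_pt I).

(** The differential is $h\mapsto(h_1+h_2I)d$: holomorphy for left multiplication by $C_I$, with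
    arbitrary quaternions as values. *)
Definition holo (g : R * R -> quat) := forall v, exists d,
  is_diff v g (fun h => h.1 *: d + h.2 *: (I * d)).

Lemma holo_continuous g : holo g -> continuous g.
Proof. by move=> hg v; have [d hd] := hg v; apply: differentiable_continuous. Qed.

Lemma slice_ptE v x : S v * x = v.1 *: x + v.2 *: (I * x).
Proof. by rewrite /slice_pt mulrDl -!scalerAl mul1r. Qed.

Section Circle.
Variables (r : R) (z : R * R).
Hypothesis (r0 : 0 < r) (zr : `|S z| < r).

Let T : R := 2 * pi.
Let T0 : 0 < T. Proof. by rewrite mulr_gt0// pi_gt0. Qed.

Definition circle (t : R) : R * R := (r * cos t, r * sin t).
Definition circle_inv (t : R) : R * R := (r^-1 * cos t, - (r^-1 * sin t)).

(** For $\zeta=re^{It}$ one has $D=|\zeta-z|^2$, and [b1], [b2] are the coordinates of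
    $I\zeta\,\overline{(\zeta-z)}/D$, that is of the Cauchy weight $\zeta'(t)/(\zeta-z)$; [c1], [c2]
    are those of $\zeta-z$. *)
Let D := trig (r ^+ 2 + z.1 ^+ 2 + z.2 ^+ 2) (- 2 * r * z.1) (- 2 * r * z.2).
Let b1 t := trig 0 (- (r * z.2)) (r * z.1) t / D t.
Let b2 t := trig (r ^+ 2) (- (r * z.1)) (- (r * z.2)) t / D t.
Let c1 := trig (- z.1) r 0.
Let c2 := trig (- z.2) 0 r.

Let norm_circle t : `|S (circle t)| = r.
Proof.
apply/eqP; rewrite -(@eqrXn2 _ 2)// ?(ltW r0)// sqr_norm_slice_pt//= !exprMn -mulrDr.
by rewrite cos2Dsin2 mulr1.
Qed.

Let c12E t : (c1 t, c2 t) = circle t - z.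
Proof. by rewrite /c1 /c2 /trig /circle; congr pair => /=; ring. Qed.

Let DE t : D t = `|S (circle t) - S z| ^+ 2.
Proof.
rewrite -slice_ptB sqr_norm_slice_pt//= /D /trig.
have := cos2Dsin2 t => h.
have -> : r ^+ 2 = r ^+ 2 * (cos t ^+ 2 + sin t ^+ 2) by rewrite h mulr1.
ring.
Qed.

Let dist_ge t : r - `|S z| <= `|S (circle t) - S z|.
Proof. by rewrite -{1}(norm_circle t); exact: lerB_dist. Qed.

Let rz0 : 0 < r - `|S z|. Proof. by rewrite subr_gt0. Qed.

Let D_gt0 t : 0 < D t.
Proof. by rewrite DE exprn_gt0// (lt_le_trans rz0 (dist_ge t)). Qed.

Let D_neq0 t : D t != 0. Proof. by rewrite gt_eqF. Qed.

Definition cauchy_weight t : R * R := (b1 t, b2 t).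
Local Notation beta t := (S (cauchy_weight t)).

Let eq1 t : b1 t * c1 t - b2 t * c2 t = - (r * sin t).
Proof.
rewrite /b1 /b2 mulrAC [X in _ - X]mulrAC -mulrBl; apply: (mulIf (D_neq0 t)).
rewrite divfK// /c1 /c2 /D /trig; have := cos2Dsin2 t => h.
have -> : r ^+ 2 + z.1 ^+ 2 + z.2 ^+ 2 = r ^+ 2 * (cos t ^+ 2 + sin t ^+ 2) + z.1 ^+ 2 + z.2 ^+ 2.
  by rewrite h mulr1.
have -> : (r ^+ 2 + (- (r * z.1) * cos t + - (r * z.2) * sin t)) =
  (r ^+ 2 * (cos t ^+ 2 + sin t ^+ 2) + (- (r * z.1) * cos t + - (r * z.2) * sin t)).
  by rewrite h mulr1.
ring.
Qed.

Let eq2 t : b1 t * c2 t + b2 t * c1 t = r * cos t.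
Proof.
rewrite /b1 /b2 mulrAC [X in _ + X]mulrAC -mulrDl; apply: (mulIf (D_neq0 t)).
rewrite divfK// /c1 /c2 /D /trig; have := cos2Dsin2 t => h.
have -> : r ^+ 2 + z.1 ^+ 2 + z.2 ^+ 2 = r ^+ 2 * (cos t ^+ 2 + sin t ^+ 2) + z.1 ^+ 2 + z.2 ^+ 2.
  by rewrite h mulr1.
have -> : (r ^+ 2 + (- (r * z.1) * cos t + - (r * z.2) * sin t)) =
  (r ^+ 2 * (cos t ^+ 2 + sin t ^+ 2) + (- (r * z.1) * cos t + - (r * z.2) * sin t)).
  by rewrite h mulr1.
ring.
Qed.

Let betaE t : beta t * (S (circle t) - S z) = I * S (circle t).
Proof.
rewrite -slice_ptB -c12E slice_ptM//= eq1 eq2.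
transitivity (S (0, 1) * S (circle t)); last first.
  by congr (_ * _); rewrite /slice_pt /= scale0r add0r scale1r.
by rewrite slice_ptM//=; congr S; congr pair; ring.
Qed.

Let circleV t : S (circle t) * S (circle_inv t) = 1.
Proof.
rewrite slice_ptM//= /slice_pt /=.
have -> : r * cos t * (r^-1 * cos t) - r * sin t * - (r^-1 * sin t) = cos t ^+ 2 + sin t ^+ 2.
  by field; rewrite gt_eqF.
have -> : r * cos t * - (r^-1 * sin t) + r * sin t * (r^-1 * cos t) = 0 by ring.
by rewrite cos2Dsin2 scale1r scale0r addr0.
Qed.

(** One step of the geometric expansion of $I/(1-z\zeta^{-1})$. Its iteration produces the Taylor
    polynomial together with an exact remainder. *)
Let beta_geom t : beta t = I + beta t * (S z * S (circle_inv t)).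
Proof.
apply/eqP; rewrite -subr_eq; apply/eqP.
have IE : I * S (circle t) * S (circle_inv t) = I by rewrite -mulrA circleV mulr1.
rewrite -[RHS]IE.
by rewrite -betaE mulrBr mulrBl -mulrA circleV mulr1 mulrA.
Qed.

Let norm_circle_inv t : `|S (circle_inv t)| = r^-1.
Proof.
have := congr1 (fun x => `|x|) (circleV t); rewrite qnormM norm_circle qnorm1 => h.
by apply: (mulfI (lt0r_neq0 r0)); rewrite h divff ?gt_eqF.
Qed.

Let norm_beta t : `|beta t| <= r / (r - `|S z|).
Proof.
have := congr1 (fun x => `|x|) (betaE t).
rewrite !qnormM norm_circle (imag_unit_norm unitI) mul1r => h.
rewrite ler_pdivlMr// -[leRHS]h; apply: ler_wpM2l => //.
Qed.

Let hK (x : R * R) M : `|S x| <= M -> `|x.1| <= M /\ `|x.2| <= M.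
Proof.
move=> h; have M0 : 0 <= M := le_trans (normr_ge0 _) h.
have /= : `|S x| ^+ 2 <= M ^+ 2 by rewrite ler_pXn2r ?nnegrE.
rewrite sqr_norm_slice_pt// => h2.
have sq (a : R) : a ^+ 2 <= M ^+ 2 -> `|a| <= M.
  by move=> ha; rewrite -(@ler_pXn2r _ 2)// ?nnegrE// real_normK ?num_real.
have := sqr_ge0 x.1; have := sqr_ge0 x.2 => ? ?.
by split; apply: sq; lra.
Qed.

Lemma continuous_slice_pt_comp (f : R -> R * R) : continuous (fun t => (f t).1) ->
  continuous (fun t => (f t).2) -> continuous (fun t => S (f t)).
Proof.
move=> h1 h2 t; apply: cvgD; [exact: (cvgZr_tmp (h1 t))|exact: (cvgZr_tmp (h2 t))].
Qed.

Let contM (f g : R -> quat) : continuous f -> continuous g -> continuous (fun t => f t * g t).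
Proof. by move=> cf cg t; exact: (cvg_quatM (cf t) (cg t)). Qed.

Let contX (f : R -> quat) n : continuous f -> continuous (fun t => f t ^+ n).
Proof.
move=> cf; elim: n => [|n IH]; first by under eq_fun do rewrite expr0; move=> t; exact: cst_continuous.
by under eq_fun do rewrite exprS; exact: contM.
Qed.

Let hb1 (t : R) : is_derive t 1 b1 ('D_1 b1 t).
Proof. by apply/derivableP; exact: derivable_trig_quot. Qed.
Let hb2 (t : R) : is_derive t 1 b2 ('D_1 b2 t).
Proof. by apply/derivableP; exact: derivable_trig_quot. Qed.

Let cont_beta : continuous (fun t => beta t).
Proof. by apply: continuous_slice_pt_comp; [exact: derive_continuous hb1|exact: derive_continuous hb2]. Qed.

Lemma continuous_circle : continuous circle.
Proof.
have h (f : R -> R) : continuous f -> continuous (fun t => r * f t).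
  by move=> cf t; apply: cvgM; [exact: cst_continuous|exact: cf].
by move=> t; exact: (cvg_pair (h _ (@continuous_cos R) t) (h _ (@continuous_sin R) t)).
Qed.

Let cont_circle_inv : continuous (fun t => S (circle_inv t)).
Proof.
apply: continuous_slice_pt_comp => t /=; last apply: cvgN.
  by apply: cvgM; [exact: cst_continuous|exact: continuous_cos].
by apply: cvgM; [exact: cst_continuous|exact: continuous_sin].
Qed.

Let W := S (rint 0 T b1, rint 0 T b2).

(** Cauchy's formula with the total weight [W] left unevaluated. For a real linear functional l, the
    pair u = l(g), v = l(Ig) satisfies the Cauchy-Riemann hypothesis of [homotopy_integral]; it is
    applied to the four coordinates. *)
Let weight_integral g : holo g -> qint (fun t => beta t * g (circle t)) = W * g z.
Proof.
move=> hg; pose K := 2 * r + r / (r - `|S z|).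
have Kb : r / (r - `|S z|) <= K by rewrite lerDr mulr_ge0// ltW.
have Kc : 2 * r <= K by rewrite lerDl divr_ge0// ltW.
have bK t : `|b1 t| <= K /\ `|b2 t| <= K.
  by apply: (hK (x := (b1 t, b2 t))); apply: le_trans (norm_beta t) _.
have cK t : `|c1 t| <= K /\ `|c2 t| <= K.
  apply: (hK (x := (c1 t, c2 t))); rewrite c12E slice_ptB.
  apply: le_trans (ler_normB _ _) _; rewrite norm_circle; apply: le_trans Kc.
  by rewrite mulr_natl mulr2n lerD2l ltW.
have E (l : {linear quat -> R}) : continuous l ->
    rint 0 T (fun t => l (beta t * g (circle t))) = l (W * g z).
  move=> cl.
  have lin (a b : R) x y : l (a *: x + b *: y) = a * l x + b * l y.
    by rewrite linearD !linearZ.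
  have huv p : exists u1 u2, is_diff p (l \o g) (fun h => u1 * h.1 + u2 * h.2) /\
      is_diff p (l \o (lmulq I \o g)) (fun h => u2 * h.1 - u1 * h.2).
    have [d hd] := hg p; exists (l d), (l (I * d)); split.
      apply: (is_diff_ext (is_diff_comp hd (is_diff_linear (g p) cl))) => // h /=.
      by rewrite linearD !linearZ /= /GRing.scale /=; ring.
    have hI := is_diff_comp hd (is_diff_linear (g p) (@continuous_lmulq R I)).
    apply: (is_diff_ext (is_diff_comp hI (is_diff_linear _ cl))) => // h /=.
    rewrite linearD !linearZ /= /lmulq mulrA imag_unitM// mulN1r linearD !linearZ linearN /=.
    by rewrite /GRing.scale /=; ring.
  have := homotopy_integral z.1 z.2 huv (is_derive_trig _ _ _) (is_derive_trig _ _ _)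
    hb1 hb2 _ _ (ltW T0) (trig_2pi _ _ _) (trig_2pi _ _ _)
    (fun t => (cK t).1) (fun t => (cK t).2) (fun t => (bK t).1) (fun t => (bK t).2).
  have -> : (fun t => b1 t * (l \o g) (z.1 + trig (- z.1) r 0 t, z.2 + trig (- z.2) 0 r t) +
       b2 t * (l \o (lmulq I \o g)) (z.1 + trig (- z.1) r 0 t, z.2 + trig (- z.2) 0 r t)) =
      (fun t => l (beta t * g (circle t))).
    apply/funext => t; have -> : (z.1 + trig (- z.1) r 0 t, z.2 + trig (- z.2) 0 r t) = circle t.
      by rewrite /trig /circle; congr pair; ring.
    by rewrite slice_ptE lin.
  move=> -> //; last first.
    by move=> t; rewrite [LHS](eq2 t) /trig; ring.
  - by move=> t; rewrite [LHS](eq1 t) /trig; ring.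
  - by rewrite /W slice_ptE lin /= -surjective_pairing
       mulrC [X in _ + X]mulrC.
by apply: quat_eq; apply: E; [exact: continuous_qre|exact: continuous_qi|
  exact: continuous_qj|exact: continuous_qk].
Qed.

Definition circle_coef (g : R * R -> quat) n := T^-1 *: qint (fun t => S (circle_inv t) ^+ n * g (circle t)).

Let expand (g : R * R -> quat) N : continuous g ->
  qint (fun t => beta t * g (circle t)) =
  I * (\sum_(n < N) S z ^+ n * (T *: circle_coef g n)) +
  qint (fun t => beta t * ((S z * S (circle_inv t)) ^+ N * g (circle t))).
Proof.
move=> cg.
have cgc : continuous (fun t => g (circle t)).
  by move=> t; apply: (@continuous_comp _ _ _ circle g); [exact: continuous_circle|exact: cg].
have czd : continuous (fun t => S z * S (circle_inv t)).
  by apply: contM => // t; exact: cst_continuous.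
have cq n : continuous (fun t => beta t * ((S z * S (circle_inv t)) ^+ n * g (circle t))).
  by apply: contM => //; apply: contM => //; exact: contX.
elim: N => [|N IH].
  rewrite big_ord0 mulr0 add0r; congr qint; apply/funext => t.
  by rewrite expr0 mul1r.
rewrite IH big_ord_recr /= mulrDr -addrA; congr (_ + _).
have -> : (fun t => beta t * ((S z * S (circle_inv t)) ^+ N * g (circle t))) =
   (fun t => (I * S z ^+ N) * (S (circle_inv t) ^+ N * g (circle t)) +
     beta t * ((S z * S (circle_inv t)) ^+ N.+1 * g (circle t))).
  apply/funext => t; rewrite {1}beta_geom mulrDl exprS -!mulrA; congr (_ + _).
  by rewrite (exprMn_comm N (slice_ptC unitI z (circle_inv t))) !mulrA.
rewrite qintD; last 2 first.
- by apply: contM; [move=> t; exact: cst_continuous|apply: contM => //; exact: contX].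
- exact: cq.
rewrite qintMl; last by apply: contM => //; exact: contX.
by rewrite /circle_coef scalerA divff ?scale1r ?mulrA// gt_eqF.
Qed.

Let norm_expand (g : R * R -> quat) N M : continuous g -> (forall t, `|g (circle t)| <= M) ->
  `|qint (fun t => beta t * ((S z * S (circle_inv t)) ^+ N * g (circle t)))| <=
   2 * (r / (r - `|S z|) * ((`|S z| / r) ^+ N * M) * T).
Proof.
move=> cg gM.
have cgc : continuous (fun t => g (circle t)).
  by move=> t; apply: (@continuous_comp _ _ _ circle g); [exact: continuous_circle|exact: cg].
apply: norm_qint => [|t].
  apply: contM => //; apply: contM => //; apply: contX; apply: contM => //.
  by move=> t; exact: cst_continuous.
rewrite !qnormM qnormX qnormM norm_circle_inv.
have q0 : 0 <= (`|S z| / r) ^+ N by rewrite exprn_ge0// divr_ge0// ltW.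
by apply: ler_pM => //; [rewrite mulr_ge0|exact: ler_wpM2l].
Qed.

Let norm_coef (g : R * R -> quat) n M : continuous g -> (forall t, `|g (circle t)| <= M) ->
  `|circle_coef g n| <= 2 * M / r ^+ n.
Proof.
move=> cg gM; have cgc : continuous (fun t => g (circle t)).
  by move=> t; apply: (@continuous_comp _ _ _ circle g); [exact: continuous_circle|exact: cg].
rewrite /circle_coef normrZ ger0_norm ?invr_ge0 ?(ltW T0)// ler_pdivrMl//.
have -> : T * (2 * M / r ^+ n) = 2 * (r ^- n * M * T) by ring.
apply: norm_qint => [|t]; first by apply: contM => //; exact: contX.
rewrite qnormM qnormX norm_circle_inv -exprVn; apply: ler_wpM2l => //.
by rewrite exprn_ge0// invr_ge0 ltW.
Qed.

Let circle_invX n t : S (circle_inv t) ^+ n =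
  S (r ^- n * cos (n%:R * t), - (r ^- n * sin (n%:R * t))).
Proof.
elim: n => [|n IH].
  by rewrite !expr0 mul0r cos0 sin0 invr1 mulr1 mulr0 oppr0 slice_pt_re scale1r.
rewrite exprS IH slice_ptM//=; congr S.
rewrite mulrSr mulrDl mul1r cosD sinD exprS invfM.
by congr pair; ring.
Qed.

Let coef_one n : circle_coef (fun=> 1) n = (n == 0%N)%:R.
Proof.
rewrite /circle_coef; under eq_fun do rewrite mulr1 circle_invX.
have cc : continuous (fun t : R => cos (n%:R * t)).
  move=> t; apply: (@continuous_comp _ _ _ (fun t : R => n%:R * t) cos); last exact: continuous_cos.
  by apply: cvgM; [exact: cst_continuous|exact: cvg_id].
have cs : continuous (fun t : R => sin (n%:R * t)).
  move=> t; apply: (@continuous_comp _ _ _ (fun t : R => n%:R * t) sin); last exact: continuous_sin.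
  by apply: cvgM; [exact: cst_continuous|exact: cvg_id].
rewrite qint_slice; last 2 first.
- by move=> t; apply: cvgM; [exact: cst_continuous|exact: cc].
- by move=> t; apply: cvgN; apply: cvgM; [exact: cst_continuous|exact: cs].
rewrite rintN ?rintZ//; last by move=> t; apply: cvgM; [exact: cst_continuous|exact: cs].
rewrite rint_sin mulr0 oppr0 slice_pt_re.
have [->|n0] := posnP n.
  under eq_fun do rewrite mul0r cos0.
  rewrite rint_cst ?(ltW T0)// expr0 invr1 !mul1r subr0 scalerA mulVf ?scale1r ?gt_eqF//.
by rewrite rint_cos// mulr0 scale0r scaler0.
Qed.

(** Instead of computing a rational trigonometric integral, the weight formula is applied to the
    constant 1. Its circle coefficients are 1, 0, 0, ..., and the remainder of the expansion tends
    to 0. *)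
Let WE : W = I * T%:A.
Proof.
have h1 : holo (fun=> 1).
  move=> v; exists 0; apply: (is_diff_ext (is_diff_cst (1 : quat) v)) => // h.
  by rewrite mulr0 !scaler0 addr0.
have := weight_integral h1; rewrite mulr1 => EW.
have c1' : continuous (fun _ : R * R => 1 : quat) by move=> v; exact: cst_continuous.
apply/eqP; rewrite -subr_eq0 -normr_le0; apply/ler_addgt0Pl => e e0; rewrite addr0.
pose C := 2 * (r / (r - `|S z|)) * T.
have C0 : 0 < C by rewrite /C mulr_gt0// mulr_gt0// divr_gt0.
have : geometric C (`|S z| / r) @ \oo --> 0.
  by apply: cvg_geometric; rewrite ger0_norm ?divr_ge0 ?(ltW r0)// ltr_pdivrMr// mul1r.
move=> /cvgrPdist_le /(_ e e0) [n _ /(_ n.+1 (leqnSn n))] /=.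
rewrite sub0r normrN ger0_norm; last first.
  by rewrite mulr_ge0 ?(ltW C0)// exprn_ge0// divr_ge0// ltW.
apply: le_trans; rewrite -EW (expand n.+1 c1').
have -> : \sum_(i < n.+1) S z ^+ i * (T *: circle_coef (fun=> 1) i) = T%:A.
  rewrite big_ord_recl expr0 mul1r coef_one big1 ?addr0// => i _.
  by rewrite coef_one scaler0 mulr0.
rewrite [X in X - _]addrC addrK.
have l1 t : `|(fun=> 1 : quat) (circle t)| <= 1 :> R by rewrite qnorm1.
have := @norm_expand (fun=> 1) n.+1 1 c1' l1.
move/le_trans; apply; rewrite mulr1 /C.
by rewrite le_eqVlt; apply/orP; left; apply/eqP; ring.
Qed.

(** After N steps of [beta_geom] the remainder is the weight integral of $(z\zeta^{-1})^N g(\zeta)$,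
    whose size is explicit since $|\zeta|=r$. *)
Lemma circle_taylor g M : holo g -> (forall t, `|g (circle t)| <= M) ->
  (forall n, `|circle_coef g n| <= 2 * M / r ^+ n) /\
  (forall N, `|g z - \sum_(n < N) S z ^+ n * circle_coef g n| <=
     2 * M * (`|S z| / r) ^+ N * (r / (r - `|S z|))).
Proof.
move=> hg gM; have cg := holo_continuous hg.
split => [n|N]; first exact: norm_coef.
have := weight_integral hg; rewrite (expand N cg) WE.
under eq_bigr do rewrite -scalerAr.
rewrite -scaler_sumr -mulrA mulr_algl => E.
have {}E : I * (T *: (g z - \sum_(n < N) S z ^+ n * circle_coef g n)) =
    qint (fun t => beta t * ((S z * S (circle_inv t)) ^+ N * g (circle t))).
  by rewrite scalerBr mulrBr -E addrAC subrr add0r.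
have := norm_expand N cg gM; rewrite -E qnormM imag_unit_norm// mul1r normrZ (gtr0_norm T0) => h.
by rewrite -(ler_pM2l T0); apply: le_trans h _; rewrite le_eqVlt; apply/orP; left; apply/eqP; ring.
Qed.

End Circle.
End Holomorphic.

(** * Entire power series and slice regular functions *)

Section EntireSeries.
Variable R : realType.
Local Notation quat := (quat R).
Implicit Types (a b : nat -> quat) (x y h : quat).

(** Infinite radius of convergence, stated through majorants at every radius because products, star
    powers and compositions are all estimated by such majorants. *)
Definition entire a := forall r : R, 0 <= r -> exists M, sum_le (fun n => `|a n| * r ^+ n) M.

Lemma coef_bound_sum a (C r s : R) : 0 <= s -> s < r -> (forall n, `|a n| <= C / r ^+ n) ->
  sum_le (fun n => `|a n| * s ^+ n) (C * (1 - s / r)^-1).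
Proof.
move=> s0 sr aC; have r0 : 0 < r := le_lt_trans s0 sr.
have C0 : 0 <= C by have := aC 0%N; rewrite expr0 divr1; apply: le_trans.
have q : 0 <= s / r < 1 by rewrite divr_ge0 ?(ltW r0)// ltr_pdivrMr ?mul1r.
move=> N; apply: (@le_trans _ _ (C * \sum_(n < N) (s / r) ^+ n)); last first.
  by apply: ler_wpM2l => //; exact: geometric_sum_le.
rewrite mulr_sumr; apply: ler_sum => n _.
have -> : C * (s / r) ^+ n = C / r ^+ n * s ^+ n by rewrite exprMn exprVn; ring.
by apply: ler_wpM2r; rewrite ?exprn_ge0.
Qed.

Lemma entire_coef_bound a : (forall r : R, 0 < r -> exists C, forall n, `|a n| <= C / r ^+ n) ->
  entire a.
Proof.
move=> h r r0; have [C hC] := h (r + 1) (ltr_wpDl r0 ltr01).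
by eexists; apply: (coef_bound_sum r0 _ hC); rewrite ltrDl.
Qed.

Lemma sum_le_term (u : nat -> R) M n : (forall n, 0 <= u n) -> sum_le u M -> u n <= M.
Proof.
move=> u0 /(_ n.+1); rewrite big_ord_recr /=; apply: le_trans.
by rewrite lerDr sumr_ge0.
Qed.

Lemma asum_pser a M x (r : R) : sum_le (fun n => `|a n| * r ^+ n) M -> `|x| <= r ->
  asum (fun n => x ^+ n * a n).
Proof.
move=> aM xr; apply: asum_comp aM => n; rewrite qnormM qnormX mulrC.
by apply: ler_wpM2l => //; rewrite lerXn2r ?nnegrE// (le_trans _ xr).
Qed.

Lemma entire_asum a x : entire a -> asum (fun n => x ^+ n * a n).
Proof. by move=> ea; have [M aM] := ea _ (normr_ge0 x); exact: asum_pser aM _. Qed.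

Definition pser a x := qsum (fun n => x ^+ n * a n).

Lemma cvg_pser a x : entire a -> (fun N => \sum_(n < N) x ^+ n * a n) @ \oo --> pser a x.
Proof. by move=> /(entire_asum x) /cvg_qsum. Qed.

Lemma norm_pser_le a x (r M : R) : sum_le (fun n => `|a n| * r ^+ n) M -> `|x| <= r ->
  `|pser a x| <= M.
Proof.
move=> aM xr; apply: (norm_qsum_le _ aM) => n; rewrite qnormM qnormX mulrC.
by apply: ler_wpM2l => //; rewrite lerXn2r ?nnegrE// (le_trans _ xr).
Qed.

Lemma entireD a b : entire a -> entire b -> entire (fun n => a n + b n).
Proof.
move=> ea eb r r0; have [M aM] := ea r r0; have [M' bM] := eb r r0.
exists (M + M') => N; apply: le_trans (lerD (aM N) (bM N)); rewrite -big_split /=.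
apply: ler_sum => n _; rewrite -mulrDl; apply: ler_wpM2r; first exact: exprn_ge0.
exact: ler_normD.
Qed.

Lemma entireMr a c : entire a -> entire (fun n => a n * c).
Proof.
move=> ea r r0; have [M aM] := ea r r0.
exists (M * `|c|) => N; under eq_bigr do rewrite qnormM mulrAC.
by rewrite -mulr_suml ler_wpM2r.
Qed.

Lemma entireN a : entire a -> entire (fun n => - a n).
Proof.
move=> ea r r0; have [M aM] := ea r r0; exists M => N.
by under eq_bigr do rewrite normrN.
Qed.

Lemma entireB a b : entire a -> entire b -> entire (fun n => a n - b n).
Proof. by move=> ea eb; apply: entireD => //; exact: entireN. Qed.

Lemma entire0 : entire (fun=> 0).
Proof. by move=> r r0; exists 0 => N; rewrite big1// => n _; rewrite normr0 mul0r. Qed.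

Lemma pserD a b x : entire a -> entire b -> pser (fun n => a n + b n) x = pser a x + pser b x.
Proof.
move=> ea eb; rewrite /pser -qsumD; [|exact: entire_asum..].
by congr qsum; apply/funext => n; rewrite mulrDr.
Qed.

Lemma pserMr a c x : entire a -> pser (fun n => a n * c) x = pser a x * c.
Proof.
move=> ea; rewrite /pser -qsumMr; last exact: entire_asum.
by congr qsum; apply/funext => n; rewrite mulrA.
Qed.

Lemma pserB a b x : entire a -> entire b -> pser (fun n => a n - b n) x = pser a x - pser b x.
Proof.
move=> ea eb; rewrite /pser -qsumB; [|exact: entire_asum..].
by congr qsum; apply/funext => n; rewrite mulrBr.
Qed.

Lemma pser0 x : pser (fun=> 0) x = 0.
Proof.
apply: qsum_eq; rewrite [psum _](_ : _ = cst 0); first exact: cvg_cst.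
by apply/funext => N; rewrite /psum big1// => n _; rewrite mulr0.
Qed.

Lemma real_quatX (t : R) n : (t%:A : quat) ^+ n = (t ^+ n)%:A.
Proof. by rewrite exprZn expr1n. Qed.

Lemma norm_real (t : R) : `|t%:A : quat| = `|t|.
Proof. by rewrite normrZ qnorm1 mulr1. Qed.

Lemma pser_zero_coef a M (r : R) : 0 < r -> sum_le (fun n => `|a n| * r ^+ n) M ->
  (forall t : R, 0 < t < r -> pser a t%:A = 0) -> forall n, a n = 0.
Proof.
move=> r0 aM z n; elim/ltn_ind: n => n IH.
have M0 := sum_le_ge0 aM.
have term k := sum_le_term k (fun n => mulr_ge0 (normr_ge0 (a n)) (exprn_ge0 n (ltW r0))) aM.
apply/eqP; rewrite -normr_le0; apply/ler_addgt0Pl => e e0; rewrite addr0.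
(* |a n| t^n <= sum_(k > n) |a k| t^k <= (t / r)^n.+1 M *)
have key t : 0 < t < r -> `|a n| * r ^+ n <= t / r * M.
  move=> /andP[t0 tr]; have at_ : asum (fun n => t%:A ^+ n * a n).
    by apply: (asum_pser aM); rewrite norm_real gtr0_norm// ltW.
  have := z t; rewrite t0 tr => /(_ isT); rewrite /pser (qsum_split n.+1 at_).
  rewrite /psum big_ord_recr /= big1 ?add0r; last by move=> i _; rewrite IH ?mulr0.
  move=> /eqP; rewrite addr_eq0 => /eqP h.
  have : `|(t%:A ^+ n * a n : quat)| <= (t / r) ^+ n.+1 * M.
    rewrite h normrN; apply: (@norm_qsum_le _ _
      (fun k => (t / r) ^+ n.+1 * (`|a (k + n.+1)%N| * r ^+ (k + n.+1)))) => [k|].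
      rewrite qnormM qnormX norm_real (gtr0_norm t0) exprD.
      rewrite [leRHS](_ : _ = r ^+ k * t ^+ n.+1 * `|a (k + n.+1)%N|); last first.
        by rewrite exprMn exprVn exprD; field; rewrite expf_neq0// gt_eqF.
      rewrite ler_wpM2r// ler_wpM2r ?exprn_ge0 ?(ltW t0)//.
      by rewrite lerXn2r ?nnegrE ?(ltW tr)// ltW.
    move=> N; rewrite -mulr_sumr; apply: ler_wpM2l.
      by rewrite exprn_ge0// divr_ge0// ltW.
    apply: le_trans (aM (n.+1 + N)%N); rewrite [leRHS]big_split_ord /=.
    under eq_bigr do rewrite addnC.
    by rewrite lerDr sumr_ge0// => i _; rewrite mulr_ge0// exprn_ge0// ltW.
  rewrite qnormM qnormX norm_real (gtr0_norm t0) => h2.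
  have tn : 0 < (t / r) ^+ n by rewrite exprn_gt0// divr_gt0.
  rewrite -(ler_pM2l tn) [leRHS]mulrA -exprSr; apply: le_trans h2.
  rewrite le_eqVlt; apply/orP; left; apply/eqP.
  by rewrite exprMn exprVn; field; rewrite expf_neq0// gt_eqF.
have rn : 0 < r ^+ n by rewrite exprn_gt0.
rewrite -(ler_pM2r rn).
pose t := Num.min (r / 2) (r * (e * r ^+ n) / (M + 1)).
have M10 : 0 < M + 1 by rewrite ltr_wpDl.
have t0 : 0 < t by rewrite lt_min divr_gt0//= divr_gt0// !mulr_gt0.
have tr : t < r by rewrite /t gt_min ltr_pdivrMr// ltr_pMr// ltr1n.
apply: (le_trans (key t _)); first by rewrite t0.
apply: (@le_trans _ _ (t / r * (M + 1))).
  by rewrite ler_wpM2l ?divr_ge0 ?ltW// ltrDl.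
rewrite mulrAC ler_pdivrMr// -ler_pdivlMr// mulrC /t ge_min; apply/orP; right.
by rewrite mulrC [r * _]mulrC.
Qed.

(** Agreement on a real interval suffices. Real points belong to every slice, so expansions found on
    different slices, or on discs of different radii, can be identified. *)
Lemma pser_unique_local a b M (r : R) : 0 < r -> sum_le (fun n => `|a n| * r ^+ n) M ->
  sum_le (fun n => `|b n| * r ^+ n) M ->
  (forall t : R, 0 < t < r -> pser a t%:A = pser b t%:A) -> a = b.
Proof.
move=> r0 aM bM h; apply/funext => n; apply/eqP; rewrite -subr_eq0; apply/eqP; move: n.
apply: (@pser_zero_coef (fun n => a n - b n) (M + M) r r0).
  move=> N; apply: le_trans (lerD (aM N) (bM N)); rewrite -big_split /=.
  apply: ler_sum => n _; rewrite -mulrDl; apply: ler_wpM2r; last exact: ler_normB.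
  by rewrite exprn_ge0// ltW.
move=> t /andP[t0 tr]; rewrite /pser.
under eq_fun do rewrite mulrBr.
have tn : `|t%:A : quat| <= r by rewrite norm_real gtr0_norm// ltW.
rewrite qsumB; [|exact: (asum_pser aM)|exact: (asum_pser bM)].
by apply/eqP; rewrite subr_eq0 -!/(pser _ _) h// t0.
Qed.

Lemma pser_unique a b : entire a -> entire b ->
  (forall t : R, 0 < t < 1 -> pser a t%:A = pser b t%:A) -> a = b.
Proof.
move=> ea eb h; have [M aM] := ea 1 ler01; have [M' bM] := eb 1 ler01.
apply: (@pser_unique_local a b (Num.max M M') 1) => // N.
  by apply: le_trans (aM N) _; rewrite le_max lexx.
by apply: le_trans (bM N) _; rewrite le_max lexx orbT.
Qed.

(** Convergence at the real point r bounds the partial sums, hence their differences $r^na_n$; this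
    for every r > 0 gives absolute convergence everywhere. *)
Lemma has_power_series_entire f a : has_power_series f a -> entire a.
Proof.
move=> hf; apply: entire_coef_bound => r r0.
have := hf r%:A => cv.
have [K hK] : exists K, forall N, `|\sum_(n < N) (r%:A : quat) ^+ n * a n| <= K.
  have : bounded_fun (fun N => \sum_(n < N) (r%:A : quat) ^+ n * a n).
    by apply: cvg_seq_bounded; apply/cvg_ex; exists (f r%:A).
  move=> [K [Kr hK]]; exists (K + 1) => N; apply: hK => //.
  by rewrite ltrDl.
exists (K + K) => n; rewrite ler_pdivlMr ?exprn_gt0//.
have -> : `|a n| * r ^+ n = `|\sum_(k < n.+1) (r%:A : quat) ^+ k * a k -
    \sum_(k < n) (r%:A : quat) ^+ k * a k|.
  by rewrite big_ord_recr /= addrAC subrr add0r qnormM qnormX norm_real gtr0_norm// mulrC.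
by apply: le_trans (ler_normB _ _) _; exact: lerD.
Qed.

Lemma has_power_seriesE f a : has_power_series f a -> forall x, f x = pser a x.
Proof.
move=> hf x; apply: (cvg_quat_unique (hf x)); apply: cvg_pser.
exact: has_power_series_entire hf.
Qed.

Lemma has_power_series_pser a : entire a -> has_power_series (pser a) a.
Proof. by move=> ea x; exact: cvg_pser. Qed.

Lemma ps_coefE f a : has_power_series f a -> ps_coef f = a.
Proof.
move=> hf; rewrite /ps_coef; case: xgetP => [b -> /= hb|/(_ a)//].
apply: pser_unique => [||t _]; [exact: has_power_series_entire hb|
  exact: has_power_series_entire hf|].
by rewrite -(has_power_seriesE hb) -(has_power_seriesE hf).
Qed.

End EntireSeries.

(** * Differentiability of entire series *)

Section SeriesDerivative.
Variable R : realType.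
Local Notation quat := (quat R).
Implicit Types (a b : nat -> quat) (x y h : quat).

Lemma cvg_lip (V W : normedModType R) (T : Type) (F : set_system T) {FF : Filter F}
  (phi : V -> W) (M : R) (f : T -> V) (x : V) :
  (forall x y : V, `|phi x - phi y| <= M * `|x - y|) -> f @ F --> x -> phi \o f @ F --> phi x.
Proof.
move=> lip /cvgrPdist_lt fx; apply/cvgrPdist_lt => e e0.
have M1 : 0 < `|M| + 1 by rewrite ltr_wpDl.
near=> t; apply: (le_lt_trans (lip _ _)).
apply: (@le_lt_trans _ _ ((`|M| + 1) * `|x - f t|)).
  by apply: ler_wpM2r => //; apply: le_trans (ler_norm _) _; rewrite lerDl.
by rewrite mulrC -ltr_pdivlMr//; near: t; apply: fx; rewrite divr_gt0.
Unshelve. all: end_near. Qed.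

(** The differential of $x^n$ in direction h without commutativity: the sum of $x^i\,h\,x^{n-1-i}$
    over i < n. *)
Fixpoint dpow x h n : quat := if n is m.+1 then h * x ^+ m + x * dpow x h m else 0.

Lemma dpow_linear x (c : R) h k n : dpow x (c *: h + k) n = c *: dpow x h n + dpow x k n.
Proof.
elim: n => [|n IH] /=; first by rewrite scaler0 addr0.
by rewrite IH mulrDl mulrDr scalerDr -scalerAl -scalerAr addrACA.
Qed.

Lemma norm_dpow x h n (r : R) : 1 <= r -> `|x| <= r -> `|dpow x h n| <= n%:R * `|h| * r ^+ n.
Proof.
move=> r1 xr; have r0 : 0 <= r by apply: le_trans r1.
elim: n => [|n IH] /=; first by rewrite normr0 !mul0r.
apply: le_trans (ler_normD _ _) _; rewrite !qnormM qnormX.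
have -> : n.+1%:R * `|h| * r ^+ n.+1 = `|h| * r ^+ n.+1 + r * (n%:R * `|h| * r ^+ n).
  by rewrite exprS -natr1; ring.
apply: lerD; last by apply: ler_pM.
apply: ler_wpM2l => //; apply: (@le_trans _ _ (r ^+ n)); first by rewrite lerXn2r ?nnegrE.
by rewrite exprS ler_peMl// exprn_ge0.
Qed.

Lemma norm_subX x y n (r : R) : 1 <= r -> `|x| <= r -> `|y| <= r ->
  `|y ^+ n - x ^+ n| <= n%:R * `|y - x| * r ^+ n.
Proof.
move=> r1 xr yr; have r0 : 0 <= r by apply: le_trans r1.
elim: n => [|n IH]; first by rewrite !expr0 subrr normr0 !mul0r.
have -> : y ^+ n.+1 - x ^+ n.+1 = (y - x) * y ^+ n + x * (y ^+ n - x ^+ n).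
  by rewrite !exprS mulrBl mulrBr addrA subrK.
apply: le_trans (ler_normD _ _) _; rewrite !qnormM qnormX.
have -> : n.+1%:R * `|y - x| * r ^+ n.+1 = `|y - x| * r ^+ n.+1 + r * (n%:R * `|y - x| * r ^+ n).
  by rewrite exprS -natr1; ring.
apply: lerD; last by apply: ler_pM.
apply: ler_wpM2l => //; apply: (@le_trans _ _ (r ^+ n)); first by rewrite lerXn2r ?nnegrE.
by rewrite exprS ler_peMl// exprn_ge0.
Qed.

Lemma norm_dpow_err x h n (r : R) : 1 <= r -> `|x| <= r -> `|x + h| <= r ->
  `|(x + h) ^+ n - x ^+ n - dpow x h n| <= n%:R ^+ 2 * `|h| ^+ 2 * r ^+ n.
Proof.
move=> r1 xr yr; have r0 : 0 <= r by apply: le_trans r1.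
elim: n => [|n IH]; first by rewrite !expr0 /= subrr subr0 normr0 expr0n/= !mul0r.
have -> : (x + h) ^+ n.+1 - x ^+ n.+1 - dpow x h n.+1 =
    x * ((x + h) ^+ n - x ^+ n - dpow x h n) + h * ((x + h) ^+ n - x ^+ n).
  rewrite !exprS /= mulrDl !mulrBr opprD !addrA.
  by rewrite [LHS](ACl (1*3*5*2*4)%AC).
apply: le_trans (ler_normD _ _) _; rewrite !qnormM.
have hn := norm_subX n r1 xr yr; rewrite [x + h]addrC addrK in hn.
have := ler_pM (normr_ge0 x) (normr_ge0 _) xr IH; rewrite [x + h]addrC => h1.
have h2 := ler_wpM2l (normr_ge0 h) hn.
apply: le_trans (lerD h1 h2) _.
have X0 : 0 <= `|h| ^+ 2 * r ^+ n by rewrite mulr_ge0// exprn_ge0.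
apply: (@le_trans _ _ ((n%:R ^+ 2 + n%:R) * (`|h| ^+ 2 * r ^+ n) * r)).
  have -> : r * (n%:R ^+ 2 * `|h| ^+ 2 * r ^+ n) + `|h| * (n%:R * `|h| * r ^+ n) =
    n%:R ^+ 2 * (`|h| ^+ 2 * r ^+ n) * r + n%:R * (`|h| ^+ 2 * r ^+ n) * 1 by ring.
  rewrite mulrDl mulrDl lerD2l ler_wpM2l// mulr_ge0//.
rewrite -natr1 [r ^+ _.+1]exprS; have -> : (n%:R + 1) ^+ 2 * `|h| ^+ 2 * (r * r ^+ n) =
  (n%:R + 1) ^+ 2 * (`|h| ^+ 2 * r ^+ n) * r by ring.
apply: ler_wpM2r => //; apply: ler_wpM2r => //.
have : 0 <= n%:R :> R by [].
by move: (n%:R : R) => m m0; nra.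
Qed.

Lemma natr_le_exp2 n : n%:R <= 2 ^+ n :> R.
Proof. by rewrite -natrX ler_nat ltnW// ltn_expl. Qed.

Section Differential.
Variables (a : nat -> quat) (ea : entire a) (x : quat).

Definition dpser h := qsum (fun n => dpow x h n * a n).

Let r := `|x| + 1.
Let r1 : 1 <= r. Proof. by rewrite lerDr. Qed.
Let r0 : 0 <= r. Proof. by apply: le_trans r1. Qed.
Let xr : `|x| <= r. Proof. by rewrite lerDl. Qed.

(** The radius [r] leaves room for increments of norm at most 1, and the factor 4 absorbs the
    $n^2\le4^n$ of the second-order error in [norm_dpow_err]. *)
Let bound : exists2 M, 0 <= M & sum_le (fun n => `|a n| * (4 * r) ^+ n) M.
Proof.
by have [M hM] := ea (mulr_ge0 (ler0n _ 4) r0); exists M => //; exact: sum_le_ge0 hM.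
Qed.

Let term_le n h : `|dpow x h n * a n| <= `|h| * (`|a n| * (4 * r) ^+ n).
Proof.
rewrite qnormM mulrCA mulrC; apply: ler_wpM2l => //; apply: le_trans (norm_dpow h n r1 xr) _.
rewrite mulrAC mulrC; apply: ler_wpM2l => //; rewrite exprMn; apply: ler_wpM2r.
  by rewrite exprn_ge0.
by apply: le_trans (natr_le_exp2 n) _; rewrite lerXn2r ?nnegrE// ler_nat.
Qed.

Lemma asum_dpser h : asum (fun n => dpow x h n * a n).
Proof.
have [M M0 hM] := bound; apply: (@asum_comp _ _ _ (`|h| * M)) => [n|]; first exact: term_le.
by move=> N; rewrite -mulr_sumr ler_wpM2l.
Qed.

Lemma dpser_linear : linear dpser.
Proof.
move=> c h k; rewrite /dpser -qsumZ; last exact: asum_dpser.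
rewrite -qsumD; [|by apply: asumZ; exact: asum_dpser|exact: asum_dpser].
by congr qsum; apply/funext => n; rewrite dpow_linear mulrDl scalerAl.
Qed.

HB.instance Definition _ := GRing.isLinear.Build R quat quat *:%R dpser dpser_linear.

Lemma dpser_continuous : continuous dpser.
Proof.
have [M M0 hM] := bound; move=> h.
have lip k : `|dpser k| <= `|k| * M.
  apply: (norm_qsum_le (fun n => term_le n k)) => N.
  by rewrite -mulr_sumr ler_wpM2l.
apply: (@cvg_lip _ _ _ (nbhs h) _ _ M id h) => [x1 x2|]; last exact: cvg_id.
by rewrite -linearB mulrC; exact: lip.
Qed.

Let expansion h : `|h| <= 1 ->
  exists2 M, 0 <= M & forall h, `|h| <= 1 -> `|pser a (x + h) - pser a x - dpser h| <= M * `|h| ^+ 2.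
Proof.
move=> _; have [M M0 hM] := bound; exists M => // k k1.
have yr : `|x + k| <= r by apply: le_trans (ler_normD _ _) _; rewrite lerD2l.
rewrite /pser /dpser -qsumB; [|exact: entire_asum..].
rewrite -qsumB; [|by apply: asumD; [|apply: asumN]; exact: entire_asum|exact: asum_dpser].
apply: (@norm_qsum_le _ _ (fun n => `|k| ^+ 2 * (`|a n| * (4 * r) ^+ n))) => [n|N]; last first.
  by rewrite -mulr_sumr mulrC ler_wpM2r// exprn_ge0.
rewrite -!mulrBl qnormM mulrC mulrCA; apply: ler_wpM2l => //.
apply: le_trans (norm_dpow_err n r1 xr yr) _.
rewrite [_ * `|k| ^+ 2]mulrC -mulrA; apply: ler_wpM2l; first exact: exprn_ge0.
rewrite exprMn; apply: ler_wpM2r; first exact: exprn_ge0.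
apply: (@le_trans _ _ ((2 ^+ n) ^+ 2)).
  by rewrite lerXn2r ?nnegrE ?exprn_ge0// natr_le_exp2.
by rewrite -exprM mulnC exprM -natrX.
Qed.

Lemma is_diff_pser : is_diff x (pser a) dpser.
Proof.
have [M M0 hM] := expansion (h := 0) ltac:(by rewrite normr0).
have E : pser a \o shift x = cst (pser a x) + dpser +o_ 0 id.
  apply/eqaddoP => e e0; near=> h => /=.
  rewrite !fctE opprD addrA [h + x]addrC; apply: (le_trans (hM h _)).
    by near: h; exact: nbhs0_le.
  rewrite expr2 mulrA ler_wpM2r//.
  apply: (@le_trans _ _ ((M + 1) * `|h|)); first by rewrite ler_wpM2r// lerDl.
  have M1 : 0 < M + 1 by rewrite ltr_wpDl.
  rewrite mulrC -ler_pdivlMr//; near: h.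
  exact: nbhs0_le (divr_gt0 e0 (ltr_wpDl M0 ltr01)).
have dE := @diff_unique _ _ _ _ (dpser : {linear quat -> quat}) _ dpser_continuous E.
apply: DiffDef; last exact: dE.
by apply/diff_locallyP; rewrite dE; split => //; exact: dpser_continuous.
Unshelve. all: end_near. Qed.

End Differential.

(** On $C_I$ the powers of [x] commute with [I], which can therefore be pulled out on the left. This
    is the Cauchy-Riemann equation for the series. *)
Lemma dpser_slice I a x : imag_unit I -> slice I x -> entire a -> dpser a x I = I * dpser a x 1.
Proof.
move=> unitI xI ea; rewrite /dpser -qsumMl; last exact: asum_dpser.
congr qsum; apply/funext => n; rewrite mulrA; congr (_ * _).
elim: n => [|n IH] /=; first by rewrite mulr0.
by rewrite IH mul1r mulrDr !mulrA (sliceC unitI xI (slice_self I)).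
Qed.

Lemma slice_pt_linear (I : quat) : linear (slice_pt I).
Proof. by move=> c p q; rewrite slice_ptD slice_ptZ. Qed.

HB.instance Definition _ (I : quat) := GRing.isLinear.Build R (R * R)%type quat *:%R
  (slice_pt I) (@slice_pt_linear I).

Lemma continuous_slice_linear (I : quat) : continuous (slice_pt I).
Proof.
move=> p; apply: cvgD.
  by apply: cvgZr_tmp; exact: cvg_fst.
by apply: cvgZr_tmp; exact: cvg_snd.
Qed.

Lemma holo_pser I a : imag_unit I -> entire a -> holo I (pser a \o slice_pt I).
Proof.
move=> unitI ea v; exists (dpser a (slice_pt I v) 1).
have h := is_diff_comp (is_diff_linear v (@continuous_slice_linear I)) (is_diff_pser ea (slice_pt I v)).
apply: (is_diff_ext h) => // p /=.
rewrite -(dpser_slice unitI _ ea); last by exists v.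
by rewrite /slice_pt linearD !linearZ.
Qed.

Lemma slice_regular_pser a : entire a -> slice_regular (pser a).
Proof.
move=> ea; split=> [x|I unitI z].
  by have h := is_diff_pser ea x; exact: ex_diff.
have [d hd] := holo_pser unitI ea z.
have df : differentiable (pser a \o slice_pt I) z by exact: ex_diff.
rewrite !deriveE// (@diff_val _ _ _ _ _ _ _ hd) /= !scale1r !scale0r addr0 add0r.
by rewrite mulrA imag_unitM// mulN1r subrr scaler0.
Qed.

Lemma holo_slice_regular I (f : quat -> quat) : imag_unit I -> slice_regular f -> holo I (f \o slice_pt I).
Proof.
move=> unitI [df cr] v; exists ('D_(1, 0) (f \o slice_pt I) v).
have d1 : differentiable (f \o slice_pt I) v.
  by apply: differentiable_comp (df _); exact: (linear_differentiable v (@continuous_slice_linear I)).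
have := differentiableP d1; move/is_diff_ext; apply => // h.
(* The Cauchy-Riemann equation multiplied on the left by 2I. *)
have -> : I * 'D_(1, 0) (f \o slice_pt I) v = 'D_(0, 1) (f \o slice_pt I) v.
  have := cr I unitI v => /(congr1 (fun x => I * ((2 : R) *: x))).
  rewrite scalerA divff// scale1r scaler0 mulr0 mulrDr mulrA imag_unitM// mulN1r.
  by move/eqP; rewrite subr_eq0 => /eqP.
rewrite !deriveE//.
have {1}-> : h = h.1 *: (1, 0) + h.2 *: (0, 1) :> R * R.
  case: h => a b /=; rewrite -[RHS]/(a * 1 + b * 0, a * 0 + b * 1).
  by rewrite !mulr0 !mulr1 addr0 add0r.
by rewrite linearD !linearZ.
Qed.

End SeriesDerivative.

(** * Power series of slice regular functions *)

Section Taylor.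
Variable R : realType.
Local Notation quat := (quat R).
Implicit Types (a b : nat -> quat) (x y : quat) (f : quat -> quat).

Lemma imag_unit_i : imag_unit (Quat 0 1 0 0 : quat).
Proof. by rewrite /imag_unit expr2; apply: quat_eq; rewrite !qE /=; ring. Qed.

Section OnSlice.
Variable I : quat.
Hypothesis unitI : imag_unit I.
Local Notation S := (slice_pt I).

Lemma abs_le_norm_slice (v : R * R) : `|v.1| <= `|S v| /\ `|v.2| <= `|S v|.
Proof.
have h := sqr_norm_slice_pt unitI v.
have sq (c : R) : c ^+ 2 <= `|S v| ^+ 2 -> `|c| <= `|S v|.
  by move=> hc; rewrite -(@ler_pXn2r _ 2)// ?nnegrE// real_normK ?num_real.
have := sqr_ge0 v.1; have := sqr_ge0 v.2 => ? ?.
by split; apply: sq; rewrite h; lra.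
Qed.

Lemma bounded_on_disc (g : R * R -> quat) (r : R) : continuous g -> 0 <= r ->
  exists2 M, 0 <= M & forall v, `|S v| <= r -> `|g v| <= M.
Proof.
move=> cg r0; pose A := `[- r, r]%classic `*` `[- r, r]%classic.
have cA : compact A by apply: compact_setX; exact: segment_compact.
have A0 : A !=set0 by exists (0, 0); split; rewrite /= in_itv /= oppr_le0 r0.
have cn : {within A, continuous (fun v => `|g v|)}.
  by apply: continuous_subspaceT => v; apply: cvg_norm; exact: cg.
have [c _ hc] := compact_EVT_max A0 cA cn.
exists `|g c| => // v vr; apply: hc; rewrite inE.
have [h1 h2] := abs_le_norm_slice v.
by split; rewrite /= in_itv /= -ler_norml (le_trans _ vr).
Qed.

Lemma norm_circle (r t : R) : 0 <= r -> `|S (circle r t)| = r.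
Proof.
move=> r0; apply/eqP; rewrite -(@eqrXn2 _ 2)// sqr_norm_slice_pt//= !exprMn -mulrDr.
by rewrite cos2Dsin2 mulr1.
Qed.

Lemma taylor_disc (g : R * R -> quat) (r M : R) : holo I g -> 0 < r ->
  (forall v, `|S v| = r -> `|g v| <= M) -> exists a,
  (forall n, `|a n| <= 2 * M / r ^+ n) /\ forall v, `|S v| < r ->
    asum (fun n => S v ^+ n * a n) /\ g v = pser a (S v).
Proof.
move=> hg r0 gM; have gM' t : `|g (circle r t)| <= M by apply: gM; rewrite norm_circle// ltW.
have M0 : 0 <= M := le_trans (normr_ge0 _) (gM' 0).
exists (circle_coef I r g).
have S0r : `|S 0| < r by rewrite slice_pt0 normr0.
have [hc _] := circle_taylor unitI r0 S0r hg gM'.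
split => // v vr; have [_ hN] := circle_taylor unitI r0 vr hg gM'.
have as_ : asum (fun n => S v ^+ n * circle_coef I r g n).
  exact: (asum_pser (coef_bound_sum (normr_ge0 _) vr hc)).
split => //; apply: (@cvg_quat_unique _ (psum (fun n => S v ^+ n * circle_coef I r g n))).
  2: exact: cvg_qsum.
have q : `| `|S v| / r | < 1.
  by rewrite ger0_norm ?divr_ge0 ?(ltW r0)// ltr_pdivrMr ?mul1r.
have := cvg_geometric (2 * M * (r / (r - `|S v|))) q.
move=> /cvgrPdist_le h; apply/cvgrPdist_le => e e0; apply: filterS (h e e0) => N /=.
rewrite sub0r normrN => hh; apply: le_trans (hN N) _; apply: le_trans hh.
by apply: le_trans (ler_norm _); rewrite le_eqVlt; apply/orP; left; apply/eqP; ring.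
Qed.

(** Each radius yields its own coefficients. They agree on a real interval below min(1, r), hence
    coincide, so one sequence satisfies the Cauchy estimates at all radii. *)
Lemma taylor_entire (g : R * R -> quat) : holo I g ->
  exists2 a, entire a & forall v, g v = pser a (S v).
Proof.
move=> hg; have cg := holo_continuous hg.
have ex (r : R) : 0 < r -> exists a, exists2 M, (forall n, `|a n| <= 2 * M / r ^+ n) &
    forall v, `|S v| < r -> g v = pser a (S v).
  move=> r0; have [M _ hM] := bounded_on_disc cg (ltW r0).
  have [a [h1 h2]] := taylor_disc hg r0 (fun v vr => hM v (eq_ind_r (fun t => t <= r) (lexx r) vr)).
  by exists a, M => // v vr; have [] := h2 v vr.
have [a [M aM ha]] := ex 1 ltr01.
have same (r : R) (b : nat -> quat) (M' : R) : 0 < r -> (forall n, `|b n| <= 2 * M' / r ^+ n) ->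
    (forall v, `|S v| < r -> g v = pser b (S v)) -> b = a.
  move=> r0 bM hb; pose s := Num.min 1 r / 2.
  have m0 : 0 < Num.min 1 r by rewrite lt_min ltr01.
  have s0 : 0 < s by rewrite divr_gt0.
  have sm : s < Num.min 1 r by rewrite ltr_pdivrMr// ltr_pMr// ltr1n.
  have [s1 sr] : s < 1 /\ s < r by move: sm; rewrite lt_min => /andP.
  have h1 := coef_bound_sum (ltW s0) sr bM; have h2 := coef_bound_sum (ltW s0) s1 aM.
  apply: (@pser_unique_local _ b a (Num.max (2 * M' * (1 - s / r)^-1)
    (2 * M * (1 - s / 1)^-1)) s s0).
  - by move=> N; apply: le_trans (h1 N) _; rewrite le_max lexx.
  - by move=> N; apply: le_trans (h2 N) _; rewrite le_max lexx orbT.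
  move=> t /andP[t0 ts]; have St : S (t, 0) = t%:A by rewrite slice_pt_re.
  have nt : `|S (t, 0)| = t by rewrite St norm_real gtr0_norm.
  by rewrite -St -ha ?hb// nt; apply: lt_trans ts _.
exists a => [|v].
  apply: entire_coef_bound => r r0; have [b [M' bM hb]] := ex r r0.
  by exists (2 * M'); rewrite -(same r b M').
have r0 : 0 < `|S v| + 1 by rewrite ltr_wpDl.
have [b [M' bM hb]] := ex _ r0.
by rewrite -(same _ b M' r0 bM hb) hb// ltrDl.
Qed.

Lemma cauchy_coef a (r M : R) n : entire a -> 0 < r ->
  (forall x, slice I x -> `|x| = r -> `|pser a x| <= M) -> `|a n| <= 2 * M / r ^+ n.
Proof.
move=> ea r0 aM; have hg := holo_pser unitI ea.
have [b [bM hb]] := taylor_disc hg r0 (fun v vr => aM (S v) (ex_intro2 _ _ v Logic.I erefl) vr).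
suff -> : a = b by exact: bM.
pose s := r / 2; have s0 : 0 < s by rewrite divr_gt0.
have sr : s < r by rewrite ltr_pdivrMr// ltr_pMr// ltr1n.
have [M1 hM1] := ea s (ltW s0); have hM2 := coef_bound_sum (ltW s0) sr bM.
apply: (@pser_unique_local _ a b (Num.max M1 (2 * M * (1 - s / r)^-1)) s s0).
- by move=> N; apply: le_trans (hM1 N) _; rewrite le_max lexx.
- by move=> N; apply: le_trans (hM2 N) _; rewrite le_max lexx orbT.
move=> t /andP[t0 ts]; have St : S (t, 0) = t%:A by rewrite slice_pt_re.
have nt : `|S (t, 0)| = t by rewrite St norm_real gtr0_norm.
have [|_ h] := hb (t, 0); first by rewrite nt; exact: lt_trans ts _.
by rewrite -St -h.
Qed.

Lemma holo_translate (g : R * R -> quat) c : holo I g -> holo I (fun v => g (v + c)).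
Proof.
move=> hg v; have [d hd] := hg (v + c); exists d.
have sh : is_diff v (fun v => v + c) (id : R * R -> R * R).
  by apply: (is_diff_ext (is_diffD (is_diff_id v) (is_diff_cst c v))) => // h; rewrite !fctE addr0.
exact: (is_diff_ext (is_diff_comp sh hd)).
Qed.

(** The expansion about [c] is cut after one term. Evaluated at the centre it identifies the zeroth
    coefficient as g(c); at [v] the remainder is the claimed bound, since |v - c| <= r/2 makes r/(r
    - |v - c|) at most 2. *)
Lemma holo_lipschitz (g : R * R -> quat) c (r M : R) v : holo I g -> 0 < r ->
  (forall v, `|S (v - c)| <= r -> `|g v| <= M) -> `|S (v - c)| <= r / 2 ->
  `|g v - g c| <= 4 * M * (`|S (v - c)| / r).
Proof.
move=> hg r0 gM vr; have hg' := holo_translate c hg.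
have gM' t : `|g (circle r t + c)| <= M by apply: gM; rewrite addrK norm_circle// ltW.
have M0 : 0 <= M := le_trans (normr_ge0 _) (gM' 0).
have S0r : `|S 0| < r by rewrite slice_pt0 normr0.
have r2 : r / 2 < r by rewrite ltr_pdivrMr// ltr_pMr// ltr1n.
have Svr : `|S (v - c)| < r by exact: le_lt_trans r2.
have [_ h0] := circle_taylor unitI r0 S0r hg' gM'.
have [_ h1] := circle_taylor unitI r0 Svr hg' gM'.
have := h0 1%N; rewrite slice_pt0 normr0 mul0r expr1 mulr0 mul0r big_ord1 expr0 mul1r add0r.
rewrite normr_le0 subr_eq0 => /eqP gc.
have := h1 1%N; rewrite big_ord1 expr0 mul1r expr1 -gc subrK => h.
apply: le_trans h _.
have -> : 4 * M * (`|S (v - c)| / r) = 2 * M * (`|S (v - c)| / r) * 2 by ring.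
apply: ler_wpM2l; first by rewrite mulr_ge0 ?divr_ge0 ?(ltW r0)// mulr_ge0.
by rewrite ler_pdivrMr ?subr_gt0//; lra.
Qed.

End OnSlice.

(** The expansions on two slices agree at real points, so the coefficients found on one slice serve
    on all of them. *)
Lemma slice_regular_series f : slice_regular f ->
  exists2 a, entire a & forall x, f x = pser a x.
Proof.
move=> hf; have [a ea ha] := taylor_entire imag_unit_i (holo_slice_regular imag_unit_i hf).
exists a => // x; have [I unitI [v _ <-]] := quat_in_slice x imag_unit_i.
have [b eb hb] := taylor_entire unitI (holo_slice_regular unitI hf).
suff -> : a = b by exact: hb.
apply: pser_unique => // t _.
have h := ha (t, 0); have h' := hb (t, 0); rewrite /= !slice_pt_re in h h'.
by rewrite -h -h'.
Qed.

Lemma slice_regular_coef f : slice_regular f ->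
  entire (ps_coef f) /\ forall x, f x = pser (ps_coef f) x.
Proof.
move=> /slice_regular_series[a ea ha].
have -> : f = pser a by apply/funext.
by rewrite (ps_coefE (has_power_series_pser ea)).
Qed.

Lemma ps_coef_pser a : entire a -> ps_coef (pser a) = a.
Proof. by move=> ea; apply: ps_coefE; exact: has_power_series_pser. Qed.

Lemma slice_regular_continuous f : slice_regular f -> continuous f.
Proof. by move=> [df _] x; apply: differentiable_continuous. Qed.

Lemma cauchy_cvg_quat (u : nat -> quat) :
  (forall e : R, 0 < e -> exists N0, forall N N', (N0 <= N)%N -> (N0 <= N')%N -> `|u N - u N'| <= e) ->
  cvgn u.
Proof.
move=> hu.
have cv (phi : {linear quat -> R}) : (forall x, `|phi x| <= `|x|) -> cvgn (fun N => phi (u N)).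
  move=> le; apply: cauchy_cvg; apply: cauchy_exP => e e0.
  have e20 : 0 < e / 2 by rewrite divr_gt0.
  have [N0 h] := hu _ e20; exists (phi (u N0)); exists N0 => // n /= hn.
  rewrite -ball_normE /= -linearB (le_lt_trans (le _))// (le_lt_trans (h _ _ _ _))//.
  by rewrite ltr_pdivrMr// ltr_pMr// ltr1n.
apply/cvg_ex; exists (Quat (limn (fun N => qre (u N))) (limn (fun N => qi (u N)))
  (limn (fun N => qj (u N))) (limn (fun N => qk (u N)))).
apply: cvg_quat => /=.
- by apply: (cv (@qre R)) => x; exact: ler_qre.
- by apply: (cv (@qi R)) => x; exact: ler_qi.
- by apply: (cv (@qj R)) => x; exact: ler_qj.
- by apply: (cv (@qk R)) => x; exact: ler_qk.
Qed.

(* Weierstrass: by the Cauchy estimates the coefficients converge as well. *)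
Lemma entire_limit (aN : nat -> nat -> quat) (F : quat -> quat) :
  (forall N, entire (aN N)) ->
  (forall r e : R, 0 < r -> 0 < e -> exists N0, forall N x, (N0 <= N)%N -> `|x| <= r ->
     `|F x - pser (aN N) x| <= e) ->
  exists2 d, entire d & forall x, F x = pser d x.
Proof.
move=> eN cvF; have unitI := imag_unit_i; set I := Quat 0 1 0 0 in unitI.
have cau (r e : R) : 0 < r -> 0 < e -> exists N0, forall N N' n, (N0 <= N)%N -> (N0 <= N')%N ->
    `|aN N n - aN N' n| <= e / r ^+ n.
  move=> r0 e0; have e40 : 0 < e / 4 by rewrite divr_gt0.
  have [N0 h] := cvF r _ r0 e40; exists N0 => N N' n hN hN'.
  have -> : e / r ^+ n = 2 * (e / 4 + e / 4) / r ^+ n by congr (_ / _); field.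
  apply: (@cauchy_coef I unitI (fun n => aN N n - aN N' n)) => //; first exact: entireB.
  move=> x _ xr; rewrite pserB//.
  have -> : pser (aN N) x - pser (aN N') x = (F x - pser (aN N') x) - (F x - pser (aN N) x).
    by rewrite opprB [RHS]addrC addrA subrK.
  by apply: le_trans (ler_normB _ _) _; apply: lerD; apply: h; rewrite ?xr.
have cvd n : exists d : quat, (fun N => aN N n) @ \oo --> d.
  apply/cvg_ex; apply: cauchy_cvg_quat => e e0.
  have [N0 h] := cau 1 e ltr01 e0; exists N0 => N N' hN hN'.
  by have := h N N' n hN hN'; rewrite expr1n divr1.
pose d n := projT1 (cid (cvd n)).
have hd n : (fun N => aN N n) @ \oo --> d n by rewrite /d; case: cid.
have dist (r e : R) : 0 < r -> 0 < e -> exists N0, forall N n, (N0 <= N)%N ->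
    `|d n - aN N n| <= e / r ^+ n.
  move=> r0 e0; have [N0 h] := cau r e r0 e0; exists N0 => N n hN.
  apply: (@cvg_quat_le _ (fun N' => aN N' n - aN N n)).
    by exists N0 => // N' /= hN'; exact: h.
  by apply: cvgB (hd n) _; exact: cvg_cst.
have ed : entire d.
  apply: entire_coef_bound => r r0; have [N0 h] := dist r 1 r0 ltr01.
  have [M hM] := eN N0 r (ltW r0); exists (M + 1) => n.
  rewrite -[d n](subrK (aN N0 n)); apply: le_trans (ler_normD _ _) _.
  rewrite mulrDl addrC; apply: lerD; last exact: h.
  rewrite ler_pdivlMr ?exprn_gt0//.
  by apply: (sum_le_term n _ hM) => k; rewrite mulr_ge0// exprn_ge0// ltW.
exists d => // x; apply/eqP; rewrite -subr_eq0 -normr_le0; apply/ler_addgt0Pl => e e0.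
rewrite addr0; pose r := `|x| + 1; have r0 : 0 < r by rewrite ltr_wpDl.
have xr : `|x| <= r by rewrite lerDl.
have e20 : 0 < e / 2 by rewrite divr_gt0.
have e40 : 0 < e / 4 by rewrite divr_gt0.
have [N1 h1] := cvF r _ r0 e20.
have [N2 h2] := dist (2 * r) (e / 4) (mulr_gt0 (ltr0n _ 2) r0) e40.
pose N := maxn N1 N2.
have -> : F x - pser d x = (F x - pser (aN N) x) - pser (fun n => d n - aN N n) x.
  by rewrite pserB// opprB addrA subrK.
apply: le_trans (ler_normB _ _) _.
rewrite [leRHS](splitr e).
apply: lerD; first by apply: h1 => //; exact: leq_maxl.
have r2 : r < 2 * r by rewrite mulrC ltr_pMr// ltr1n.
have := coef_bound_sum (ltW r0) r2 (fun n => h2 N n (leq_maxr _ _)).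
have -> : e / 4 * (1 - r / (2 * r))^-1 = e / 2.
  have -> : r / (2 * r) = 2^-1 by field; rewrite gt_eqF.
  by field.
by move=> /norm_pser_le; apply.
Qed.

End Taylor.

(** * The slice composition at a point *)

Section SliceDecomposition.
Variable R : realType.
Local Notation quat := (quat R).
Implicit Types x y : quat.
Variable I : quat.
Hypothesis unitI : imag_unit I.

(** Commutation makes the cross product of the two imaginary parts vanish; the imaginary part of [x]
    is then its projection [c] along [I]. *)
Lemma sliceP x : x * I = I * x -> slice I x.
Proof.
have [r0 s1] := imag_unitE unitI => h.
have hi := congr1 (@qi R) h; have hj := congr1 (@qj R) h; have hk := congr1 (@qk R) h.
rewrite !qE in hi hj hk; rewrite r0 in hi hj hk.
pose c := qi x * qi I + qj x * qj I + qk x * qk I.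
exists (qre x, c) => //; rewrite /slice_pt /=.
have e1 : qj x * qk I = qk x * qj I by lra.
have e2 : qk x * qi I = qi x * qk I by lra.
have e3 : qi x * qj I = qj x * qi I by lra.
apply: quat_eq; rewrite !qE ?r0 ?mulr1 ?mulr0 ?addr0 ?add0r //.
- transitivity (qi x * (qi I ^+ 2 + qj I ^+ 2 + qk I ^+ 2)); last by rewrite s1 mulr1.
  have -> : c * qi I = qi x * qi I ^+ 2 + (qj x * qi I) * qj I + (qk x * qi I) * qk I.
    by rewrite /c; ring.
  by rewrite -e3 e2; ring.
- transitivity (qj x * (qi I ^+ 2 + qj I ^+ 2 + qk I ^+ 2)); last by rewrite s1 mulr1.
  have -> : c * qj I = (qi x * qj I) * qi I + qj x * qj I ^+ 2 + (qk x * qj I) * qk I.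
    by rewrite /c; ring.
  by rewrite e3 -e1; ring.
- transitivity (qk x * (qi I ^+ 2 + qj I ^+ 2 + qk I ^+ 2)); last by rewrite s1 mulr1.
  have -> : c * qk I = (qi x * qk I) * qi I + (qj x * qk I) * qj I + qk x * qk I ^+ 2.
    by rewrite /c; ring.
  by rewrite e1 -e2; ring.
Qed.

Definition anti x := x * I = - (I * x).

Lemma antiE x c : anti x -> slice I c -> x * c = qconj c * x.
Proof.
move=> ax [v _ <-]; rewrite slice_pt_conj// /slice_pt /= mulrDr mulrDl.
by rewrite -!scalerAr -!scalerAl mulr1 mul1r ax scalerN scaleNr.
Qed.

Lemma anti_slice x c : anti x -> slice I c -> anti (c * x).
Proof.
move=> ax cI; rewrite /anti -mulrA ax mulrN !mulrA.
by rewrite (sliceC unitI cI (slice_self I)).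
Qed.

Lemma slice_anti_decomp x : exists P1 P2, [/\ slice I P1, anti P2 & x = P1 + P2].
Proof.
have e1 : I * x * I * I = - (I * x) by rewrite -mulrA imag_unitM// mulrN1.
have e2 : I * (I * x * I) = - (x * I) by rewrite !mulrA imag_unitM// mulN1r mulNr.
exists (2^-1 *: (x - I * x * I)), (2^-1 *: (x + I * x * I)); split.
- apply: sliceP; rewrite -scalerAl -scalerAr; congr (_ *: _).
  by rewrite mulrBl mulrBr e1 e2 !opprK addrC.
- rewrite /anti -scalerAl -scalerAr -scalerN; congr (_ *: _).
  by rewrite mulrDl mulrDr e1 e2 opprB.
- rewrite -scalerDr addrACA addNr addr0 scalerDr -scalerDl.
  by rewrite [X in X *: _](_ : _ = 1) ?scale1r//; field.
Qed.

(** Since I(c + e) = (c - e)I, the sum and the difference have the same norm, and each part is half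
    of a sum or difference of the two. This extracts both parts of a composed kernel from its
    modulus. *)
Lemma norm_slice_anti c e : slice I c -> anti e -> `|c| <= `|c + e| /\ `|e| <= `|c + e|.
Proof.
move=> cI ae; have nI := imag_unit_norm unitI.
have E : `|c - e| = `|c + e|.
  have <- : `|I * (c + e)| = `|c + e| by rewrite qnormM nI mul1r.
  have <- : `|(c - e) * I| = `|c - e| by rewrite qnormM nI mulr1.
  by rewrite mulrBl mulrDr ae opprK (sliceC unitI cI (slice_self I)).
have two (u v : quat) : u + u = (2 : R) *: u by rewrite -mulr2n scaler_nat.
split.
- have : `|c + c| <= `|c + e| + `|c - e|.
    by apply: le_trans (ler_normD _ _); rewrite addrACA subrr addr0.
  rewrite (two c c) normrZ ger0_norm// E; lra.
- have : `|e + e| <= `|c + e| + `|c - e|.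
    apply: le_trans (ler_normB _ _).
    by rewrite opprB [X in _ <= `|X|]addrC addrA subrK.
  rewrite (two e e) normrZ ger0_norm// E; lra.
Qed.

End SliceDecomposition.

(** * Star powers and their linear recursion *)

Section StarPowers.
Variable R : realType.
Local Notation quat := (quat R).
Implicit Types (a b c : nat -> quat) (x y : quat).

Lemma conv_coefM (V : nzRingType) (a b : nat -> V) N n : (n < N)%N ->
  cprod a b n = ((\poly_(i < N) a i) * (\poly_(i < N) b i))`_n.
Proof.
move=> nN; rewrite coefM; apply: eq_bigr => i _; rewrite !coef_poly.
have iN : (i < N)%N by apply: leq_ltn_trans nN; rewrite -ltnS.
by rewrite iN (leq_ltn_trans (leq_subr _ _) nN).
Qed.

(** Coefficient n only sees the first n + 1 entries, so associativity is inherited from the product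
    of truncated polynomials. *)
Lemma convA (V : nzRingType) (a b c : nat -> V) : cprod a (cprod b c) = cprod (cprod a b) c.
Proof.
apply/funext => n.
pose P (u : nat -> V) : {poly V} := \poly_(i < n.+1) u i.
transitivity ((P a * (P b * P c))`_n).
  rewrite coefM; apply: eq_bigr => i _; rewrite /P coef_poly ltn_ord.
  by rewrite (@conv_coefM _ _ _ n.+1)// ltnS leq_subr.
rewrite mulrA coefM; apply: eq_bigr => i _; rewrite [(P c)`__]coef_poly ltnS leq_subr.
by rewrite -conv_coefM// ltn_ord.
Qed.

Lemma norm_conv_sum a b (r A B : R) : 0 <= r -> sum_le (fun n => `|a n| * r ^+ n) A ->
  sum_le (fun n => `|b n| * r ^+ n) B -> sum_le (fun n => `|cprod a b n| * r ^+ n) (A * B).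
Proof.
move=> r0 aA bB.
have p n := exprn_ge0 n r0.
have := sum_conv_le (fun n => mulr_ge0 (normr_ge0 (a n)) (p n))
  (fun n => mulr_ge0 (normr_ge0 (b n)) (p n)) aA bB.
apply: sum_le_trans => n; apply: (@le_trans _ _ (cprod (fun n => `|a n|) (fun n => `|b n|) n * r ^+ n)).
  by apply: ler_wpM2r => //; exact: norm_conv_le.
rewrite /cprod mulr_suml; apply: ler_sum => i _.
by rewrite mulrACA -exprD subnKC// -ltnS.
Qed.

Lemma entire_conv a b : entire a -> entire b -> entire (cprod a b).
Proof.
move=> ea eb r r0; have [A aA] := ea r r0; have [B bB] := eb r r0.
by exists (A * B); exact: norm_conv_sum.
Qed.

(** Real coefficients commute with the powers of [x]; a star product with such a left factor is
    therefore evaluated pointwise, at every [x]. *)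
Lemma pser_conv_real (t : nat -> R) c x : entire (fun n => (t n)%:A) -> entire c ->
  pser (cprod (fun n => (t n)%:A) c) x = pser (fun n => (t n)%:A) x * pser c x.
Proof.
move=> et ec; rewrite /pser -qsum_conv; [|exact: entire_asum..].
congr qsum; apply/funext => n; rewrite /cprod mulr_sumr; apply: eq_bigr => i _.
rewrite !mulr_algl -!scalerAr mulr1 -scalerAl mulrA -exprD subnKC// -ltnS//.
Qed.

Lemma pser_real_slice I (t : nat -> R) x : imag_unit I -> slice I x -> entire (fun n => (t n)%:A) ->
  slice I (pser (fun n => (t n)%:A) x).
Proof.
move=> unitI xI et; apply: sliceP => //; rewrite /pser -qsumMl; last exact: entire_asum.
rewrite -qsumMr; last exact: entire_asum.
congr qsum; apply/funext => n; rewrite -!scalerAr mulr1 -scalerAl.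
by rewrite (sliceC unitI (sliceX unitI n xI) (slice_self I)).
Qed.

Lemma real_of_conj x : qconj x = x -> x = (qre x)%:A.
Proof.
move=> h; have hi := congr1 (@qi R) h; have hj := congr1 (@qj R) h.
have hk := congr1 (@qk R) h; rewrite !qE in hi hj hk.
by apply: quat_eq; rewrite !qE ?mulr1 ?mulr0 //; lra.
Qed.

Section Powers.
Variable b : nat -> quat.
Hypothesis eb : entire b.

Fixpoint spow n : nat -> quat := if n is m.+1 then cprod b (spow m) else (fun k => (k == 0%N)%:R).

Lemma spow_bound (r B : R) n : 0 <= r -> sum_le (fun n => `|b n| * r ^+ n) B ->
  sum_le (fun m => `|spow n m| * r ^+ m) (B ^+ n).
Proof.
move=> r0 bB; elim: n => [|n IH] /=; last by rewrite exprS; exact: norm_conv_sum.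
move=> [|N]; first by rewrite big_ord0 expr0.
rewrite big_ord_recl big1 ?addr0 ?expr0 ?mulr1 ?qnorm1// => i _.
by rewrite /= normr0 mul0r.
Qed.

Lemma entire_spow n : entire (spow n).
Proof. by move=> r r0; have [B bB] := eb r0; exists (B ^+ n); exact: spow_bound. Qed.

Lemma pser_spow0 x : pser (spow 0) x = 1.
Proof.
rewrite /pser (qsum_split 1 (entire_asum x (entire_spow 0))) /psum big_ord1 expr0 mul1r.
rewrite (_ : qsum _ = 0) ?addr0//; apply: qsum_eq.
rewrite [psum _](_ : _ = cst 0); first exact: cvg_cst.
by apply/funext => N; rewrite /psum big1// => i _; rewrite addn1 /= mulr0.
Qed.

Lemma star_exp_pser n : star_exp (pser b) n = pser (spow n).
Proof.
elim: n => [|n IH]; first by apply/funext => x; rewrite pser_spow0.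
rewrite /star_exp iterS -/(star_exp _ _) IH /star.
by rewrite !ps_coef_pser//; exact: entire_spow.
Qed.

Lemma norm_star_exp x n (r B : R) : sum_le (fun n => `|b n| * r ^+ n) B -> `|x| <= r ->
  `|star_exp (pser b) n x| <= B ^+ n.
Proof.
move=> bB xr; rewrite star_exp_pser; apply: (norm_pser_le _ xr).
by apply: spow_bound => //; apply: le_trans xr.
Qed.

(** Coefficients of the trace and of the symmetrization of the series: with $b^c$ the conjugated
    coefficients, [tr] is $b+b^c$ and [nm] is $b^c\star b$. Reversing the convolution sum shows that
    [nm] is its own conjugate, hence real. *)
Let tr n : R := 2 * qre (b n).
Let nm := cprod (fun n => qconj (b n)) b.
Let nr n : R := qre (nm n).

Let nmE n : nm n = (nr n)%:A.
Proof.
apply: real_of_conj; rewrite /nm /cprod.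
rewrite (big_morph (@qconj R) (@qconjD R) (@qconj0 R)).
rewrite (reindex_inj rev_ord_inj) /=; apply: eq_bigr => i _.
by rewrite qconjM qconjK subSS subKn// -ltnS.
Qed.

Let entire_conj : entire (fun n => qconj (b n)).
Proof. by move=> r r0; have [M bM] := eb r0; exists M => N; under eq_bigr do rewrite qnormC. Qed.

Let entire_tr : entire (fun n => (tr n)%:A).
Proof.
have := entireD eb entire_conj; congr entire; apply/funext => n.
by apply: quat_eq; rewrite /tr !qE; ring.
Qed.

Let entire_nr : entire (fun n => (nr n)%:A).
Proof. by have := entire_conv entire_conj eb; congr entire; apply/funext => n; exact: nmE. Qed.

(** The series satisfies its own quadratic equation: [b] is the trace minus its conjugate, and
    $b^c\star b$ is the symmetrization. Both coefficients are real series, so the star identity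
    becomes a pointwise recursion. *)
Let star_exp_rec n x : star_exp (pser b) n.+2 x =
  pser (fun n => (tr n)%:A) x * star_exp (pser b) n.+1 x -
  pser (fun n => (nr n)%:A) x * star_exp (pser b) n x.
Proof.
rewrite !star_exp_pser.
have -> : spow n.+2 = (fun k => cprod (fun n => (tr n)%:A) (spow n.+1) k -
    cprod (fun n => (nr n)%:A) (spow n) k).
  have -> : (fun n => (nr n)%:A) = nm by apply/funext => k; rewrite nmE.
  rewrite -convA; apply/funext => k; rewrite /= /cprod -sumrB; apply: eq_bigr => i _.
  rewrite -mulrBl; congr (_ * _).
  by apply: quat_eq; rewrite /tr !qE; ring.
rewrite pserB; last 2 first.
- by apply: entire_conv => //; exact: entire_spow.
- by apply: entire_conv => //; exact: entire_spow.
by rewrite !pser_conv_real//; exact: entire_spow.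
Qed.

(* Divided differences of the powers: [(l - m) * dd l m n = l ^+ n - m ^+ n]. *)
Fixpoint dd (l m : quat) n : quat := if n is k.+1 then l * dd l m k + m ^+ k else 0.

(** At a point of $C_I$ the trace and the symmetrization take values in $C_I$, so the characteristic
    polynomial has its roots there. The solution with initial values 1 and [pser b x] is written in
    Newton form, which needs no division by l - m and so covers the double root. *)
Lemma star_exp_roots I x : imag_unit I -> slice I x -> exists l m, [/\ slice I l, slice I m &
  forall n, star_exp (pser b) n x = l ^+ n + dd l m n * (pser b x - l)].
Proof.
move=> unitI xI; set t := pser (fun n => (tr n)%:A) x; set d := pser (fun n => (nr n)%:A) x.
have tI : slice I t by exact: pser_real_slice.
have dI : slice I d by exact: pser_real_slice.
have [s sI sE] := slice_sqrt unitI (sliceB (sliceM unitI (sliceZ 2^-1 tI) (sliceZ 2^-1 tI)) dI).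
have [l [m [lI mI lmt lmd]]] : exists l m, [/\ slice I l, slice I m, l + m = t & l * m = d].
  exists (2^-1 *: t + s), (2^-1 *: t - s); split.
  - by apply: sliceD => //; exact: sliceZ.
  - by apply: sliceB => //; exact: sliceZ.
  - by rewrite addrACA subrr addr0 -scalerDl [X in X *: _](_ : _ = 1) ?scale1r//; field.
  rewrite mulrBr !mulrDl sE (sliceC unitI sI (sliceZ 2^-1 tI)).
  by rewrite opprD addrA [X in X - _]addrK opprB addrC subrK.
have lmC : l * m = m * l := sliceC unitI lI mI.
exists l, m; split => // n.
have rec (k : nat) (p : quat) : l ^+ k.+2 + dd l m k.+2 * p =
    t * (l ^+ k.+1 + dd l m k.+1 * p) - d * (l ^+ k + dd l m k * p).
  rewrite -lmt -lmd (mulrDr (l + m)) (mulrDr (l * m)) opprD addrACA; congr (_ + _).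
    by rewrite mulrDl !exprS lmC -!mulrA addrK.
  rewrite !mulrA -mulrBl; congr (_ * _).
  have mdd : m * dd l m k.+1 = l * m * dd l m k + m ^+ k.+1.
    by rewrite /= mulrDr mulrA -lmC exprS.
  by rewrite [in RHS]mulrDl mdd addrA [_ + _ + m ^+ _]addrAC addrK.
suff : star_exp (pser b) n x = l ^+ n + dd l m n * (pser b x - l) /\
  star_exp (pser b) n.+1 x = l ^+ n.+1 + dd l m n.+1 * (pser b x - l) by case.
elim: n => [|n [IH1 IH2]]; last by split => //; rewrite star_exp_rec IH1 IH2 (rec n).
split; first by rewrite star_exp_pser pser_spow0 expr0 mul0r addr0.
have -> : star_exp (pser b) 1 x = pser b x.
  rewrite star_exp_pser; congr (pser _ x); apply/funext => k.
  rewrite /= /cprod big_ord_recr /= subnn mulr1 big1 ?add0r// => i _.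
  by rewrite -(subnSK (ltn_ord i)) mulr0.
by rewrite /= mulr0 add0r expr0 mul1r expr1 addrC subrK.
Qed.

Lemma dd_diff l m n : l * m = m * l -> (l - m) * dd l m n = l ^+ n - m ^+ n.
Proof.
move=> lm; elim: n => [|n IH]; first by rewrite mulr0 !expr0 subrr.
rewrite /= mulrDr mulrA; have -> : (l - m) * l = l * (l - m) by rewrite mulrBl mulrBr lm.
by rewrite -mulrA IH mulrBr mulrBl !exprS addrA subrK.
Qed.

End Powers.
End StarPowers.

Section DividedDifference.
Variable R : realType.
Local Notation quat := (quat R).
Implicit Types (a b c : nat -> quat) (x y l m P : quat).

Lemma norm_dd l m n (r : R) : 1 <= r -> `|l| <= r -> `|m| <= r -> `|dd l m n| <= n%:R * r ^+ n.
Proof.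
move=> r1 lr mr; have r0 : 0 <= r by apply: le_trans r1.
elim: n => [|n IH] /=; first by rewrite normr0 mul0r.
apply: le_trans (ler_normD _ _) _; rewrite qnormM qnormX -natr1 mulrDl mul1r exprS.
rewrite [n%:R * _]mulrCA; apply: lerD; first exact: ler_pM.
by apply: (@le_trans _ _ (r ^+ n)); [rewrite lerXn2r ?nnegrE|rewrite ler_peMl// exprn_ge0].
Qed.

Lemma norm_ddB l m m' n (r : R) : 1 <= r -> `|l| <= r -> `|m| <= r -> `|m'| <= r ->
  `|dd l m n - dd l m' n| <= n%:R ^+ 2 * r ^+ n * `|m - m'|.
Proof.
move=> r1 lr mr m'r; have r0 : 0 <= r by apply: le_trans r1.
elim: n => [|n IH] /=; first by rewrite subrr normr0 expr0n/= !mul0r.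
rewrite opprD addrACA -mulrBr; apply: le_trans (ler_normD _ _) _; rewrite qnormM.
have h1 := ler_pM (normr_ge0 l) (normr_ge0 _) lr IH.
have h2 := norm_subX n r1 m'r mr.
apply: le_trans (lerD h1 h2) _.
have X0 : 0 <= r ^+ n * `|m - m'| by rewrite mulr_ge0// exprn_ge0.
have -> : r * (n%:R ^+ 2 * r ^+ n * `|m - m'|) + n%:R * `|m - m'| * r ^+ n =
  (r * n%:R ^+ 2 + n%:R) * (r ^+ n * `|m - m'|) by ring.
have -> : n.+1%:R ^+ 2 * r ^+ n.+1 * `|m - m'| = (r * n.+1%:R ^+ 2) * (r ^+ n * `|m - m'|).
  by rewrite [r ^+ n.+1]exprS; ring.
apply: ler_wpM2r => //; rewrite -natr1.
have n0 := ler0n R n; move: (n%:R : R) n0 => k k0.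
have : k <= r * k by rewrite ler_peMl.
have : 0 <= r * k by rewrite mulr_ge0.
by move=> ? ?; rewrite sqrrD mulrDr mulrDr; nra.
Qed.

(** The divided difference of the series at [l] and [m]; being defined termwise it keeps its meaning
    at l = m, where it is the derivative. *)
Definition fdd a l m := qsum (fun n => dd l m n * a n).

Lemma asum_fdd a l m : entire a -> asum (fun n => dd l m n * a n).
Proof.
move=> ea; pose r := `|l| + `|m| + 1.
have r1 : 1 <= r by rewrite lerDr addr_ge0.
have r0 : 0 <= r by apply: le_trans r1.
have lr : `|l| <= r by rewrite /r -addrA lerDl addr_ge0.
have mr : `|m| <= r by rewrite /r addrAC lerDr addr_ge0.
have [M hM] := ea (2 * r) (mulr_ge0 (ler0n _ 2) r0).
apply: (asum_comp _ hM) => n; rewrite qnormM mulrC; apply: ler_wpM2l => //.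
apply: le_trans (norm_dd n r1 lr mr) _; rewrite exprMn; apply: ler_wpM2r.
  exact: exprn_ge0.
exact: natr_le_exp2.
Qed.

Lemma fdd_diff a l m : entire a -> l * m = m * l -> (l - m) * fdd a l m = pser a l - pser a m.
Proof.
move=> ea lm; rewrite /fdd -qsumMl; last exact: asum_fdd.
rewrite /pser -qsumB; [|exact: entire_asum..].
by congr qsum; apply/funext => n; rewrite mulrA dd_diff// mulrBl.
Qed.

Lemma fdd_continuous a l m : entire a ->
  exists2 C, 0 <= C & forall m', `|m - m'| <= 1 -> `|fdd a l m - fdd a l m'| <= C * `|m - m'|.
Proof.
move=> ea; pose r := `|l| + `|m| + 1.
have r1 : 1 <= r by rewrite lerDr addr_ge0.
have r0 : 0 <= r by apply: le_trans r1.
have lr : `|l| <= r by rewrite /r -addrA lerDl addr_ge0.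
have mr : `|m| <= r by rewrite /r addrAC lerDr addr_ge0.
have [M hM] := ea (4 * r) (mulr_ge0 (ler0n _ 4) r0).
exists M; first exact: sum_le_ge0 hM.
move=> m' mm'; have m'r : `|m'| <= r.
  rewrite -(subKr m m'); apply: le_trans (ler_normB _ _) _.
  by rewrite /r -addrA; apply: le_trans (lerD (lexx _) mm') _; rewrite lerDr.
rewrite /fdd -qsumB; [|exact: asum_fdd..].
apply: (@norm_qsum_le _ _ (fun n => `|m - m'| * (`|a n| * (4 * r) ^+ n))) => [n|N]; last first.
  by rewrite -mulr_sumr mulrC ler_wpM2r.
rewrite -mulrBl qnormM mulrC mulrCA; apply: ler_wpM2l => //.
apply: le_trans (norm_ddB n r1 lr mr m'r) _; rewrite mulrC; apply: ler_wpM2l => //.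
rewrite exprMn; apply: ler_wpM2r; first exact: exprn_ge0.
apply: (@le_trans _ _ ((2 ^+ n) ^+ 2)).
  by rewrite lerXn2r ?nnegrE ?exprn_ge0// natr_le_exp2.
by rewrite -exprM mulnC exprM -natrX.
Qed.

End DividedDifference.

Section SliceComposition.
Variable R : realType.
Local Notation quat := (quat R).
Implicit Types (a b c : nat -> quat) (x y l m P : quat) (f psi : quat -> quat).

(** Majorant sums are submultiplicative under the star product, so the star powers grow at most
    geometrically on each ball. The series of a composition is then dominated by that of the outer
    function at the real point B. *)
Lemma norm_star_exp_le psi x (r : R) : slice_regular psi -> 0 <= r ->
  exists2 B, 0 <= B & forall n x, `|x| <= r -> `|star_exp psi n x| <= B ^+ n.
Proof.
move=> /slice_regular_coef[eb hb] r0.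
have -> : psi = pser (ps_coef psi) by apply/funext.
have [B bB] := eb r r0; exists B; first exact: sum_le_ge0 bB.
by move=> n y; exact: norm_star_exp.
Qed.

Lemma slice_comp_asum psi a x : slice_regular psi -> entire a ->
  asum (fun n => star_exp psi n x * a n).
Proof.
move=> hpsi ea; have [B B0 hB] := norm_star_exp_le x hpsi (normr_ge0 x).
have [M hM] := ea B B0; apply: (asum_comp _ hM) => n.
by rewrite qnormM mulrC; apply: ler_wpM2l => //; exact: hB.
Qed.

Lemma slice_comp_pser psi a x : entire a ->
  slice_comp (pser a) psi x = qsum (fun n => star_exp psi n x * a n).
Proof. by move=> ea; rewrite /slice_comp ps_coef_pser. Qed.

Lemma slice_compB psi f g : slice_regular psi -> slice_regular f -> slice_regular g ->
  slice_comp (f \- g) psi = slice_comp f psi \- slice_comp g psi.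
Proof.
move=> hpsi /slice_regular_series[a ea fa] /slice_regular_series[b eb gb].
have -> : f = pser a by apply/funext.
have -> : g = pser b by apply/funext.
have -> : pser a \- pser b = pser (fun n => a n - b n).
  by apply/funext => x; rewrite pserB.
apply/funext => x; rewrite /= !slice_comp_pser//; last exact: entireB.
rewrite -qsumB; [|exact: slice_comp_asum..].
by congr qsum; apply/funext => n; rewrite mulrBr.
Qed.

Lemma slice_regular_comp psi f : slice_regular psi -> slice_regular f ->
  slice_regular (slice_comp f psi).
Proof.
move=> hpsi /slice_regular_series[a ea fa]; have -> : f = pser a by apply/funext.
have [eb hb] := slice_regular_coef hpsi; set b := ps_coef psi in eb hb.
have psiE : psi = pser b by apply/funext.
pose aN N k := \sum_(n < N) spow b n k * a n.
have eN N : entire (aN N).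
  elim: N => [|N IH]; first by rewrite /aN; under eq_fun do rewrite big_ord0; exact: entire0.
  rewrite /aN; under eq_fun do rewrite big_ord_recr /=.
  by apply: entireD => //; apply: entireMr; exact: entire_spow.
have NE N x : pser (aN N) x = \sum_(n < N) star_exp psi n x * a n.
  elim: N => [|N IH].
    by rewrite big_ord0 /aN; under eq_fun do rewrite big_ord0; rewrite pser0.
  rewrite big_ord_recr /= -IH psiE star_exp_pser// -pserMr; last exact: entire_spow.
  rewrite -pserD//; last by apply: entireMr; exact: entire_spow.
  by congr (pser _ x); apply/funext => k; rewrite /aN big_ord_recr.
have [d ed hd] : exists2 d, entire d & forall x, slice_comp (pser a) psi x = pser d x.
  apply: (entire_limit eN) => r e r0 e0.
  have [B B0 hB] := norm_star_exp_le 0 hpsi (ltW r0).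
  (* Twice the radius [B] gives the tail after N terms an extra factor $2^{-N}$, uniformly on the
     ball. *)
  have [M hM] := ea (2 * B) (mulr_ge0 (ler0n _ 2) B0).
  have M0 := sum_le_ge0 hM.
  have : geometric M (2^-1 : R) @ \oo --> 0.
    by apply: cvg_geometric; rewrite ger0_norm ?invf_lt1 ?ltr1n// invr_ge0.
  move=> /cvgrPdist_le /(_ e e0) [N0 _ hN0]; exists N0 => N x NN xr.
  have := hN0 N NN; rewrite /= sub0r normrN ger0_norm; last first.
    by rewrite mulr_ge0// exprn_ge0// invr_ge0.
  apply: le_trans; rewrite slice_comp_pser// NE (qsum_split N (slice_comp_asum x hpsi ea)).
  rewrite /psum addrC addKr.
  apply: (@norm_qsum_le _ _ (fun n => 2^-1 ^+ N * (`|a (n + N)%N| * (2 * B) ^+ (n + N)))) => [n|K].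
    rewrite qnormM mulrC mulrCA; apply: ler_wpM2l => //.
    apply: le_trans (hB _ _ xr) _.
    have -> : 2^-1 ^+ N * (2 * B) ^+ (n + N) = 2 ^+ n * B ^+ (n + N).
      by rewrite exprMn [2 ^+ (n + N)]exprD exprVn; field; rewrite expf_neq0.
    by rewrite ler_peMl ?exprn_ge0// exprn_ege1// ler1n.
  rewrite -mulr_sumr mulrC; apply: ler_wpM2r; first by rewrite exprn_ge0// invr_ge0.
  apply: le_trans (hM (N + K)%N); rewrite [leRHS]big_split_ord /=.
  under eq_bigr do rewrite addnC.
  by rewrite lerDr sumr_ge0// => i _; rewrite mulr_ge0// exprn_ge0// mulr_ge0.
have -> : slice_comp (pser a) psi = pser d by apply/funext.
exact: slice_regular_pser.
Qed.

Section OnSlice.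
Variable I : quat.
Hypothesis unitI : imag_unit I.

Lemma slice_dd l m n : slice I l -> slice I m -> slice I (dd l m n).
Proof.
move=> lI mI; elim: n => [|n IH] /=; first exact: slice0.
by apply: sliceD; [apply: sliceM|apply: sliceX].
Qed.

Lemma conj_dd l m n : slice I l -> slice I m -> qconj (dd l m n) = dd (qconj l) (qconj m) n.
Proof.
move=> lI mI; elim: n => [|n IH] /=; first by rewrite qconj0.
rewrite qconjD qconjM IH qconjX; congr (_ + _).
by apply: (sliceC unitI); [apply: slice_dd; exact: slice_conj|exact: slice_conj].
Qed.

Lemma slice_qsum (u : nat -> quat) : asum u -> (forall n, slice I (u n)) -> slice I (qsum u).
Proof.
move=> au uI; apply: sliceP => //; rewrite -qsumMl// -qsumMr//.
by congr qsum; apply/funext => n; rewrite (sliceC unitI (uI n) (slice_self I)).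
Qed.

Lemma slice_pser a x : entire a -> (forall n, slice I (a n)) -> slice I x -> slice I (pser a x).
Proof.
move=> ea aI xI; apply: slice_qsum; first exact: entire_asum.
by move=> n; apply: sliceM => //; exact: sliceX.
Qed.

Lemma slice_fdd a l m : entire a -> (forall n, slice I (a n)) -> slice I l -> slice I m ->
  slice I (fdd a l m).
Proof.
move=> ea aI lI mI; apply: slice_qsum; first exact: asum_fdd.
by move=> n; apply: sliceM => //; exact: slice_dd.
Qed.

(* On [C_I] the composition is a functional supported at the two roots [l], [m] of the
   characteristic polynomial of [psi x]. *)
Lemma slice_comp_roots psi x : slice_regular psi -> slice I x -> exists l m P1 P2,
  [/\ slice I l, slice I m, slice I P1, anti I P2 & forall a, entire a ->
    slice_comp (pser a) psi x =
    (pser a l + P1 * fdd a l m) + P2 * fdd a (qconj l) (qconj m)].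
Proof.
move=> hpsi xI; have [eb hb] := slice_regular_coef hpsi.
have psiE : psi = pser (ps_coef psi) by apply/funext.
have [l [m [lI mI E]]] := star_exp_roots eb unitI xI; rewrite -psiE in E.
have [P1 [P2 [P1I P2a PE]]] := slice_anti_decomp unitI (psi x - l).
exists l, m, P1, P2; split => // a ea; rewrite slice_comp_pser//.
rewrite -qsumMl; last exact: asum_fdd.
rewrite -qsumMl; last exact: asum_fdd.
have a1 := asumMl P1 (asum_fdd l m ea).
have a2 := asumMl P2 (asum_fdd (qconj l) (qconj m) ea).
rewrite /pser -(qsumD (entire_asum l ea) a1) -(qsumD (asumD (entire_asum l ea) a1) a2).
(* The divided difference of the powers commutes with [P1], but is conjugated when moved across
   [P2]; hence the conjugate nodes in the third term. *)
congr qsum; apply/funext => n; rewrite E PE mulrDr !mulrDl addrA; congr (_ + _ + _).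
  by rewrite (sliceC unitI (slice_dd n lI mI) P1I) mulrA.
rewrite mulrA; congr (_ * _); rewrite -conj_dd//.
by rewrite (antiE unitI P2a (slice_conj unitI (slice_dd n lI mI))) qconjK.
Qed.

End OnSlice.
End SliceComposition.

(** * The quaternionic exponential *)

Section Exponential.
Variable R : realType.
Local Notation quat := (quat R).
Implicit Types (x y : quat).

Definition exp_quat_coef n : quat := (n`!%:R^-1 : R)%:A.

Lemma exp_sum_le (r : R) : 0 <= r -> sum_le (fun n => r ^+ n / n`!%:R) (expR r).
Proof.
move=> r0 N; have -> : \sum_(n < N) r ^+ n / n`!%:R = series (exp_coeff r) N.
  by rewrite /series /= big_mkord; apply: eq_bigr => n _; rewrite /exp_coeff.
rewrite /expR; apply: nondecreasing_cvgn_le; last exact: is_cvg_series_exp_coeff.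
apply: nondecreasing_series => n _ _.
by rewrite /exp_coeff /= divr_ge0 ?exprn_ge0.
Qed.

Lemma entire_exp : entire exp_quat_coef.
Proof.
move=> r r0; exists (expR r); apply: sum_le_trans (exp_sum_le r0) => n.
by rewrite /exp_quat_coef norm_real ger0_norm ?invr_ge0// mulrC.
Qed.

Definition qexp x := pser exp_quat_coef x.

Lemma asum_exp x : asum (fun n => (n`!%:R^-1 : R) *: x ^+ n).
Proof.
have := entire_asum x entire_exp; congr asum; apply/funext => n.
by rewrite /exp_quat_coef -scalerAr mulr1.
Qed.

Lemma qexpE x : qexp x = qsum (fun n => (n`!%:R^-1 : R) *: x ^+ n).
Proof.
rewrite /qexp /pser; congr qsum; apply/funext => n.
by rewrite /exp_quat_coef -scalerAr mulr1.
Qed.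

Lemma qexpD x y : x * y = y * x -> qexp (x + y) = qexp x * qexp y.
Proof.
move=> xy; rewrite !qexpE -qsum_conv; [|exact: asum_exp..].
congr qsum; apply/funext => n; rewrite [x + y]addrC exprDn_comm; last exact/esym.
rewrite scaler_sumr; apply: eq_bigr => i _.
have inl : (i <= n)%N by rewrite -ltnS.
have cm : y ^+ (n - i) * x ^+ i = x ^+ i * y ^+ (n - i).
  by apply: commrX; apply: commr_sym; apply: commrX.
rewrite cm -scalerAl -scalerAr scalerA.
have -> : x ^+ i * y ^+ (n - i) *+ 'C(n, i) = ('C(n, i)%:R : R) *: (x ^+ i * y ^+ (n - i)).
  by rewrite scaler_nat.
rewrite scalerA; congr (_ *: _).
rewrite -(bin_fact inl) !natrM; field.
by rewrite !pnatr_eq0 -!lt0n bin_gt0 inl !fact_gt0.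
Qed.

Lemma qexp_conj x : qexp (qconj x) = qconj (qexp x).
Proof.
rewrite !qexpE -qsum_conj; last exact: asum_exp.
by congr qsum; apply/funext => n; rewrite qconjZ qconjX.
Qed.

Lemma qexp_real (t : R) : qexp t%:A = (expR t)%:A.
Proof.
rewrite qexpE; apply: qsum_eq; rewrite /expR.
have cv := @is_cvg_series_exp_coeff R t.
have -> : psum (fun n => n`!%:R^-1 *: (t%:A : quat) ^+ n) = (fun N => (series (exp_coeff t) N)%:A).
  apply/funext => N; rewrite /psum /series /= big_mkord scaler_suml.
  by apply: eq_bigr => n _; rewrite real_quatX scalerA /exp_coeff /= mulrC.
exact: (cvgZr_tmp cv).
Qed.

(** [x] commutes with its conjugate, so exp(x) times its conjugate is exp(2 Re x). *)
Lemma norm_qexp x : `|qexp x| = expR (qre x).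
Proof.
apply/eqP; rewrite -(@eqrXn2 _ 2)// ?expR_ge0//; apply/eqP.
have := mulq_conj (qexp x); rewrite -qexp_conj -qexpD; last by rewrite mulq_conj mulqC_conj.
have -> : x + qconj x = (2 * qre x)%:A.
  by apply: quat_eq; rewrite !qE; ring.
rewrite qexp_real => /(congr1 (@qre R)); rewrite !qE !mulr1 => <-.
by rewrite -expRM_natl mulr_natl.
Qed.

End Exponential.

(** * Two-point interpolation by kernels *)

Section Kernel.
Variable R : realType.
Local Notation quat := (quat R).
Implicit Types (a b c : nat -> quat) (x y z w : quat) (f psi : quat -> quat).

(** Coefficients of $s\exp(tz\overline w)$. Two free parameters cover both the normalized kernel
    ($t=\alpha$) and its reciprocal ($t=-\alpha$, inverse normalization). *)
Definition gkernel (s t : R) w n : quat := (s * (t ^+ n / n`!%:R)) *: qconj w ^+ n.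

Lemma entire_gkernel s t w : entire (gkernel s t w).
Proof.
move=> r r0; have p : 0 <= `|t| * `|w| * r by rewrite !mulr_ge0.
exists (`|s| * expR (`|t| * `|w| * r)) => N.
apply: (@le_trans _ _ (`|s| * \sum_(n < N) (`|t| * `|w| * r) ^+ n / n`!%:R)); last first.
  by apply: ler_wpM2l => //; exact: exp_sum_le.
rewrite mulr_sumr; apply: ler_sum => n _.
rewrite /gkernel normrZ qnormX qnormC !normrM normfV normrX [`|n`!%:R|]ger0_norm// !exprMn.
by rewrite le_eqVlt; apply/orP; left; apply/eqP; ring.
Qed.

Definition kcoef (alpha : R) w := gkernel (expR (- (alpha / 2) * `|w| ^+ 2)) alpha w.

Lemma entire_kcoef alpha w : entire (kcoef alpha w).
Proof. exact: entire_gkernel. Qed.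

Lemma fock_kernelE alpha w : fock_kernel alpha w = pser (kcoef alpha w).
Proof.
apply/funext => z; rewrite /fock_kernel.
have as1 : asum (fun n => (alpha ^+ n / n`!%:R) *: (z ^+ n * qconj w ^+ n)).
  have := entire_asum z (@entire_gkernel 1 alpha w); congr asum; apply/funext => n.
  by rewrite /gkernel mul1r -scalerAr.
transitivity (expR (- (alpha / 2) * `|w| ^+ 2) *:
  qsum (fun n => (alpha ^+ n / n`!%:R) *: (z ^+ n * qconj w ^+ n))); first by [].
rewrite -qsumZ// /pser; congr qsum; apply/funext => n.
by rewrite /kcoef /gkernel scalerA scalerAr.
Qed.

Lemma slice_regular_kernel alpha w : slice_regular (fock_kernel alpha w).
Proof. by rewrite fock_kernelE; apply: slice_regular_pser; exact: entire_kcoef. Qed.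

Section OnSlice.
Variable I : quat.
Hypothesis unitI : imag_unit I.

Lemma slice_gkernel s t w n : slice I w -> slice I (gkernel s t w n).
Proof. by move=> wI; apply: sliceZ; apply: sliceX => //; exact: slice_conj. Qed.

Lemma pser_gkernel s t w z : slice I w -> slice I z ->
  pser (gkernel s t w) z = s *: qexp (t *: (z * qconj w)).
Proof.
move=> wI zI; rewrite qexpE -qsumZ; last exact: asum_exp.
congr qsum; apply/funext => n; rewrite /gkernel -scalerAr !scalerA exprZn scalerA.
rewrite exprMn_comm; last by apply: (sliceC unitI) => //; exact: slice_conj.
by congr (_ *: _); ring.
Qed.

Lemma pser_cprod_slice e a x : (forall n, slice I (e n)) -> slice I x -> entire e -> entire a ->
  pser (cprod e a) x = pser e x * pser a x.
Proof.
move=> eI xI ee ea; rewrite /pser -qsum_conv; [|exact: entire_asum..].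
congr qsum; apply/funext => n; rewrite /cprod mulr_sumr; apply: eq_bigr => i _.
rewrite !mulrA -[x ^+ i * e i * _]mulrA (sliceC unitI (eI i) (sliceX unitI _ xI)) mulrA.
by rewrite -exprD subnKC// -ltnS.
Qed.

Lemma sqr_normB x y : `|x - y| ^+ 2 = `|x| ^+ 2 + `|y| ^+ 2 - 2 * qre (x * qconj y).
Proof. by rewrite !sqr_qnorm !qE; ring. Qed.

(** Completing the square: against the weight of the Fock space, a kernel is exactly a Gaussian
    centred at [w]. *)
Lemma norm_kcoef alpha w z : slice I w -> slice I z ->
  `|pser (kcoef alpha w) z| = expR (- (alpha / 2) * `|z - w| ^+ 2) * expR (alpha / 2 * `|z| ^+ 2).
Proof.
move=> wI zI; rewrite pser_gkernel// normrZ norm_qexp ger0_norm ?expR_ge0// qreZ -!expRD.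
by congr expR; rewrite sqr_normB; field.
Qed.

Lemma norm_mul_sub_le (x y u v : quat) (m n : R) : `|x| = m -> `|y| = n ->
  `|x * u - y * v| <= m * `|u| + n * `|v|.
Proof. by move=> <- <-; apply: le_trans (ler_normB _ _) _; rewrite !qnormM. Qed.

Lemma norm_mul3 (x y z : quat) (m n : R) : `|x| = m -> `|y| = n -> `|x * y * z| = m * n * `|z|.
Proof. by move=> <- <-; rewrite !qnormM. Qed.

Lemma one_sub_exp_ge (t : R) : 0 <= t -> t / (1 + t) <= 1 - expR (- t).
Proof.
move=> t0; have t1 : 0 < 1 + t by rewrite ltr_pwDl.
rewrite ler_pdivrMr// mulrBl mul1r.
have : expR (- t) * (1 + t) <= 1.
  by rewrite expRN mulrC ler_pdivrMr ?expR_gt0// mul1r expR_ge1Dx.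
lra.
Qed.

Lemma pser_kcoef alpha w z : slice I w -> slice I z ->
  pser (kcoef alpha w) z =
  expR (- (alpha / 2) * `|w| ^+ 2) *: qexp (alpha *: (z * qconj w)).
Proof. exact: pser_gkernel. Qed.

Lemma gauss_ineq1 (t x y z : R) : 0 < t -> x <= z -> y <= z ->
  - (t * z) <= - (t / 2) * x + - (t / 2) * y.
Proof. by move=> *; nra. Qed.

Lemma gauss_ineq2 (t x y z : R) : 0 < t -> x <= z -> 0 <= y -> 0 <= z ->
  - (t / 2) * y + t / 4 * x <= 2 * t * z.
Proof. by move=> *; nra. Qed.

Lemma gauss_ineq3 (t x y z : R) : 0 < t -> x <= z -> y <= z -> 0 <= z ->
  t / 4 * x <= - (t / 2) * y + t * z.
Proof. by move=> *; nra. Qed.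

Lemma gauss_ineq4 (t x y z : R) : 0 < t -> x <= 8 * z + 2 * y ->
  - (t / 2) * y + t / 4 * x <= 2 * t * z.
Proof. by move=> *; nra. Qed.

Lemma gauss_ineq5 (x y : R) : (2 * x + y) ^+ 2 <= 8 * x ^+ 2 + 2 * y ^+ 2.
Proof. by have := sqr_ge0 (2 * x - y); nra. Qed.

Local Opaque pser kcoef gkernel.

Section Interpolation.
Variables (alpha rho D : R).
Hypotheses (alpha0 : 0 < alpha) (rho0 : 0 < rho) (D0 : 0 <= D).
Local Notation k w := (kcoef alpha w).

(** The first summand serves nodes at distance at least 1, the second nodes closer than 1. Their
    last factors are the reciprocals of the lower bounds for $1-e^{-\alpha\rho d}$, in the second
    case after extraction of the distance d. *)
Definition interp_cst : R :=
  2 * expR (2 * alpha * D ^+ 2) * expR (alpha * D ^+ 2) / (1 - expR (- (alpha * rho))) +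
  2 * expR (alpha * (3 + D) ^+ 2) * expR (alpha * D ^+ 2) * (1 + alpha * rho) / (alpha * rho).

Let ar0 : 0 < alpha * rho. Proof. exact: mulr_gt0. Qed.

Let den0 : 0 < 1 - expR (- (alpha * rho)).
Proof. by rewrite subr_gt0 expR_lt1 oppr_lt0. Qed.

Let cst1_ge0 : 0 < 2 * expR (2 * alpha * D ^+ 2) * expR (alpha * D ^+ 2) / (1 - expR (- (alpha * rho))).
Proof. by rewrite divr_gt0// !mulr_gt0// expR_gt0. Qed.

Let cst2_ge0 : 0 < 2 * expR (alpha * (3 + D) ^+ 2) * expR (alpha * D ^+ 2) * (1 + alpha * rho) / (alpha * rho).
Proof. by rewrite divr_gt0// !mulr_gt0 ?expR_gt0// ltr_pwDl// ltW. Qed.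

Lemma interp_cst_gt0 : 0 < interp_cst. Proof. exact: addr_gt0. Qed.

Variables (l m w1 w2 : quat).
Hypotheses (lI : slice I l) (mI : slice I m) (w1I : slice I w1) (w2I : slice I w2).
Hypotheses (lm : l != m) (lw : `|l - w1| <= D) (mw : `|m - w2| <= D).
Hypothesis dir : rho * `|l - m| <= qre (qconj (w1 - w2) * (l - m)).

(** The determinant of two-point interpolation at [l], [m] by the kernels at [w1], [w2]. The
    hypothesis [dir] aligns w1 - w2 with l - m, which keeps the ratio of the two products below 1 in
    modulus. *)
Definition kdet := pser (k w1) l * pser (k w2) m - pser (k w2) l * pser (k w1) m.

Let d := `|l - m|.
Let d0 : 0 < d. Proof. by rewrite normr_gt0 subr_eq0. Qed.

(** The exponents differ by
    $l\overline{w_1}+m\overline{w_2}-l\overline{w_2}-m\overline{w_1}=\overline{(w_1-w_2)}(l-m)$,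
    while the normalizing factors of the two products are the same. *)
Let kdetE : kdet = pser (k w1) l * pser (k w2) m *
  (1 - qexp (- alpha *: (qconj (w1 - w2) * (l - m)))).
Proof.
have cI w : slice I w -> slice I (qconj w) by exact: slice_conj.
have w1c := cI _ w1I; have w2c := cI _ w2I.
rewrite /kdet mulrBr mulr1; congr (_ - _).
have sM (c c' : R) (u v : quat) : (c *: u) * (c' *: v) = (c * c') *: (u * v).
  by rewrite -scalerAl -scalerAr scalerA.
have xI (u v : quat) : slice I u -> slice I v -> slice I (alpha *: (u * qconj v)).
  by move=> uI vI; apply: sliceZ; apply: sliceM => //; exact: slice_conj.
rewrite (pser_kcoef _ w1I lI) (pser_kcoef _ w1I mI) (pser_kcoef _ w2I lI) (pser_kcoef _ w2I mI).
have gen (c1 c2 : R) (x1 x2 x3 x4 z : quat) : x3 * x4 = x1 * x2 * z ->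
    (c2 *: x3) * (c1 *: x4) = (c1 *: x1) * (c2 *: x2) * z.
  by move=> h; rewrite !sM -scalerAl h mulrC.
apply: gen.
have zI : slice I (- alpha *: (qconj (w1 - w2) * (l - m))).
  by apply: sliceZ; apply: sliceM => //; [apply: slice_conj => //; exact: sliceB|exact: sliceB].
have lw1 := xI _ _ lI w1I; have lw2 := xI _ _ lI w2I.
have mw1 := xI _ _ mI w1I; have mw2 := xI _ _ mI w2I.
rewrite -(qexpD (sliceC unitI lw2 mw1)) -(qexpD (sliceC unitI lw1 mw2)).
rewrite -(qexpD (sliceC unitI (sliceD lw1 mw2) zI)); congr qexp.
have -> : qconj (w1 - w2) * (l - m) =
    (l * qconj w1 + m * qconj w2) - (l * qconj w2 + m * qconj w1).
  rewrite qconjD qconjN mulrBr !mulrBl.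
  rewrite (sliceC unitI w1c lI) (sliceC unitI w1c mI) (sliceC unitI w2c lI) (sliceC unitI w2c mI).
  by rewrite opprB addrACA opprD.
by rewrite -!scalerDr scaleNr -scalerBr subKr.
Qed.

Lemma kdet_neq0 : kdet != 0.
Proof.
rewrite kdetE -normr_eq0 (norm_mul3 _ (norm_kcoef alpha w1I lI) (norm_kcoef alpha w2I mI)).
rewrite mulf_neq0//; first by rewrite !mulf_neq0// gt_eqF// expR_gt0.
rewrite normr_eq0 subr_eq0 eq_sym; apply/eqP => /(congr1 (fun x => `|x|)).
rewrite norm_qexp qnorm1 qreZ => /eqP; rewrite -(@expR0 R) (inj_eq (@expR_inj R)) mulNr oppr_eq0.
rewrite mulf_eq0 (gt_eqF alpha0)/=; apply/negP; rewrite gt_eqF//.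
by apply: lt_le_trans dir; exact: mulr_gt0.
Qed.

Let kdet_ge : expR (- (alpha * D ^+ 2)) * (expR (alpha / 2 * `|l| ^+ 2) * expR (alpha / 2 * `|m| ^+ 2)) *
  (1 - expR (- (alpha * rho * d))) <= `|kdet|.
Proof.
rewrite kdetE (norm_mul3 _ (norm_kcoef alpha w1I lI) (norm_kcoef alpha w2I mI)).
have sq (x : R) : 0 <= x -> x <= D -> x ^+ 2 <= D ^+ 2 by move=> x0 xD; rewrite lerXn2r ?nnegrE.
have s1 := sq _ (normr_ge0 _) lw; have s2 := sq _ (normr_ge0 _) mw.
have -> : expR (- (alpha / 2) * `|l - w1| ^+ 2) * expR (alpha / 2 * `|l| ^+ 2) *
    (expR (- (alpha / 2) * `|m - w2| ^+ 2) * expR (alpha / 2 * `|m| ^+ 2)) =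
    (expR (- (alpha / 2) * `|l - w1| ^+ 2) * expR (- (alpha / 2) * `|m - w2| ^+ 2)) *
    (expR (alpha / 2 * `|l| ^+ 2) * expR (alpha / 2 * `|m| ^+ 2)) by ring.
have p0 : 0 <= 1 - expR (- (alpha * rho * d)).
  by rewrite subr_ge0 expR_le1 oppr_le0 !mulr_ge0 ?ltW.
have AB : 0 <= expR (alpha / 2 * `|l| ^+ 2) * expR (alpha / 2 * `|m| ^+ 2).
  by rewrite mulr_ge0// expR_ge0.
apply: ler_pM => //.
- apply: ler_wpM2r => //; rewrite -expRD ler_expR.
  exact: gauss_ineq1.
- apply: le_trans (lerB_dist _ _); rewrite qnorm1 lerD2l lerN2 norm_qexp ler_expR qreZ mulNr lerN2.
  by rewrite -mulrA ler_pM2l.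
Qed.

Variables (a : nat -> quat) (ea : entire a) (S1 : R).
Hypothesis hS1 : forall u, slice I u ->
  `|pser a u| * expR (- (alpha / 2) * `|u| ^+ 2) * expR (- (alpha / 4) * `|u - w1| ^+ 2) <= S1.

Let S10 : 0 <= S1.
Proof. by apply: le_trans (hS1 lI); rewrite !mulr_ge0// expR_ge0. Qed.

Let val_le u : slice I u ->
  `|pser a u| <= S1 * (expR (alpha / 2 * `|u| ^+ 2) * expR (alpha / 4 * `|u - w1| ^+ 2)).
Proof.
move=> uI; set A := expR _; set B := expR _.
have := hS1 uI; rewrite !mulNr !expRN -/A -/B ler_pdivrMr ?expR_gt0// ler_pdivrMr ?expR_gt0//.
by move/le_trans; apply; rewrite le_eqVlt; apply/orP; left; apply/eqP; ring.
Qed.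

(** Each product is estimated separately. In the second one [m] may be far from [w1], but then [l]
    is far from [w2], and the decay of the kernel at [l] pays for the growth allowed to [a] at
    [m]. *)
Let far : 1 <= d -> `|pser (k w2) m * pser a l - pser (k w2) l * pser a m| <=
  2 * expR (2 * alpha * D ^+ 2) * S1 * (expR (alpha / 2 * `|l| ^+ 2) * expR (alpha / 2 * `|m| ^+ 2)).
Proof.
move=> _; apply: le_trans (norm_mul_sub_le _ _ (norm_kcoef alpha w2I mI) (norm_kcoef alpha w2I lI)) _.
have sq (x y : R) : 0 <= x -> x <= y -> x ^+ 2 <= y ^+ 2.
  by move=> x0 xD; rewrite lerXn2r ?nnegrE ?(le_trans x0).
have s1 := sq _ _ (normr_ge0 _) lw; have s2 := sq _ _ (normr_ge0 _) mw.
set X := `|l - w2|.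
have m1 : `|m - w1| <= 2 * D + X.
  have -> : m - w1 = (m - w2) - (l - w2) + (l - w1).
    by rewrite opprB [m - w2 + _]addrA subrK addrA subrK.
  apply: le_trans (ler_normD _ _) _; have := ler_normB (m - w2) (l - w2).
  by rewrite -/X; move: lw mw; lra.
have s3 := sq _ _ (normr_ge0 _) m1.
have X0 : 0 <= X by rewrite normr_ge0.
have D20 := sqr_ge0 D.
have hl := val_le lI; have hm := val_le mI.
have E1 : expR (- (alpha / 2) * `|m - w2| ^+ 2) * expR (alpha / 2 * `|m| ^+ 2) * `|pser a l| <=
   expR (2 * alpha * D ^+ 2) * S1 * (expR (alpha / 2 * `|l| ^+ 2) * expR (alpha / 2 * `|m| ^+ 2)).
  have c0 : 0 <= expR (- (alpha / 2) * `|m - w2| ^+ 2) * expR (alpha / 2 * `|m| ^+ 2).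
    by rewrite mulr_ge0// expR_ge0.
  apply: le_trans (ler_wpM2l c0 hl) _.
  rewrite [leLHS](_ : _ = expR (- (alpha / 2) * `|m - w2| ^+ 2 + alpha / 4 * `|l - w1| ^+ 2) * S1 *
    (expR (alpha / 2 * `|l| ^+ 2) * expR (alpha / 2 * `|m| ^+ 2))); last by rewrite expRD; ring.
  apply: ler_wpM2r; first by rewrite mulr_ge0// expR_ge0.
  apply: ler_wpM2r => //; rewrite ler_expR.
  by apply: gauss_ineq2 => //; exact: sqr_ge0.
have E2 : expR (- (alpha / 2) * X ^+ 2) * expR (alpha / 2 * `|l| ^+ 2) * `|pser a m| <=
   expR (2 * alpha * D ^+ 2) * S1 * (expR (alpha / 2 * `|l| ^+ 2) * expR (alpha / 2 * `|m| ^+ 2)).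
  have c0 : 0 <= expR (- (alpha / 2) * X ^+ 2) * expR (alpha / 2 * `|l| ^+ 2).
    by rewrite mulr_ge0// expR_ge0.
  apply: le_trans (ler_wpM2l c0 hm) _.
  rewrite [leLHS](_ : _ = expR (- (alpha / 2) * X ^+ 2 + alpha / 4 * `|m - w1| ^+ 2) * S1 *
    (expR (alpha / 2 * `|l| ^+ 2) * expR (alpha / 2 * `|m| ^+ 2))); last by rewrite expRD; ring.
  apply: ler_wpM2r; first by rewrite mulr_ge0// expR_ge0.
  apply: ler_wpM2r => //; rewrite ler_expR.
  (* The balance that fixes the weight: $-\frac\alpha2X^2+\frac\alpha4(8D^2+2X^2)=2\alpha D^2$, so X
     disappears. *)
  have h : `|m - w1| ^+ 2 <= 8 * D ^+ 2 + 2 * X ^+ 2.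
    by apply: le_trans s3 _; exact: gauss_ineq5.
  exact: gauss_ineq4.
by apply: le_trans (lerD E1 E2) _; rewrite le_eqVlt; apply/orP; left; apply/eqP; ring.
Qed.

Let near : d < 1 -> `|pser (k w2) m * pser a l - pser (k w2) l * pser a m| <=
  2 * expR (alpha * (3 + D) ^+ 2) * S1 * d * (expR (alpha / 2 * `|l| ^+ 2) * expR (alpha / 2 * `|m| ^+ 2)).
Proof.
(* [ki] is the series of the reciprocal of the kernel at [w2]. Its coefficients lie in $C_I$, so its
   Cauchy product with [a] is a pointwise product on the slice. *)
move=> d1; pose ki := gkernel (expR (alpha / 2 * `|w2| ^+ 2)) (- alpha) w2.
have kI n : slice I (ki n) by exact: slice_gkernel.
have kV u : slice I u -> pser ki u * pser (k w2) u = 1.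
  move=> uI; rewrite /ki (pser_gkernel (expR (alpha / 2 * `|w2| ^+ 2)) (- alpha) w2I uI).
  rewrite (pser_kcoef _ w2I uI).
  rewrite -[LHS]scalerAl -[X in _ *: X]scalerAr scalerA -expRD -qexpD; last first.
    by apply: (sliceC unitI); apply: sliceZ; apply: sliceM => //; exact: slice_conj.
  rewrite scaleNr addNr mulNr subrr expR0 scale1r.
  by have := @qexp_real R 0; rewrite expR0 scale0r scale1r.
pose phi : quat -> quat := pser (cprod ki a).
have ep : entire (cprod ki a) by apply: entire_conv => //; exact: entire_gkernel.
have phiE u : slice I u -> phi u = pser ki u * pser a u.
  by move=> uI; apply: pser_cprod_slice => //; exact: entire_gkernel.
have kk u : slice I u -> pser a u = pser (k w2) u * phi u.
  move=> uI; rewrite phiE// mulrA.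
  rewrite (sliceC unitI (slice_pser unitI (entire_kcoef alpha w2) (fun n => slice_gkernel _ _ n w2I) uI)
     (slice_pser unitI (@entire_gkernel _ _ _) kI uI)).
  by rewrite kV// mul1r.
have slk u : slice I u -> slice I (pser (k w2) u).
  by move=> uI; apply: slice_pser => //; [exact: entire_kcoef|move=> n; exact: slice_gkernel].
have -> : pser (k w2) m * pser a l - pser (k w2) l * pser a m =
    pser (k w2) l * pser (k w2) m * (phi l - phi m).
  have gen (x y u v : quat) : y * x = x * y -> y * (x * u) - x * (y * v) = x * y * (u - v).
    by move=> xy; rewrite mulrBr !mulrA xy.
  rewrite (kk l lI) (kk m mI); apply: gen; apply: (sliceC unitI); exact: slk.
pose M := S1 * expR (alpha * (3 + D) ^+ 2).
(* On the disc of radius 2 about [m] both centres stay within 3 + D: 2 to reach [m], less than 1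
   from [m] to [l], and [D] from a node to its centre. *)
have hM u : slice I u -> `|u - m| <= 2 -> `|phi u| <= M.
  move=> uI um; have k0 : 0 < `|pser (k w2) u| by rewrite (norm_kcoef alpha w2I uI) mulr_gt0// expR_gt0.
  rewrite -(ler_pM2l k0) -qnormM -kk//; apply: le_trans (val_le uI) _; rewrite (norm_kcoef alpha w2I uI) /M.
  have u2 : `|u - w2| <= 3 + D.
    have -> : u - w2 = (u - m) + (m - w2) by rewrite addrA subrK.
    by apply: le_trans (ler_normD _ _) _; move: um mw; lra.
  have u1 : `|u - w1| <= 3 + D.
    have -> : u - w1 = (u - m) - (l - m) + (l - w1).
      by rewrite opprB [u - m + _]addrA subrK addrA subrK.
    apply: le_trans (ler_normD _ _) _; have := ler_normB (u - m) (l - m).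
    by rewrite -/d; move: um lw d1; lra.
  have sq (x y : R) : 0 <= x -> x <= y -> x ^+ 2 <= y ^+ 2.
    by move=> x0 xD; rewrite lerXn2r ?nnegrE ?(le_trans x0).
  have t1 := sq _ _ (normr_ge0 _) u1; have t2 := sq _ _ (normr_ge0 _) u2.
  rewrite [leRHS](_ : _ = S1 * (expR (alpha / 2 * `|u| ^+ 2) *
     expR (- (alpha / 2) * `|u - w2| ^+ 2 + alpha * (3 + D) ^+ 2))); last by rewrite expRD; ring.
  apply: ler_wpM2l => //; apply: ler_wpM2l; first exact: expR_ge0.
  by rewrite ler_expR; apply: gauss_ineq3 => //; exact: sqr_ge0.
have [[lv _ lE] [mv _ mE]] := (lI, mI).
have Slm : slice_pt I (lv - mv) = l - m by rewrite slice_ptB lE mE.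
have := @holo_lipschitz _ I unitI (phi \o slice_pt I) mv 2 M lv (holo_pser unitI ep) (ltr0n _ 2).
rewrite /= Slm lE mE -/d => h.
have {}h : `|phi l - phi m| <= 4 * M * (d / 2).
  apply: h => [v|]; last by rewrite divff// ltW.
  by rewrite slice_ptB mE => hv; apply: hM => //; exists v.
rewrite (norm_mul3 _ (norm_kcoef alpha w2I lI) (norm_kcoef alpha w2I mI)).
have e1 (x : R) : expR (- (alpha / 2) * x ^+ 2) <= 1.
  by rewrite expR_le1 mulNr oppr_le0 mulr_ge0 ?sqr_ge0// divr_ge0// ltW.
have A0 := expR_ge0 (alpha / 2 * `|l| ^+ 2); have B0 := expR_ge0 (alpha / 2 * `|m| ^+ 2).
have k1 : expR (- (alpha / 2) * `|l - w2| ^+ 2) * expR (alpha / 2 * `|l| ^+ 2) <= expR (alpha / 2 * `|l| ^+ 2).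
  by rewrite ler_piMl.
have k2 : expR (- (alpha / 2) * `|m - w2| ^+ 2) * expR (alpha / 2 * `|m| ^+ 2) <= expR (alpha / 2 * `|m| ^+ 2).
  by rewrite ler_piMl.
have k12 := ler_pM (mulr_ge0 (expR_ge0 _) A0) (mulr_ge0 (expR_ge0 _) B0) k1 k2.
apply: le_trans (ler_pM _ (normr_ge0 _) k12 h) _; first by rewrite !mulr_ge0// expR_ge0.
by rewrite /M le_eqVlt; apply/orP; left; apply/eqP; field.
Qed.

(* The determinant [kdet] vanishes to first order as [l] and [m] merge; when they are closer than
   1 the left-hand side is compared with the increment of the holomorphic [a / k w2]. *)
Lemma interp_bound : `|pser (k w2) m * pser a l - pser (k w2) l * pser a m| <= interp_cst * S1 * `|kdet|.
Proof.
set A := expR (alpha / 2 * `|l| ^+ 2) * expR (alpha / 2 * `|m| ^+ 2).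
have A0 : 0 <= A by rewrite mulr_ge0// expR_ge0.
have DD : expR (alpha * D ^+ 2) * expR (- (alpha * D ^+ 2)) = 1 by rewrite -expRD subrr expR0.
have [d1|d1] := leP 1 d.
  apply: le_trans (far d1) _; rewrite -/A.
  apply: (@le_trans _ _ (2 * expR (2 * alpha * D ^+ 2) * expR (alpha * D ^+ 2) /
    (1 - expR (- (alpha * rho))) * S1 * `|kdet|)); last first.
    by apply: ler_wpM2r => //; apply: ler_wpM2r => //; rewrite /interp_cst lerDl ltW.
  have h : expR (- (alpha * D ^+ 2)) * A * (1 - expR (- (alpha * rho))) <= `|kdet|.
    apply: le_trans kdet_ge; apply: ler_wpM2l; first by rewrite mulr_ge0// expR_ge0.
    by rewrite lerD2l lerN2 ler_expR lerN2 ler_peMr// ltW.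
  have c0 : 0 <= 2 * expR (2 * alpha * D ^+ 2) * expR (alpha * D ^+ 2) /
    (1 - expR (- (alpha * rho))) * S1 by rewrite mulr_ge0// ltW.
  apply: le_trans (ler_wpM2l c0 h); rewrite le_eqVlt; apply/orP; left; apply/eqP.
  rewrite [RHS](_ : _ = 2 * expR (2 * alpha * D ^+ 2) * S1 * A *
    (expR (alpha * D ^+ 2) * expR (- (alpha * D ^+ 2)))); first by rewrite DD mulr1.
  by field; rewrite gt_eqF.
apply: le_trans (near d1) _; rewrite -/A.
apply: (@le_trans _ _ (2 * expR (alpha * (3 + D) ^+ 2) * expR (alpha * D ^+ 2) * (1 + alpha * rho) /
   (alpha * rho) * S1 * `|kdet|)); last first.
  by apply: ler_wpM2r => //; apply: ler_wpM2r => //; rewrite /interp_cst lerDr ltW.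
have h : expR (- (alpha * D ^+ 2)) * A * (alpha * rho * d / (1 + alpha * rho)) <= `|kdet|.
  apply: le_trans kdet_ge; apply: ler_wpM2l; first by rewrite mulr_ge0// expR_ge0.
  have x0 : 0 <= alpha * rho * d by rewrite mulr_ge0// ltW.
  apply: le_trans (one_sub_exp_ge x0); apply: ler_wpM2l => //.
  rewrite lef_pV2 ?posrE ?ltr_pwDl ?(ltW ar0)// lerD2l ler_piMr// ltW//.
have c0 : 0 <= 2 * expR (alpha * (3 + D) ^+ 2) * expR (alpha * D ^+ 2) * (1 + alpha * rho) /
   (alpha * rho) * S1 by rewrite mulr_ge0// ltW.
apply: le_trans (ler_wpM2l c0 h); rewrite le_eqVlt; apply/orP; left; apply/eqP.
rewrite [RHS](_ : _ = 2 * expR (alpha * (3 + D) ^+ 2) * S1 * d * A *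
    (expR (alpha * D ^+ 2) * expR (- (alpha * D ^+ 2)))); first by rewrite DD mulr1.
by field; rewrite !gt_eqF// ltr_pwDl// ltW.
Qed.

End Interpolation.
End OnSlice.
End Kernel.

(** * Choice of lattice points and interpolation of divided differences *)

Section Pointwise.
Variable R : realType.
Local Notation quat := (quat R).
Variable I : quat.
Hypothesis unitI : imag_unit I.
Implicit Types (a b c : nat -> quat) (x y z w P l m : quat) (f psi : quat -> quat).

(** A square lattice of mesh 2 [rho], shifted by [rho] in the real direction: odd multiples there
    keep every point at distance at least [rho] from 0, as used for compactness. *)
Definition lattice (rho : R) (ij : int * int) : quat :=
  slice_pt I (rho * (2 * ij.1%:~R + 1), rho * (2 * ij.2%:~R)).

Lemma slice_lattice rho ij : slice I (lattice rho ij).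
Proof. by exists (rho * (2 * ij.1%:~R + 1), rho * (2 * ij.2%:~R)). Qed.

Lemma norm_slice_pt_le (v : R * R) : `|slice_pt I v| <= `|v.1| + `|v.2|.
Proof.
have h : `|slice_pt I v| ^+ 2 <= (`|v.1| + `|v.2|) ^+ 2.
  rewrite sqr_norm_slice_pt// sqrrD !real_normK ?num_real//.
  by rewrite addrAC lerDl mulrn_wge0// mulr_ge0.
by rewrite -ler_sqr ?nnegrE ?addr_ge0.
Qed.

Lemma floor_mul_dist (h t : R) : 0 < h -> 0 <= t - h * (Num.floor (t / h))%:~R < h.
Proof.
move=> h0; have /andP[] := Num.Theory.floor_itv (t / h).
rewrite intrD ler_pdivlMr// ltr_pdivrMr// mulrDl mul1r ![_%:~R * h]mulrC => h1 h2.
by rewrite subr_ge0 h1/= ltrBlDl.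
Qed.

Lemma lattice_near rho u : 0 < rho -> slice I u -> exists ij, `|u - lattice rho ij| <= 3 * rho.
Proof.
move=> rho0 [v _ <-].
have h0 : 0 < 2 * rho by exact: mulr_gt0.
have /andP[a1 a2] := floor_mul_dist v.1 h0.
have /andP[b1 b2] := floor_mul_dist v.2 h0.
exists (Num.floor (v.1 / (2 * rho)), Num.floor (v.2 / (2 * rho))).
rewrite /lattice -slice_ptB; apply: le_trans (norm_slice_pt_le _) _ => /=.
have c1 : `|v.1 - rho * (2 * (Num.floor (v.1 / (2 * rho)))%:~R + 1)| <= rho.
  by move: a1 a2; move: (_%:~R) => k; rewrite ler_norml; lra.
have c2 : `|v.2 - rho * (2 * (Num.floor (v.2 / (2 * rho)))%:~R)| <= 2 * rho.
  by move: b1 b2; move: (_%:~R) => k; rewrite ler_norml; lra.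
lra.
Qed.

Lemma qre_conj_norm x : qre (qconj x * x) = `|x| ^+ 2.
Proof. by rewrite mulqC_conj !qE mulr1. Qed.

(** Each centre is pushed outwards by 4 [rho] and then rounded to the lattice with error at most 3
    [rho]. The total push of 8 [rho] beats the rounding error [e] of at most 6 [rho]. *)
Lemma direction_le (rho c d : R) x e : 0 < rho -> 0 <= c -> 0 <= d -> `|x| = 1 -> `|e| <= 6 * rho ->
  rho * `|d *: x| <= qre (qconj ((c + 8 * rho) *: x + e) * (d *: x)).
Proof.
move=> rho0 c0 d0 x1 e6; rewrite qconjD qconjZ mulrDl -scalerAr -scalerAl -scalerAr qreD !qreZ.
rewrite qre_conj_norm x1 expr1n mulr1 normrZ x1 mulr1 ger0_norm//.
have : `|qre (qconj e * x)| <= 6 * rho.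
  by apply: le_trans (ler_qre _) _; rewrite qnormM qnormC x1 mulr1.
rewrite ler_norml => /andP[h _].
have : d * (qre (qconj e * x) + 6 * rho) >= 0 by apply: mulr_ge0 => //; lra.
have := mulr_ge0 d0 c0; have := mulr_ge0 d0 (ltW rho0); lra.
Qed.

Local Opaque pser kcoef gkernel.

Section TwoPoints.
Variables (alpha rho : R).
Hypotheses (alpha0 : 0 < alpha) (rho0 : 0 < rho).
Local Notation k w := (kcoef alpha w).
(** Distance from a node to its centre: a push of 4 [rho], a rounding of 3 [rho], and 1 for the
    displacement of the second node in the confluent case. *)
Let D : R := 7 * rho + 1.
Let D0 : 0 <= D. Proof. by rewrite addr_ge0// mulr_ge0// ltW. Qed.
Let C := interp_cst alpha rho D.
Let C0 : 0 < C. Proof. exact: interp_cst_gt0. Qed.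

(** Cramer's rule: the matrix has entries in the commutative field $C_I$, while the right-hand side
    [x], [y] is arbitrary and stays on the right. *)
Lemma interp_solve (A B c e x y : quat) : slice I A -> slice I B -> slice I c -> slice I e ->
  A * B - c * e != 0 ->
  let v := qinv (A * B - c * e) in
  x = A * (v * (B * x - c * y)) + c * (v * (A * y - e * x)) /\
  y = e * (v * (B * x - c * y)) + B * (v * (A * y - e * x)).
Proof.
move=> AI BI cI eI d0 v; have CC := sliceC unitI.
have vI : slice I v by apply: slice_inv => //; apply: sliceB; exact: sliceM.
have E : v * (A * B - c * e) = 1 by exact: mulVq.
split.
  rewrite !mulrA (CC _ _ AI vI) (CC _ _ cI vI) -!mulrA -mulrDr !mulrBr !mulrA (CC _ _ AI cI).
  by rewrite addrA subrK -mulrBl mulrA E mul1r.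
rewrite !mulrA (CC _ _ eI vI) (CC _ _ BI vI) -!mulrA -mulrDr !mulrBr !mulrA (CC _ _ BI eI) (CC _ _ BI AI).
by rewrite addrC addrA subrK (CC _ _ eI cI) -mulrBl mulrA E mul1r.
Qed.

Lemma interp_cancel (z F F1 F2 A B c e u v : quat) : z != 0 ->
  z * F = (A * u + c * v) - (e * u + B * v) -> z * F1 = A - e -> z * F2 = c - B ->
  F = F1 * u + F2 * v.
Proof.
move=> z0 hF h1 h2; rewrite -[LHS]mul1r -[RHS]mul1r -(mulVq z0) -!mulrA hF; congr (_ * _).
by rewrite mulrDr !mulrA h1 h2 !mulrBl opprD addrACA.
Qed.

Lemma interp_combine (s : R) (P x F x1 x2 F1 F2 u v : quat) :
  x = x1 * u + x2 * v -> F = F1 * u + F2 * v ->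
  s *: x + P * F = (s *: x1 + P * F1) * u + (s *: x2 + P * F2) * v.
Proof. by move=> -> ->; rewrite scalerDr mulrDr !mulrDl !scalerAl !mulrA addrACA. Qed.

Lemma interp_norm (x y u v : quat) (c s1 s2 : R) : `|u| <= c * s1 -> `|v| <= c * s2 ->
  `|x * u + y * v| <= c * (s1 * `|x| + s2 * `|y|).
Proof.
move=> hu hv; apply: le_trans (ler_normD _ _) _; rewrite !qnormM mulrDr !mulrA.
by apply: lerD; rewrite mulrC; apply: ler_wpM2r.
Qed.

Lemma interp_perturb (c s1 s2 f1 f2 p c1 c2 ca d : R) :
  c * (s1 * (f1 + p * (c1 * d)) + s2 * (f2 + p * (c2 * d))) + p * (ca * d) =
  c * (s1 * f1 + s2 * f2) + d * (p * (ca + c * (s1 * c1 + s2 * c2)) + 1 - 1).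
Proof. by ring. Qed.

Lemma norm_interp_div l m w1 w2 a S1 : slice I l -> slice I m -> slice I w1 -> slice I w2 ->
  l != m -> `|l - w1| <= D -> `|m - w2| <= D ->
  rho * `|l - m| <= qre (qconj (w1 - w2) * (l - m)) -> entire a ->
  (forall u, slice I u ->
  `|pser a u| * expR (- (alpha / 2) * `|u| ^+ 2) * expR (- (alpha / 4) * `|u - w1| ^+ 2) <= S1) ->
  `|qinv (kdet alpha l m w1 w2) * (pser (k w2) m * pser a l - pser (k w2) l * pser a m)| <= C * S1.
Proof.
move=> lI mI w1I w2I lm lw mw dir ea hS.
have K := kdet_neq0 unitI alpha0 rho0 lI mI w1I w2I lm dir.
rewrite qnormM qnormV mulrC ler_pdivrMr ?normr_gt0//.
exact: (interp_bound unitI alpha0 rho0 D0 lI mI w1I w2I lm lw mw dir ea hS).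
Qed.

(** For distinct nodes the divided difference depends only on the values at [l] and [m]. Two kernels
    with right coefficients reproduce these values, and the functional is right linear, so it is the
    same combination of its values on the kernels. The case s = 1 is used at the roots, s = 0 at
    their conjugates. *)
Lemma fdd_interp_neq l m w1 w2 a (S1 S2 s : R) P : slice I l -> slice I m -> slice I w1 -> slice I w2 ->
  l != m -> `|l - w1| <= D -> `|m - w2| <= D ->
  rho * `|l - m| <= qre (qconj (w1 - w2) * (l - m)) -> entire a ->
  (forall u, slice I u ->
  `|pser a u| * expR (- (alpha / 2) * `|u| ^+ 2) * expR (- (alpha / 4) * `|u - w1| ^+ 2) <= S1) ->
  (forall u, slice I u ->
  `|pser a u| * expR (- (alpha / 2) * `|u| ^+ 2) * expR (- (alpha / 4) * `|u - w2| ^+ 2) <= S2) ->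
  `|s *: pser a l + P * fdd a l m| <=
    C * (S1 * `|s *: pser (k w1) l + P * fdd (k w1) l m| +
         S2 * `|s *: pser (k w2) l + P * fdd (k w2) l m|).
Proof.
move=> lI mI w1I w2I lm lw mw dir ea hS1 hS2.
have ml : m != l by rewrite eq_sym.
(* The second coefficient is the first one after exchanging (l, w1) with (m, w2); the alignment
   condition and the determinant are invariant under this exchange. *)
have dir' : rho * `|m - l| <= qre (qconj (w2 - w1) * (m - l)).
  by rewrite distrC -(opprB w1) -(opprB l) qconjN mulrNN.
have B1 := norm_interp_div lI mI w1I w2I lm lw mw dir ea hS1.
have B2 := norm_interp_div mI lI w2I w1I ml mw lw dir' ea hS2.
have K := kdet_neq0 unitI alpha0 rho0 lI mI w1I w2I lm dir.
have sk w u : slice I w -> slice I u -> slice I (pser (k w) u).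
  by move=> wI uI; apply: slice_pser => //; [exact: entire_kcoef|move=> n; exact: slice_gkernel].
have A1 := sk _ _ w1I lI; have A2 := sk _ _ w2I mI; have A3 := sk _ _ w2I lI; have A4 := sk _ _ w1I mI.
have KI : slice I (kdet alpha l m w1 w2) by apply: sliceB; exact: sliceM.
have VI := slice_inv unitI KI.
have CC := sliceC unitI.
have Esym : kdet alpha m l w2 w1 = kdet alpha l m w1 w2.
  have gen (x y z t : quat) : x * y = y * x -> z * t = t * z -> x * y - z * t = y * x - t * z.
    by move=> -> ->.
  exact: (gen _ _ _ _ (CC _ _ A2 A1) (CC _ _ A4 A3)).
move: B1 B2; rewrite Esym.
pose e1 := qinv (kdet alpha l m w1 w2) * (pser (k w2) m * pser a l - pser (k w2) l * pser a m).
pose e2 := qinv (kdet alpha l m w1 w2) * (pser (k w1) l * pser a m - pser (k w1) m * pser a l).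
move=> B1' B2'; have B1 : `|e1| <= C * S1 := B1'; have B2 : `|e2| <= C * S2 := B2'.
have [El Em] : pser a l = pser (k w1) l * e1 + pser (k w2) l * e2 /\
    pser a m = pser (k w1) m * e1 + pser (k w2) m * e2.
  exact: (interp_solve (pser a l) (pser a m) A1 A2 A3 A4 K).
have Ef : fdd a l m = fdd (k w1) l m * e1 + fdd (k w2) l m * e2.
  have lmC := CC _ _ lI mI; have ha := fdd_diff ea lmC; rewrite El Em in ha.
  apply: (interp_cancel _ ha (fdd_diff (entire_kcoef alpha w1) lmC) (fdd_diff (entire_kcoef alpha w2) lmC)).
  by rewrite subr_eq0.
rewrite (interp_combine s P El Ef).
exact: interp_norm.
Qed.

Definition weighted_bound a w (S : R) := forall u, slice I u ->
  `|pser a u| * expR (- (alpha / 2) * `|u| ^+ 2) * expR (- (alpha / 4) * `|u - w| ^+ 2) <= S.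

(* The case [l = m] is the limit of the points [l - d] as [d] tends to 0, with [w1] and [w2] fixed. *)
Lemma fdd_interp_eq l w1 w2 a (S1 S2 s : R) P (e : quat) :
  slice I l -> slice I w1 -> slice I w2 ->
  `|l - w1| <= 7 * rho -> `|l - w2| <= 7 * rho -> w1 - w2 = (8 * rho) *: 1 + e ->
  `|e| <= 6 * rho -> entire a -> weighted_bound a w1 S1 -> weighted_bound a w2 S2 ->
  `|s *: pser a l + P * fdd a l l| <=
    C * (S1 * `|s *: pser (k w1) l + P * fdd (k w1) l l| +
         S2 * `|s *: pser (k w2) l + P * fdd (k w2) l l|).
Proof.
move=> lI w1I w2I lw1 lw2 we e6 ea hS1 hS2.
have S10 : 0 <= S1 by apply: le_trans (hS1 l lI); rewrite !mulr_ge0// expR_ge0.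
have S20 : 0 <= S2 by apply: le_trans (hS2 l lI); rewrite !mulr_ge0// expR_ge0.
have [Ca Ca0 ca] := fdd_continuous l l ea.
have [C1 C10 c1] := fdd_continuous l l (entire_kcoef alpha w1).
have [C2 C20 c2] := fdd_continuous l l (entire_kcoef alpha w2).
set F := fun b m => s *: pser b l + P * fdd b l m.
change (`|F a l| <= C * (S1 * `|F (k w1) l| + S2 * `|F (k w2) l|)).
have FL b m (c : R) : `|fdd b l l - fdd b l m| <= c -> `|F b l - F b m| <= `|P| * c.
  move=> h; rewrite /F opprD addrACA subrr add0r -mulrBr qnormM; exact: ler_wpM2l.
(* [K] collects the Lipschitz constants in the second node on both sides of the inequality, so that
   moving it by [d] costs at most d K <= t; the added 1 keeps [K] positive. *)
pose K := `|P| * (Ca + C * (S1 * C1 + S2 * C2)) + 1.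
have K0 : 0 < K.
  have h0 : 0 <= C * (S1 * C1 + S2 * C2) by apply: mulr_ge0; [exact: ltW|rewrite addr_ge0// mulr_ge0].
  by apply: ltr_pwDr => //; apply: mulr_ge0 => //; exact: addr_ge0.
apply/ler_addgt0Pr => t t0; pose d := Num.min 1 (t / K).
have d0 : 0 < d by rewrite lt_min ltr01 divr_gt0.
have d1 : d <= 1 by rewrite ge_min lexx.
have dt : d * K <= t by rewrite -ler_pdivlMr// ge_min lexx orbT.
pose m : quat := l - d *: 1.
have lmE : l - m = d *: 1 by rewrite /m opprB addrC subrK.
have n1 : `|d *: (1 : quat)| = d by rewrite normrZ qnorm1 mulr1 gtr0_norm.
have mI : slice I m by apply: sliceB => //; exact: slice_real.
have lmd : `|l - m| <= 1 by rewrite lmE n1.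
have h : `|F a m| <= C * (S1 * `|F (k w1) m| + S2 * `|F (k w2) m|).
  apply: fdd_interp_neq => //.
  - by rewrite -subr_eq0 lmE -normr_gt0 n1.
  - by apply: le_trans lw1 _; rewrite /D; lra.
  - have -> : m - w2 = (l - w2) - (l - m) by rewrite opprB [RHS]addrC addrA subrK.
    by apply: le_trans (ler_normB _ _) _; rewrite lerD.
  - rewrite lmE we; have := @direction_le rho 0 d 1 e rho0 (lexx _) (ltW d0) (qnorm1 _) e6.
    by rewrite add0r.
have ha := FL _ _ _ (ca _ lmd); have h1 := FL _ _ _ (c1 _ lmd); have h2 := FL _ _ _ (c2 _ lmd).
move: ha h1 h2; rewrite lmE n1 => ha h1 h2.
have a1 : `|F a l| <= `|F a m| + `|P| * (Ca * d).
  by rewrite -lerBlDl; apply: le_trans ha; exact: lerB_dist.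
have a2 : `|F (k w1) m| <= `|F (k w1) l| + `|P| * (C1 * d).
  by rewrite -lerBlDl; apply: le_trans h1; rewrite distrC; exact: lerB_dist.
have a3 : `|F (k w2) m| <= `|F (k w2) l| + `|P| * (C2 * d).
  by rewrite -lerBlDl; apply: le_trans h2; rewrite distrC; exact: lerB_dist.
apply: le_trans a1 _; apply: le_trans (lerD h (lexx _)) _.
have h3 : C * (S1 * `|F (k w1) m| + S2 * `|F (k w2) m|) <=
   C * (S1 * (`|F (k w1) l| + `|P| * (C1 * d)) + S2 * (`|F (k w2) l| + `|P| * (C2 * d))).
  apply: ler_wpM2l; first exact: ltW.
  by apply: lerD; apply: ler_wpM2l.
apply: le_trans (lerD h3 (lexx _)) _.
apply: (@le_trans _ _ (C * (S1 * `|F (k w1) l| + S2 * `|F (k w2) l|) + d * (K - 1))).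
  by rewrite le_eqVlt; apply/orP; left; apply/eqP; exact: interp_perturb.
by rewrite lerD2l; apply: le_trans dt; rewrite ler_pM2l// gerBl.
Qed.

(** The lattice points are roundings of [l] and [m] pushed apart along the direction of l - m, or
    along the real axis when the nodes coincide. They depend on the nodes only, hence serve every
    [a], [s] and [P]. *)
Lemma fdd_interp l m : slice I l -> slice I m -> exists ij1 ij2, forall a (S1 S2 s : R) P, entire a ->
  weighted_bound a (lattice rho ij1) S1 -> weighted_bound a (lattice rho ij2) S2 ->
  `|s *: pser a l + P * fdd a l m| <=
    C * (S1 * `|s *: pser (k (lattice rho ij1)) l + P * fdd (k (lattice rho ij1)) l m| +
         S2 * `|s *: pser (k (lattice rho ij2)) l + P * fdd (k (lattice rho ij2)) l m|).
Proof.
move=> lI mI.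
have [x [d [xI x1 d0 dE x_eq]]] : exists x (d : R),
    [/\ slice I x, `|x| = 1, 0 <= d, l - m = d *: x & l = m -> x = 1 /\ d = 0].
  have [->|lm] := eqVneq l m.
    exists 1, 0; split=> //; [exact: slice1|exact: qnorm1|].
    by rewrite subrr scale0r.
  have n0 : `|l - m| != 0 by rewrite normr_eq0 subr_eq0.
  exists (`|l - m|^-1 *: (l - m)), `|l - m|; split=> //; first by apply: sliceZ; exact: sliceB.
  - by rewrite normrZ ger0_norm ?invr_ge0// mulVf.
  - by rewrite scalerA divff// scale1r.
  - by move=> lme; move: lm; rewrite lme eqxx.
have uI : slice I (l + (4 * rho) *: x) by apply: sliceD => //; exact: sliceZ.
have vI : slice I (m - (4 * rho) *: x) by apply: sliceB => //; exact: sliceZ.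
have [ij1 n1] := lattice_near rho0 uI; have [ij2 n2] := lattice_near rho0 vI.
exists ij1, ij2 => a S1 S2 s P ea h1 h2.
set w1 := lattice rho ij1 in n1 h1 *; set w2 := lattice rho ij2 in n2 h2 *.
have w1I : slice I w1 by exact: slice_lattice.
have w2I : slice I w2 by exact: slice_lattice.
have nx : `|(4 * rho) *: x| = 4 * rho by rewrite normrZ x1 mulr1 gtr0_norm// mulr_gt0.
have lw : `|l - w1| <= 7 * rho.
  have -> : l - w1 = (l + (4 * rho) *: x - w1) - (4 * rho) *: x by rewrite [l + _ - w1]addrAC addrK.
  by apply: le_trans (ler_normB _ _) _; rewrite nx; move: n1; lra.
have mw : `|m - w2| <= 7 * rho.
  have -> : m - w2 = (m - (4 * rho) *: x - w2) + (4 * rho) *: x by rewrite addrAC subrK.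
  by apply: le_trans (ler_normD _ _) _; rewrite nx; move: n2; lra.
pose e := (m - (4 * rho) *: x - w2) - (l + (4 * rho) *: x - w1).
have e6 : `|e| <= 6 * rho by apply: le_trans (ler_normB _ _) _; move: n1 n2; lra.
have we : w1 - w2 = (d + 8 * rho) *: x + e.
  rewrite scalerDl -dE /e; apply: quat_eq; rewrite !qE; ring.
have [lm|lm] := eqVneq l m; last first.
  apply: fdd_interp_neq => //.
  - by apply: le_trans lw _; rewrite /D lerDl.
  - by apply: le_trans mw _; rewrite /D lerDl.
  - by rewrite we dE; exact: direction_le.
have [xE dE0] := x_eq lm; move: we mw; rewrite xE dE0 add0r -lm => we mw.
exact: (@fdd_interp_eq l w1 w2 a S1 S2 s P e).
Qed.

End TwoPoints.
End Pointwise.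

(** * The pointwise estimate of a composition *)

Section CompPointwise.
Variable R : realType.
Local Notation quat := (quat R).
Variable I : quat.
Hypothesis unitI : imag_unit I.
Implicit Types (a b c : nat -> quat) (x y z w P l m : quat) (f psi : quat -> quat).

Local Opaque pser kcoef gkernel.

Definition pointwise_cst (alpha rho : R) := 4 * interp_cst alpha rho (7 * rho + 1).

Lemma pointwise_cst_gt0 alpha rho : 0 < alpha -> 0 < rho -> 0 < pointwise_cst alpha rho.
Proof.
by move=> a0 r0; rewrite mulr_gt0//; apply: interp_cst_gt0 => //; rewrite addr_ge0// mulr_ge0// ltW.
Qed.

(** Keeping only the largest of the four terms allows a power q > 0 to be taken afterwards with no
    triangle inequality. *)
Lemma max4_le (T : Type) (F : T -> R) (c : R) (i1 i2 i3 i4 : T) : 0 <= c ->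
  exists i, c * (F i1 + F i2) + c * (F i3 + F i4) <= 4 * c * F i.
Proof.
move=> c0.
have two j k : exists i, F j <= F i /\ F k <= F i.
  by have [h|h] := leP (F j) (F k); [exists k|exists j; rewrite lexx ltW].
have [j [j1 j2]] := two i1 i2; have [k [k1 k2]] := two i3 i4; have [i [h1 h2]] := two j k.
exists i; rewrite -mulrDr [4 * c]mulrC -mulrA; apply: ler_wpM2l => //; lra.
Qed.

Lemma scale1_interp (x y1 y2 X Y1 Y2 : quat) (c s1 s2 : R) :
  `|1 *: x + X| <= c * (s1 * `|1 *: y1 + Y1| + s2 * `|1 *: y2 + Y2|) ->
  `|x + X| <= c * (s1 * `|y1 + Y1| + s2 * `|y2 + Y2|).
Proof. by rewrite !scale1r. Qed.

Lemma scale0_interp (x y1 y2 X Y1 Y2 : quat) (c s1 s2 : R) :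
  `|0 *: x + X| <= c * (s1 * `|0 *: y1 + Y1| + s2 * `|0 *: y2 + Y2|) ->
  `|X| <= c * (s1 * `|Y1| + s2 * `|Y2|).
Proof. by rewrite !scale0r !add0r. Qed.

(** The slice part and the anticommuting part of the functional are interpolated separately. A
    kernel centred in $C_I$ has coefficients in $C_I$, so its two parts really lie in $C_I$ and in
    the anticommuting complement, and each is bounded by the full |(k_w • psi)(z)|. For [f] only the
    triangle inequality is used. *)
Lemma comp_pointwise (alpha rho : R) f psi z (S : int * int -> R) : 0 < alpha -> 0 < rho ->
  slice_regular f -> slice_regular psi -> slice I z ->
  (forall ij u, slice I u -> `|f u| * expR (- (alpha / 2) * `|u| ^+ 2) *
     expR (- (alpha / 4) * `|u - lattice I rho ij| ^+ 2) <= S ij) ->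
  exists ij, `|slice_comp f psi z| <= pointwise_cst alpha rho *
    (S ij * `|slice_comp (fock_kernel alpha (lattice I rho ij)) psi z|).
Proof.
move=> alpha0 rho0 hf hpsi zI hS.
have [ea fE] := slice_regular_coef hf; set a := ps_coef f in ea fE.
have {}fE : f = pser a by apply/funext.
have [l [m [P1 [P2 [lI mI P1I P2I E]]]]] := slice_comp_roots unitI hpsi zI.
have [i1 [i2 h12]] := fdd_interp unitI alpha0 rho0 lI mI.
have [i3 [i4 h34]] := fdd_interp unitI alpha0 rho0 (slice_conj unitI lI) (slice_conj unitI mI).
have hW ij : weighted_bound I alpha a (lattice I rho ij) (S ij).
  by move=> u uI; rewrite -fE; exact: hS.
have S0 ij : 0 <= S ij by apply: le_trans (hS ij z zI); rewrite !mulr_ge0// expR_ge0.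
pose T ij := `|slice_comp (fock_kernel alpha (lattice I rho ij)) psi z|.
have TE ij : T ij = `|(pser (kcoef alpha (lattice I rho ij)) l +
    P1 * fdd (kcoef alpha (lattice I rho ij)) l m) +
    P2 * fdd (kcoef alpha (lattice I rho ij)) (qconj l) (qconj m)|.
  by rewrite /T fock_kernelE E//; exact: entire_kcoef.
have kI ij n : slice I (kcoef alpha (lattice I rho ij) n).
  by apply: slice_gkernel => //; exact: slice_lattice.
have ek ij := entire_kcoef alpha (lattice I rho ij).
have ant ij : anti I (P2 * fdd (kcoef alpha (lattice I rho ij)) (qconj l) (qconj m)).
  have sI : slice I (fdd (kcoef alpha (lattice I rho ij)) (qconj l) (qconj m)).
    by apply: slice_fdd => //; exact: slice_conj.
  rewrite (antiE unitI P2I sI); apply: anti_slice => //; exact: slice_conj.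
have sl ij : slice I (pser (kcoef alpha (lattice I rho ij)) l +
    P1 * fdd (kcoef alpha (lattice I rho ij)) l m).
  apply: sliceD; first exact: slice_pser.
  by apply: sliceM => //; exact: slice_fdd.
have NN ij := norm_slice_anti unitI (sl ij) (ant ij).
pose C := interp_cst alpha rho (7 * rho + 1).
have C0 : 0 < C by apply: interp_cst_gt0 => //; rewrite addr_ge0// mulr_ge0// ltW.
have b1 : `|pser a l + P1 * fdd a l m| <= C * (S i1 * T i1 + S i2 * T i2).
  apply: le_trans (scale1_interp (h12 a _ _ 1 P1 ea (hW i1) (hW i2))) _.
  apply: ler_wpM2l; first exact: ltW.
  by apply: lerD; apply: ler_wpM2l => //; rewrite TE; exact: (proj1 (NN _)).
have b2 : `|P2 * fdd a (qconj l) (qconj m)| <= C * (S i3 * T i3 + S i4 * T i4).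
  apply: le_trans (scale0_interp (h34 a _ _ 0 P2 ea (hW i3) (hW i4))) _.
  apply: ler_wpM2l; first exact: ltW.
  by apply: lerD; apply: ler_wpM2l => //; rewrite TE; exact: (proj2 (NN _)).
have [i hi] := max4_le (fun i => S i * T i) i1 i2 i3 i4 (ltW C0).
exists i; rewrite fE (E a ea); apply: le_trans (ler_normD _ _) _.
exact: le_trans (lerD b1 b2) hi.
Qed.

End CompPointwise.

(** * Integration over the plane and Gaussian sums *)

Section PlaneMeasure.
Variable R : realType.
Implicit Types (f g h : R * R -> R) (u v z : R * R).

Local Notation mu2 := ((@lebesgue_measure R) \x (@lebesgue_measure R))%E.

Lemma rat_interval (x e : R) : 0 < e ->
  exists s : rat * rat, (x \in `]ratr s.1, ratr s.2[) /\ forall y, (y \in `]ratr s.1, ratr s.2[) -> `|x - y| < e.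
Proof.
move=> e0; have l : x - e < x by rewrite ltrBlDr ltrDl.
have r : x < x + e by rewrite ltrDl.
have [q1] := rat_in_itvoo l; have [q2] := rat_in_itvoo r.
rewrite !in_itv /= => /andP[a1 a2] /andP[b1 b2].
exists (q1, q2); split; first by rewrite in_itv /= b2.
by move=> y; rewrite in_itv /= => /andP[c1 c2]; rewrite ltr_norml; apply/andP; split; lra.
Qed.

(** The plane carries the product sigma-algebra; an open set belongs to it as the countable union of
    the rational boxes that it contains. *)
Lemma continuous_measurable_plane f : continuous f -> measurable_fun [set: R * R] f.
Proof.
move=> cf; apply: (measurability _ (@RGenOpens.measurableE R)) => _ [_ [a [b ->] <-]].
rewrite setTI; set U := f @^-1` _.
have oU : open U.
  apply: open_comp; [by move=> z _; exact: cf|exact: interval_open].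
pose box (s : (rat * rat) * (rat * rat)) : set (R * R) :=
  `]ratr s.1.1, ratr s.1.2[%classic `*` `]ratr s.2.1, ratr s.2.2[%classic.
pose B s := if pselect (box s `<=` U) then box s else set0.
have -> : U = \bigcup_s B s.
  apply/seteqP; split => [[x y] Uxy|z [s _]]; last by rewrite /B; case: pselect => // /[apply].
  have /nbhs_ballP[e /= e0 he] := open_nbhs_nbhs (conj oU Uxy).
  have [s1 [i1 h1]] := rat_interval x e0; have [s2 [i2 h2]] := rat_interval y e0.
  exists (s1, s2) => //; rewrite /B; case: pselect => [bU|[]]; first by [].
  by move=> -[x' y'] [/= hx hy]; apply: he; split; [exact: h1|exact: h2].
apply: countable_bigcupT_measurable => [|s]; first exact: countableP.
by rewrite /B; case: pselect => [bU|nU]; [apply: measurableX; exact: measurable_itv|exact: measurable0].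
Qed.

Definition pint h : \bar R := (\int[mu2]_(z in [set: R * R]) (h z)%:E)%E.

Lemma pint_ge0 h : (forall z, 0 <= h z) -> (0 <= pint h)%E.
Proof. by move=> h0; apply: integral_ge0 => z _; rewrite lee_fin. Qed.

Lemma le_pint g h : measurable_fun [set: R * R] g -> measurable_fun [set: R * R] h ->
  (forall z, 0 <= g z) -> (forall z, g z <= h z) -> (pint g <= pint h)%E.
Proof.
move=> mg mh g0 gh; apply: ge0_le_integral => //.
- by move=> z _; rewrite lee_fin.
- exact/measurable_EFinP.
- exact/measurable_EFinP.
- by move=> z _; rewrite lee_fin.
Qed.

Lemma pintZ (c : R) h : measurable_fun [set: R * R] h -> (forall z, 0 <= h z) -> 0 <= c ->
  pint (fun z => c * h z) = (c%:E * pint h)%E.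
Proof.
move=> mh h0 c0; rewrite /pint -ge0_integralZl//; last by move=> z _; rewrite lee_fin.
exact/measurable_EFinP.
Qed.

Lemma pintD g h : measurable_fun [set: R * R] g -> measurable_fun [set: R * R] h ->
  (forall z, 0 <= g z) -> (forall z, 0 <= h z) ->
  pint (fun z => g z + h z) = (pint g + pint h)%E.
Proof.
move=> mg mh g0 h0; rewrite /pint -ge0_integralD//.
- by move=> z _; rewrite lee_fin.
- exact/measurable_EFinP.
- by move=> z _; rewrite lee_fin.
- exact/measurable_EFinP.
Qed.

Lemma le_pintD (c : R) f g h : measurable_fun [set: R * R] f -> measurable_fun [set: R * R] g ->
  measurable_fun [set: R * R] h -> (forall z, 0 <= f z) -> (forall z, 0 <= g z) -> (forall z, 0 <= h z) ->
  0 <= c -> (forall z, f z <= c * (g z + h z)) -> (pint f <= c%:E * (pint g + pint h))%E.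
Proof.
move=> mf mg mh f0 g0 h0 c0 fgh; rewrite -pintD// -pintZ//; last by move=> z; rewrite addr_ge0.
  apply: le_pint => //; apply: measurable_funM => //; exact: measurable_funD.
exact: measurable_funD.
Qed.

Lemma pint_fubini h : measurable_fun [set: R * R] h -> (forall z, 0 <= h z) ->
  pint h = (\int[@lebesgue_measure R]_x \int[@lebesgue_measure R]_y (h (x, y))%:E)%E.
Proof.
move=> mh h0; rewrite /pint fubini_tonelli1//; exact/measurable_EFinP.
Qed.

Lemma integral_reflect (h : R -> R) : measurable_fun setT h -> (forall x, 0 <= h x) ->
  (\int[@lebesgue_measure R]_x (h (- x))%:E = \int[@lebesgue_measure R]_x (h x)%:E)%E.
Proof.
move=> mh h0.
have mhN : measurable_fun setT (h \o -%R).
  by apply: measurableT_comp => //; exact: oppr_measurable.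
have split_int (k : R -> R) : measurable_fun setT k -> (forall x, 0 <= k x) ->
    (\int[@lebesgue_measure R]_x (k x)%:E = \int[@lebesgue_measure R]_(x in `]-oo, 0%R]) (k x)%:E +
     \int[@lebesgue_measure R]_(x in `[0%R, +oo[) (k x)%:E)%E.
  move=> mk k0.
  have mkE (D : set R) : measurable_fun D (fun x => (k x)%:E).
    by apply/measurable_EFinP; apply: measurable_funTS.
  rewrite -(@integral_itv_obnd_cbnd _ 0 (BInfty _ false)); last exact: mkE.
  rewrite -ge0_integral_setU//=.
  - by rewrite (itv_setU_setT false (0 : R)).
  - exact: mkE.
  - by move=> x _; rewrite lee_fin.
  - by rewrite disj_set2E; apply/eqP/seteqP; split => // x []; rewrite /= !in_itv/= andbT => /le_lt_trans /[apply]; rewrite ltxx.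
rewrite (split_int _ mh h0) (split_int _ mhN (fun x => h0 (- x))).
have sub (k : R -> R) : measurable_fun setT k -> (forall x, 0 <= k x) ->
    (\int[@lebesgue_measure R]_(x in `[0%R, +oo[) (k x)%:E = \int[@lebesgue_measure R]_(x in `]-oo, 0%R]) (k (- x))%:E)%E.
  move=> mk k0; apply: (@ge0_integration_by_substitution0 R (fun x => (k x)%:E)).
    exact/measurable_EFinP.
  by move=> x; rewrite lee_fin.
rewrite (sub _ mh h0) (sub _ mhN (fun x => h0 (- x))).
rewrite addrC; congr (_ + _)%E.
by apply: eq_integral => x _ /=; rewrite opprK.
Qed.

Lemma pint_reflect h : measurable_fun [set: R * R] h -> (forall z, 0 <= h z) ->
  pint (fun z => h (z.1, - z.2)) = pint h.
Proof.
move=> mh h0.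
have mr : measurable_fun [set: R * R] (fun z => h (z.1, - z.2)).
  apply: measurableT_comp => //; apply: measurable_fun_pair; first exact: measurable_fst.
  by apply: measurableT_comp; [exact: oppr_measurable|exact: measurable_snd].
rewrite (pint_fubini mr (fun z => h0 (z.1, - z.2))) (pint_fubini mh h0).
apply: eq_integral => x _ /=; apply: (@integral_reflect (fun y => h (x, y))) => //.
by apply: measurableT_comp => //; exact: measurable_pair1.
Qed.

Lemma pint_box h u (s k : R) : measurable_fun [set: R * R] h -> (forall z, 0 <= h z) -> 0 < s ->
  0 <= k ->
  (forall z, `|z.1 - u.1| <= s -> `|z.2 - u.2| <= s -> k <= h z) -> ((k * (4 * s ^+ 2))%:E <= pint h)%E.
Proof.
move=> mh h0 s0 k0 hk.
pose B : set (R * R) := `[u.1 - s, u.1 + s]%classic `*` `[u.2 - s, u.2 + s]%classic.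
have mB : measurable B by apply: measurableX; exact: measurable_itv.
have mE (D : set (R * R)) : measurable_fun D (fun x => (h x)%:E).
  by apply/measurable_EFinP; apply: measurable_funTS.
apply: (@le_trans _ _ (\int[mu2]_(z in B) (h z)%:E)%E); last first.
  by apply: ge0_subset_integral => //; [exact: mE|move=> z _; rewrite lee_fin].
apply: (@le_trans _ _ (\int[mu2]_(z in B) (cst k%:E) z)%E); last first.
  apply: ge0_le_integral => //.
  - exact: mE.
  - move=> z [/=]; rewrite !in_itv /= => h1 h2; rewrite lee_fin; apply: hk; rewrite ler_norml; apply/andP; split; lra.
have muB : mu2 B = (@lebesgue_measure R `[u.1 - s, u.1 + s]%classic%R * @lebesgue_measure R `[u.2 - s, u.2 + s]%classic%R)%E.
  by apply: product_measure1E; exact: measurable_itv.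
have -> : (\int[mu2]_(z in B) cst k%:E z = k%:E * mu2 B)%E by exact: integral_cst.
rewrite muB.
rewrite !lebesgue_measure_itv /= !lte_fin.
have lt (x : R) : x - s < x + s by lra.
rewrite !lt -!EFinB -!EFinM lee_fin le_eqVlt; apply/orP; left; apply/eqP; ring.
Qed.

(** The integrand is $\sqrt{\pi/c}$ times the normal density of mean [m] and variance 1/(2c). *)
Lemma gauss_integral (c m : R) : 0 < c ->
  (\int[@lebesgue_measure R]_x (expR (- c * (x - m) ^+ 2))%:E = (Num.sqrt (pi / c))%:E)%E.
Proof.
move=> c0; pose s := Num.sqrt (1 / (2 * c)).
have s2 : s ^+ 2 = 1 / (2 * c) by rewrite sqr_sqrtr// divr_ge0// mulr_ge0// ltW.
have s0 : s != 0 by rewrite gt_eqF// sqrtr_gt0 divr_gt0// mulr_gt0.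
have p0 : 0 < Num.sqrt (pi / c) by rewrite sqrtr_gt0 divr_gt0// pi_gt0.
have E x : expR (- c * (x - m) ^+ 2) = Num.sqrt (pi / c) * normal_pdf m s x.
  rewrite /normal_pdf (negbTE s0) /normal_peak /normal_fun s2.
  have -> : 1 / (2 * c) * pi *+ 2 = pi / c by field; rewrite gt_eqF.
  rewrite mulVKf ?gt_eqF//; congr expR; field; rewrite gt_eqF//.
under eq_integral do rewrite E EFinM.
rewrite ge0_integralZl//.
- by rewrite integral_normal_pdf mule1.
- by apply/measurable_EFinP; exact: measurable_normal_pdf.
- by move=> x _; rewrite lee_fin normal_pdf_ge0.
Qed.

Definition gauss (c : R) u z := expR (- c * ((z.1 - u.1) ^+ 2 + (z.2 - u.2) ^+ 2)).

Lemma gauss_ge0 c u z : 0 <= gauss c u z. Proof. exact: expR_ge0. Qed.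

Lemma continuous_gauss c u : continuous (gauss c u).
Proof.
move=> z; apply: continuous_comp; last exact: continuous_expR.
apply: cvgM; first exact: cvg_cst.
by apply: cvgD; apply: cvgM; apply: cvgB; try exact: cvg_cst; [exact: cvg_fst|exact: cvg_fst|exact: cvg_snd|exact: cvg_snd].
Qed.

Lemma measurable_gauss c u : measurable_fun [set: R * R] (gauss c u).
Proof. by apply: continuous_measurable_plane; exact: continuous_gauss. Qed.

Lemma pint_gauss c u : 0 < c -> pint (gauss c u) = (pi / c)%:E.
Proof.
move=> c0; rewrite pint_fubini; [|exact: measurable_gauss|exact: gauss_ge0].
have p0 : 0 <= pi / c by rewrite divr_ge0// ?pi_ge0// ltW.
have E x : (\int[@lebesgue_measure R]_y (gauss c u (x, y))%:E =
    (Num.sqrt (pi / c))%:E * (expR (- c * (x - u.1) ^+ 2))%:E)%E.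
  rewrite muleC -(gauss_integral u.2 c0) -ge0_integralZl//.
  - by apply: eq_integral => y _; rewrite -EFinM -expRD /gauss /= mulrDr.
  - apply/measurable_EFinP; apply: measurableT_comp; first exact: measurable_expR.
    by apply: measurable_funM => //; apply: measurable_funX; exact: measurable_funB.
under eq_integral do rewrite E.
rewrite ge0_integralZl//.
- by rewrite gauss_integral// -EFinM -expr2 sqr_sqrtr.
- apply/measurable_EFinP; apply: measurableT_comp; first exact: measurable_expR.
  by apply: measurable_funM => //; apply: measurable_funX; exact: measurable_funB.
Qed.

End PlaneMeasure.

(** * Gaussian sums over the integers *)

Section IntegerSums.
Variable R : realType.
Implicit Types (F G : int -> \bar R).

(** [Negz n] is -n-1, so pairing it with n enumerates every integer once and 0 is not counted
    twice. *)
Definition isum F : \bar R := (\sum_(0 <= n <oo) (F (Posz n) + F (Negz n)))%E.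

Let term_ge0 F : (forall i, (0 <= F i)%E) -> forall n, (0 <= F (Posz n) + F (Negz n))%E.
Proof. by move=> F0 n; rewrite adde_ge0. Qed.

Lemma isum_ge0 F : (forall i, (0 <= F i)%E) -> (0 <= isum F)%E.
Proof. by move=> F0; apply: nneseries_ge0 => n _ _; exact: term_ge0. Qed.

Lemma isum_term F i : (forall j, (0 <= F j)%E) -> (F i <= isum F)%E.
Proof.
move=> F0.
have h n : (F (Posz n) + F (Negz n) <= isum F)%E.
  have := @nneseries_lim_ge R (fun n => F (Posz n) + F (Negz n))%E xpredT 0 n.+1
    (fun n _ _ => term_ge0 F0 n).
  rewrite big_nat_recr//=; apply: le_trans; rewrite leeDr//.
  by apply: sume_ge0 => k _; exact: term_ge0.
by case: i => n; apply: le_trans (h n); rewrite ?leeDl ?leeDr.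
Qed.

Lemma le_isum F G : (forall i, (0 <= F i)%E) -> (forall i, (F i <= G i)%E) -> (isum F <= isum G)%E.
Proof.
move=> F0 FG; apply: lee_nneseries => [n _ _|n _]; first exact: term_ge0.
exact: leeD.
Qed.

Lemma isumZ (c : R) F : (forall i, (0 <= F i)%E) -> 0 <= c ->
  isum (fun i => c%:E * F i)%E = (c%:E * isum F)%E.
Proof.
move=> F0 c0; rewrite /isum -nneseriesZl//; last by move=> n _; exact: term_ge0.
by apply: eq_eseriesr => n _; rewrite ge0_muleDr.
Qed.

Lemma isum_integral d (T : measurableType d) (mu : {measure set T -> \bar R}) (F : int -> T -> \bar R) :
  (forall i, measurable_fun setT (F i)) -> (forall i x, (0 <= F i x)%E) ->
  (\int[mu]_x isum (fun i => F i x) = isum (fun i => \int[mu]_x F i x))%E.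
Proof.
move=> mF F0; rewrite /isum integral_nneseries//.
- apply: eq_eseriesr => n _; rewrite ge0_integralD//.
- by move=> n; exact: emeasurable_funD.
- by move=> n x _; rewrite adde_ge0.
Qed.

Lemma isum_measurable d (T : measurableType d) (F : int -> T -> \bar R) :
  (forall i, measurable_fun setT (F i)) -> (forall i x, (0 <= F i x)%E) ->
  measurable_fun setT (fun x => isum (fun i => F i x)).
Proof.
move=> mF F0; apply: (@ge0_emeasurable_sum _ _ _ _ (fun n x => F (Posz n) x + F (Negz n) x)%E xpredT).
- by move=> n x _ _; rewrite adde_ge0.
- by move=> n _; exact: emeasurable_funD.
Qed.

Lemma frac_abs_diff (t s : R) : s <= t ->
  (t - s) / ((1 + `|t|) * (1 + `|s|)) <= t / (1 + `|t|) - s / (1 + `|s|).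
Proof.
move=> st; have t1 : 0 < 1 + `|t| by rewrite ltr_pwDl.
have s1 : 0 < 1 + `|s| by rewrite ltr_pwDl.
have -> : t / (1 + `|t|) - s / (1 + `|s|) =
    (t * (1 + `|s|) - s * (1 + `|t|)) / ((1 + `|t|) * (1 + `|s|)).
  by field; rewrite !gt_eqF.
rewrite ler_pM2r ?invr_gt0 ?mulr_gt0//.
have : 0 <= t * `|s| - s * `|t|.
  by move: st; case: (ger0P t) => t0; case: (ger0P s) => s0 st; nra.
by rewrite !mulrDr !mulr1; lra.
Qed.

(** The factor 2(1 + h) comes from $(1+|t|)(1+|t-h|)\le2(1+h)(1+t^2)$, and $1+c^{-1}$ from
    $1+t^2\le(1+c^{-1})(1+ct^2)\le(1+c^{-1})e^{ct^2}$. *)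
Definition gauss_sum_cst (c h : R) := 2 * (1 + h) * (1 + c^-1) / h.

(* [t / (1 + |t|)] is a bounded function whose increments dominate the Gaussian, so that the
   Gaussian sums telescope. *)
Lemma gauss_le_diff (c h t : R) : 0 < c -> 0 < h ->
  expR (- c * t ^+ 2) <= gauss_sum_cst c h * (t / (1 + `|t|) - (t - h) / (1 + `|t - h|)).
Proof.
move=> c0 h0; have K0 : 0 <= gauss_sum_cst c h.
  by rewrite !mulr_ge0 ?invr_ge0 ?addr_ge0 ?invr_ge0// ltW.
have sh : t - h <= t by rewrite gerBl ltW.
apply: le_trans (ler_wpM2l K0 (frac_abs_diff sh)); rewrite opprB addrC subrK.
have t1 : 0 < 1 + `|t| by rewrite ltr_pwDl.
have s1 : 0 < 1 + `|t - h| by rewrite ltr_pwDl.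
rewrite [leRHS]mulrA ler_pdivlMr ?mulr_gt0//.
have -> : gauss_sum_cst c h * h = 2 * (1 + h) * (1 + c^-1) by rewrite /gauss_sum_cst mulfVK// gt_eqF.
rewrite mulNr expRN mulrC ler_pdivrMr ?expR_gt0//.
apply: (@le_trans _ _ (2 * (1 + h) * (1 + c^-1) * (1 + c * t ^+ 2))); last first.
  apply: ler_wpM2l; last exact: expR_ge1Dx.
  by rewrite !mulr_ge0 ?addr_ge0 ?invr_ge0// ltW.
have st : `|t - h| <= `|t| + h by apply: le_trans (ler_normB _ _) _; rewrite (gtr0_norm h0).
have h1 : (1 + `|t|) * (1 + `|t - h|) <= 2 * (1 + h) * (1 + t ^+ 2).
  rewrite -(real_normK (num_real t)); have a0 := normr_ge0 t; have b0 := normr_ge0 (t - h).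
  move: a0 b0 st; move: `|t| `|t - h| => a b a0 b0 ab.
  apply: (@le_trans _ _ ((1 + a) * ((1 + h) * (1 + a)))).
    by apply: ler_wpM2l; nra.
  have := sqr_ge0 (1 - a); nra.
apply: le_trans h1 _; rewrite -mulrA -[leRHS]mulrA -[leRHS]mulrA; apply: ler_wpM2l => //.
apply: ler_wpM2l; first by rewrite addr_ge0// ltW.
have -> : (1 + c^-1) * (1 + c * t ^+ 2) = 1 + t ^+ 2 + (c * t ^+ 2 + c^-1) by field; rewrite gt_eqF.
by rewrite lerDl addr_ge0// ?invr_ge0 ?(ltW c0)// mulr_ge0 ?sqr_ge0// ltW.
Qed.

(** Uniform in the centre [x]: the sums over nonnegative and over negative integers both telescope,
    and [H] varies by at most 2, which gives the factor 4. *)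
Lemma isum_gauss (c h x : R) : 0 < c -> 0 < h ->
  (isum (fun i => (expR (- c * (x - h * i%:~R) ^+ 2))%:E) <= (4 * gauss_sum_cst c h)%:E)%E.
Proof.
move=> c0 h0; have K0 : 0 <= gauss_sum_cst c h.
  by rewrite !mulr_ge0 ?invr_ge0 ?addr_ge0 ?invr_ge0// ltW.
pose H (t : R) := t / (1 + `|t|).
have H1 t : `|H t| <= 1.
  rewrite normrM normfV (ger0_norm (addr_ge0 ler01 (normr_ge0 t))) ler_pdivrMr ?ltr_pwDl//.
  by rewrite mul1r lerDr.
have bound s t : H s - H t <= 2.
  by have := H1 s; have := H1 t; rewrite !ler_norml => /andP[? ?] /andP[? ?]; lra.
apply: lime_le; first by apply: is_cvg_nneseries => n _ _; rewrite adde_ge0// lee_fin expR_ge0.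
apply: nearW => N; rewrite big_mkord.
under eq_bigr do rewrite -EFinD.
rewrite sumEFin lee_fin big_split /=.
have p1 : \sum_(n < N) expR (- c * (x - h * (Posz n)%:~R) ^+ 2) <= gauss_sum_cst c h * 2.
  apply: (@le_trans _ _ (\sum_(n < N) gauss_sum_cst c h * (H (x - h * n%:R) - H (x - h * n.+1%:R)))).
    apply: ler_sum => n _; apply: le_trans (gauss_le_diff _ c0 h0) _.
    have -> : x - h * n.+1%:R = x - h * n%:R - h by rewrite -natr1 mulrDr mulr1 opprD addrA.
    by [].
  rewrite -mulr_sumr; apply: ler_wpM2l => //.
  have -> : \sum_(n < N) (H (x - h * n%:R) - H (x - h * n.+1%:R)) = H x - H (x - h * N%:R).
    rewrite -(big_mkord xpredT (fun n => H (x - h * n%:R) - H (x - h * n.+1%:R))).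
    under eq_bigr do rewrite -opprB.
    by rewrite sumrN (telescope_sumr (fun n => H (x - h * n%:R)))// opprB mulr0 subr0.
  exact: bound.
have p2 : \sum_(n < N) expR (- c * (x - h * (Negz n)%:~R) ^+ 2) <= gauss_sum_cst c h * 2.
  apply: (@le_trans _ _ (\sum_(n < N) gauss_sum_cst c h * (H (x + h * n.+1%:R) - H (x + h * n%:R)))).
    apply: ler_sum => n _; rewrite NegzE mulrNz mulrN opprK.
    apply: le_trans (gauss_le_diff _ c0 h0) _.
    have -> : x + h * n.+1%:R - h = x + h * n%:R by rewrite -natr1 mulrDr mulr1 addrA addrK.
    by [].
  rewrite -mulr_sumr; apply: ler_wpM2l => //.
  rewrite -(big_mkord xpredT (fun n => H (x + h * n.+1%:R) - H (x + h * n%:R))).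
  by rewrite (telescope_sumr (fun n => H (x + h * n%:R))).
by have := lerD p1 p2; lra.
Qed.

End IntegerSums.

(** * Fock norms *)

Section PowerReal.
Variable R : realType.

Lemma powR_root (p x : R) : 0 < p -> 0 <= x -> (x `^ p) `^ p^-1 = x.
Proof. by move=> p0 x0; rewrite -powRrM divff ?gt_eqF// powRr1. Qed.

Lemma root_powR (p x : R) : 0 < p -> 0 <= x -> (x `^ p^-1) `^ p = x.
Proof. by move=> p0 x0; rewrite -powRrM mulVf ?gt_eqF// powRr1. Qed.

Lemma le_powR (p x y : R) : 0 <= p -> 0 <= x -> x <= y -> x `^ p <= y `^ p.
Proof. by move=> p0 x0 xy; apply: ge0_ler_powR; rewrite ?nnegrE// (le_trans x0). Qed.

Lemma powR_expR (x p : R) : expR x `^ p = expR (x * p).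
Proof. by rewrite expRM. Qed.

Lemma powR_le_root (p x y : R) : 0 < p -> 0 <= x -> x `^ p <= y -> x <= y `^ p^-1.
Proof.
move=> p0 x0 xy; rewrite -(powR_root p0 x0); apply: le_powR => //; first by rewrite invr_ge0 ltW.
exact: powR_ge0.
Qed.

Lemma sqr_addr1_le (x : R) : (1 + x) ^+ 2 <= 2 * x ^+ 2 + 2.
Proof. by have := sqr_ge0 (1 - x); nra. Qed.

Lemma gauss_exponent_le (t x y : R) : 0 < t -> x <= 2 * y + 2 ->
  - (t / 4) * y <= - (t / 8) * x + t / 4.
Proof. by move=> *; nra. Qed.

End PowerReal.

Section FockDensity.
Variable R : realType.
Local Notation quat := (quat R).
Variable I : quat.
Hypothesis unitI : imag_unit I.
Local Notation S := (slice_pt I).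
Implicit Types (a : nat -> quat) (f psi : quat -> quat) (u v w : R * R).

Local Opaque pser kcoef gkernel.

(* Maximizing [(1 - |v - u|) ^+ N * |g v|] over the unit disc gives a point around which [g] does
   not oscillate; this sub-mean-value argument works for every exponent [p > 0]. *)
Lemma holo_box_lower (g : R * R -> quat) u N : holo I g -> (0 < N)%N ->
  exists v0 (s : R), [/\ 0 < s, s <= 1 &
    forall v, `|v.1 - v0.1| <= s -> `|v.2 - v0.2| <= s ->
      `|S (v - u)| <= 1 /\ `|g u| <= 4 * (64 * 2 ^+ N) ^+ N * s ^+ N * `|g v|].
Proof.
move=> hg N0.
have box_le v v0 (s : R) : `|v.1 - v0.1| <= s -> `|v.2 - v0.2| <= s -> `|S (v - v0)| <= 2 * s.
  by move=> h1 h2; apply: le_trans (norm_slice_pt_le unitI _) _ => /=; lra.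
have [gu0|gu0] := eqVneq (g u) 0.
  exists u, 2^-1; split => // [|v h1 h2]; first by rewrite invf_le1 ?ler1n.
  split; first by apply: le_trans (box_le _ _ _ h1 h2) _; rewrite divff.
  by rewrite gu0 normr0 !mulr_ge0// exprn_ge0// ?mulr_ge0// ?exprn_ge0// invr_ge0.
pose wt v := (1 - `|S (v - u)|) ^+ N * `|g v|.
pose E := [set wt v | v in [set v | `|S (v - u)| <= 1]].
have [B B0 hB] := bounded_on_disc unitI (holo_continuous (holo_translate u hg)) (@ler01 R).
have wt_ge0 v : `|S (v - u)| <= 1 -> 0 <= wt v by move=> h; rewrite mulr_ge0// exprn_ge0// subr_ge0.
have supE : has_sup E.
  split; first by exists (wt u), u => //=; rewrite subrr slice_pt0 normr0.
  exists B => _ [v /= vu <-].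
  have h1 : (1 - `|S (v - u)|) ^+ N <= 1 by rewrite exprn_ile1 ?subr_ge0 ?gerBl.
  apply: le_trans (ler_pM _ (normr_ge0 _) h1 (lexx _)) _; first by rewrite exprn_ge0// subr_ge0.
  by rewrite mul1r; have := hB _ vu; rewrite /= subrK.
set M := sup E.
have leM v : `|S (v - u)| <= 1 -> wt v <= M.
  by move=> h; apply: ub_le_sup; [exact: (proj2 supE)|exists v].
have M0 : 0 < M.
  apply: lt_le_trans (leM u _); rewrite /wt subrr slice_pt0 normr0 ?subr0 ?expr1n ?mul1r ?normr_gt0//.
have [_ [v0 /= v0u <-] hv0] : exists2 x, E x & M / 2 < x.
  have [x Ex hx] := sup_adherent (divr_gt0 M0 (ltr0n R 2)) supE.
  by exists x => //; move: hx; rewrite -/M; lra.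
set d := 1 - `|S (v0 - u)| in hv0.
have d_ge0 : 0 <= d by rewrite subr_ge0.
have d1 : d <= 1 by rewrite gerBl.
have d0 : 0 < d.
  rewrite lt_neqAle d_ge0 andbT eq_sym; apply/eqP => d0; move: hv0.
  by rewrite /wt -/d d0 expr0n gtn_eqF// mul0r; lra.
have hv0' : M < 2 * (d ^+ N * `|g v0|) by move: hv0; rewrite /wt -/d; lra.
have disc v : `|S (v - v0)| <= d / 2 -> d / 2 <= 1 - `|S (v - u)|.
  move=> h; have -> : v - u = (v - v0) + (v0 - u) by rewrite addrA subrK.
  by rewrite slice_ptD; have := ler_normD (S (v - v0)) (S (v0 - u)); move: h; rewrite /d; lra.
(* [v0] maximizes the weighted function up to a factor 2, and within d/2 of it the weight drops by
   at most $2^N$. *)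
have bnd v : `|S (v - v0)| <= d / 2 -> `|g v| <= 2 * 2 ^+ N * `|g v0|.
  move=> h; have hd := disc _ h.
  have vu : `|S (v - u)| <= 1 by move: hd d0; lra.
  have h2 : (d / 2) ^+ N * `|g v| <= 2 * (d ^+ N * `|g v0|).
    apply: le_trans (ltW hv0'); apply: le_trans (leM _ vu); apply: ler_wpM2r => //.
    by rewrite lerXn2r ?nnegrE//; lra.
  have dN : 0 < d ^+ N by rewrite exprn_gt0.
  have tN : 0 < 2 ^+ N :> R by rewrite exprn_gt0.
  rewrite -(ler_pM2l (exprn_gt0 N (divr_gt0 d0 (ltr0n R 2)))); apply: le_trans h2 _.
  rewrite exprMn exprVn le_eqVlt; apply/orP; left; apply/eqP; field.
  by rewrite gt_eqF.
pose s := d / (64 * 2 ^+ N).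
have K0 : 0 < 64 * 2 ^+ N :> R by rewrite mulr_gt0// exprn_gt0.
have two1 : 1 <= 2 ^+ N :> R by rewrite exprn_ege1// ler1n.
have s0 : 0 < s by rewrite divr_gt0.
have s64 : s * (64 * 2 ^+ N) = d by rewrite mulfVK// gt_eqF.
have sd : 64 * s <= d by rewrite -s64; move: two1 s0; move: (2 ^+ N) => x; nra.
exists v0, s; split => //; first by move: sd d1 s0; lra.
move=> v h1 h2; have vs := box_le _ _ _ h1 h2.
have vd : `|S (v - v0)| <= d / 2 by apply: le_trans vs _; lra.
have vd4 : `|S (v - v0)| <= d / 2 / 2 by apply: le_trans vs _; lra.
split; first by have := disc _ vd; lra.
have lip := holo_lipschitz unitI hg (divr_gt0 d0 (ltr0n _ 2)) bnd vd4.
have half : `|g v - g v0| <= `|g v0| / 2.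
  apply: le_trans lip _.
  have x0 : 0 <= `|g v0| by [].
  apply: (@le_trans _ _ (4 * (2 * 2 ^+ N * `|g v0|) * (2 * s / (d / 2)))).
    apply: ler_wpM2l; first by rewrite !mulr_ge0// exprn_ge0.
    by apply: ler_wpM2r => //; rewrite invr_ge0 divr_ge0.
  rewrite /s le_eqVlt; apply/orP; left; apply/eqP; field.
  by rewrite !gt_eqF ?exprn_gt0.
have gv : `|g v0| <= 2 * `|g v|.
  have : `|g v0| - `|g v| <= `|g v - g v0| by rewrite distrC; exact: lerB_dist.
  by lra.
have guM : `|g u| <= M by have := leM u; rewrite /wt subrr slice_pt0 normr0 subr0 expr1n mul1r; exact.
apply: le_trans guM _; apply: le_trans (ltW hv0') _.
rewrite -s64 exprMn.
have sN : 0 <= s ^+ N * (64 * 2 ^+ N) ^+ N by rewrite mulr_ge0// exprn_ge0// ltW.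
apply: (@le_trans _ _ (2 * (s ^+ N * (64 * 2 ^+ N) ^+ N * (2 * `|g v|)))).
  by apply: ler_wpM2l => //; apply: ler_wpM2l.
by rewrite le_eqVlt; apply/orP; left; apply/eqP; ring.
Qed.

Definition fock_dens (alpha p : R) f (z : quat) : R :=
  `|f z| `^ p * expR (- (alpha * p / 2) * `|z| ^+ 2).

Lemma fock_dens_ge0 alpha p f z : 0 <= fock_dens alpha p f z.
Proof. by rewrite mulr_ge0 ?powR_ge0 ?expR_ge0. Qed.

Lemma fock_densE alpha p f z :
  fock_dens alpha p f z = (`|f z| * expR (- (alpha / 2) * `|z| ^+ 2)) `^ p.
Proof.
by rewrite powRM ?expR_ge0// powR_expR; congr (_ * expR _); ring.
Qed.

Lemma continuous_slice_pt : continuous S.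
Proof. exact: continuous_slice_linear. Qed.

Lemma measurable_norm_slice (f : quat -> quat) : continuous f ->
  measurable_fun [set: R * R] (fun v => `|f (S v)|).
Proof.
move=> cf; apply: continuous_measurable_plane => v.
apply: continuous_comp; last exact: norm_continuous.
by apply: continuous_comp; [exact: continuous_slice_pt|exact: cf].
Qed.

Lemma measurable_fock_dens alpha p f : slice_regular f ->
  measurable_fun [set: R * R] (fock_dens alpha p f \o S).
Proof.
move=> hf; apply: measurable_funM.
  apply: (measurableT_comp (measurable_powR p)).
  by apply: measurable_norm_slice; exact: slice_regular_continuous.
apply: measurableT_comp; first exact: measurable_expR.
apply: measurable_funM => //; apply: measurable_funX.
by apply: (@measurable_norm_slice id) => x; exact: cvg_id.
Qed.

Lemma sqr_norm_sliceB u w : `|S (u - w)| ^+ 2 = (u.1 - w.1) ^+ 2 + (u.2 - w.2) ^+ 2.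
Proof. by rewrite sqr_norm_slice_pt. Qed.

(** N exceeds 2/p, hence $(s^N)^p\le s^2$: the unknown side s of the box is absorbed by the area of
    the box. The exponent $\frac34\alpha p$ is $\frac12\alpha p$ for the change of weight plus
    $\frac14\alpha p$ for the change of Gaussian. *)
Definition submean_cst (alpha p : R) : R :=
  let N := (Num.truncn (2 / p)).+1 in
  (4 * (64 * 2 ^+ N) ^+ N) `^ p * expR (3 * (alpha * p) / 4).

Lemma submean_cst_gt0 alpha p : 0 < submean_cst alpha p.
Proof.
by rewrite mulr_gt0 ?expR_gt0// powR_gt0// mulr_gt0// exprn_gt0// mulr_gt0// exprn_gt0.
Qed.

(** [f] is multiplied by a holomorphic exponential such that
    $|g(v)|=|f(v)|e^{-\alpha|v|^2/2}e^{\alpha|v-u|^2/2}$: at [u] this is the weighted modulus, and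
    on the unit disc about [u] the last factor is bounded. The box lower bound for g is then
    integrated. *)
Lemma fock_submean alpha p f u w : 0 < alpha -> 0 < p -> slice_regular f ->
  ((fock_dens alpha p f (S u) * gauss (alpha * p / 4) w u)%:E <=
   (submean_cst alpha p)%:E *
     pint (fun v => fock_dens alpha p f (S v) * gauss (alpha * p / 8) w v)%R)%E.
Proof.
move=> alpha0 p0 hf; have [ea fE] := slice_regular_coef hf; set a := ps_coef f in ea fE.
have uI : slice I (S u) by exists u.
pose ki := gkernel (expR (alpha / 2 * `|S u| ^+ 2)) (- alpha) (S u).
have eki : entire ki by exact: entire_gkernel.
have kI n : slice I (ki n) by exact: slice_gkernel.
have ep : entire (cprod ki a) by exact: entire_conv.
pose g := pser (cprod ki a) \o S.
have gE v : `|g v| = `|f (S v)| * expR (- (alpha / 2) * `|S v| ^+ 2) * expR (alpha / 2 * `|S (v - u)| ^+ 2).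
  have vI : slice I (S v) by exists v.
  rewrite /g /= (pser_cprod_slice unitI kI vI eki ea) -fE qnormM mulrC -mulrA -expRD; congr (_ * _).
  rewrite /ki (pser_gkernel unitI _ _ uI vI) normrZ norm_qexp ger0_norm ?expR_ge0// qreZ -expRD.
  by congr expR; rewrite slice_ptB sqr_normB; field.
set N := (Num.truncn (2 / p)).+1.
have [v0 [s [s0 s1 hbox]]] := holo_box_lower u (holo_pser unitI ep) (ltn0Sn (Num.truncn (2 / p))).
rewrite -/N in hbox; set K : R := 4 * (64 * 2 ^+ N) ^+ N in hbox.
have K0 : 0 < K by rewrite mulr_gt0// exprn_gt0// mulr_gt0// exprn_gt0.
have Np : 2 <= N%:R * p.
  rewrite -ler_pdivrMr//; have /andP[_] := truncn_itv (divr_ge0 (ler0n R 2) (ltW p0)).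
  by move/ltW.
have sNp : (s ^+ N) `^ p <= s ^+ 2.
  rewrite -(powR_mulrn N (ltW s0)) -powRrM.
  by rewrite -(powR_mulrn 2 (ltW s0)); apply: ger_powR => //; rewrite s0.
pose C := submean_cst alpha p; have C0 : 0 < C by exact: submean_cst_gt0.
set T := fock_dens alpha p f (S u) * gauss (alpha * p / 4) w u.
have T0 : 0 <= T by rewrite mulr_ge0 ?fock_dens_ge0 ?gauss_ge0.
pose h v := fock_dens alpha p f (S v) * gauss (alpha * p / 8) w v.
have key v : `|v.1 - v0.1| <= s -> `|v.2 - v0.2| <= s -> T / (C * s ^+ 2) <= h v.
  move=> h1 h2; have [vu gv] := hbox v h1 h2.
  rewrite ler_pdivrMr; last by apply: mulr_gt0 => //; exact: exprn_gt0.
  have vu2 : `|S (v - u)| ^+ 2 <= 1 by rewrite exprn_ile1.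
  have e1 : fock_dens alpha p f (S u) <= K `^ p * s ^+ 2 * (fock_dens alpha p f (S v) * expR (alpha * p / 2)).
    have -> : fock_dens alpha p f (S u) = `|g u| `^ p.
      by rewrite fock_densE gE subrr slice_pt0 normr0 expr0n mulr0 expR0 mulr1.
    apply: le_trans (le_powR (ltW p0) (normr_ge0 _) gv) _.
    have s0' := ltW s0; have K0' := ltW K0.
    rewrite powRM ?mulr_ge0 ?exprn_ge0// powRM ?exprn_ge0//.
    rewrite -[leLHS]mulrA -[leRHS]mulrA; apply: ler_wpM2l; first exact: powR_ge0.
    apply: ler_pM => //; rewrite ?powR_ge0//.
    have gEv := gE v; rewrite /g in gEv.
    rewrite gEv powRM ?mulr_ge0 ?expR_ge0// -fock_densE; apply: ler_wpM2l; first exact: fock_dens_ge0.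
    rewrite powR_expR ler_expR.
    have -> : alpha / 2 * `|S (v - u)| ^+ 2 * p = alpha * p / 2 * `|S (v - u)| ^+ 2 by ring.
    apply: ler_piMr => //.
    by rewrite divr_ge0// mulr_ge0// ltW.
  (* Halving the exponent pays for moving from [u] to [v], since $|v-w|^2\le2|u-w|^2+2$ when |v - u|
     <= 1. *)
  have e2 : gauss (alpha * p / 4) w u <= gauss (alpha * p / 8) w v * expR (alpha * p / 4).
    rewrite /gauss -!sqr_norm_sliceB -expRD ler_expR.
    have tri : `|S (v - w)| ^+ 2 <= 2 * `|S (u - w)| ^+ 2 + 2.
      have le1 : `|S (v - w)| <= 1 + `|S (u - w)|.
        have -> : v - w = (v - u) + (u - w) by rewrite addrA subrK.
        by rewrite slice_ptD; apply: le_trans (ler_normD _ _) _; rewrite lerD2r.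
      have le2 : `|S (v - w)| ^+ 2 <= (1 + `|S (u - w)|) ^+ 2 by rewrite lerXn2r ?nnegrE ?addr_ge0.
      by apply: le_trans le2 _; exact: sqr_addr1_le.
    have ap : 0 < alpha * p by exact: mulr_gt0.
    exact: gauss_exponent_le.
  apply: le_trans (ler_pM (fock_dens_ge0 _ _ _ _) (gauss_ge0 _ _ _) e1 e2) _.
  rewrite le_eqVlt; apply/orP; left; apply/eqP.
  have -> : C = K `^ p * (expR (alpha * p / 2) * expR (alpha * p / 4)).
    by rewrite /C /submean_cst -expRD; congr (_ * expR _); field.
  by rewrite /h; ring.
have mh : measurable_fun [set: R * R] h.
  by apply: measurable_funM; [exact: measurable_fock_dens|exact: measurable_gauss].
have h0 v : 0 <= h v by rewrite mulr_ge0 ?fock_dens_ge0 ?gauss_ge0.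
have T1 : 0 <= T / (C * s ^+ 2) by rewrite divr_ge0// mulr_ge0 ?exprn_ge0 ?ltW.
have := pint_box mh h0 s0 T1 key.
have -> : T / (C * s ^+ 2) * (4 * s ^+ 2) = 4 * (T / C) by field; rewrite !gt_eqF.
move=> hp; apply: (@le_trans _ _ (C%:E * (4 * (T / C))%:E)%E); last first.
  apply: lee_pmul => //; rewrite lee_fin; first exact: ltW.
  by apply: mulr_ge0 => //; apply: divr_ge0 => //; exact: ltW.
rewrite -EFinM lee_fin; have -> : C * (4 * (T / C)) = 4 * T by field; rewrite gt_eqF.
by rewrite ler_peMl// ler1n.
Qed.

End FockDensity.

Section PlaneSeries.
Variable R : realType.

Local Notation mu2 := ((@lebesgue_measure R) \x (@lebesgue_measure R))%E.

Definition eint (h : R * R -> \bar R) : \bar R := (\int[mu2]_(z in [set: R * R]) h z)%E.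

Lemma pint_eint (h : R * R -> R) : pint h = eint (fun z => (h z)%:E). Proof. by []. Qed.

Lemma eint_ge0 (h : R * R -> \bar R) : (forall z, (0 <= h z)%E) -> (0 <= eint h)%E.
Proof. by move=> h0; apply: integral_ge0. Qed.

Lemma le_eint (g h : R * R -> \bar R) : measurable_fun [set: R * R] g -> measurable_fun [set: R * R] h ->
  (forall z, (0 <= g z)%E) -> (forall z, (g z <= h z)%E) -> (eint g <= eint h)%E.
Proof. by move=> mg mh g0 gh; apply: ge0_le_integral. Qed.

Lemma eintZ (c : R) (h : R * R -> \bar R) : measurable_fun [set: R * R] h ->
  (forall z, (0 <= h z)%E) -> 0 <= c -> eint (fun z => c%:E * h z)%E = (c%:E * eint h)%E.
Proof. by move=> mh h0 c0; rewrite /eint ge0_integralZl. Qed.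

Lemma isum_eint (F : int -> R * R -> \bar R) :
  (forall i, measurable_fun [set: R * R] (F i)) -> (forall i v, (0 <= F i v)%E) ->
  isum (fun i => eint (F i)) = eint (fun v => isum (fun i => F i v)).
Proof. by move=> mF F0; rewrite /eint isum_integral. Qed.

End PlaneSeries.

(** * The integral estimate by Berezin integrals at lattice points *)

Section Sufficiency.
Variable R : realType.
Local Notation quat := (quat R).
Variable I : quat.
Hypothesis unitI : imag_unit I.
Local Notation S := (slice_pt I).
Implicit Types (a : nat -> quat) (f psi : quat -> quat) (u v w : R * R).

Local Opaque pser kcoef gkernel slice_comp.

Definition plattice (rho : R) (i j : int) : R * R := (rho * (2 * i%:~R + 1), rho * (2 * j%:~R)).

(** By Tonelli the sum goes under the integral, where the Gaussian splits into two one-dimensional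
    Gaussian sums with bounds uniform in v. *)
Lemma isum_gaussM (h : R * R -> R) (c rho : R) : 0 < c -> 0 < rho ->
  measurable_fun [set: R * R] h -> (forall v, 0 <= h v) ->
  (isum (fun i => isum (fun j => pint (fun v => h v * gauss c (plattice rho i j) v)%R)) <=
   ((4 * gauss_sum_cst c (2 * rho)) ^+ 2)%:E * pint h)%E.
Proof.
move=> c0 rho0 mh h0; have h20 : 0 < 2 * rho by exact: mulr_gt0.
set K : R := 4 * gauss_sum_cst c (2 * rho).
have K0 : 0 <= K.
  have cV : 0 <= c^-1 by rewrite invr_ge0 ltW.
  have rV : 0 <= (2 * rho)^-1 by rewrite invr_ge0 ltW.
  by rewrite /K /gauss_sum_cst !mulr_ge0 ?addr_ge0 ?(ltW h20).
have SG x : (isum (fun j => (expR (- c * (x - 2 * rho * j%:~R) ^+ 2))%:E) <= K%:E)%E.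
  exact: isum_gauss.
clearbody K.
pose F i j v := (h v * gauss c (plattice rho i j) v)%:E.
have F0 i j v : (0 <= F i j v)%E by rewrite lee_fin mulr_ge0 ?gauss_ge0.
have mF i j : measurable_fun [set: R * R] (F i j).
  by apply/measurable_EFinP; apply: measurable_funM => //; exact: measurable_gauss.
have F1 i v : (0 <= isum (fun j => F i j v))%E by exact: isum_ge0.
have mF1 i : measurable_fun [set: R * R] (fun v => isum (fun j => F i j v)) by exact: isum_measurable.
have -> : isum (fun i => isum (fun j => pint (fun v => h v * gauss c (plattice rho i j) v)%R)) =
    eint (fun v => isum (fun i => isum (fun j => F i j v))).
  rewrite -isum_eint//; congr isum; apply/funext => i.
  by rewrite -(isum_eint (mF i) (F0 i)).
rewrite -pintZ ?exprn_ge0//; apply: le_eint.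
- exact: isum_measurable.
- by apply/measurable_EFinP; exact: measurable_funM.
- by move=> v; exact: isum_ge0.
move=> v; pose a i := expR (- c * ((v.1 - rho) - 2 * rho * i%:~R) ^+ 2).
pose b j := expR (- c * (v.2 - 2 * rho * j%:~R) ^+ 2).
have E i j : F i j v = ((h v * a i)%:E * (b j)%:E)%E.
  rewrite /F -EFinM; congr EFin; rewrite -mulrA; congr (_ * _); rewrite /a /b -expRD /gauss /plattice /=.
  by congr expR; ring.
have a0 i : 0 <= a i by exact: expR_ge0.
have b0 i : 0 <= b i by exact: expR_ge0.
have sb : (isum (fun j => (b j)%:E) <= K%:E)%E by exact: SG.
have sa : (isum (fun j => (a j)%:E) <= K%:E)%E by exact: SG.
apply: (@le_trans _ _ (isum (fun i => (h v * K)%:E * (a i)%:E)%E)).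
  apply: le_isum => // i; under [X in isum X]eq_fun do rewrite E.
  rewrite isumZ ?mulr_ge0//.
  apply: (@le_trans _ _ ((h v * a i)%:E * K%:E)%E).
    by apply: lee_pmul => //; [rewrite lee_fin mulr_ge0|apply: isum_ge0 => j; rewrite lee_fin].
  by rewrite -!EFinM lee_fin mulrAC.
rewrite isumZ ?mulr_ge0//.
apply: (@le_trans _ _ ((h v * K)%:E * K%:E)%E).
  by apply: lee_pmul => //; [rewrite lee_fin mulr_ge0|apply: isum_ge0 => j; rewrite lee_fin].
by rewrite -EFinM lee_fin expr2 mulrC [h v * _]mulrC mulrA.
Qed.

Definition comp_cst (alpha p q rho : R) :=
  pointwise_cst alpha rho `^ q * submean_cst alpha p `^ (q / p).

Lemma comp_cst_gt0 (alpha p q rho : R) : 0 < alpha -> 0 < rho -> 0 < comp_cst alpha p q rho.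
Proof.
by move=> a0 r0; rewrite mulr_gt0// powR_gt0 ?pointwise_cst_gt0 ?submean_cst_gt0.
Qed.

(** The sub-mean-value estimate allows $S_w=(CG_w)^{1/p}$ in the pointwise bound. The lattice point
    there depends on z in an uncontrolled way, so its term is replaced by the sum over the whole
    lattice before integrating. *)
Lemma comp_integral_le (alpha p q rho N : R) f psi : 0 < alpha -> 0 < p -> p <= q -> 0 < rho ->
  slice_regular f -> slice_regular psi ->
  pint (fock_dens alpha p f \o S) = N%:E ->
  (pint (fock_dens alpha q (slice_comp f psi) \o S) <=
   (comp_cst alpha p q rho * N `^ ((q - p) / p))%:E *
    isum (fun i => isum (fun j =>
      pint (fun v => fock_dens alpha p f (S v) * gauss (alpha * p / 8) (plattice rho i j) v)%R *
      pint (fock_dens alpha q (slice_comp (fock_kernel alpha (S (plattice rho i j))) psi) \o S))))%E.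
Proof.
move=> alpha0 p0 pq rho0 hf hpsi hN; have q0 : 0 < q by exact: lt_le_trans pq.
have mf := measurable_fock_dens I alpha p hf.
have c0 : 0 < alpha * p / 8 by rewrite divr_gt0// mulr_gt0.
pose g i j v := fock_dens alpha p f (S v) * gauss (alpha * p / 8) (plattice rho i j) v.
have mg i j : measurable_fun [set: R * R] (g i j) by apply: measurable_funM => //; exact: measurable_gauss.
have g0 i j v : 0 <= g i j v by rewrite mulr_ge0 ?fock_dens_ge0 ?gauss_ge0.
have gN i j : (pint (g i j) <= N%:E)%E.
  rewrite -hN; apply: le_pint => // v; rewrite /g ler_piMr ?fock_dens_ge0//.
  by rewrite expR_le1 mulNr oppr_le0 mulr_ge0 ?(ltW c0)// addr_ge0 ?sqr_ge0.
pose G i j := fine (pint (g i j)).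
have GE i j : pint (g i j) = (G i j)%:E.
  by rewrite fineK// ge0_fin_numE ?pint_ge0//; apply: le_lt_trans (gN i j) _; rewrite ltry.
have G0 i j : 0 <= G i j by rewrite -lee_fin -GE pint_ge0.
have GN i j : G i j <= N by rewrite -lee_fin -GE.
have N0 : 0 <= N by apply: le_trans (GN 0 0).
pose C := submean_cst alpha p; have C0 : 0 < C by exact: submean_cst_gt0.
pose C1 := pointwise_cst alpha rho; have C10 : 0 < C1 by exact: pointwise_cst_gt0.
pose St (ij : int * int) := (C * G ij.1 ij.2) `^ p^-1.
have St0 ij : 0 <= St ij by exact: powR_ge0.
have hSt ij (u : quat) : slice I u -> `|f u| * expR (- (alpha / 2) * `|u| ^+ 2) *
     expR (- (alpha / 4) * `|u - lattice I rho ij| ^+ 2) <= St ij.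
  move=> [v _ <-]; apply: powR_le_root => //.
  rewrite powRM ?mulr_ge0 ?expR_ge0// -fock_densE powR_expR.
  have -> : - (alpha / 4) * `|S v - lattice I rho ij| ^+ 2 * p =
      - (alpha * p / 4) * ((v.1 - (plattice rho ij.1 ij.2).1) ^+ 2 + (v.2 - (plattice rho ij.1 ij.2).2) ^+ 2).
    by rewrite -(sqr_norm_sliceB unitI) slice_ptB; change (S (plattice rho ij.1 ij.2)) with (lattice I rho ij); ring.
  have := fock_submean unitI v (plattice rho ij.1 ij.2) alpha0 p0 hf.
  by rewrite (GE ij.1 ij.2) -EFinM lee_fin.
pose F := slice_comp f psi; have hF : slice_regular F by exact: slice_regular_comp.
pose Kf i j := slice_comp (fock_kernel alpha (S (plattice rho i j))) psi.
have hK i j : slice_regular (Kf i j) by apply: slice_regular_comp => //; exact: slice_regular_kernel.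
set A := comp_cst alpha p q rho * N `^ ((q - p) / p).
have A0 : 0 <= A by rewrite mulr_ge0 ?powR_ge0// ltW// comp_cst_gt0.
(* The step that needs p <= q: the power splits as 1 + (q - p)/p, and [G i j] <= [N] bounds the
   second factor. The sum over the lattice becomes linear in G. *)
have Gq i j : G i j `^ (q / p) <= G i j * N `^ ((q - p) / p).
  have [->|n0] := eqVneq (G i j) 0.
    by rewrite powR0 ?mul0r// gt_eqF// divr_gt0.
  have -> : q / p = 1 + (q - p) / p by field; rewrite gt_eqF.
  rewrite powRD ?n0 ?implybT// powRr1//; apply: ler_wpM2l => //; apply: le_powR => //.
  by rewrite divr_ge0 ?subr_ge0// ltW.
have point v : exists i j, fock_dens alpha q F (S v) <= A * (G i j * fock_dens alpha q (Kf i j) (S v)).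
  have [[i j] hij] := comp_pointwise unitI alpha0 rho0 hf hpsi (ex_intro2 _ _ v Logic.I erefl) hSt.
  exists i, j; rewrite /fock_dens.
  have := le_powR (ltW q0) (normr_ge0 _) hij.
  rewrite (powRM _ (ltW C10) (mulr_ge0 (St0 _) (normr_ge0 _))) (powRM _ (St0 _) (normr_ge0 _)) => h.
  have e0 : 0 <= expR (- (alpha * q / 2) * `|S v| ^+ 2) by exact: expR_ge0.
  apply: le_trans (ler_wpM2r e0 h) _; rewrite !mulrA; apply: ler_wpM2r => //; apply: ler_wpM2r.
    exact: powR_ge0.
  rewrite /St /= -powRrM [p^-1 * q]mulrC (powRM _ (ltW C0) (G0 _ _)) /A /comp_cst.
  rewrite -!mulrA; apply: ler_wpM2l; first exact: powR_ge0.
  by apply: ler_wpM2l; [exact: powR_ge0|rewrite [leRHS]mulrC; exact: Gq].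
have mK i j := measurable_fock_dens I alpha q (hK i j).
pose T i j v := (G i j * fock_dens alpha q (Kf i j) (S v))%:E.
have T0 i j v : (0 <= T i j v)%E by rewrite lee_fin mulr_ge0 ?fock_dens_ge0.
have mT i j : measurable_fun [set: R * R] (T i j) by apply/measurable_EFinP; apply: measurable_funM => //; exact: mK.
have T1 v : (0 <= isum (fun i => isum (fun j => T i j v)))%E by apply: isum_ge0 => i; exact: isum_ge0.
have mT2 : measurable_fun [set: R * R] (fun v => isum (fun i => isum (fun j => T i j v))).
  by apply: isum_measurable => [i|i v]; [exact: isum_measurable|exact: isum_ge0].
have mT1 i : measurable_fun [set: R * R] (fun v => isum (fun j => T i j v)).
  by apply: isum_measurable; [exact: mT|exact: T0].
have T2 i v : (0 <= isum (fun j => T i j v))%E by apply: isum_ge0 => j; exact: T0.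
apply: (@le_trans _ _ (eint (fun v => A%:E * isum (fun i => isum (fun j => T i j v)))%E)).
  rewrite pint_eint; apply: le_eint.
  - by apply/measurable_EFinP; exact: measurable_fock_dens.
  - exact: measurable_funeM.
  - by move=> v; rewrite lee_fin fock_dens_ge0.
  move=> v; have [i [j hij]] := point v.
  apply: (@le_trans _ _ (A%:E * T i j v)%E); first by rewrite /T -EFinM lee_fin.
  apply: lee_pmul => //.
  apply: le_trans (isum_term i (fun i => isum_ge0 (fun j => T0 i j v))).
  exact: (isum_term j).
rewrite eintZ//; apply: lee_pmul => //; first exact: eint_ge0.
rewrite -(isum_eint mT1 T2).
apply: le_isum => [i|i]; first by apply: eint_ge0 => v.
rewrite -(isum_eint (mT i) (T0 i)); apply: le_isum => [j|j]; first by apply: eint_ge0 => v.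
rewrite (GE i j) -pintZ//; [exact: mK|by move=> v; exact: fock_dens_ge0].
Qed.

End Sufficiency.

(** * Comparison of the norms on different slices *)

Section SliceChange.
Variable R : realType.
Local Notation quat := (quat R).
Implicit Types (a : nat -> quat) (f psi : quat -> quat) (u v w : R * R) (I J : quat).

Lemma slice_pt_pow_coord v n : exists w, forall I, imag_unit I -> slice_pt I v ^+ n = slice_pt I w.
Proof.
elim: n => [|n [w IH]]; first by exists (1, 0) => I _; rewrite expr0 slice_pt_re scale1r.
exists (v.1 * w.1 - v.2 * w.2, v.1 * w.2 + v.2 * w.1) => I unitI.
by rewrite exprS IH// slice_ptM.
Qed.

Definition pconj v : R * R := (v.1, - v.2).

Lemma slice_pt_pconj I v : imag_unit I -> slice_pt I (pconj v) = qconj (slice_pt I v).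
Proof. by move=> unitI; rewrite slice_pt_conj. Qed.

(* With [J = I] this is trivial; in general it holds because [slice_pt I v ^+ n] has the same
   coordinates in every slice. *)
Lemma slice_representation a v I J : imag_unit I -> imag_unit J -> entire a ->
  pser a (slice_pt I v) =
  2^-1 *: (pser a (slice_pt J v) + pser a (slice_pt J (pconj v))) -
  2^-1 *: (I * J * (pser a (slice_pt J v) - pser a (slice_pt J (pconj v)))).
Proof.
move=> unitI unitJ ea.
have as1 := entire_asum (slice_pt J v) ea; have as2 := entire_asum (slice_pt J (pconj v)) ea.
have asD := asumD as1 as2; have asB : asum (fun n => slice_pt J v ^+ n * a n - slice_pt J (pconj v) ^+ n * a n).
  exact: asumD as1 (asumN as2).
rewrite /pser -qsumD// -qsumB// -qsumMl// -!qsumZ//; last exact: asumMl.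
rewrite -qsumB; [|exact: asumZ|by apply: asumZ; exact: asumMl].
congr qsum; apply/funext => n.
rewrite -mulrDl -mulrBl slice_pt_pconj// -qconjX//.
have [w hw] := slice_pt_pow_coord v n; rewrite !hw// -slice_pt_pconj//.
have -> : slice_pt J w + slice_pt J (pconj w) = (2 * w.1)%:A.
  by rewrite -slice_ptD /slice_pt /= subrr scale0r addr0 mulr2n mulrDl !mul1r.
have -> : slice_pt J w - slice_pt J (pconj w) = (2 * w.2) *: J.
  by rewrite -slice_ptB /slice_pt /= subrr scale0r add0r opprK mulrDl !mul1r.
rewrite mulrA -[I * J * _]mulrA -[J * _]scalerAr -expr2 unitJ -scalerAr mulrN mulr1 scalerN.
rewrite mulNr scalerN opprK -scalerDr -mulrDl scalerAl scalerDr !scalerA !mulrA mulVf ?pnatr_eq0//.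
by rewrite !mul1r.
Qed.

Lemma norm_slice_le f v I J : imag_unit I -> imag_unit J -> slice_regular f ->
  `|f (slice_pt I v)| <= `|f (slice_pt J v)| + `|f (slice_pt J (pconj v))|.
Proof.
move=> unitI unitJ hf; have [ea fE] := slice_regular_coef hf; rewrite !fE.
rewrite (slice_representation v unitI unitJ ea).
move: (pser (ps_coef f) (slice_pt J v)) (pser (ps_coef f) (slice_pt J (pconj v))) => x y.
have e1 : `|2^-1 *: (x + y)| = 2^-1 * `|x + y| by rewrite normrZ ger0_norm.
have e0 : `|I * J * (x - y)| = `|x - y|.
  by rewrite !qnormM (imag_unit_norm unitI) (imag_unit_norm unitJ) !mul1r.
have e2 : `|2^-1 *: (I * J * (x - y))| = 2^-1 * `|x - y| by rewrite normrZ e0 ger0_norm.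
apply: le_trans (ler_normB _ _) _; rewrite e1 e2.
have := ler_normD x y; have := ler_normB x y; lra.
Qed.

(** The sum is at most twice the larger term. This crude form is valid for every p > 0, below 1
    included. *)
Lemma powRD_le (x y p : R) : 0 < p -> 0 <= x -> 0 <= y -> (x + y) `^ p <= 2 `^ p * (x `^ p + y `^ p).
Proof.
move=> p0; wlog xy : x y / x <= y => [hw x0 y0|x0 y0].
  by have [xy|/ltW xy] := leP x y; [exact: hw|rewrite addrC [_ `^ p + _]addrC; exact: hw].
apply: (@le_trans _ _ ((2 * y) `^ p)).
  by apply: le_powR; [exact: ltW|exact: addr_ge0|lra].
rewrite powRM//; apply: ler_wpM2l; first exact: powR_ge0.
by rewrite lerDr powR_ge0.
Qed.

Lemma norm_slice_pt_eq v I J : imag_unit I -> imag_unit J -> `|slice_pt I v| = `|slice_pt J v|.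
Proof.
move=> unitI unitJ; apply/eqP; rewrite -(@eqrXn2 _ 2)//; apply/eqP.
by rewrite !sqr_norm_slice_pt.
Qed.

Definition slice_cst (p : R) : R := 2 * 2 `^ p.

Lemma slice_cst_gt0 p : 0 < slice_cst p. Proof. by rewrite mulr_gt0// powR_gt0. Qed.

Lemma slice_change (alpha p : R) f I J : imag_unit I -> imag_unit J -> 0 < p -> slice_regular f ->
  (pint (fock_dens alpha p f \o slice_pt I) <=
   (slice_cst p)%:E * pint (fock_dens alpha p f \o slice_pt J))%E.
Proof.
move=> unitI unitJ p0 hf.
have m1 := @measurable_fock_dens R J alpha p f hf.
have mI := @measurable_fock_dens R I alpha p f hf.
have m2 : measurable_fun [set: R * R] ((fock_dens alpha p f \o slice_pt J) \o pconj).
  apply: measurableT_comp => //; apply: measurable_fun_pair; first exact: measurable_fst.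
  by apply: measurableT_comp; [exact: oppr_measurable|exact: measurable_snd].
pose h v := fock_dens alpha p f (slice_pt J v).
have h0 v : 0 <= h v by exact: fock_dens_ge0.
apply: (@le_trans _ _ ((2 `^ p)%:E * (pint h + pint (h \o pconj)))%E).
  apply: le_pintD => //.
  - by move=> v; exact: fock_dens_ge0.
  - by move=> v; exact: h0.
  move=> v; rewrite /h /= /fock_dens.
  have -> : `|slice_pt J (pconj v)| = `|slice_pt J v| by rewrite slice_pt_pconj// qnormC.
  rewrite (norm_slice_pt_eq v unitI unitJ) -mulrDl mulrA; apply: ler_wpM2r; first exact: expR_ge0.
  apply: le_trans (powRD_le p0 (normr_ge0 _) (normr_ge0 _)).
  by apply: le_powR; [exact: ltW|exact: normr_ge0|exact: norm_slice_le].
have -> : pint (h \o pconj) = pint h by exact: pint_reflect m1 h0.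
by rewrite /slice_cst mulrC EFinM -muleA -mule2n mule_natl.
Qed.

(** The weighted modulus of a kernel is a Gaussian centred at [w], so the integral does not depend
    on [w]; kernels are test functions of constant norm. *)
Lemma pint_kernel (alpha p : R) I w : imag_unit I -> 0 < alpha -> 0 < p ->
  pint (fock_dens alpha p (fock_kernel alpha (slice_pt I w)) \o slice_pt I) =
  (2 * pi / (alpha * p))%:E.
Proof.
move=> unitI alpha0 p0.
have ap0 : 0 < alpha * p / 2 by rewrite divr_gt0// mulr_gt0.
have -> : fock_dens alpha p (fock_kernel alpha (slice_pt I w)) \o slice_pt I = gauss (alpha * p / 2) w.
  apply/funext => v /=; rewrite fock_densE fock_kernelE.
  have wI : slice I (slice_pt I w) by exists w.
  have vI : slice I (slice_pt I v) by exists v.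
  rewrite (norm_kcoef unitI alpha wI vI) -!expRD powR_expR.
  by congr expR; rewrite -slice_ptB (sqr_norm_sliceB unitI); ring.
by rewrite pint_gauss//; congr EFin; field; rewrite !gt_eqF.
Qed.

Lemma fock_normpE (alpha p : R) I f :
  fock_normp alpha p I f = ((alpha * p / (2 * pi))%:E * pint (fock_dens alpha p f \o slice_pt I))%E.
Proof. by []. Qed.

Lemma berezinE (alpha q : R) psi I (w : quat) :
  berezin alpha q psi I w = pint (fock_dens alpha q (slice_comp (fock_kernel alpha w) psi) \o slice_pt I).
Proof. by []. Qed.

Lemma norm_cst_gt0 (alpha p : R) : 0 < alpha -> 0 < p -> 0 < alpha * p / (2 * pi).
Proof. by move=> *; rewrite divr_gt0 ?mulr_gt0 ?pi_gt0. Qed.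

Lemma fockE (alpha p : R) I f : 0 < alpha -> 0 < p ->
  fock alpha p I f <-> slice_regular f /\ (pint (fock_dens alpha p f \o slice_pt I) < +oo)%E.
Proof.
move=> a0 p0; have c0 := norm_cst_gt0 a0 p0; split => -[hf h]; split => //.
  move: h; rewrite fock_normpE; case: (pint _) (@pint_ge0 R _ (fun v => fock_dens_ge0 alpha p f (slice_pt I v))) => [r _ _|_|//].
    by rewrite ltry.
  by rewrite gt0_muley// lte_fin.
rewrite fock_normpE; move: h; case: (pint _) => // [r _|_]; first by rewrite -EFinM ltry.
by rewrite gt0_muleNy// ?lte_fin.
Qed.

Lemma fock_slice (alpha p : R) I J f : imag_unit I -> imag_unit J -> 0 < alpha -> 0 < p ->
  fock alpha p J f -> fock alpha p I f.
Proof.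
move=> unitI unitJ a0 p0 hJ; have [hf h] := proj1 (fockE J f a0 p0) hJ.
apply: (proj2 (fockE I f a0 p0)); split; first exact: hf.
apply: le_lt_trans (slice_change alpha unitI unitJ p0 hf) _.
rewrite -ge0_fin_numE in h; last by apply: pint_ge0 => v; exact: fock_dens_ge0.
by rewrite -(fineK h) -EFinM ltry.
Qed.

Lemma poweR_le (x y : \bar R) (r : R) : 0 <= r -> (0 <= x)%E -> (x <= y)%E -> (x `^ r <= y `^ r)%E.
Proof.
move=> r0 x0 xy; apply: gt0_ler_poweR => //; rewrite in_itv /= ?x0 ?leey//.
by rewrite (le_trans x0 xy).
Qed.

Lemma fock_norm_ge0 (alpha p : R) I f : (0 <= fock_norm alpha p I f)%E.
Proof. exact: poweR_ge0. Qed.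

Lemma fock_norm_real (alpha p N : R) I f : 0 < alpha -> 0 < p -> 0 <= N ->
  pint (fock_dens alpha p f \o slice_pt I) = N%:E ->
  fock_norm alpha p I f = ((alpha * p / (2 * pi) * N) `^ p^-1)%:E.
Proof. by move=> a0 p0 N0 h; rewrite /fock_norm fock_normpE h -EFinM poweR_EFin. Qed.

Lemma pint_dens_fin (alpha p : R) I f : (pint (fock_dens alpha p f \o slice_pt I) < +oo)%E ->
  exists2 N : R, 0 <= N & pint (fock_dens alpha p f \o slice_pt I) = N%:E.
Proof.
move=> h; have h0 : (0 <= pint (fock_dens alpha p f \o slice_pt I))%E.
  by apply: pint_ge0 => v; exact: fock_dens_ge0.
rewrite -ge0_fin_numE// in h; exists (fine (pint (fock_dens alpha p f \o slice_pt I))).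
  exact: fine_ge0.
by rewrite fineK.
Qed.

End SliceChange.

(** * Boundedness *)

Section Boundedness.
Variable R : realType.
Local Notation quat := (quat R).
Variables (alpha p q : R) (I J : quat).
Hypotheses (alpha0 : 0 < alpha) (p0 : 0 < p) (pq : p <= q).
Hypotheses (unitI : imag_unit I) (unitJ : imag_unit J).
Implicit Types (f psi : quat -> quat).

Local Opaque pser kcoef gkernel slice_comp.

Let q0 : 0 < q. Proof. exact: lt_le_trans pq. Qed.

Lemma fock_norm_le_const (r : R) (K : quat) f (N : R) : 0 < r -> 0 <= N ->
  (pint (fock_dens alpha r f \o slice_pt K) <= N%:E)%E ->
  (fock_norm alpha r K f <= ((alpha * r / (2 * pi) * N) `^ r^-1)%:E)%E.
Proof.
move=> r0 N0 h; have c0 := norm_cst_gt0 alpha0 r0.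
rewrite /fock_norm fock_normpE -poweR_EFin (EFinM _ N); apply: poweR_le.
- by rewrite invr_ge0 ltW.
- by rewrite mule_ge0 ?lee_fin ?(ltW c0)// pint_ge0// => v; exact: fock_dens_ge0.
- by apply: lee_pmul => //; [rewrite lee_fin ltW|apply: pint_ge0 => v; exact: fock_dens_ge0].
Qed.

Definition kernel_cst (r : R) := slice_cst r `^ r^-1.

Lemma fock_kernel_norm (r : R) w : 0 < r -> slice I w ->
  fock alpha r J (fock_kernel alpha w) /\ (fock_norm alpha r J (fock_kernel alpha w) <= (kernel_cst r)%:E)%E.
Proof.
move=> r0 [v _ <-]; have hk := slice_regular_kernel alpha (slice_pt I v).
have h := slice_change alpha unitJ unitI r0 hk.
rewrite (pint_kernel v unitI alpha0 r0) -EFinM in h.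
have s0 := slice_cst_gt0 r; have pi0 := pi_gt0 R.
have N0 : 0 <= slice_cst r * (2 * pi / (alpha * r)).
  by apply: mulr_ge0; [exact: ltW|rewrite divr_ge0// ?mulr_ge0// ltW].
split.
  apply: (proj2 (fockE J _ alpha0 r0)); split; first exact: hk.
  by apply: le_lt_trans h _; rewrite ltry.
apply: le_trans (fock_norm_le_const r0 N0 h) _.
rewrite lee_fin le_eqVlt; apply/orP; left; apply/eqP; rewrite /kernel_cst; congr (_ `^ _).
have an : alpha != 0 by rewrite gt_eqF.
have rn : r != 0 by rewrite gt_eqF.
have pn : (pi : R) != 0 by rewrite gt_eqF.
move: (pi : R) pn => x xn; field.
by rewrite an rn xn.
Qed.

(** The Berezin integral is unnormalized and taken on the slice of [I], whereas norms are normalized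
    and taken on the slice of [J]: this constant undoes the normalization and changes the slice. *)
Definition berezin_norm_cst (r : R) := (slice_cst r * (2 * pi / (alpha * r))) `^ r^-1.

Lemma berezin_norm_cst_gt0 r : 0 < r -> 0 < berezin_norm_cst r.
Proof. by move=> r0; rewrite powR_gt0// mulr_gt0 ?slice_cst_gt0// divr_gt0 ?mulr_gt0 ?pi_gt0. Qed.

Lemma pint_root_le_norm (r : R) f : 0 < r -> slice_regular f ->
  (pint (fock_dens alpha r f \o slice_pt I) `^ r^-1 <=
   (berezin_norm_cst r)%:E * fock_norm alpha r J f)%E.
Proof.
move=> r0 hf; have pi0 := pi_gt0 R.
have c0 : 0 < slice_cst r * (2 * pi / (alpha * r)).
  by rewrite mulr_gt0 ?slice_cst_gt0// divr_gt0 ?mulr_gt0.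
have n0 K : (0 <= pint (fock_dens alpha r f \o slice_pt K))%E.
  by apply: pint_ge0 => v; exact: fock_dens_ge0.
have nn0 : (0 <= fock_normp alpha r J f)%E.
  by rewrite fock_normpE mule_ge0// lee_fin ltW// norm_cst_gt0.
rewrite /fock_norm -poweR_EFin -poweRM//; last by rewrite lee_fin ltW.
apply: poweR_le => //; first by rewrite invr_ge0 ltW.
apply: le_trans (slice_change alpha unitI unitJ r0 hf) _.
rewrite fock_normpE muleA -EFinM; apply: lee_pmul => //.
- by rewrite lee_fin ltW// slice_cst_gt0.
- have an : alpha != 0 by rewrite gt_eqF.
  have rn : r != 0 by rewrite gt_eqF.
  have pn : (pi : R) != 0 by rewrite gt_eqF.
  rewrite lee_fin le_eqVlt; apply/orP; left; apply/eqP.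
  move: (pi : R) pn => x xn; field.
  by rewrite an rn xn.
Qed.

Lemma op_bound_ge_berezin psi C w : slice_regular psi ->
  op_bound alpha p q J (comp_op psi) C -> slice I w ->
  (berezin alpha q psi I w `^ q^-1 <= (berezin_norm_cst q * kernel_cst p * C)%:E)%E.
Proof.
move=> hpsi [C0 maps hC] wI; have [kf kn] := fock_kernel_norm p0 wI.
have hT : slice_regular (slice_comp (fock_kernel alpha w) psi).
  by apply: slice_regular_comp => //; exact: slice_regular_kernel.
rewrite berezinE; apply: le_trans (pint_root_le_norm q0 hT) _.
rewrite -mulrA EFinM; apply: lee_pmul => //.
- by rewrite lee_fin ltW// berezin_norm_cst_gt0.
- exact: fock_norm_ge0.
apply: le_trans (hC _ kf) _; rewrite mulrC EFinM; apply: lee_pmul => //.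
exact: fock_norm_ge0.
Qed.

Variable rho : R.
Hypothesis rho0 : 0 < rho.

Definition gauss_lattice_cst := (4 * gauss_sum_cst (alpha * p / 8) (2 * rho)) ^+ 2.

Lemma comp_pint_bound psi f (b N : R) : slice_regular psi -> slice_regular f -> 0 <= b ->
  (forall i j, (berezin alpha q psi I (slice_pt I (plattice rho i j)) <= b%:E)%E) ->
  pint (fock_dens alpha p f \o slice_pt I) = N%:E ->
  (pint (fock_dens alpha q (slice_comp f psi) \o slice_pt I) <=
   (comp_cst alpha p q rho * gauss_lattice_cst * b * N `^ (q / p))%:E)%E.
Proof.
move=> hpsi hf b0 hb hN.
have N0 : 0 <= N by rewrite -lee_fin -hN; apply: pint_ge0 => v; exact: fock_dens_ge0.
have c0 : 0 < alpha * p / 8 by rewrite divr_gt0// mulr_gt0.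
have cc0 := comp_cst_gt0 p q alpha0 rho0.
pose g i j v := fock_dens alpha p f (slice_pt I v) * gauss (alpha * p / 8) (plattice rho i j) v.
have g0 i j : (0 <= pint (g i j))%E.
  by apply: pint_ge0 => v; rewrite mulr_ge0 ?fock_dens_ge0 ?gauss_ge0.
have B0 w : (0 <= berezin alpha q psi I w)%E.
  by rewrite berezinE; apply: pint_ge0 => v; exact: fock_dens_ge0.
have h := comp_integral_le unitI alpha0 p0 pq rho0 hf hpsi hN.
have AN : 0 <= comp_cst alpha p q rho * N `^ ((q - p) / p) by rewrite mulr_ge0 ?powR_ge0// ltW.
apply: le_trans h _.
apply: (@le_trans _ _ ((comp_cst alpha p q rho * N `^ ((q - p) / p))%:E *
    (b%:E * (gauss_lattice_cst%:E * N%:E)))%E); last first.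
  rewrite -!EFinM lee_fin le_eqVlt; apply/orP; left; apply/eqP.
  have -> : q / p = (q - p) / p + 1 by field; rewrite gt_eqF.
  have [->|nN] := eqVneq N 0; first by rewrite (@powR0 _ (_ + 1)) ?mulr0 ?gt_eqF// ltr_wpDl// divr_ge0 ?subr_ge0// ltW.
  by rewrite powRD ?nN ?implybT// powRr1//; ring.
apply: lee_pmul => //.
- by apply: isum_ge0 => i; apply: isum_ge0 => j; apply: mule_ge0; [exact: g0|exact: B0].
have hG := isum_gaussM c0 rho0 (@measurable_fock_dens R I alpha p f hf) (fun v => fock_dens_ge0 alpha p f (slice_pt I v)).
rewrite hN in hG.
apply: (@le_trans _ _ (b%:E * isum (fun i => isum (fun j => pint (g i j))))%E); last first.
  by apply: lee_pmul => //; apply: isum_ge0 => i; exact: isum_ge0.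
rewrite -isumZ//; last by move=> i; exact: isum_ge0.
apply: le_isum => [i|i]; first by apply: isum_ge0 => j; apply: mule_ge0; [exact: g0|exact: B0].
rewrite -(isumZ (g0 i) b0); apply: le_isum => [j|j]; first by apply: mule_ge0; [exact: g0|exact: B0].
rewrite muleC; apply: lee_pmul; [exact: B0|exact: g0|exact: hb|exact: lexx].
Qed.

Definition op_cst : R :=
  (alpha * q / (2 * pi) * (slice_cst q * (comp_cst alpha p q rho * gauss_lattice_cst))) `^ q^-1 *
  (slice_cst p * (2 * pi / (alpha * p))) `^ p^-1.

Lemma gauss_lattice_cst_gt0 : 0 < gauss_lattice_cst.
Proof.
have c0 : 0 < alpha * p / 8 by rewrite divr_gt0// mulr_gt0.
by rewrite /gauss_lattice_cst /gauss_sum_cst exprn_gt0// !mulr_gt0 ?invr_gt0 ?addr_gt0 ?invr_gt0 ?mulr_gt0.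
Qed.

Lemma op_cst_gt0 : 0 < op_cst.
Proof.
have pi0 := pi_gt0 R.
apply: mulr_gt0; apply: powR_gt0.
  apply: mulr_gt0; first exact: norm_cst_gt0.
  apply: mulr_gt0; first exact: slice_cst_gt0.
  by apply: mulr_gt0; [exact: comp_cst_gt0|exact: gauss_lattice_cst_gt0].
by apply: mulr_gt0; [exact: slice_cst_gt0|rewrite divr_gt0// mulr_gt0].
Qed.

(** Only Berezin integrals at lattice points are bounded in the hypothesis. The compactness
    criterion supplies exactly this for a suitable mesh, and so yields the mapping property there as
    well. *)
Lemma berezin_op_bound psi (b : R) : slice_regular psi -> 0 <= b ->
  (forall i j, (berezin alpha q psi I (slice_pt I (plattice rho i j)) <= (b `^ q)%:E)%E) ->
  op_bound alpha p q J (comp_op psi) (op_cst * b).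
Proof.
move=> hpsi b0 hb; have pi0 := pi_gt0 R.
have main f : fock alpha p J f -> fock alpha q J (slice_comp f psi) /\
    (fock_norm alpha q J (slice_comp f psi) <= (op_cst * b)%:E * fock_norm alpha p J f)%E.
  move=> fJ; have [hf hJ] := proj1 (fockE J f alpha0 p0) fJ.
  have [_ hI] := proj1 (fockE I f alpha0 p0) (fock_slice unitI unitJ alpha0 p0 fJ).
  have [N N0 hN] := pint_dens_fin hI; have [M M0 hM] := pint_dens_fin hJ.
  have hT : slice_regular (slice_comp f psi) by exact: slice_regular_comp.
  have NM : N <= slice_cst p * M.
    by have := slice_change alpha unitI unitJ p0 hf; rewrite hN hM -EFinM lee_fin.
  have h1 := comp_pint_bound hpsi hf (powR_ge0 b q) hb hN.
  have h2 := slice_change alpha unitJ unitI q0 hT.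
  have G0 := gauss_lattice_cst_gt0; have cc0 := comp_cst_gt0 p q alpha0 rho0.
  have sq0 := slice_cst_gt0 q; have sp0 := slice_cst_gt0 p.
  set B := comp_cst alpha p q rho * gauss_lattice_cst * (b `^ q) * N `^ (q / p) in h1.
  have B0 : 0 <= B.
    apply: mulr_ge0; last exact: powR_ge0.
    apply: mulr_ge0; last exact: powR_ge0.
    by apply: mulr_ge0; exact: ltW.
  have h3 : (pint (fock_dens alpha q (slice_comp f psi) \o slice_pt J) <= (slice_cst q * B)%:E)%E.
    apply: le_trans h2 _; rewrite (EFinM _ B); apply: lee_pmul => //.
    - by rewrite lee_fin ltW.
    - by apply: pint_ge0 => v; exact: fock_dens_ge0.
  split.
    apply: (proj2 (fockE J _ alpha0 q0)); split; first exact: hT.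
    by apply: le_lt_trans h3 _; rewrite ltry.
  apply: le_trans (fock_norm_le_const q0 (mulr_ge0 (ltW sq0) B0) h3) _.
  rewrite (fock_norm_real alpha0 p0 M0 hM) -EFinM lee_fin.
  have kq := norm_cst_gt0 alpha0 q0; have kp := norm_cst_gt0 alpha0 p0.
  have -> : alpha * q / (2 * pi) * (slice_cst q * B) =
     (alpha * q / (2 * pi) * (slice_cst q * (comp_cst alpha p q rho * gauss_lattice_cst))) *
     (b `^ q * N `^ (q / p)) by rewrite /B; ring.
  set X := alpha * q / (2 * pi) * (slice_cst q * _).
  have X0 : 0 <= X.
    apply: mulr_ge0; first exact: ltW.
    by apply: mulr_ge0; [exact: ltW|apply: mulr_ge0; exact: ltW].
  rewrite (powRM _ X0 (mulr_ge0 (powR_ge0 _ _) (powR_ge0 _ _))) (powRM _ (powR_ge0 _ _) (powR_ge0 _ _)).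
  rewrite powR_root// -powRrM.
  have -> : q / p * q^-1 = p^-1 by field; rewrite !gt_eqF.
  have -> : op_cst * b * (alpha * p / (2 * pi) * M) `^ p^-1 =
     X `^ q^-1 * (b * ((slice_cst p * (2 * pi / (alpha * p))) `^ p^-1 * (alpha * p / (2 * pi) * M) `^ p^-1)).
    by rewrite /op_cst -/X; ring.
  apply: ler_wpM2l; first exact: powR_ge0.
  apply: ler_wpM2l => //; rewrite -powRM; last by apply: mulr_ge0 => //; exact: ltW.
    apply: le_powR => //; first by rewrite invr_ge0 ltW.
    apply: le_trans NM _; rewrite le_eqVlt; apply/orP; left; apply/eqP.
    have an : alpha != 0 by rewrite gt_eqF.
    have pn : p != 0 by rewrite gt_eqF.
    have pin : (pi : R) != 0 by rewrite gt_eqF.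
    move: (pi : R) pin => x xn; field; by rewrite an pn xn.
  by apply: mulr_ge0; [exact: ltW|rewrite divr_ge0// mulr_ge0// ltW].
split; first by apply: mulr_ge0 => //; apply: ltW; exact: op_cst_gt0.
- by move=> f /main[].
- by move=> f /main[].
Qed.

End Boundedness.

(** * Compactness *)

Section Diagonal.
Variable R : realType.
Local Notation quat := (quat R).

(** By Tychonoff the sequence has a cluster point in a product of segments. The subsequence is built
    recursively: its N-th index exceeds the previous one and brings the first N coordinates within
    1/(N + 1) of the cluster point. *)
Lemma real_diagonal (v : nat -> nat -> R) (B : nat -> R) : (forall n k, `|v n k| <= B k) ->
  exists phi : nat -> nat, {homo phi : m n / (m < n)%N} /\
    exists l : nat -> R, forall k, (fun n => v (phi n) k) @ \oo --> l k.
Proof.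
move=> vB; pose T := prod_topology (fun _ : nat => R).
have cA : compact [set f : T | forall k, `[- B k, B k]%classic (f k)].
  exact: (@tychonoff nat (fun _ => R) (fun k => `[- B k, B k]%classic) (fun k => @segment_compact _ _ _)).
have [|g [_ gcl]] := cA ((v : nat -> T) @ \oo) _.
  by exists 0%N => // n _ k /=; rewrite in_itv /= -ler_norml.
have step N m : exists n, (m < n)%N /\ forall k, (k < N)%N -> `|g k - v n k| < N.+1%:R^-1.
  have nU : nbhs g [set h : T | forall k : 'I_N, `|g k - h k| < N.+1%:R^-1].
    apply: (@filter_forall _ _ (fun (k : 'I_N) (h : T) => `|g k - h k| < N.+1%:R^-1) (nbhs g)) => k.
    have /(_ (ball (g k) N.+1%:R^-1)) := @proj_continuous nat (fun _ => R) k g.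
    by apply; apply: nbhsx_ballx; rewrite invr_gt0.
  have nF : ((v : nat -> T) @ \oo) (v @` [set n | (m < n)%N]).
    by exists m.+1 => // n /= mn; exists n.
  have [h [[n /= mn <-] hU]] := gcl _ _ nF nU.
  by exists n; split => // k kN; exact: (hU (Ordinal kN)).
have [nx hnx] := choice (fun s : nat * nat => step s.1 s.2).
pose phi := fix phi N := if N is N'.+1 then nx (N, phi N') else nx (0%N, 0%N).
have phiU N k : (k < N)%N -> `|g k - v (phi N) k| < N.+1%:R^-1.
  by case: N => // N kN; have [_] := hnx (N.+1, phi N); exact.
exists phi; split.
  by apply: homo_ltn => [? ? ?|N]; [exact: ltn_trans|have [] := hnx (N.+1, phi N)].
exists g => k; apply/cvgrPdist_le => e e0.
near=> N; apply: ltW; apply: (@lt_trans _ _ N.+1%:R^-1).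
  by apply: phiU; near: N; exact: nbhs_infty_gt.
by near: N; exact: (near_infty_natSinv_lt (PosNum e0)).
Unshelve. all: by end_near.
Qed.

(** The four real components are interleaved, component c of entry k sitting at index 4k + c, so
    that a single real extraction serves all of them. *)
Lemma quat_diagonal (u : nat -> nat -> quat) (B : nat -> R) : (forall n k, `|u n k| <= B k) ->
  exists phi : nat -> nat, {homo phi : m n / (m < n)%N} /\
    exists l : nat -> quat, forall k, (fun n => u (phi n) k) @ \oo --> l k.
Proof.
move=> uB; pose comp (c : nat) (x : quat) : R :=
  if c == 0%N then qre x else if c == 1%N then qi x else if c == 2%N then qj x else qk x.
have [|phi [hphi [l hl]]] := @real_diagonal (fun n m => comp (m %% 4)%N (u n (m %/ 4)%N)) (fun m => B (m %/ 4)%N).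
  move=> n m; apply: le_trans (uB n (m %/ 4)%N); rewrite /comp.
  by case: ifP => _; [exact: ler_qre|case: ifP => _; [exact: ler_qi|case: ifP => _; [exact: ler_qj|exact: ler_qk]]].
exists phi; split => //; exists (fun k => Quat (l (4 * k)%N) (l (4 * k + 1)%N) (l (4 * k + 2)%N) (l (4 * k + 3)%N)) => k.
have hc c : (c < 4)%N -> (fun n => comp c (u (phi n) k)) @ \oo --> l (4 * k + c)%N.
  move=> c4; have := hl (4 * k + c)%N.
  have -> : ((4 * k + c) %/ 4 = k)%N by rewrite mulnC divnMDl// divn_small// addn0.
  by have -> : ((4 * k + c) %% 4 = c)%N by rewrite mulnC modnMDl modn_small.
apply: cvg_quat => /=; [by have := hc 0%N isT; rewrite addn0|exact: (hc 1%N isT)|exact: (hc 2 isT)|exact: (hc 3 isT)].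
Qed.

End Diagonal.

Section LocallyUniform.
Variable R : realType.
Local Notation quat := (quat R).
Implicit Types (a : nat -> quat) (f psi : quat -> quat).

Lemma cvg0P (u : nat -> quat) x : u @ \oo --> x ->
  forall e : R, 0 < e -> exists n0, forall n, (n0 <= n)%N -> `|u n - x| <= e.
Proof.
move=> /cvgrPdist_le h e e0; have [n0 _ hn] := h e e0.
by exists n0 => n nn; rewrite distrC; exact: hn.
Qed.

(** Cauchy bounds at a radius at least twice |x| make the tail geometric with ratio 1/2. *)
Lemma pser_tail_le a x (M r : R) K : 0 < r -> 0 <= M -> 2 * `|x| <= r ->
  (forall n, `|a n| <= M / r ^+ n) -> entire a ->
  `|pser a x| <= \sum_(k < K) `|x| ^+ k * `|a k| + 2 * M * 2^-1 ^+ K.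
Proof.
move=> r0 M0 xr aM ea; rewrite /pser (qsum_split K (entire_asum x ea)).
apply: le_trans (ler_normD _ _) _; apply: lerD.
  by apply: le_trans (ler_norm_sum _ _ _) _; apply: ler_sum => k _; rewrite qnormM qnormX.
have h : 0 <= (2^-1 : R) < 1 by rewrite invr_ge0 ler0n invf_lt1// ltr1n.
apply: (@norm_qsum_le _ _ (fun n => M * 2^-1 ^+ K * 2^-1 ^+ n)) => [n|N].
  rewrite qnormM qnormX; apply: (@le_trans _ _ (`|x| ^+ (n + K) * (M / r ^+ (n + K)))).
    by apply: ler_wpM2l => //; exact: exprn_ge0.
  have xr' : `|x| / r <= 2^-1 by rewrite ler_pdivrMr//; lra.
  have -> : `|x| ^+ (n + K) * (M / r ^+ (n + K)) = M * (`|x| / r) ^+ (n + K).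
    by rewrite exprMn exprVn; ring.
  rewrite -mulrA -exprD addnC; apply: ler_wpM2l => //.
  by rewrite lerXn2r ?nnegrE ?divr_ge0 ?invr_ge0// ltW.
rewrite -mulr_sumr; have := geometric_sum_le h N.
have -> : (1 - 2^-1 : R)^-1 = 2 by field.
move=> hs; have p : 0 <= M * 2^-1 ^+ K by rewrite mulr_ge0// exprn_ge0// invr_ge0.
by apply: le_trans (ler_wpM2l p hs) _; rewrite le_eqVlt; apply/orP; left; apply/eqP; ring.
Qed.

Lemma pser_null_cvg (d : nat -> nat -> quat) (x : quat) (M r : R) : 0 < r -> 0 <= M -> 2 * `|x| <= r ->
  (forall n k, `|d n k| <= M / r ^+ k) -> (forall n, entire (d n)) ->
  (forall k, (fun n => d n k) @ \oo --> (0 : quat)) ->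
  forall e : R, 0 < e -> exists n0, forall n, (n0 <= n)%N -> `|pser (d n) x| <= e.
Proof.
move=> r0 M0 xr dM ed dk e e0.
have [K hK] : exists K, 2 * M * 2^-1 ^+ K <= e / 2.
  have [K hK] : exists K : nat, 4 * M / e <= K%:R.
    by exists (Num.truncn (4 * M / e)).+1; rewrite ltW// truncnS_gt.
  exists K; have K2 := natr_le_exp2 R K; have p2 : 0 < 2 ^+ K :> R by rewrite exprn_gt0.
  rewrite exprVn ler_pdivrMr//; move: hK; rewrite ler_pdivrMr// => hK.
  by have := ler_wpM2l (ltW e0) K2; move: hK; lra.
pose A : R := \sum_(k < K) `|x| ^+ k.
have A0 : 0 <= A by apply: sumr_ge0 => k _; exact: exprn_ge0.
have [n0 hn0] : exists n0, forall n, (n0 <= n)%N -> forall k : 'I_K, `|d n k| <= e / 2 / (A + 1).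
  have e1 : 0 < e / 2 / (A + 1) by rewrite !divr_gt0// ltr_pwDr.
  have [f hf] := choice (fun k => cvg0P (dk k) e1).
  exists (\max_(k < K) f k) => n nn k; have := hf k n; rewrite subr0; apply.
  by apply: leq_trans nn; exact: (leq_bigmax_cond k).
exists n0 => n nn; apply: le_trans (pser_tail_le K r0 M0 xr (dM n) (ed n)) _.
have : \sum_(k < K) `|x| ^+ k * `|d n k| <= A * (e / 2 / (A + 1)).
  rewrite /A mulr_suml; apply: ler_sum => k _; apply: ler_wpM2l; first exact: exprn_ge0.
  exact: hn0.
have : A * (e / 2 / (A + 1)) <= e / 2.
  by rewrite mulrCA ger_pMr ?divr_gt0// ler_pdivrMr ?ltr_pwDr// mul1r lerDl.
by move: hK; lra.
Qed.

End LocallyUniform.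

Section PowerLimit.
Variable R : realType.

(** The formula exp(p ln u) settles positive limits only; at the limit 0 the bound is obtained
    directly from monotonicity and p-th roots. *)
Lemma powR_cvg (p : R) (u : nat -> R) l : 0 < p -> (forall n, 0 <= u n) ->
  u @ \oo --> l -> (fun n => u n `^ p) @ \oo --> l `^ p.
Proof.
move=> p0 u0 ul; have l0 : 0 <= l by apply: (cvgr_to_ge ul); exact: nearW.
have [l_eq0|l_neq0] := eqVneq l 0.
  rewrite l_eq0 powR0 ?gt_eqF//; apply/cvgrPdist_le => e e0.
  have e1 : 0 < e `^ p^-1 by exact: powR_gt0.
  move: ul; rewrite l_eq0 => /cvgrPdist_le/(_ _ e1); apply: filterS => n.
  rewrite !sub0r !normrN ger0_norm// ger0_norm ?powR_ge0// => h.
  by rewrite -(root_powR p0 (ltW e0)); apply: le_powR => //; exact: ltW.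
have lp : 0 < l by rewrite lt_neqAle eq_sym l_neq0.
rewrite /powR (negbTE l_neq0).
have near_pos : \forall n \near \oo, 0 < u n by exact: (cvgr_gt _ ul).
have c : (fun n => expR (p * ln (u n))) @ \oo --> expR (p * ln l).
  apply: continuous_cvg; first exact: continuous_expR.
  apply: cvgMl_tmp; apply: continuous_cvg => //; exact: continuous_ln.
apply: cvg_trans c; apply: near_eq_cvg; near=> n.
by rewrite gt_eqF//; near: n.
Unshelve. all: by end_near.
Qed.

End PowerLimit.

(** * Point evaluations and Montel's theorem *)

Section FockCompact.
Variable R : realType.
Local Notation quat := (quat R).
Variables (alpha p : R) (I : quat).
Hypotheses (alpha0 : 0 < alpha) (p0 : 0 < p) (unitI : imag_unit I).
Local Notation S := (slice_pt I).
Implicit Types (a : nat -> quat) (f psi : quat -> quat).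

Local Opaque pser kcoef gkernel slice_comp.

(** The sub-mean-value estimate with the Gaussian centred at [u] itself: there it equals 1, and
    under the integral it is at most 1. *)
Lemma fock_eval f (N : R) u : slice_regular f -> (pint (fock_dens alpha p f \o S) <= N%:E)%E ->
  fock_dens alpha p f (S u) <= submean_cst alpha p * N.
Proof.
move=> hf hN; have c0 := submean_cst_gt0 alpha p.
have ap : 0 < alpha * p / 8 by rewrite divr_gt0// mulr_gt0.
have := fock_submean unitI u u alpha0 p0 hf.
have -> : gauss (alpha * p / 4) u u = 1 by rewrite /gauss !subrr expr0n addr0 mulr0 expR0.
rewrite mulr1 => h; rewrite -lee_fin (EFinM _ N); apply: le_trans h _.
apply: lee_pmul; [by rewrite lee_fin ltW| |exact: lexx|].
  by apply: pint_ge0 => v; rewrite mulr_ge0 ?fock_dens_ge0 ?gauss_ge0.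
apply: le_trans hN; apply: le_pint.
- apply: measurable_funM; first exact: measurable_fock_dens.
  exact: measurable_gauss.
- exact: measurable_fock_dens.
- by move=> v; rewrite mulr_ge0 ?fock_dens_ge0 ?gauss_ge0.
- move=> v; rewrite ler_piMr ?fock_dens_ge0//.
  by rewrite expR_le1 mulNr oppr_le0 mulr_ge0 ?(ltW ap)// addr_ge0 ?sqr_ge0.
Qed.

Definition eval_bound (N r : R) := (submean_cst alpha p * N) `^ p^-1 * expR (alpha / 2 * r ^+ 2).

Lemma eval_bound_ge0 N r : 0 <= eval_bound N r.
Proof. by rewrite mulr_ge0 ?powR_ge0 ?expR_ge0. Qed.

Lemma norm_fock_eval f (N : R) x : slice_regular f -> (pint (fock_dens alpha p f \o S) <= N%:E)%E ->
  slice I x -> `|f x| <= eval_bound N `|x|.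
Proof.
move=> hf hN [u _ <-]; have := fock_eval u hf hN; rewrite fock_densE => h.
have {}h := powR_le_root p0 (mulr_ge0 (normr_ge0 _) (expR_ge0 _)) h.
by rewrite -ler_pdivrMr ?expR_gt0// -expRN -mulNr.
Qed.

Lemma fock_coef_bound a (N r : R) n : entire a -> 0 < r ->
  (pint (fock_dens alpha p (pser a) \o S) <= N%:E)%E -> `|a n| <= 2 * eval_bound N r / r ^+ n.
Proof.
move=> ea r0 hN; apply: (cauchy_coef unitI) => // x xI xr.
by have := norm_fock_eval (slice_regular_pser ea) hN xI; rewrite xr.
Qed.

(* Montel's argument; Fatou's lemma controls the norm of the limit. *)
Lemma fock_montel (f : nat -> quat -> quat) (N : R) : (forall n, slice_regular (f n)) ->
  (forall n, (pint (fock_dens alpha p (f n) \o S) <= N%:E)%E) ->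
  exists phi : nat -> nat, {homo phi : m n / (m < n)%N} /\ exists g,
    [/\ slice_regular g, (pint (fock_dens alpha p g \o S) <= N%:E)%E &
        forall x, (fun n => `|f (phi n) x - g x|) @ \oo --> (0 : R)].
Proof.
move=> hf hN.
pose a n := ps_coef (f n).
have ea n : entire (a n) by have [] := slice_regular_coef (hf n).
have fE n : f n = pser (a n) by apply/funext; have [] := slice_regular_coef (hf n).
have aB n k (r : R) : 0 < r -> `|a n k| <= 2 * eval_bound N r / r ^+ k.
  by move=> r0; apply: fock_coef_bound => //; rewrite -fE.
(* The bounds at radius 1 are enough to extract; those at all radii pass to the limit coefficients
   and make them entire. *)
have [phi [hphi [l hl]]] := @quat_diagonal R a (fun k => 2 * eval_bound N 1 / 1 ^+ k) (fun n k => aB n k _ ltr01).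
have lB k (r : R) : 0 < r -> `|l k| <= 2 * eval_bound N r / r ^+ k.
  by move=> r0; apply: (cvg_quat_le _ (hl k)); apply: nearW => n; exact: aB.
have el : entire l by apply: entire_coef_bound => r r0; exists (2 * eval_bound N r) => k; exact: lB.
pose d n k := a (phi n) k - l k.
have ed n : entire (d n) by exact: entireB.
have dE n x : f (phi n) x - pser l x = pser (d n) x by rewrite fE -pserB.
have conv x : (fun n => `|f (phi n) x - pser l x|) @ \oo --> (0 : R).
  pose r := 2 * `|x| + 1; have r0 : 0 < r by rewrite ltr_pwDr// mulr_ge0.
  apply/cvgrPdist_le => e e0.
  have M0 : 0 <= 4 * eval_bound N r by rewrite mulr_ge0// eval_bound_ge0.
  have [|||n0 hn0] := @pser_null_cvg R d x (4 * eval_bound N r) r r0 M0 _ _ ed _ e e0.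
  - by rewrite lerDl.
  - move=> n k; apply: le_trans (ler_normB _ _) _.
    have -> : 4 * eval_bound N r / r ^+ k = 2 * eval_bound N r / r ^+ k + 2 * eval_bound N r / r ^+ k by ring.
    by apply: lerD; [exact: aB|exact: lB].
  - move=> k; apply/cvgrPdist_le => t t0; have /cvgrPdist_le/(_ t t0) := hl k.
    by apply: filterS => n; rewrite sub0r normrN distrC.
  by exists n0 => // n nn /=; rewrite sub0r normrN normr_id dE; exact: hn0.
exists phi; split => //; exists (pser l); split => //; first exact: slice_regular_pser.
pose D n v := (fock_dens alpha p (f (phi n)) (S v))%:E.
have mD n : measurable_fun [set: R * R] (D n) by apply/measurable_EFinP; exact: measurable_fock_dens.
have cD v : D n v @[n --> \oo] --> (fock_dens alpha p (pser l) (S v))%:E.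
  apply: cvg_EFin; first exact: nearW.
  apply: cvgMr_tmp; apply: powR_cvg => //; apply/cvgrPdist_le => e e0.
  have /cvgrPdist_le/(_ e e0) := conv (S v); apply: filterS => n; rewrite sub0r normrN normr_id => h.
  by apply: le_trans h; rewrite distrC; exact: ler_dist_dist.
have fat := @fatou _ _ R ((@lebesgue_measure R) \x (@lebesgue_measure R))%E setT measurableT D mD
  (fun n v _ => fock_dens_ge0 alpha p (f (phi n)) (S v)).
apply: (@le_trans _ _ (eint (fun v => limn_einf (D ^~ v)))).
  rewrite pint_eint le_eqVlt; apply/orP; left; apply/eqP; congr eint; apply/funext => v.
  by have [-> _] := cvg_limn_einf_sup (cD v).
apply: le_trans fat _; rewrite limn_einf_lim; apply: lime_le; first exact: is_cvg_einfs.
apply: nearW => n; apply: le_trans (hN (phi n)).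
by apply: ereal_inf_lbound; exists n => //=.
Qed.

End FockCompact.

Section SmallSequences.
Variable R : realType.

Lemma cvge0_small (x : nat -> \bar R) : x @ \oo --> 0%E ->
  forall e : R, 0 < e -> exists n0, forall n, (n0 <= n)%N -> (x n <= e%:E)%E.
Proof.
move=> /fine_cvgP[[n1 _ hn1] /cvgrPdist_le h] e e0; have [n2 _ hn2] := h e e0.
exists (maxn n1 n2) => n; rewrite geq_max => /andP[a1 a2].
have := hn2 n a2; rewrite /= sub0r normrN => h3.
by rewrite -(fineK (hn1 n a1)) lee_fin; apply: le_trans h3; exact: ler_norm.
Qed.

Lemma small_cvge0 (x : nat -> \bar R) : (forall n, (0 <= x n)%E) ->
  (forall e : R, 0 < e -> exists n0, forall n, (n0 <= n)%N -> (x n <= e%:E)%E) -> x @ \oo --> 0%E.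
Proof.
move=> x0 h; apply/fine_cvgP; split.
  have [n0 hn0] := h 1 ltr01; exists n0 => // n /= nn.
  by rewrite ge0_fin_numE//; apply: le_lt_trans (hn0 n nn) _; rewrite ltry.
apply/cvgrPdist_le => e e0; have [n0 hn0] := h e e0; exists n0 => // n /= nn.
have xf : x n \is a fin_num by rewrite ge0_fin_numE//; apply: le_lt_trans (hn0 n nn) _; rewrite ltry.
by rewrite sub0r normrN ger0_norm ?fine_ge0// -lee_fin fineK//; exact: hn0.
Qed.

Lemma isumD (F G : int -> \bar R) : (forall i, (0 <= F i)%E) -> (forall i, (0 <= G i)%E) ->
  isum (fun i => F i + G i)%E = (isum F + isum G)%E.
Proof.
move=> F0 G0; rewrite /isum -nneseriesD; [|by move=> n _ _; rewrite adde_ge0..].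
by apply: eq_eseriesr => n _; rewrite addeACA.
Qed.

Lemma isum2_le (T g k : int -> int -> \bar R) (s t : R) : 0 <= s -> 0 <= t ->
  (forall i j, (0 <= T i j)%E) -> (forall i j, (0 <= g i j)%E) -> (forall i j, (0 <= k i j)%E) ->
  (forall i j, (T i j <= s%:E * g i j + t%:E * k i j)%E) ->
  (isum (fun i => isum (T i)) <=
    s%:E * isum (fun i => isum (g i)) + t%:E * isum (fun i => isum (k i)))%E.
Proof.
move=> s0 t0 T0 g0 k0 h.
have g1 i : (0 <= isum (g i))%E by exact: isum_ge0.
have k1 i : (0 <= isum (k i))%E by exact: isum_ge0.
have sg i j : (0 <= s%:E * g i j)%E by rewrite mule_ge0.
have tk i j : (0 <= t%:E * k i j)%E by rewrite mule_ge0.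
apply: (@le_trans _ _ (isum (fun i => s%:E * isum (g i) + t%:E * isum (k i))%E)).
  apply: le_isum => i; first exact: isum_ge0.
  rewrite -(isumZ (g0 i) s0) -(isumZ (k0 i) t0) -(isumD (sg i) (tk i)).
  by apply: le_isum.
rewrite isumD; [|by move=> i; rewrite mule_ge0..].
by rewrite (isumZ g1 s0) (isumZ k1 t0).
Qed.

End SmallSequences.

(** * Vanishing of compositions along null sequences *)

Section Compactness.
Variable R : realType.
Local Notation quat := (quat R).
Variables (alpha p q : R) (I J : quat).
Hypotheses (alpha0 : 0 < alpha) (p0 : 0 < p) (pq : p <= q).
Hypotheses (unitI : imag_unit I) (unitJ : imag_unit J).
Local Notation S := (slice_pt I).
Implicit Types (a : nat -> quat) (f g psi : quat -> quat).

Local Opaque pser kcoef gkernel slice_comp.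

Let q0 : 0 < q. Proof. exact: lt_le_trans pq. Qed.

(** Dominated convergence: by [fock_eval] the densities are bounded by one constant, so a multiple
    of the Gaussian dominates them all. *)
Lemma fock_dens_gauss_cvg (F : nat -> quat -> quat) (N c : R) : 0 < c -> (forall n, slice_regular (F n)) ->
  (forall n, (pint (fock_dens alpha p (F n) \o S) <= N%:E)%E) ->
  (forall x, (fun n => `|F n x|) @ \oo --> (0 : R)) ->
  (fun n => pint (fun v => fock_dens alpha p (F n) (S v) * gauss c 0 v)) @ \oo --> 0%E.
Proof.
move=> c0 hF hN hx.
pose h n v := (fock_dens alpha p (F n) (S v) * gauss c 0 v)%:E.
have N0 : 0 <= N.
  by rewrite -lee_fin; apply: le_trans (hN 0%N); apply: pint_ge0 => v; exact: fock_dens_ge0.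
have s0 := submean_cst_gt0 alpha p.
have mh n : measurable_fun [set: R * R] (h n).
  apply/measurable_EFinP; apply: measurable_funM; first exact: measurable_fock_dens.
  exact: measurable_gauss.
pose K := submean_cst alpha p * N.
have K0 : 0 <= K by apply: mulr_ge0 => //; exact: ltW.
pose G v := (K * gauss c 0 v)%:E.
have mG : measurable_fun [set: R * R] G.
  by apply/measurable_EFinP; apply: measurable_funM => //; exact: measurable_gauss.
have iG : (((@lebesgue_measure R) \x (@lebesgue_measure R))%E).-integrable [set: R * R] G.
  apply/integrableP; split => //.
  have -> : (\int[((@lebesgue_measure R) \x (@lebesgue_measure R))]_v `|G v| = pint (fun v => K * gauss c 0 v)%R)%E.
    by apply: eq_integral => v _; rewrite gee0_abs// lee_fin mulr_ge0 ?gauss_ge0.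
  rewrite pintZ//; [|exact: measurable_gauss|by move=> v; exact: gauss_ge0].
  by rewrite pint_gauss// -EFinM ltry.
have ch v : h n v @[n --> \oo] --> 0%E.
  apply: cvg_EFin; first exact: nearW.
  have -> : (0 : R) = (0 * expR (- (alpha * p / 2) * `|S v| ^+ 2)) * gauss c 0 v by rewrite !mul0r.
  apply: cvgMr_tmp; apply: cvgMr_tmp.
  by have := powR_cvg p0 (fun n => normr_ge0 (F n (S v))) (hx (S v)); rewrite powR0// gt_eqF.
have := @dominated_cvg _ _ R ((@lebesgue_measure R) \x (@lebesgue_measure R))%E setT measurableT h (fun=> 0%E) G mh (fun v _ => ch v) (fun v _ => isT) iG.
rewrite integral0; apply => n v _; rewrite gee0_abs; last by rewrite lee_fin mulr_ge0 ?fock_dens_ge0 ?gauss_ge0.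
rewrite lee_fin; apply: ler_wpM2r; first exact: gauss_ge0.
by apply: fock_eval.
Qed.

Lemma slice_regularB f g : slice_regular f -> slice_regular g -> slice_regular (f \- g).
Proof.
move=> /slice_regular_series[a ea fa] /slice_regular_series[b eb gb].
have -> : f \- g = pser (fun n => a n - b n).
  by apply/funext => x; rewrite pserB// /= fa gb.
by apply: slice_regular_pser; exact: entireB.
Qed.

Lemma pint_densB f g (M N : R) : slice_regular f -> slice_regular g ->
  (pint (fock_dens alpha p f \o S) <= M%:E)%E -> (pint (fock_dens alpha p g \o S) <= N%:E)%E ->
  (pint (fock_dens alpha p (f \- g)%R \o S) <= (2 `^ p * (M + N))%:E)%E.
Proof.
move=> hf hg hM hN.
have mf := @measurable_fock_dens R I alpha p f hf; have mg := @measurable_fock_dens R I alpha p g hg.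
have d0 (h : quat -> quat) v : 0 <= fock_dens alpha p h (S v) by exact: fock_dens_ge0.
apply: (@le_trans _ _ ((2 `^ p)%:E * (pint (fock_dens alpha p f \o S) + pint (fock_dens alpha p g \o S)))%E).
  apply: le_pintD (@measurable_fock_dens R I alpha p _ (slice_regularB hf hg)) mf mg _ _ _ (powR_ge0 _ _) _.
  - by move=> v; exact: d0.
  - by move=> v; exact: d0.
  - by move=> v; exact: d0.
  move=> v; rewrite /fock_dens /= -mulrDl mulrA; apply: ler_wpM2r; first exact: expR_ge0.
  apply: le_trans (powRD_le p0 (normr_ge0 _) (normr_ge0 _)).
  by apply: le_powR; [exact: ltW|exact: normr_ge0|exact: ler_normB].
rewrite (EFinM (2 `^ p)) EFinD; apply: lee_pmul; [|apply: adde_ge0; apply: pint_ge0 => v; exact: d0|exact: lexx|exact: leeD].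
by rewrite lee_fin; exact: powR_ge0.
Qed.

Lemma norm_plattice_ge (rho : R) i j : 0 <= rho -> rho <= `|S (plattice rho i j)|.
Proof.
move=> rho0; have [h _] := abs_le_norm_slice unitI (plattice rho i j); apply: le_trans h.
rewrite /= normrM ger0_norm// ler_peMr//.
have -> : 2 * i%:~R + 1 = (2 * i + 1)%:~R :> R by rewrite intrD intrM.
rewrite -intr_norm ler1z; lia.
Qed.

(** From $|v|^2\le2|w|^2+2|v-w|^2$, that is $|v-2w|^2\ge0$. Half of the Gaussian about [w] is traded
    for a fixed Gaussian about 0, and the remaining half can still be summed over the lattice; the
    lattice points in the ball need not be enumerated. *)
Lemma gauss_cut (c r : R) w v : 0 < c -> `|S w| <= r ->
  gauss c w v <= expR (c / 2 * r ^+ 2) * (gauss (c / 4) 0 v * gauss (c / 2) w v).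
Proof.
move=> c0 wr; rewrite /gauss -!expRD ler_expR /= !subr0.
have r0 : 0 <= r by apply: le_trans wr.
have : `|S w| ^+ 2 <= r ^+ 2 by rewrite lerXn2r ?nnegrE.
rewrite sqr_norm_slice_pt//; case: w v {wr} => [a b] [x y] /= h.
have := sqr_ge0 (x - 2 * a); have := sqr_ge0 (y - 2 * b) => h1 h2.
suff : 0 <= c / 4 * (2 * r ^+ 2 - (x ^+ 2 + y ^+ 2) + 2 * ((x - a) ^+ 2 + (y - b) ^+ 2)) by lra.
by apply: mulr_ge0; [rewrite divr_ge0// ltW|lra].
Qed.

Definition berezin_vanishing psi := forall e : R, 0 < e -> exists r : R,
  forall w, slice I w -> r < `|w| -> (berezin alpha q psi I w < e%:E)%E.

(** The lattice sum is cut at |w| = r. Outside, the Berezin integrals are below [eps]; inside, they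
    are at most 1, and [gauss_cut] reduces the sum to the integral of the densities against one
    Gaussian, which tends to 0. *)
Lemma comp_pint_vanishing psi (F : nat -> quat -> quat) (N rho : R) : slice_regular psi -> 0 < rho ->
  berezin_vanishing psi ->
  (forall i j, (berezin alpha q psi I (S (plattice rho i j)) <= 1%:E)%E) ->
  (forall n, slice_regular (F n)) ->
  (forall n, (pint (fock_dens alpha p (F n) \o S) <= N%:E)%E) ->
  (forall x, (fun n => `|F n x|) @ \oo --> (0 : R)) ->
  forall e : R, 0 < e -> exists n0, forall n, (n0 <= n)%N ->
    (pint (fock_dens alpha q (slice_comp (F n) psi) \o S) <= e%:E)%E.
Proof.
move=> hpsi rho0 crit hb hF hN hx e e0.
have N0 : 0 <= N.
  by rewrite -lee_fin; apply: le_trans (hN 0%N); apply: pint_ge0 => v; exact: fock_dens_ge0.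
pose c := alpha * p / 8; have c0 : 0 < c by rewrite divr_gt0// mulr_gt0.
have c20 : 0 < c / 2 by exact: divr_gt0.
have c40 : 0 < c / 4 by exact: divr_gt0.
pose A := comp_cst alpha p q rho * N `^ ((q - p) / p).
have A0 : 0 <= A by apply: mulr_ge0; [exact: ltW (comp_cst_gt0 _ _ _ _)|exact: powR_ge0].
pose K1 := (4 * gauss_sum_cst c (2 * rho)) ^+ 2; pose K2 := (4 * gauss_sum_cst (c / 2) (2 * rho)) ^+ 2.
have K10 : 0 <= K1 by exact: sqr_ge0.
have K20 : 0 <= K2 by exact: sqr_ge0.
(* [eps] and [dl] give each of the two halves of the sum at most e/2; the added 1 keeps the
   denominators positive. *)
pose eps := e / 2 / (A * K1 * N + 1).
have D1 : 0 < A * K1 * N + 1 by apply: ltr_pwDr => //; exact: (mulr_ge0 (mulr_ge0 A0 K10) N0).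
have eps0 : 0 < eps by rewrite divr_gt0// divr_gt0.
have [r hr] := crit eps eps0.
pose Cr := expR (c / 2 * r ^+ 2); have Cr0 : 0 <= Cr by exact: expR_ge0.
pose dl := e / 2 / (A * Cr * K2 + 1).
have D2 : 0 < A * Cr * K2 + 1 by apply: ltr_pwDr => //; exact: (mulr_ge0 (mulr_ge0 A0 Cr0) K20).
have dl0 : 0 < dl by rewrite divr_gt0// divr_gt0.
have [n0 hn0] := cvge0_small (fock_dens_gauss_cvg c40 hF hN hx) dl0.
exists n0 => n nn; have {}hn0 := hn0 n nn.
have mF := @measurable_fock_dens R I alpha p (F n) (hF n).
pose d v := fock_dens alpha p (F n) (S v).
have d0 v : 0 <= d v by exact: fock_dens_ge0.
have [M M0 hM] := pint_dens_fin (le_lt_trans (hN n) (ltry N)).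
have MN : M <= N by rewrite -lee_fin -hM.
apply: le_trans (comp_integral_le unitI alpha0 p0 pq rho0 (hF n) hpsi hM) _.
pose g i j := pint (fun v => d v * gauss c (plattice rho i j) v).
pose k i j := pint (fun v => d v * gauss (c / 4) 0 v * gauss (c / 2) (plattice rho i j) v).
pose B i j := berezin alpha q psi I (S (plattice rho i j)).
have g0 i j : (0 <= g i j)%E by apply: pint_ge0 => v; rewrite mulr_ge0 ?gauss_ge0.
have k00 i j v : 0 <= d v * gauss (c / 4) 0 v * gauss (c / 2) (plattice rho i j) v.
  by apply: mulr_ge0; [apply: mulr_ge0; [exact: d0|exact: gauss_ge0]|exact: gauss_ge0].
have k0 i j : (0 <= k i j)%E by apply: pint_ge0.
have B0 i j : (0 <= B i j)%E by rewrite /B berezinE; apply: pint_ge0 => v; exact: fock_dens_ge0.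
have mg c' w : measurable_fun [set: R * R] (gauss c' w : R * R -> R) by exact: measurable_gauss.
have md4 : measurable_fun [set: R * R] (fun v => d v * gauss (c / 4) 0 v) by exact: measurable_funM.
have term i j : (g i j * B i j <= eps%:E * g i j + Cr%:E * k i j)%E.
  have [wr|wr] := leP `|S (plattice rho i j)| r; last first.
    apply: (@le_trans _ _ (eps%:E * g i j)%E).
      rewrite muleC; apply: lee_pmul; [exact: B0|exact: g0| |exact: lexx].
      by apply: ltW; apply: hr => //; exists (plattice rho i j).
    by apply: leeDl; apply: mule_ge0; [rewrite lee_fin|exact: k0].
  apply: (@le_trans _ _ (Cr%:E * k i j)%E); last by apply: leeDr; apply: mule_ge0; [rewrite lee_fin ltW|exact: g0].
  apply: (@le_trans _ _ (g i j * 1%:E)%E); first by apply: lee_pmul; [exact: g0|exact: B0|exact: lexx|exact: hb].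
  rewrite mule1 /k -pintZ//; last exact: measurable_funM.
  apply: le_pint.
  - exact: measurable_funM.
  - by apply: measurable_funM => //; exact: measurable_funM.
  - by move=> v; rewrite mulr_ge0 ?gauss_ge0.
  - move=> v; have h := ler_wpM2l (d0 v) (gauss_cut v c0 wr).
    by apply: le_trans h _; rewrite le_eqVlt; apply/orP; left; apply/eqP; rewrite /Cr; ring.
have G1 := isum_gaussM c0 rho0 mF d0; rewrite -/K1 in G1.
have G2 := isum_gaussM c20 rho0 md4 (fun v => mulr_ge0 (d0 v) (gauss_ge0 _ _ v)); rewrite -/K2 in G2.
have S1 : (isum (fun i => isum (fun j => g i j * B i j)) <=
    eps%:E * isum (fun i => isum (fun j => g i j)) + Cr%:E * isum (fun i => isum (fun j => k i j)))%E.
  exact: (isum2_le (ltW eps0) Cr0 (fun i j => mule_ge0 (g0 i j) (B0 i j)) g0 k0 term).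
have S2 : (isum (fun i => isum (fun j => g i j * B i j)) <= (eps * (K1 * N) + Cr * (K2 * dl))%:E)%E.
  apply: le_trans S1 _.
  apply: (@le_trans _ _ (eps%:E * (K1%:E * N%:E) + Cr%:E * (K2%:E * dl%:E))%E); last by rewrite -!EFinM -EFinD.
  apply: leeD; apply: lee_pmul.
  - by rewrite lee_fin ltW.
  - by apply: isum_ge0 => i; exact: isum_ge0.
  - exact: lexx.
  - apply: le_trans G1 _; apply: lee_pmul; [by rewrite lee_fin|exact: pint_ge0|exact: lexx|exact: hN].
  - by rewrite lee_fin.
  - by apply: isum_ge0 => i; exact: isum_ge0.
  - exact: lexx.
  - apply: le_trans G2 _; apply: lee_pmul; [by rewrite lee_fin| |exact: lexx|exact: hn0].
    by apply: pint_ge0 => v; apply: mulr_ge0; [exact: d0|exact: gauss_ge0].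
have AM : comp_cst alpha p q rho * M `^ ((q - p) / p) <= A.
  apply: ler_wpM2l; first exact: ltW (comp_cst_gt0 _ _ _ _).
  by apply: le_powR => //; rewrite divr_ge0 ?subr_ge0// ltW.
apply: (@le_trans _ _ (A%:E * (eps * (K1 * N) + Cr * (K2 * dl))%:E)%E).
  apply: lee_pmul; [|by apply: isum_ge0 => i; apply: isum_ge0 => j; apply: mule_ge0; [exact: g0|exact: B0]|by []|exact: S2].
  by rewrite lee_fin; apply: mulr_ge0; [exact: ltW (comp_cst_gt0 _ _ _ _)|exact: powR_ge0].
rewrite -EFinM lee_fin.
have half (t x : R) : 0 <= t -> x = e / 2 / (t + 1) -> t * x <= e / 2.
  move=> t0 ->; have t1 : 0 < t + 1 by rewrite ltr_pwDr.
  by rewrite mulrCA ger_pMr ?divr_gt0// ler_pdivrMr// mul1r lerDl.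
have h1 := @half (A * K1 * N) eps _ erefl; have h2 := @half (A * Cr * K2) dl _ erefl.
have {}h1 := h1 (mulr_ge0 (mulr_ge0 A0 K10) N0); have {}h2 := h2 (mulr_ge0 (mulr_ge0 A0 Cr0) K20).
have -> : A * (eps * (K1 * N) + Cr * (K2 * dl)) = A * K1 * N * eps + A * Cr * K2 * dl by ring.
by lra.
Qed.

End Compactness.

(** * The compactness criterion *)

Section CompactOperator.
Variable R : realType.
Local Notation quat := (quat R).
Variables (alpha p q : R) (I J : quat).
Hypotheses (alpha0 : 0 < alpha) (p0 : 0 < p) (pq : p <= q).
Hypotheses (unitI : imag_unit I) (unitJ : imag_unit J).
Local Notation S := (slice_pt I).
Implicit Types (a : nat -> quat) (f g psi : quat -> quat).

Lemma norm_kcoef_coef w n :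
  `|kcoef alpha w n| = expR (- (alpha / 2) * `|w| ^+ 2) * (alpha ^+ n / n`!%:R) * `|w| ^+ n.
Proof.
have t0 : 0 <= alpha ^+ n / n`!%:R by rewrite divr_ge0// exprn_ge0// ltW.
by rewrite /kcoef /gkernel normrZ qnormX qnormC normrM (ger0_norm (expR_ge0 _)) (ger0_norm t0).
Qed.

Local Opaque pser kcoef gkernel slice_comp.

Let q0 : 0 < q. Proof. exact: lt_le_trans pq. Qed.

Lemma poweR_root_le (x : \bar R) (r s : R) : 0 < r -> (0 <= x)%E -> (x `^ r^-1 <= s%:E)%E ->
  (x <= (s `^ r)%:E)%E.
Proof.
move=> r0; case: x => [x||] //=.
  rewrite !lee_fin => x0 h; rewrite -(root_powR r0 x0); apply: le_powR => //; first exact: ltW.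
  exact: powR_ge0.
by move=> _; rewrite invr_eq0 gt_eqF.
Qed.

Lemma pint_le_fock_norm (M : R) f : fock alpha p J f -> (fock_norm alpha p J f <= M%:E)%E ->
  (pint (fock_dens alpha p f \o slice_pt J) <= (M `^ p / (alpha * p / (2 * pi)))%:E)%E.
Proof.
move=> fJ; have k0 := norm_cst_gt0 alpha0 p0.
have [hf hJ] := proj1 (fockE J f alpha0 p0) fJ; have [X X0 hX] := pint_dens_fin hJ.
rewrite (fock_norm_real alpha0 p0 X0 hX) hX !lee_fin => h.
rewrite ler_pdivlMr// mulrC.
have kX : 0 <= alpha * p / (2 * pi) * X by apply: mulr_ge0 => //; exact: ltW.
rewrite -(root_powR p0 kX); apply: le_powR => //; first exact: ltW.
exact: powR_ge0.
Qed.

(** Vanishing at infinity says nothing about small w. Taking [rho] beyond the radius where the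
    Berezin integrals fall below 1 puts all lattice points outside it, so they are bounded by 1 on
    the lattice. The differences with a Montel limit then tend to 0 in norm after composition. *)
Lemma compact_suff psi : slice_regular psi -> berezin_vanishing alpha q I psi ->
  compact_op alpha p q J (comp_op psi).
Proof.
move=> hpsi crit; have [r1 hr1] := crit 1 ltr01.
pose rho := Num.max r1 0 + 1; have rho0 : 0 < rho by rewrite ltr_wpDl// le_max lexx orbT.
have r1rho : r1 < rho by rewrite /rho (@le_lt_trans _ _ (Num.max r1 0)) ?le_max ?lexx// ltrDl.
have hb i j : (berezin alpha q psi I (S (plattice rho i j)) <= 1%:E)%E.
  apply: ltW; apply: hr1; first by exists (plattice rho i j).
  by apply: lt_le_trans r1rho _; exact: norm_plattice_ge (ltW rho0).
have [_ maps _] : op_bound alpha p q J (comp_op psi) (op_cst alpha p q rho * 1).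
  apply: (berezin_op_bound alpha0 p0 pq unitI unitJ rho0 hpsi ler01) => i j.
  by rewrite powR1; exact: hb.
split=> // f M hf.
have fS n : slice_regular (f n) by have [[]] := hf n.
have k0 := norm_cst_gt0 alpha0 p0.
pose N := slice_cst p * (M `^ p / (alpha * p / (2 * pi))).
have hN n : (pint (fock_dens alpha p (f n) \o S) <= N%:E)%E.
  have [fJ fM] := hf n; apply: le_trans (slice_change alpha unitI unitJ p0 (fS n)) _.
  rewrite /N (EFinM (slice_cst p)); apply: lee_pmul => //.
  - by rewrite lee_fin ltW// slice_cst_gt0.
  - by apply: pint_ge0 => v; exact: fock_dens_ge0.
  - exact: pint_le_fock_norm.
have [phi [hphi [g [gS gN conv]]]] := fock_montel alpha0 p0 unitI fS hN.
have gJ : fock alpha p J g.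
  apply: (fock_slice unitJ unitI alpha0 p0); apply: (proj2 (fockE I g alpha0 p0)); split; first exact: gS.
  by apply: le_lt_trans gN _; rewrite ltry.
exists phi; split => //; exists (comp_op psi g); first exact: maps.
pose F n := f (phi n) \- g.
have FS n : slice_regular (F n) by exact: slice_regularB.
have FN n := pint_densB p0 (fS (phi n)) gS (hN (phi n)) gN.
have vanish := comp_pint_vanishing alpha0 p0 pq unitI hpsi rho0 crit hb FS FN conv.
apply: small_cvge0 => [n|e e0]; first exact: fock_norm_ge0.
have kq := norm_cst_gt0 alpha0 q0; have sq0 := slice_cst_gt0 q.
pose X := alpha * q / (2 * pi) * slice_cst q; have X0 : 0 < X by exact: mulr_gt0.
pose d := e `^ q / X; have d0 : 0 < d by rewrite divr_gt0// powR_gt0.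
have [n0 hn0] := vanish d d0; exists n0 => n nn.
have -> : comp_op psi (f (phi n)) \- comp_op psi g = slice_comp (F n) psi by rewrite /F slice_compB.
have TS : slice_regular (slice_comp (F n) psi) by exact: slice_regular_comp.
have h : (pint (fock_dens alpha q (slice_comp (F n) psi) \o slice_pt J) <= (slice_cst q * d)%:E)%E.
  apply: le_trans (slice_change alpha unitJ unitI q0 TS) _; rewrite (EFinM _ d); apply: lee_pmul => //.
  - by rewrite lee_fin ltW.
  - by apply: pint_ge0 => v; exact: fock_dens_ge0.
  - exact: hn0.
apply: le_trans (fock_norm_le_const alpha0 q0 (mulr_ge0 (ltW sq0) (ltW d0)) h) _.
rewrite lee_fin mulrA -/X /d mulrCA divff ?gt_eqF// mulr1 powR_root//.
exact: ltW.
Qed.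

(** With star powers bounded by $B^n$ at [z], the composed kernel is at most
    $e^{-\alpha|w|^2/2+B\alpha|w|}$: the normalization beats the exponential growth. *)
Lemma kernel_comp_small psi z (e : R) : slice_regular psi -> 0 < e ->
  exists r : R, forall w, r < `|w| -> `|slice_comp (fock_kernel alpha w) psi z| <= e.
Proof.
move=> hpsi e0; have [B B0 hB] := norm_star_exp_le z hpsi (normr_ge0 z).
(* The summand 2B + 1 brings the exponent below $-y$ with $y=\alpha|w|/2$; then $e^{-y}\le1/y$, and
   $2/(\alpha e)$ makes 1/y at most e. *)
exists (2 * B + 1 + 2 / (alpha * e)) => w hw; rewrite fock_kernelE slice_comp_pser; last exact: entire_kcoef.
have ae0 : 0 < 2 / (alpha * e) by rewrite divr_gt0// mulr_gt0.
have w0 : 0 < `|w| by move: hw; lra.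
have x0 : 0 <= B * (alpha * `|w|) by rewrite mulr_ge0// mulr_ge0// ltW.
pose c := expR (- (alpha / 2) * `|w| ^+ 2).
apply: (@le_trans _ _ (c * expR (B * (alpha * `|w|)))).
  apply: (@norm_qsum_le _ _ (fun n => c * ((B * (alpha * `|w|)) ^+ n / n`!%:R))) => [n|N].
    rewrite qnormM norm_kcoef_coef -/c.
    have t0 : 0 <= alpha ^+ n / n`!%:R by rewrite divr_ge0// exprn_ge0// ltW.
    apply: (@le_trans _ _ (B ^+ n * (c * (alpha ^+ n / n`!%:R) * `|w| ^+ n))).
      by apply: ler_wpM2r; [apply: mulr_ge0; [apply: mulr_ge0 => //; exact: expR_ge0|exact: exprn_ge0]|exact: hB].
    by rewrite !exprMn le_eqVlt; apply/orP; left; apply/eqP; ring.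
  by rewrite -mulr_sumr; apply: ler_wpM2l; [exact: expR_ge0|exact: exp_sum_le].
rewrite -expRD.
have le1 : - (alpha / 2) * `|w| ^+ 2 + B * (alpha * `|w|) <= - (alpha / 2 * `|w|).
  have : 0 <= alpha / 2 * `|w| * (`|w| - 2 * B - 1).
    by apply: mulr_ge0; [rewrite mulr_ge0// divr_ge0// ltW|lra].
  by lra.
apply: (@le_trans _ _ (expR (- (alpha / 2 * `|w|)))); first by rewrite ler_expR.
have y0 : 0 < alpha / 2 * `|w| by rewrite mulr_gt0// divr_gt0.
rewrite expRN; apply: (@le_trans _ _ (alpha / 2 * `|w|)^-1).
  rewrite lef_pV2 ?posrE ?expR_gt0//; apply: le_trans (expR_ge1Dx _); lra.
have h : 2 / (alpha * e) <= `|w| by move: hw; lra.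
rewrite -[e]invrK lef_pV2 ?posrE ?invr_gt0//.
apply: (@le_trans _ _ (alpha / 2 * (2 / (alpha * e)))); last by apply: ler_wpM2l => //; rewrite divr_ge0// ltW.
by rewrite le_eqVlt; apply/orP; left; apply/eqP; field; rewrite !gt_eqF.
Qed.

(** If the criterion fails, kernels with centres going to infinity keep their Berezin integrals
    above some e. A subsequence of the composed kernels converges in norm to some g, which is 0 on
    the slice, so these integrals tend to 0. *)
Lemma compact_nec psi : slice_regular psi -> compact_op alpha p q J (comp_op psi) ->
  berezin_vanishing alpha q I psi.
Proof.
move=> hpsi [maps hcomp]; apply: contrapT => ncrit.
have [e [e0 he]] : exists e : R, 0 < e /\ forall r : R, exists w,
    [/\ slice I w, r < `|w| & (e%:E <= berezin alpha q psi I w)%E].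
  apply: contrapT => H; apply: ncrit => e e0; apply: contrapT => Hr; apply: H.
  exists e; split => // r; apply: contrapT => Hw; apply: Hr; exists r => w wI rw.
  by rewrite ltNge; apply/negP => ew; apply: Hw; exists w.
have [w hw] := choice (fun n : nat => he n%:R).
pose f n := fock_kernel alpha (w n).
have hf n : fock alpha p J (f n) /\ (fock_norm alpha p J (f n) <= (kernel_cst p)%:E)%E.
  by have [wI _ _] := hw n; exact: (fock_kernel_norm alpha0 unitI unitJ p0 wI).
have [phi [hphi [g gJ conv]]] := hcomp f _ hf.
have [gS _] := proj1 (fockE J g alpha0 q0) gJ.
have phi_ge n : (n <= phi n)%N.
  by elim: n => // n IH; apply: leq_ltn_trans IH _; exact: hphi.
pose T n := slice_comp (f (phi n)) psi.
have TS n : slice_regular (T n) by apply: slice_regular_comp => //; exact: slice_regular_kernel.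
have DS n : slice_regular (T n \- g) by exact: slice_regularB.
have c0 := berezin_norm_cst_gt0 alpha0 q0.
have small (d : R) : 0 < d -> exists n0, forall n, (n0 <= n)%N ->
    (pint (fock_dens alpha q (T n \- g)%R \o S) <= d%:E)%E.
  move=> d0; pose s := d `^ q^-1 / berezin_norm_cst alpha q.
  have s0 : 0 < s by rewrite divr_gt0// powR_gt0.
  have [n0 hn0] := cvge0_small conv s0; exists n0 => n nn.
  rewrite -(root_powR q0 (ltW d0)); apply: poweR_root_le => //.
    by apply: pint_ge0 => v; exact: fock_dens_ge0.
  apply: le_trans (pint_root_le_norm alpha0 unitI unitJ q0 (DS n)) _.
  have -> : d `^ q^-1 = berezin_norm_cst alpha q * s by rewrite /s mulrCA divff ?mulr1// gt_eqF.
  rewrite (EFinM _ s); apply: lee_pmul => //; [by rewrite lee_fin ltW|exact: fock_norm_ge0|exact: hn0].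
(* Norm convergence forces convergence at points by the evaluation bound, while the composed kernels
   tend to 0 at each point; the accuracy t is shared equally between the two. *)
have g_eq0 v : `|g (S v)| = 0.
  apply/eqP; rewrite eq_le normr_ge0 andbT; apply/ler_addgt0Pr => t t0; rewrite add0r.
  have t20 : 0 < t / 2 by exact: divr_gt0.
  have [r hr] := kernel_comp_small (S v) hpsi t20.
  pose K := expR (alpha / 2 * `|S v| ^+ 2).
  have K0 : 0 < K by exact: expR_gt0.
  have sc0 := submean_cst_gt0 alpha q.
  pose d := (t / 2 / K) `^ q / submean_cst alpha q.
  have d0 : 0 < d by rewrite divr_gt0// powR_gt0// divr_gt0.
  have [n0 hn0] := small d d0.
  pose n := maxn n0 (Num.truncn r).+1.
  have Tn : `|T n (S v)| <= t / 2.
    apply: hr; have [_ h _] := hw (phi n); apply: le_lt_trans h.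
    apply: (@le_trans _ _ (Num.truncn r).+1%:R); first by rewrite ltW// truncnS_gt.
    by rewrite ler_nat; apply: leq_trans (phi_ge n); rewrite leq_maxr.
  have Dn : `|(T n \- g) (S v)| <= t / 2.
    have := norm_fock_eval alpha0 q0 unitI (DS n) (hn0 n (leq_maxl _ _)) (ex_intro2 _ _ v Logic.I erefl).
    move/le_trans; apply; rewrite /eval_bound -/K -ler_pdivlMr// /d mulrCA divff ?gt_eqF// mulr1.
    by rewrite powR_root// divr_ge0 ?ltW.
  have -> : g (S v) = T n (S v) - (T n \- g) (S v) by rewrite /= opprB addrC subrK.
  by apply: le_trans (ler_normB _ _) _; move: Tn Dn; lra.
have [n0 hn0] := small (e / 2) (divr_gt0 e0 (ltr0n _ 2)).
have := hn0 n0 (leqnn _).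
have -> : fock_dens alpha q (T n0 \- g)%R \o S = fock_dens alpha q (T n0) \o S.
  apply/funext => v; rewrite /fock_dens /=.
  have -> : g (S v) = 0 by apply/eqP; rewrite -normr_eq0 g_eq0.
  by rewrite subr0.
rewrite -/(berezin alpha q psi I (w (phi n0))); have [_ _ h] := hw (phi n0).
by move=> h2; have := le_trans h h2; rewrite lee_fin; lra.
Qed.

End CompactOperator.

(** * The criteria *)

Section Criteria.
Variable R : realType.
Local Notation quat := (quat R).
Variables (alpha p q : R) (I J : quat).
Hypotheses (alpha0 : 0 < alpha) (p0 : 0 < p) (pq : p <= q).
Hypotheses (unitI : imag_unit I) (unitJ : imag_unit J).
Implicit Types (psi : quat -> quat).

Let q0 : 0 < q. Proof. exact: lt_le_trans pq. Qed.

Lemma berezin_ge0 psi w : (0 <= berezin alpha q psi I w)%E.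
Proof. by rewrite berezinE; apply: pint_ge0 => v; exact: fock_dens_ge0. Qed.

Lemma bounded_nec psi : slice_regular psi -> bounded_op alpha p q J (comp_op psi) ->
  (ereal_sup [set berezin alpha q psi I w | w in slice I] < +oo)%E.
Proof.
move=> hpsi [C hC]; pose b := (berezin_norm_cst alpha q * kernel_cst p * C) `^ q.
apply: (@le_lt_trans _ _ b%:E); last exact: ltry.
apply: ge_ereal_sup => _ [w wI <-]; apply: poweR_root_le => //; first exact: berezin_ge0.
exact: (op_bound_ge_berezin alpha0 p0 pq unitI unitJ hpsi hC wI).
Qed.

Lemma root_bound_op psi (b : R) : slice_regular psi -> 0 <= b ->
  (forall w, slice I w -> (berezin alpha q psi I w <= (b `^ q)%:E)%E) ->
  op_bound alpha p q J (comp_op psi) (op_cst alpha p q 1 * b).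
Proof.
move=> hpsi b0 hb; apply: (berezin_op_bound alpha0 p0 pq unitI unitJ ltr01 hpsi b0) => i j.
by apply: hb; exists (plattice 1 i j).
Qed.

Lemma bounded_suff psi : slice_regular psi ->
  (ereal_sup [set berezin alpha q psi I w | w in slice I] < +oo)%E ->
  bounded_op alpha p q J (comp_op psi).
Proof.
move=> hpsi hs; set s := ereal_sup _ in hs.
have hw w : slice I w -> (berezin alpha q psi I w <= s)%E.
  by move=> wI; apply: ereal_sup_ubound; exists w.
have s0 : (0 <= s)%E by apply: le_trans (berezin_ge0 psi 0) (hw 0 (slice0 I)).
have sf : s \is a fin_num by rewrite ge0_fin_numE.
exists (op_cst alpha p q 1 * fine s `^ q^-1); apply: root_bound_op => // [|w wI].
  exact: powR_ge0.
by rewrite root_powR ?fine_ge0// fineK//; exact: hw.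
Qed.

(** The bound is checked against each admissible constant. If there is none, the infimum is infinite
    and nothing remains to prove. *)
Lemma op_norm_ge psi : slice_regular psi ->
  (((berezin_norm_cst alpha q * kernel_cst p)^-1)%:E *
    ereal_sup [set (berezin alpha q psi I w `^ q^-1)%E | w in slice I] <=
    op_norm alpha p q J (comp_op psi))%E.
Proof.
move=> hpsi; set s := ereal_sup _; pose K := berezin_norm_cst alpha q * kernel_cst p.
have K0 : 0 < K by rewrite mulr_gt0 ?berezin_norm_cst_gt0// powR_gt0// slice_cst_gt0.
have s0 : (0 <= s)%E.
  apply: le_trans (poweR_ge0 (berezin alpha q psi I 0) q^-1) _.
  by apply: ereal_sup_ubound; exists 0 => //; exact: slice0.
apply: le_ereal_inf_tmp => _ [C hC <-].
have sK : (s <= (K * C)%:E)%E.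
  apply: ge_ereal_sup => _ [w wI <-].
  exact: (op_bound_ge_berezin alpha0 p0 pq unitI unitJ hpsi hC wI).
apply: (@le_trans _ _ (K^-1%:E * (K * C)%:E)%E).
  by apply: lee_pmul => //; rewrite lee_fin invr_ge0 ltW.
by rewrite -EFinM mulKf// gt_eqF.
Qed.

(** A finite supremum is itself turned into an admissible constant, with mesh parameter 1; an
    infinite one makes the right-hand side infinite since the constant is positive. *)
Lemma op_norm_le psi : slice_regular psi ->
  (op_norm alpha p q J (comp_op psi) <= (op_cst alpha p q 1)%:E *
    ereal_sup [set (berezin alpha q psi I w `^ q^-1)%E | w in slice I])%E.
Proof.
move=> hpsi; set s := ereal_sup _.
have hw w : slice I w -> (berezin alpha q psi I w `^ q^-1 <= s)%E.
  by move=> wI; apply: ereal_sup_ubound; exists w.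
have s0 : (0 <= s)%E by apply: le_trans (hw 0 (slice0 I)); exact: poweR_ge0.
have C0 : 0 < op_cst alpha p q 1 by exact: op_cst_gt0.
have [sf|] := boolP (s < +oo)%E; last first.
  rewrite -leNgt leye_eq => /eqP ->.
  by rewrite gt0_muley ?leey// lte_fin.
have sE : s = (fine s)%:E by rewrite fineK// ge0_fin_numE.
rewrite sE -EFinM; apply: ereal_inf_lbound.
exists (op_cst alpha p q 1 * fine s) => //; apply: root_bound_op => // [|w wI].
  exact: fine_ge0.
by apply: poweR_root_le => //; [exact: berezin_ge0|rewrite -sE; exact: hw].
Qed.

End Criteria.

Theorem theorem1p1 (R : realType) (alpha p q : R) (J : quat R)
    (alpha_gt0 : 0 < alpha) (p_gt0 : 0 < p) (le_pq : p <= q)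
    (J_unit : imag_unit J) :
  (forall psi : quat R -> quat R, slice_regular psi ->
     let bounded := bounded_op alpha p q J (comp_op psi) in
     let bounded_crit I :=
       (ereal_sup [set berezin alpha q psi I w | w in slice I] < +oo)%E in
     (bounded <-> exists I, imag_unit I /\ bounded_crit I) /\
     (bounded <-> forall I, imag_unit I -> bounded_crit I)) /\
  (forall I, imag_unit I -> exists c C : R, [/\ 0 < c, 0 < C &
     forall psi : quat R -> quat R, slice_regular psi ->
       let s := ereal_sup
         [set (berezin alpha q psi I w `^ q^-1)%E | w in slice I] in
       (c%:E * s <= op_norm alpha p q J (comp_op psi) <= C%:E * s)%E]) /\
  (forall psi : quat R -> quat R, slice_regular psi ->
     let compact := compact_op alpha p q J (comp_op psi) in
     let compact_crit I := forall e : R, 0 < e -> exists r : R,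
       forall w, slice I w -> r < `|w| -> (berezin alpha q psi I w < e%:E)%E in
     (compact <-> exists I, imag_unit I /\ compact_crit I) /\
     (compact <-> forall I, imag_unit I -> compact_crit I)).
Proof.
have q_gt0 : 0 < q by exact: lt_le_trans le_pq.
split; last split.
- move=> psi hpsi bounded crit.
  have nec (I : quat R) : imag_unit I -> bounded -> crit I by move=> unitI; exact: bounded_nec.
  have conv (I : quat R) : imag_unit I -> crit I -> bounded by move=> unitI; exact: bounded_suff.
  (* The norms live on the slice of [J], and the criterion on any one slice is equivalent to
     boundedness. Passing from every slice to some slice is done at [J], which provides an imaginary
     unit. *)
  split; split.
  + by move=> hb; exists J; split => //; exact: nec.
  + by move=> [I [unitI hI]]; exact: conv hI.
  + by move=> hb I unitI; exact: nec.
  + by move=> h; apply: (conv J) => //; exact: h.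
- move=> I unitI.
  exists (berezin_norm_cst alpha q * kernel_cst p)^-1, (op_cst alpha p q 1); split.
  + by rewrite invr_gt0 mulr_gt0 ?berezin_norm_cst_gt0// powR_gt0// slice_cst_gt0.
  + exact: op_cst_gt0.
  + move=> psi hpsi /=; apply/andP; split; [exact: op_norm_ge|exact: op_norm_le].
- move=> psi hpsi compact crit.
  have nec (I : quat R) : imag_unit I -> compact -> crit I by move=> unitI; exact: compact_nec.
  have conv (I : quat R) : imag_unit I -> crit I -> compact by move=> unitI; exact: compact_suff.
  split; split.
  + by move=> hb; exists J; split => //; exact: nec.
  + by move=> [I [unitI hI]]; exact: conv hI.
  + by move=> hb I unitI; exact: nec.
  + by move=> h; apply: (conv J) => //; exact: h.
Qed.
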